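(* Let $c>1/2$ and, for each $n$, let $t=t(n)\in\mathbb{N}$ satisfy $t\ge c\,n$. Then, as $n\to\infty$, the law of $\mathfrak{X}(\pi_t)/|V_G^t|$ converges weakly to the Poisson–Dirichlet distribution $PD(1)$.
   Context: Let $V=\{1,2,\dots,n\}$ and let $T_1,T_2,\dots$ be independent transpositions of $V$, each chosen uniformly at random among all transpositions. Set $\pi_t=T_t\circ T_{t-1}\circ\cdots\circ T_1$. For a permutation $\sigma$ of $V$, its cycle structure $\mathfrak{X}(\sigma)$ is the infinite sequence whose $i$-th entry $\mathfrak{X}_i(\sigma)$ is the size of the $i$-th largest cycle (orbit) of $\sigma$, with $\mathfrak{X}_i(\sigma)=0$ if $\sigma$ has fewer than $i$ cycles. Let $G^t$ be the graph on $V$ in which $\{u,v\}$ is an edge iff the transposition $(u,v)$ appears among $T_1,\dots,T_t$, and let $V_G^t$ be the vertex set of a largest connected component of $G^t$ (ties broken arbitrarily). Let $\Omega=\{y\in[0,1]^{\mathbb{N}_+}:\sum_i y_i=1,\ y_1\ge y_2\ge\cdots\}$. The distribution $PD(1)$ on $\Omega$ is defined as follows: let $U_1,U_2,\dots$ be i.i.d. uniform on $[0,1]$, set $x_1=U_1$ and $x_j=U_j(1-\sum_{i<j}x_i)$; $PD(1)$ is the law of the sequence $(x_j)$ sorted in nonincreasing order. Weak convergence is for laws of random elements of $[0,1]^{\mathbb{N}_+}$ (equivalently: for every $\epsilon>0$, for all large $n$ there is a coupling of $(T_j)$ with a $PD(1)$ sample $Y$ such that $\mathbf{P}[\|Y-\mathfrak{X}(\pi_t)/|V_G^t|\|_\infty<\epsilon]>1-\epsilon$).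 *)

(* Defs.v *)
From HB Require Import structures.
From mathcomp Require Import all_boot all_order all_algebra all_fingroup.
From mathcomp Require Import all_classical all_reals all_analysis.
Set Implicit Arguments.
Unset Strict Implicit.
Unset Printing Implicit Defensive.
Import Order.TTheory GRing.Theory Num.Theory.
Import numFieldTopology.Exports.
Local Open Scope classical_set_scope.
Local Open Scope ring_scope.

Definition is_transp (n : nat) (s : {perm 'I_n}) : bool :=
  [exists x : 'I_n, exists y : 'I_n, (x != y) && (s == tperm x y)].

(* the outcomes T = (T_1,...,T_t) (indexed by 'I_t, j <-> T_{j+1}) that are
   sequences of transpositions *)
Definition transp_seq (n t : nat) (T : {ffun 'I_t -> {perm 'I_n}}) : bool :=
  [forall j, is_transp (T j)].

(* pi_t = T_t o ... o T_1 : in mathcomp, (s * s') x = s' (s x), so the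
   product T_1 * T_2 * ... * T_t applies T_1 first. *)
Definition pi_t (n t : nat) (T : {ffun 'I_t -> {perm 'I_n}}) : {perm 'I_n} :=
  (\prod_(j < t) T j)%g.

Definition cycle_sizes (n : nat) (s : {perm 'I_n}) : seq nat :=
  sort geq [seq #|C| | C : {set 'I_n} <- enum (porbits s)].

(* X_i(s) : size of the (i+1)-th largest cycle (0 if there are fewer cycles);
   index i : nat corresponds to the paper's index i+1 *)
Definition cycle_struct (n : nat) (s : {perm 'I_n}) (i : nat) : nat :=
  nth 0%N (cycle_sizes s) i.

Definition graph_rel (n t : nat) (T : {ffun 'I_t -> {perm 'I_n}}) : rel 'I_n :=
  fun u v => (u != v) && [exists j : 'I_t, T j == tperm u v].

Definition largest_comp (n t : nat) (T : {ffun 'I_t -> {perm 'I_n}}) : nat :=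
  \max_(x : 'I_n) #|[set y | connect (graph_rel T) x y]|.

Definition normalized_cycles (R : realType) (n t : nat)
    (T : {ffun 'I_t -> {perm 'I_n}}) : nat -> R :=
  fun i => (cycle_struct (pi_t T) i)%:R / (largest_comp T)%:R.

(* expectation of F(T_1,...,T_t) for T_j i.i.d. uniform transpositions:
   the law of (T_1..T_t) is uniform on the set of t-sequences of transpositions *)
Definition exp_transp (R : realType) (n t : nat)
    (F : {ffun 'I_t -> {perm 'I_n}} -> R) : R :=
  (\sum_(T | transp_seq T) F T) /
  (#|[set T : {ffun 'I_t -> {perm 'I_n}} | transp_seq T]|)%:R.

(* stick breaking: rem u j = 1 - sum_{i<j} x_i, and x_j = u_j * rem u j *)
Fixpoint sb_rem (R : realType) (u : nat -> R) (j : nat) : R :=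
  match j with
  | 0 => 1
  | j'.+1 => sb_rem u j' - u j' * sb_rem u j'
  end.

Definition stick (R : realType) (u : nat -> R) (j : nat) : R := u j * sb_rem u j.

(* nonincreasing rearrangement of a nonnegative sequence tending to 0:
   the (i+1)-th largest value, counted with multiplicity (0 if there are
   fewer than i+1 positive entries) *)
Definition sort_noninc (R : realType) (x : nat -> R) (i : nat) : R :=
  sup [set v : R | 0 <= v /\ exists s : seq nat,
         [/\ uniq s, size s = i.+1 & forall j, j \in s -> v <= x j]].

Definition PD1_sample (R : realType) (u : nat -> R) : nat -> R :=
  sort_noninc (stick u).

Definition mutually_independent (R : realType) (d : measure_display)
    (Omega : measurableType d) (P : probability Omega R)
    (U : nat -> Omega -> R) : Prop :=
  forall (s : seq nat) (B : nat -> set R), uniq s ->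
    (forall i, measurable (B i)) ->
    P (\bigcap_(i in [set i | i \in s]) (U i @^-1` B i)) =
    (\prod_(i <- s) P (U i @^-1` B i))%E.

(* Main.v *)
(** A vertex of the giant component lies, up to [o(n)] exceptions, in a cycle of [pi_t] longer
    than [sqrt n]: new cycles shorter than [k] are created only by fragmentation, at rate [O(k/n)]
    per step, so the components of size at least [k] not carried by such cycles have total mass
    [O(k^2 t)]; and a few additional edges ("sprinkling") join all long cycles.  The size of the
    giant component, and the fact that it absorbs all components larger than a constant, come from
    the generating function [sum_u (1 - z^|comp(u)|)] followed along a characteristic in [z].

    Among the last [o(sqrt n)] transpositions, those that act inside the set [A] of vertices in long
    cycles are, up to a negligible error, a uniform perfect matching of a uniform random subset of
    [A].  Sample [m] points of [A] and walk along the cycle of one of them: every time the walk is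
    deflected by a matched vertex it continues at a uniform place, so the next sampled point met is
    uniform among the sampled points that are still available, including the starting point.
    Hence the partition of the [m] points into cycles is that of a uniform permutation of [m]
    points, whose cycle lengths are obtained by discrete uniform stick breaking of [m]; as
    [m -> oo] this converges to the continuous stick breaking defining [PD(1)]. *)

(* The window is caught between two constraints. Its length [s] has to be o(sqrt n), so that its
   transpositions are disjoint up to probability of order [s^2 / n], and [s K] has to be much larger
   than [n], so that cycles of length [K] receive many matched points. Hence [K] must exceed sqrt n
   by a growing factor. Counting splits directly only reaches lengths [k1] below sqrt n, because the
   count grows like [k^2 t]; a separate phase of [s1] steps, still o(n), therefore lifts cycles of
   length [k1] to length [K]. In the walk the recursion for the target law holds exactly as long as
   a deflection cannot send one sampled point straight to another. Errors come from roots lying just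
   ahead and from very short loops, so the induction carries a potential that records both. The
   giant component must hardly change during the last two phases. This is obtained by comparing
   means at two times instead of by concentration. Limits are taken in the order: [n] to infinity
   with the sample size [m] fixed, then [m] to infinity, where discrete and continuous stick
   breaking are driven by the same uniform variables. *)
From HB Require Import structures.
From mathcomp Require Import all_boot all_order all_algebra all_fingroup.
From mathcomp Require Import zify ring lra reals.
Set Implicit Arguments.
Unset Strict Implicit.
Unset Printing Implicit Defensive.
Import Order.TTheory GRing.Theory Num.Theory.
Local Open Scope ring_scope.

(** * Averages over lists of independent samples *)

(* [lra] preprocesses every hypothesis; keeping only those whose variables all occur in the goal
   makes it much faster in long proofs. *)
Ltac in_goal x := match goal with |- context [x] => idtac end.
Ltac foreign T :=
  match T with context [?x] => is_var x; tryif in_goal x then fail else idtac end.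
Ltac prune_context :=
  repeat match goal with
  | H : ?T |- _ => match type of T with Prop => foreign T; clear H end
  end.
Ltac lra_local := solve [prune_context; lra] || lra.

Section Average.
Variable R : realFieldType.

Definition avg (T : finType) (A : {set T}) (F : T -> R) : R :=
  (\sum_(x in A) F x) / #|A|%:R.

(** Expectation over [s] independent uniform draws from [A], as nested averages: conditioning on the
    first draws is then reduction, and most estimates are inductions on [s]. An average over the
    empty set is 0, whence the hypotheses [A != set0] for constants. *)
Fixpoint EL (T : finType) (A : {set T}) (s : nat) (F : seq T -> R) : R :=
  if s is s'.+1 then avg A (fun x => EL A s' (fun l => F (x :: l))) else F [::].

Section OneType.
Variable T : finType.
Implicit Types (A : {set T}) (F G : T -> R).

Lemma eq_avg A F G : {in A, F =1 G} -> avg A F = avg A G.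
Proof. by move=> FG; rewrite /avg (eq_bigr G). Qed.

Lemma avgD A F G : avg A (fun x => F x + G x) = avg A F + avg A G.
Proof. by rewrite /avg big_split mulrDl. Qed.

Lemma avgZ A c F : avg A (fun x => c * F x) = c * avg A F.
Proof. by rewrite /avg -mulr_sumr mulrA. Qed.

Lemma avgB A F G : avg A (fun x => F x - G x) = avg A F - avg A G.
Proof. by rewrite /avg sumrB mulrBl. Qed.

Lemma avg_cst A c : A != set0 -> avg A (fun=> c) = c.
Proof.
move=> A0; rewrite /avg sumr_const -[c *+ _]mulr_natr -mulrA divff ?mulr1 //.
by rewrite pnatr_eq0 cards_eq0.
Qed.

Lemma ler_avg A F G : (forall x, x \in A -> F x <= G x) -> avg A F <= avg A G.
Proof. by move=> FG; rewrite ler_wpM2r ?invr_ge0 // ler_sum. Qed.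

Lemma avg_ge0 A F : (forall x, x \in A -> 0 <= F x) -> 0 <= avg A F.
Proof. by move=> F0; rewrite divr_ge0 // sumr_ge0. Qed.

Lemma avg_le_cst A F c : 0 <= c -> (forall x, x \in A -> F x <= c) -> avg A F <= c.
Proof.
move=> c0 Fc; have [->|A0] := eqVneq A set0; first by rewrite /avg big_set0 mul0r.
by rewrite -[leRHS](avg_cst c A0) ler_avg.
Qed.

Lemma avg_norm A F : `|avg A F| <= avg A (fun x => `|F x|).
Proof.
by rewrite /avg normrM normfV normr_nat ler_wpM2r ?invr_ge0 // ler_norm_sum.
Qed.

Lemma avg_sum A (I : Type) (r : seq I) (P : pred I) (F : I -> T -> R) :
  avg A (fun x => \sum_(i <- r | P i) F i x) = \sum_(i <- r | P i) avg A (F i).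
Proof. by rewrite /avg exchange_big /= mulr_suml. Qed.

Lemma avg_set0 F : avg set0 F = 0.
Proof. by rewrite /avg big_set0 mul0r. Qed.

End OneType.

Lemma avg_swap (T U : finType) (A : {set T}) (B : {set U}) (F : T -> U -> R) :
  avg A (fun x => avg B (F x)) = avg B (fun y => avg A (F^~ y)).
Proof.
rewrite /avg -!mulr_suml exchange_big /= mulrAC //.
Qed.

Section EL.
Variables (T : finType) (A : {set T}).
Implicit Types (F G : seq T -> R).

Definition lists s : pred (seq T) := fun l => (size l == s) && all (mem A) l.

Lemma lists_cons s x l : lists s.+1 (x :: l) = (x \in A) && lists s l.
Proof. by rewrite /lists /= eqSS andbCA. Qed.

Lemma ler_EL s F G : (forall l, lists s l -> F l <= G l) -> EL A s F <= EL A s G.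
Proof.
elim: s F G => [|s IH] F G FG /=; first exact: FG.
by apply: ler_avg => x xA; apply: IH => l ls; apply: FG; rewrite lists_cons xA.
Qed.

Lemma eq_EL s F G : (forall l, lists s l -> F l = G l) -> EL A s F = EL A s G.
Proof.
elim: s F G => [|s IH] F G FG /=; first exact: FG.
by apply: eq_avg => x xA; apply: IH => l ls; apply: FG; rewrite lists_cons xA.
Qed.

Lemma ELD s F G : EL A s (fun l => F l + G l) = EL A s F + EL A s G.
Proof.
elim: s F G => [|s IH] F G //=; rewrite -avgD.
by apply: eq_avg => x _; rewrite IH.
Qed.

Lemma ELZ s c F : EL A s (fun l => c * F l) = c * EL A s F.
Proof.
elim: s F => [|s IH] F //=; rewrite -avgZ.
by apply: eq_avg => x _; rewrite IH.
Qed.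

Lemma ELB s F G : EL A s (fun l => F l - G l) = EL A s F - EL A s G.
Proof.
elim: s F G => [|s IH] F G //=; rewrite -avgB.
by apply: eq_avg => x _; rewrite IH.
Qed.

Lemma EL_sum s (I : Type) (r : seq I) (P : pred I) (F : I -> seq T -> R) :
  EL A s (fun l => \sum_(i <- r | P i) F i l) = \sum_(i <- r | P i) EL A s (F i).
Proof.
elim: s F => [|s IH] F //=; rewrite -avg_sum.
by apply: eq_avg => x _; rewrite IH.
Qed.

Lemma EL_cst s c : A != set0 -> EL A s (fun=> c) = c.
Proof.
move=> A0; elim: s => [|s IH] //=.
by rewrite (@eq_avg _ _ _ (fun=> c)) ?avg_cst // => x _; rewrite IH.
Qed.

Lemma EL0 s : EL A s (fun=> 0) = 0.
Proof.
elim: s => [|s IH] //=.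
by rewrite (@eq_avg _ _ _ (fun=> 0)) /avg ?big1 ?mul0r // => x _; rewrite IH.
Qed.

Lemma EL_ge0 s F : (forall l, lists s l -> 0 <= F l) -> 0 <= EL A s F.
Proof.
elim: s F => [|s IH] F F0 /=; first exact: F0.
by apply: avg_ge0 => x xA; apply: IH => l ls; apply: F0; rewrite lists_cons xA.
Qed.

Lemma EL_le_cst s F c :
  0 <= c -> (forall l, lists s l -> F l <= c) -> EL A s F <= c.
Proof.
move=> c0; elim: s F => [|s IH] F Fc /=; first exact: Fc.
apply: avg_le_cst => // x xA; apply: IH => l ls; apply: Fc.
by rewrite lists_cons xA.
Qed.

Lemma EL_norm s F : `|EL A s F| <= EL A s (fun l => `|F l|).
Proof.
elim: s F => [|s IH] F //=; apply: le_trans (avg_norm _ _) _.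
by apply: ler_avg => x _; apply: IH.
Qed.

Lemma EL_cat s1 s2 F :
  EL A (s1 + s2) F = EL A s1 (fun l1 => EL A s2 (fun l2 => F (l1 ++ l2))).
Proof.
by elim: s1 F => [|s1 IH] F //=; apply: eq_avg => x _; rewrite IH.
Qed.

Lemma EL_rcons s F :
  EL A s.+1 F = EL A s (fun l => avg A (fun x => F (rcons l x))).
Proof.
rewrite -addn1 EL_cat; apply: eq_EL => l _ /=.
by apply: eq_avg => x _; rewrite cats1.
Qed.

Lemma EL_avg (U : finType) (B : {set U}) s (F : U -> seq T -> R) :
  EL A s (fun l => avg B (F^~ l)) = avg B (fun y => EL A s (F y)).
Proof.
elim: s F => [|s IH] F //=; rewrite avg_swap.
by apply: eq_avg => x _; rewrite IH.
Qed.

(** Cross terms of independent centred variables vanish. The Chebyshev bounds [EL_count_low] and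
    [sampling] both rest on this identity. *)
Lemma EL_sqr_sum s (y : T -> R) : avg A y = 0 ->
  EL A s (fun l => (\sum_(x <- l) y x) ^+ 2) = s%:R * avg A (fun x => y x ^+ 2).
Proof.
have [->|A0] := eqVneq A set0.
  by move=> _; rewrite avg_set0 mulr0; case: s => [|s] /=;
    rewrite ?big_nil ?expr0n ?avg_set0.
move=> y0; have m0 r : EL A r (fun l => \sum_(x <- l) y x) = 0.
  elim: r => [|r IH] /=; first by rewrite big_nil.
  rewrite (@eq_avg _ _ _ y) ?y0 // => x _.
  rewrite (@eq_EL _ _ (fun l => y x + \sum_(z <- l) y z)); last first.
    by move=> l _; rewrite big_cons.
  by rewrite ELD EL_cst // IH addr0.
elim: s => [|s IH] /=; first by rewrite big_nil expr0n mul0r.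
rewrite -natr1 mulrDl mul1r -IH addrC.
rewrite (@eq_avg _ _ _ (fun x => y x ^+ 2 +
  EL A s (fun l => (\sum_(z <- l) y z) ^+ 2))); last first.
  move=> x _; rewrite (@eq_EL _ _ (fun l => (y x ^+ 2 + (y x *+ 2) *
    \sum_(z <- l) y z) + (\sum_(z <- l) y z) ^+ 2)); last first.
    by move=> l _; rewrite big_cons sqrrD mulrnAl.
  by rewrite !ELD EL_cst // ELZ m0 mulr0 addr0.
by rewrite avgD avg_cst.
Qed.

End EL.

Lemma EL_swap (T U : finType) (A : {set T}) (B : {set U}) s r
    (F : seq T -> seq U -> R) :
  EL A s (fun l => EL B r (F l)) = EL B r (fun l' => EL A s (F^~ l')).
Proof.
elim: r F => [|r IH] F //=.
rewrite (EL_avg A B s (fun x l => EL B r (fun l' => F l (x :: l')))).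
by apply: eq_avg => x _; rewrite IH.
Qed.

End Average.

(** * Cycles of a permutation times a transposition *)

Local Open Scope nat_scope.

Section SplitMerge.
Variable V : finType.
Implicit Types (s t : {perm V}) (u v x z : V).

Lemma porbit_refl_trans s x y z :
  y \in porbit s x -> z \in porbit s y -> z \in porbit s x.
Proof. by rewrite -(eq_porbit_mem s y x) => /eqP->. Qed.

Lemma porbit_step s x : porbit s (s x) = porbit s x.
Proof. by have := porbit_perm s 1 x; rewrite expg1. Qed.

Lemma mem_porbit_step s x y : (s y \in porbit s x) = (y \in porbit s x).
Proof. by rewrite porbit_sym porbit_step porbit_sym. Qed.

Lemma porbit_period s u i : 0 < i -> (s ^+ i)%g u = u ->
  porbit s u = [set x in traject s u i].
Proof.
move=> i0 iu; have iqu q : (s ^+ (q * i))%g u = u.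
  by elim: q => [|q IH]; rewrite ?perm1 // mulSn expgD permM iu.
apply/setP => x; rewrite inE; apply/porbitP/trajectP => -[k].
  move=> ->; exists (k %% i); rewrite ?ltn_pmod // -permX {1}(divn_eq k i).
  by rewrite expgD permM iqu.
by move=> _ ->; exists k; rewrite permX.
Qed.

Lemma porbit_power_inj s u i j : i < #|porbit s u| -> j < #|porbit s u| ->
  (s ^+ i)%g u = (s ^+ j)%g u -> i = j.
Proof.
move=> iN jN; rewrite !permX => /eqP.
rewrite -(nth_traject s iN) -(nth_traject s jN).
by rewrite nth_uniq ?size_traject ?uniq_traject_porbit // => /eqP.
Qed.

Lemma porbit_lt_power s u x : x \in porbit s u ->
  exists2 i, i < #|porbit s u| & x = (s ^+ i)%g u.
Proof.
rewrite porbit_traject => /trajectP[i iN ->]; exists i => //.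
by rewrite permX.
Qed.

Lemma power_card_porbit s u : (s ^+ #|porbit s u|)%g u = u.
Proof. by rewrite permX iter_porbit. Qed.

Lemma power_step s i u : s ((s ^+ i)%g u) = (s ^+ i.+1)%g u.
Proof. by rewrite expgSr permM. Qed.

Lemma porbit_mul_tperm_out s u v z :
  z \notin porbit s u -> z \notin porbit s v ->
  porbit (s * tperm u v)%g z = porbit s z.
Proof.
move=> zu zv; set t := (s * _)%g.
have tE j : (t ^+ j)%g z = (s ^+ j)%g z.
  elim: j => [|j IH]; first by rewrite !perm1.
  rewrite !expgSr !permM IH tpermD //.
    by apply: contraNneq zu => ->; rewrite porbit_step porbit_sym mem_porbit.
  by apply: contraNneq zv => ->; rewrite porbit_step porbit_sym mem_porbit.
by apply/setP => x; apply/porbitP/porbitP => -[j ->]; exists j; rewrite tE.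
Qed.

(** The product applies [s] first, so the new permutation follows [s] from [u] until it would enter
    the [i]-th iterate, where it returns to [u]. The piece of [u] thus has exactly [i] points. *)
Lemma porbit_split_fst s u i : 0 < i < #|porbit s u| ->
  porbit (s * tperm u ((s ^+ i)%g u))%g u = [set x in traject s u i].
Proof.
case/andP=> i0 iN; set v := (s ^+ i)%g u; set t := (s * _)%g.
have tE j : j < i -> (t ^+ j)%g u = (s ^+ j)%g u.
  elim: j => [|j IH] ji; first by rewrite !perm1.
  rewrite -power_step IH ?(ltnW ji) // permM power_step tpermD //.
    apply/eqP=> e; have := @porbit_power_inj s u 0 j.+1.
    by rewrite perm1 -e => /(_ (ltn_trans i0 iN) (ltn_trans ji iN) erefl).
  apply/eqP => e; have := porbit_power_inj iN (ltn_trans ji iN) e.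
  by move=> eij; rewrite eij ltnn in ji.
rewrite (@porbit_period _ _ i) //.
  apply/setP => x; rewrite !inE; apply/trajectP/trajectP => -[j ji ->];
  by exists j; rewrite // -!permX tE.
have [j ij] : exists j, i = j.+1 by exists i.-1; rewrite prednK.
by rewrite {1}ij -power_step tE ?ij // permM power_step -ij tpermR.
Qed.

Lemma porbit_split_snd s u i : 0 < i < #|porbit s u| ->
  porbit (s * tperm u ((s ^+ i)%g u))%g ((s ^+ i)%g u) =
  [set x in traject s ((s ^+ i)%g u) (#|porbit s u| - i)].
Proof.
move=> /andP[i0 iN]; set v := (s ^+ i)%g u.
have vu : (s ^+ (#|porbit s u| - i))%g v = u.
  by rewrite /v -permM -expgD subnKC ?power_card_porbit // ltnW.
have Nv : #|porbit s v| = #|porbit s u| by rewrite porbit_perm.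
rewrite -[X in tperm X]vu tpermC porbit_split_fst // Nv; lia.
Qed.

Lemma split_traject s u i : i <= #|porbit s u| ->
  traject s u #|porbit s u| =
  traject s u i ++ traject s ((s ^+ i)%g u) (#|porbit s u| - i).
Proof. by move=> iN; rewrite permX -trajectD subnKC. Qed.

Lemma porbit_split_card s u i : 0 < i < #|porbit s u| ->
  let t := (s * tperm u ((s ^+ i)%g u))%g in
  #|porbit t u| = i /\ #|porbit t ((s ^+ i)%g u)| = #|porbit s u| - i.
Proof.
move=> iN t; have /andP[_ /ltnW iN'] := iN.
have := uniq_traject_porbit s u; rewrite (split_traject iN') cat_uniq.
case/and3P=> u1 _ u2.
rewrite /t porbit_split_fst // porbit_split_snd // !cardsE.
by rewrite (card_uniqP u1) (card_uniqP u2) !size_traject.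
Qed.

Lemma porbit_splitE s u v : u != v -> v \in porbit s u ->
  let t := (s * tperm u v)%g in
  porbit t u :|: porbit t v = porbit s u /\ porbit t u :&: porbit t v = set0.
Proof.
move=> uv /porbit_lt_power[i iN ev] t.
have i0 : 0 < i by rewrite lt0n; apply: contraNneq uv => i0; rewrite ev i0 perm1.
have iN' : 0 < i < #|porbit s u| by rewrite i0.
rewrite /t ev porbit_split_fst // porbit_split_snd //; split.
  apply/setP => x; rewrite !inE [RHS]porbit_traject.
  by rewrite (split_traject (ltnW iN)) mem_cat.
apply/setP => x; rewrite !inE.
have := uniq_traject_porbit s u; rewrite (split_traject (ltnW iN)) cat_uniq.
case/and3P=> _ /hasPn dis _; apply/andP => -[x1 x2].
by have /negP := dis x x2; apply.
Qed.

(** Merging is the inverse of splitting: once [v] is known to lie in the new cycle of [u],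
    [porbit_splitE] applied to the product and the same transposition gives back the two cycles of
    [s]. *)
Lemma porbit_mergeE s u v : v \notin porbit s u ->
  porbit (s * tperm u v)%g u = porbit s u :|: porbit s v.
Proof.
move=> vu; set t := (s * _)%g.
have uv : u != v by apply: contraNneq vu => ->; apply: porbit_id.
have tE j : j < #|porbit s u| -> (t ^+ j)%g u = (s ^+ j)%g u.
  elim: j => [|j IH] jN; first by rewrite !perm1.
  rewrite -power_step IH ?(ltnW jN) // permM power_step tpermD //.
    apply/eqP=> e; have := @porbit_power_inj s u 0 j.+1.
    by rewrite perm1 -e => /(_ (ltn_trans (ltn0Sn j) jN) jN erefl).
  by apply: contraNneq vu => ->; apply: mem_porbit.
have tv : v \in porbit t u.
  have N0 : 0 < #|porbit s u| by rewrite lt0n card_porbit_neq0.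
  apply/porbitP; exists #|porbit s u|; rewrite -(prednK N0) -power_step.
  by rewrite tE ?prednK // permM power_step prednK // power_card_porbit tpermL.
have [<- _] := porbit_splitE uv tv.
by rewrite /t -mulgA tperm2 mulg1.
Qed.

Definition small_split s k (p : V * V) : bool :=
  let t := (s * tperm p.1 p.2)%g in
  (p.2 \in porbit s p.1) && ((#|porbit t p.1| < k) || (#|porbit t p.2| < k)).

(** A piece with fewer than [k] points arises only when [v] lies fewer than [k] steps after or
    before [u] on its cycle. The bound does not depend on [s], so it holds at every step whatever
    the past. *)
Lemma card_small_split s k u :
  #|[set v | (v != u) && small_split s k (u, v)]| <= k + k.
Proof.
set N := #|porbit s u|.
apply: (@leq_trans #|[set x in [seq (s ^+ i)%g u | i <- iota 0 k] ++
                              [seq (s ^+ (N - i))%g u | i <- iota 0 k]]|).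
  apply/subset_leq_card/subsetP => v; rewrite !inE mem_cat.
  case/andP=> vu /andP[/= /porbit_lt_power[i iN ev]].
  have i0 : 0 < i by rewrite lt0n; apply: contraNneq vu => i0; rewrite ev i0 perm1.
  have iN' : 0 < i < N by rewrite i0.
  have [] := porbit_split_card iN'; rewrite /= -/N ev => -> ->.
  case/orP=> ik; apply/orP; [left|right]; apply/mapP.
    by exists i; rewrite ?mem_iota.
  by exists (N - i); rewrite ?mem_iota ?subKn // ltnW.
rewrite cardsE; apply: leq_trans (card_size _) _.
by rewrite size_cat !size_map size_iota.
Qed.

(** Cuts [a] out of its cycle and makes it a fixed point. Points that have been dealt with are
    discarded in this way while the type [V] stays the same. *)
Definition byp s a : {perm V} := (s * tperm a (s a))%g.

Lemma bypE s a z : z != a -> byp s a z = if s z == a then s a else s z.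
Proof.
move=> za; rewrite permM; case: eqP => [->|/eqP sza]; first by rewrite tpermL.
by rewrite tpermD // eq_sym // (inj_eq perm_inj).
Qed.

Lemma porbit_byp s a z : z != a -> porbit (byp s a) z = porbit s z :\ a.
Proof.
move=> za; rewrite /byp; have [saa|saa] := eqVneq (s a) a.
  rewrite saa tperm1 mulg1; apply/setP => x; rewrite !inE.
  case: eqP => //= ->; apply/negbTE; rewrite porbit_sym.
  apply/porbitP => -[i]; rewrite permX iter_fix // => e.
  by rewrite e eqxx in za.
have sa : s a \in porbit s a by rewrite mem_porbit_step porbit_id.
set t := (s * _)%g.
have ta : porbit t a = [set a].
  rewrite (@porbit_period _ _ 1) //; first by apply/setP => x; rewrite !inE.
  by rewrite expg1 permM tpermR.
have [zin|zout] := boolP (z \in porbit s a).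
  rewrite eq_sym in saa; have [eU eI] := porbit_splitE saa sa; rewrite -/t ta in eU eI.
  have zt : z \in porbit t (s a).
    by move: zin; rewrite -eU !inE (negbTE za).
  move: (zin) (zt); rewrite -!eq_porbit_mem => /eqP-> /eqP->.
  rewrite -eU; apply/setP => x; rewrite !inE.
  case: eqP => //= ->; apply/negbTE.
  by have /setP/(_ a) := eI; rewrite !inE eqxx /= => ->.
rewrite porbit_mul_tperm_out ?porbit_step //.
apply/setP => x; rewrite !inE; case: eqP => //= ->.
by apply/negbTE; rewrite porbit_sym.
Qed.

Lemma byp_mulr s (m : {perm V}) a : m a = a -> byp (s * m)%g a = (byp s a * m)%g.
Proof.
move=> ma; rewrite /byp permM -[RHS]mulgA -[LHS]mulgA; congr (_ * _)%g.
apply/permP => z; rewrite !permM; case: tpermP => [e|e|/eqP n1 /eqP n2].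
- have -> : z = a by apply: (@perm_inj _ m); rewrite e.
  by rewrite tpermL.
- have -> : z = s a by apply: (@perm_inj _ m).
  by rewrite tpermR ma.
by rewrite tpermD //; [rewrite -(inj_eq (@perm_inj _ m)) ma eq_sym
  |rewrite -(inj_eq (@perm_inj _ m)) eq_sym].
Qed.

End SplitMerge.

Local Open Scope ring_scope.

(** * Random matchings *)

Section Matching.
Variables (R : realFieldType) (V : finType).
Implicit Types (Q : {set V}) (h : {perm V} -> R) (s m : {perm V}).

(** Expectation over [r] disjoint transpositions with endpoints drawn from [Q] without replacement.
    For [#|Q| = r.*2] it is a uniform perfect matching; a larger [Q] gives the partial matchings of
    [MX_close]. *)
Fixpoint IL (r : nat) Q h : R :=
  if r is r'.+1 then
    avg Q (fun x => avg (Q :\ x) (fun y =>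
      IL r' (Q :\ x :\ y) (fun m => h (tperm x y * m)%g)))
  else h 1%g.

Lemma eq_IL r Q h h' : (forall m, perm_on Q m -> h m = h' m) -> IL r Q h = IL r Q h'.
Proof.
elim: r Q h h' => [|r IH] Q h h' hh /=; first by apply: hh; apply: perm_on1.
apply: eq_avg => x xQ; apply: eq_avg => y /setD1P[_ yQ]; apply: IH => m mQ.
apply: hh; apply: perm_onM.
  apply/subsetP => z; rewrite inE; case: tpermP => [->|->|] //.
  by rewrite eqxx.
by apply: subset_trans mQ _; apply: subset_trans (subsetDl _ _) (subsetDl _ _).
Qed.

Lemma IL_bound r Q h c : 0 <= c -> (forall m, `|h m| <= c) -> `|IL r Q h| <= c.
Proof.
move=> c0; elim: r Q h => [|r IH] Q h hc //=.
apply: le_trans (avg_norm _ _) _; apply: avg_le_cst => // x _.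
apply: le_trans (avg_norm _ _) _; apply: avg_le_cst => // y _.
by apply: IH => m.
Qed.

Lemma card_rem2 r Q x y : #|Q| = r.+1.*2 -> x \in Q -> y \in Q :\ x ->
  #|Q :\ x :\ y| = r.*2.
Proof.
move=> cQ xQ yQ; have := cardsD1 x Q; have := cardsD1 y (Q :\ x).
by rewrite xQ yQ cQ doubleS /=; lia.
Qed.

Lemma card_rem1 r Q x : #|Q| = r.+1.*2 -> x \in Q -> #|Q :\ x| = r.*2.+1.
Proof. by move=> cQ xQ; have := cardsD1 x Q; rewrite xQ cQ doubleS; lia. Qed.

Lemma IL_cst r Q c : #|Q| = r.*2 -> IL r Q (fun=> c) = c.
Proof.
elim: r Q => [|r IH] Q cQ //=.
have Q0 : Q != set0 by rewrite -card_gt0 cQ.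
rewrite -[RHS](avg_cst c Q0); apply: eq_avg => x xQ.
have Qx0 : Q :\ x != set0 by rewrite -card_gt0 (card_rem1 cQ).
by rewrite -[RHS](avg_cst c Qx0); apply: eq_avg => y yQ; rewrite IH ?(card_rem2 cQ).
Qed.

Let trip Q x (a b y : V) := [&& a \in Q :\ x, b \in Q :\ x :\ a & y \in Q :\ a :\ b :\ x].

Lemma tperm_disj_comm (a b x y : V) : a != x -> a != y -> b != x -> b != y ->
  (tperm a b * tperm x y)%g = (tperm x y * tperm a b)%g.
Proof.
move=> ax ay bx by'; apply/permP => z; rewrite !permM.
case: (tpermP a b z) => [->|->|za zb].
- by rewrite (tpermD (z:=b)) 1?eq_sym // (tpermD (z:=a)) 1?eq_sym // tpermL.
- by rewrite (tpermD (z:=a)) 1?eq_sym // (tpermD (z:=b)) 1?eq_sym // tpermR.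
case: tpermP => [_|_|zx zy].
- by rewrite tpermD.
- by rewrite tpermD.
by rewrite tpermD //; apply/eqP => e; [apply: za | apply: zb].
Qed.

(* The transposition containing any prescribed point may be revealed first. *)
Lemma IL_start r Q h x : #|Q| = r.+1.*2 -> x \in Q ->
  IL r.+1 Q h = avg (Q :\ x) (fun y =>
      IL r (Q :\ x :\ y) (fun m => h (tperm x y * m)%g)).
Proof.
elim: r Q h => [|r IH] Q h cQ xQ.
  rewrite [LHS]/=; have [z zx] : exists z, Q :\ x = [set z].
    by apply/cards1P; rewrite (card_rem1 cQ).
  have zQ : z \in Q :\ x by rewrite zx set11.
  have -> : Q = [set x; z] by rewrite -(setD1K xQ) zx.
  have xz : x != z by move: zQ; rewrite !inE eq_sym => /andP[].
  have D1 : [set x; z] :\ x = [set z].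
    by apply/setP => w; rewrite !inE; case: eqVneq => [->|] //=; rewrite (negbTE xz).
  have D2 : [set x; z] :\ z = [set x].
    apply/setP => w; rewrite !inE; case: (eqVneq w z) => [->|] //=.
      by rewrite eq_sym (negbTE xz).
    by rewrite orbF.
  rewrite /avg !cards2 xz /= big_setU1 ?inE //= big_set1 D1 D2 !big_set1 !cards1.
  by rewrite tpermC !divr1; field.
pose P (a b : V) := IL r.+1 (Q :\ a :\ b) (fun m => h (tperm a b * m)%g).
pose Y (a b y : V) :=
  IL r (Q :\ a :\ b :\ x :\ y) (fun m => h (tperm a b * (tperm x y * m))%g).
have PC a b : P a b = P b a.
  by rewrite /P tpermC !setDDl (setUC [set a]).
pose S := \sum_(y in Q :\ x) P x y.
pose T := \sum_(a in Q :\ x) \sum_(b in Q :\ x :\ a) P a b.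
have d1 : #|Q|%:R != 0 :> R by rewrite cQ pnatr_eq0.
have cQx z : z \in Q -> #|Q :\ z| = r.+1.*2.+1 by exact: card_rem1.
(* [S] collects the first pairs containing [x], [T] those avoiding it. In [T] the induction
   hypothesis reveals the pair of [x] second; exchanging it with the disjoint pair [a], [b] turns
   [T] into a multiple of [S]. *)
have eTS : T = (r.+1.*2)%:R * S.
  have -> : T = (r.*2.+1)%:R^-1 *
      \sum_a \sum_b \sum_y (if trip Q x a b y then Y a b y else 0).
    rewrite /T mulr_sumr big_mkcond; apply: eq_bigr => a _.
    case: ifP => aQ; last first.
      rewrite big1 ?mulr0 // => b _; rewrite big1 // => y _.
      by rewrite /trip aQ.
    have /setD1P[ax aQ'] := aQ.
    rewrite mulr_sumr big_mkcond; apply: eq_bigr => b _.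
    case: ifP => bQ; last first.
      by rewrite big1 ?mulr0 // => y _; rewrite /trip bQ /= andbF.
    move: (bQ); rewrite !inE => /and3P[ba bx bQ'].
    have xab : x \in Q :\ a :\ b by rewrite !inE xQ eq_sym bx eq_sym ax.
    have cab : #|Q :\ a :\ b| = r.+1.*2.
      by apply: card_rem2 cQ _ _ => //; rewrite !inE ba.
    rewrite /P (IH _ _ cab xab) /avg (card_rem1 cab xab) mulrC; congr (_ * _).
    by rewrite big_mkcond; apply: eq_bigr => y _; rewrite /trip aQ bQ.
  have -> : S = (r.+1.*2)%:R^-1 * ((r.*2.+1)%:R^-1 *
      \sum_y \sum_a \sum_b (if trip Q x a b y then Y a b y else 0)).
    rewrite /S !mulr_sumr big_mkcond; apply: eq_bigr => y _.
    case: ifP => yQ; last first.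
      rewrite big1 ?mulr0 // => a _; rewrite big1 // => b _.
      by case: ifP => // /and3P[_ _]; rewrite !inE => /and4P[y1 _ _ y2];
        rewrite !inE y1 y2 in yQ.
    move: (yQ); rewrite !inE => /andP[yx yQ'].
    have cxy : #|Q :\ x :\ y| = r.+1.*2 by apply: card_rem2 cQ _ _.
    rewrite /P /= {1}/avg cxy mulrC; congr (_ * _).
    rewrite mulr_sumr big_mkcond; apply: eq_bigr => a _.
    case: ifP => aQ; last first.
      rewrite big1 ?mulr0 // => b _; case: ifP => // /and3P[a1 _].
      rewrite !inE => /and4P[_ _ ya _]; move: a1 aQ; rewrite !inE => /andP[-> ->].
      by rewrite eq_sym ya.
    rewrite {1}/avg (card_rem1 cxy aQ) mulrC mulr_sumr mulr_sumr big_mkcond.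
    apply: eq_bigr => b _; move: (aQ); rewrite !inE => /and3P[ay ax aQ'].
    rewrite /trip !inE yx yQ' ax aQ' (eq_sym y a) ay /=.
    rewrite (andbC (b != y)) (eq_sym y b) !andbT.
    case: (eqVneq b a) => [->|ba] /=; first by rewrite mulr0.
    case: (eqVneq b x) => [->|bx] /=; first by rewrite ?andbF ?mulr0.
    case: (b \in Q); rewrite ?andbF ?mulr0 //=.
    case: (eqVneq b y) => [->|bY] /=; first by rewrite mulr0.
    congr (_ * _); rewrite /Y; have -> : Q :\ x :\ y :\ a :\ b = Q :\ a :\ b :\ x :\ y.
      by apply/setP => z; rewrite !inE; do 4!case: (_ == _); rewrite ?andbF.
    by apply: eq_IL => m _; rewrite !mulgA -(tperm_disj_comm ax ay bx bY).
  rewrite mulVKf ?pnatr_eq0 //; congr (_ * _).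
  rewrite [RHS]exchange_big; apply: eq_bigr => a _.
  by rewrite exchange_big.
have eL : IL r.+2 Q h = (#|Q|%:R)^-1 * (r.+1.*2.+1)%:R^-1 * (S + (S + T)).
  rewrite /= {1}/avg mulrC -mulrA; congr (_ * _).
  rewrite (big_setD1 x) //= mulrDr; congr (_ + _).
    by rewrite /avg cQx // mulrC.
  rewrite {1}/S -big_split /= mulr_sumr; apply: eq_bigr => a aQ.
  have /setD1P[ax aQ'] := aQ.
  rewrite /avg cQx // mulrC; congr (_ * _).
  rewrite (big_setD1 x) /=; last by rewrite !inE eq_sym ax.
  rewrite PC; congr (_ + _); apply: eq_bigl => b.
  by rewrite !inE andbCA.
rewrite eL eTS /avg cQx // -/S cQ.
have -> : S + (S + (r.+1.*2)%:R * S) = (r.+2.*2)%:R * S.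
  by rewrite (_ : r.+2.*2 = 2 + r.+1.*2)%N // natrD; ring.
by rewrite mulrC mulrACA divff ?pnatr_eq0 // mul1r.
Qed.

End Matching.

Local Open Scope nat_scope.

(** * One deflection of the walk along a matched permutation *)

Section Step.
Variable V : finType.
Implicit Types (Q : {set V}) (p s m : {perm V}) (W : seq (V * nat)).

Definition orb s : rel V := fun a b => b \in porbit s a.

(** Weights of the [e]-classes of the sampled points, the class of the first point leading. A point
    carries the weight of all points already glued to it; [n] is fuel, see [typ_fuel]. *)
Fixpoint typ n (e : rel V) W : seq nat :=
  match n, W with
  | n'.+1, c :: W' => (c.2 + \sum_(b <- W' | e c.1 b.1) b.2) ::
                      typ n' e [seq b <- W' | ~~ e c.1 b.1]
  | _, _ => [::]
  end.

Lemma eq_typ n e e' W :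
  (forall a b, a \in unzip1 W -> b \in unzip1 W -> e a b = e' a b) ->
  typ n e W = typ n e' W.
Proof.
elim: n W => [|n IH] [|c W] //= ee.
have ec b : b \in W -> e c.1 b.1 = e' c.1 b.1.
  by move=> bW; apply: ee; rewrite inE ?eqxx //= map_f ?orbT.
congr cons.
  congr (_ + _); rewrite big_seq_cond [RHS]big_seq_cond.
  by apply: eq_bigl => b; case: (boolP (b \in W)) => // bW; rewrite ec.
have -> : [seq b <- W | ~~ e' c.1 b.1] = [seq b <- W | ~~ e c.1 b.1].
  by apply: eq_in_filter => b bW; rewrite ec.
apply: IH => a b /mapP[a' a'W ->] /mapP[b' b'W ->]; apply: ee.
all: by rewrite inE map_f ?orbT //; move: a'W b'W; rewrite !mem_filter => /andP[_ ?] /andP[].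
Qed.

Lemma typ_fuel n k e W : size W <= n -> size W <= k -> typ n e W = typ k e W.
Proof.
elim: n k W => [|n IH] [|k] [|c W] //= Wn Wk; congr cons.
by apply: IH; rewrite size_filter (leq_trans (count_size _ _)).
Qed.

(** State after revealing that [x] is matched with [y]: the deflection is carried out and both
    endpoints leave the walk. The rest of the matching fixes [x] and [y], so it commutes with the
    two removals. *)
Definition stp p (x y : V) : {perm V} := byp (byp (p * tperm x y)%g x) y.

Section Table.
Variables (p : {perm V}) (x y : V).
Hypotheses (xy : x != y) (px : p x != x) (pyx : p y != x).

Lemma stpE z : z != x -> z != y ->
  stp p x y z = if p z == x then (if p y == y then p x else p y)
                else if p z == y then p x else p z.
Proof.
move=> zx zy; rewrite /stp bypE //.
have yx : y != x by rewrite eq_sym.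
have tE u : (p * tperm x y)%g u = tperm x y (p u) by rewrite permM.
have b1 u : u != x -> byp (p * tperm x y)%g x u =
    if p u == x then y else if p u == y then tperm x y (p x) else p u.
  move=> ux; rewrite bypE // !tE.
  case: (eqVneq (p u) x) => [->|pux]; first by rewrite tpermL (negbTE yx).
  case: (eqVneq (p u) y) => [->|puy]; first by rewrite tpermR eqxx.
  by rewrite tpermD ?(eq_sym _ (p u)) // (negbTE pux).
rewrite !b1 // (negbTE pyx).
case: (eqVneq (p z) x) => [pzx|pzx].
  rewrite eqxx; case: (eqVneq (p y) y) => [pyy|//].
  rewrite tpermD // eq_sym // -pyy (inj_eq perm_inj) //.
case: (eqVneq (p z) y) => [pzy|pzy]; last by rewrite (negbTE pzy).
have pxy : p x != y by rewrite -pzy (inj_eq perm_inj) eq_sym.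
by rewrite tpermD 1?eq_sym // eq_sym (negbTE pxy).
Qed.

Lemma orb_stp m a b : m x = x -> m y = y -> a != x -> a != y -> b != x -> b != y ->
  orb (stp p x y * m)%g a b = orb (p * (tperm x y * m))%g a b.
Proof.
move=> mx my ax ay bx by'; rewrite /orb /stp.
by rewrite mulgA -!byp_mulr // !porbit_byp // !inE bx by'.
Qed.

End Table.

(** Invariant of the walk. [Q] holds the points still to be matched, the first components of [W] are
    the sampled points (the roots), and [p] preserves their union. A root has to be mapped into [Q]:
    otherwise it would run into a root before any deflection, and the root met would not be
    uniform. *)
Definition valid p Q W : Prop :=
  [/\ uniq (unzip1 W), {in unzip1 W, forall w, w \notin Q},
      {in unzip1 W, forall w, p w \in Q} &
      {in Q, forall q, (p q \in Q) || (p q \in unzip1 W)}].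

(** Points of [Q] on [p]-cycles with at most two points. A walk deflected there falls back at once
    on the path issued from [x], so the deflection brings no new randomness; their number is carried
    along as an error. *)
Definition short p Q : {set V} := [set q in Q | (p q \in Q) && (p (p q) == q)].

(** How far the path after [x] is known to avoid the roots. The dangerous situation is a root
    immediately after [x], since some choices of [y] then send a root to a root; a positive gap
    excludes it. *)
Definition gapge p W x k : Prop :=
  forall i, i < k -> iter i.+1 p x \notin unzip1 W.

Section OneStep.
Variables (p : {perm V}) (Q : {set V}) (w : V) (c : nat) (W : seq (V * nat)).
Let W1 := (w, c) :: W.
Hypothesis vW : valid p Q W1.
Let x := p w.
Variable y : V.
Hypotheses (yQ : y \in Q) (yx : y != x).
Let p' := stp p x y.
Let Q' := Q :\ x :\ y.

Let wW : w \in unzip1 W1. Proof. by rewrite inE eqxx. Qed.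
Let wQ : w \notin Q. Proof. by case: vW => _ /(_ w wW). Qed.
Let xQ : x \in Q. Proof. by case: vW => _ _ /(_ w wW). Qed.
Let xy : x != y. Proof. by rewrite eq_sym. Qed.
Let wx : w != x. Proof. by apply: contraNneq wQ => ->. Qed.
Let wy : w != y. Proof. by apply: contraNneq wQ => ->. Qed.
Let px : p x != x. Proof. by rewrite {2}/x (inj_eq perm_inj) eq_sym. Qed.
Let pyx : p y != x. Proof. by rewrite (inj_eq perm_inj) eq_sym. Qed.

Lemma rootNQ v : v \in unzip1 W1 -> (v != x) * (v != y).
Proof.
case: vW => _ + _ _ => /(_ v) h /h vQ.
by split; apply: contraNneq vQ => ->.
Qed.

Lemma stp_root : p' w = if p y == y then p x else p y.
Proof. by rewrite /p' stpE // eqxx. Qed.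

Lemma stp_other z : z != x -> z != y -> z != w ->
  p' z = if p z == y then p x else p z.
Proof. by move=> zx zy zw; rewrite /p' stpE // (inj_eq perm_inj) (negbTE zw). Qed.

Lemma stp_closed : {in Q', forall q, (p' q \in Q') || (p' q \in unzip1 W1)}.
Proof.
case: vW => _ WQ pW pQ q /setD1P[qy /setD1P[qx qQ]].
have qw : q != w by apply: contraTneq qQ => ->.
have xout : p x != y -> (p x \in Q') || (p x \in unzip1 W1).
  move=> pxy; have /orP[h|->] := pQ _ xQ; last by rewrite orbT.
  by rewrite !inE pxy px h.
rewrite stp_other //; case: eqP => [pqy|/eqP pqy].
  by apply: xout; rewrite -pqy (inj_eq perm_inj) eq_sym.
have /orP[h|->] := pQ _ qQ; last by rewrite orbT.
by rewrite !inE pqy h (inj_eq perm_inj) qw.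
Qed.

Lemma stp_roots v : p x \notin unzip1 W1 \/ y != p v ->
  v \in unzip1 W1 -> v != w -> p' v \in Q'.
Proof.
move=> good vW1 vw; have [vx vy] := rootNQ vW1; case: vW => _ WQ pW pQ.
rewrite stp_other //; case: eqP => [pvy|/eqP pvy]; last first.
  by rewrite !inE pvy pW // (inj_eq perm_inj) vw.
case: good => [px'|]; last by rewrite pvy eqxx.
have /orP[h|h] := pQ _ xQ; last by rewrite h in px'.
by rewrite !inE px h -pvy (inj_eq perm_inj) eq_sym vx.
Qed.

(** Apart from [x], [y] and the root [w], only the predecessor of [y] gets a new image, namely
    [p x]. A new loop with at most two points must use this arrow, which forces [y] to be the second
    or third iterate of [x], and it lies inside this predecessor and [p x]. *)
Lemma short_stp :
  #|short p' Q'| <= #|short p Q| + (y \in [:: p (p x); p (p (p x))]).*2.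
Proof.
set b := y \in _; set z0 := (p^-1)%g y.
have pz0 : p z0 = y by rewrite /z0 permKV.
have sub : short p' Q' \subset
    short p Q :|: (if b then [set z0; p x] else set0).
  apply/subsetP => q; rewrite !inE => /and3P[/and3P[qy qx qQ]].
  case/and3P=> p'qy p'qx p'qQ /eqP e.
  have qw : q != w by apply: contraTneq qQ => ->.
  have p'qw : p' q != w by apply: contraTneq p'qQ => ->.
  have eq1 : p' q = if p q == y then p x else p q by rewrite stp_other.
  have eq2 : p' (p' q) = if p (p' q) == y then p x else p (p' q).
    by rewrite stp_other.
  case: (eqVneq (p q) y) eq1 => [pqy|pqy] eq1.
    have qz : q = z0 by apply: (@perm_inj _ p); rewrite pz0.
    have by' : b.
      rewrite /b !inE; move: eq2; rewrite e eq1.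
      case: eqP => [h _|_ h]; first by rewrite h eqxx.
      by rewrite -h pqy eqxx orbT.
    by rewrite by' qz !inE eqxx /= orbT.
  case: (eqVneq (p (p' q)) y) eq2 => [ppy|ppy] eq2.
    have qpx : q = p x by rewrite -e eq2.
    have by' : b by rewrite /b !inE -ppy eq1 qpx eqxx orbT.
    by rewrite by' !inE qpx eqxx !orbT.
  by rewrite qQ -eq1 p'qQ -eq2 e eqxx.
apply: leq_trans (subset_leq_card sub) _; apply: leq_trans (leq_card_setU _ _) _.
rewrite leq_add2l; case: (b); last by rewrite cards0.
by rewrite cards2; case: (_ != _).
Qed.

Lemma run_along t k : gapge p W1 x k -> y \notin porbit p x -> t < k ->
  iter t p' (p x) = iter t.+1 p x.
Proof.
move=> gap yx'; elim: t => [|t IH] tk //; rewrite iterS IH ?(ltnW tk) //.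
set z := iter t.+1 p x.
have zW : z \notin unzip1 W1 by apply: gap; apply: ltnW.
have zo i : iter i p x \in porbit p x by rewrite -permX mem_porbit.
have zw : z != w by apply: contraNneq zW => ->.
have zy : z != y by apply: contraNneq yx' => <-; apply: zo.
have zx : z != x.
  rewrite /z iterS {2}/x (inj_eq perm_inj); case: (t) tk => [|t'] tk.
    by rewrite eq_sym.
  by have := gap t' (ltn_trans (ltnW (ltnSn _)) tk); apply: contraNneq => ->.
rewrite stp_other //; case: eqP => [pzy|//].
by case/negP: yx'; rewrite -pzy -[p z]/(iter t.+2 p x) zo.
Qed.

(** From [p y] the walk passes to [p x] and then follows the old path. If [y] is fixed by [p] it
    starts at [p x] itself, one step further along, hence [k.-1]. *)
Lemma gap_short k : gapge p W1 x k -> p (p y) = y -> p y \in Q ->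
  gapge p' W1 (p' w) k.-1.
Proof.
move=> gap ppy pyQ.
have yx' : y \notin porbit p x.
  apply/negP => yox; have : w \in porbit p y.
    by rewrite porbit_sym -(porbit_step p w).
  rewrite (@porbit_period _ _ _ 2) //; last by rewrite permX /= ppy.
  rewrite !inE (negbTE wy) /= => /eqP e.
  by have := wQ; rewrite e pyQ.
have pxy : p x != y.
  by apply: contraNneq yx' => <-; rewrite mem_porbit_step porbit_id.
move=> i ik; have ik' : i.+1 < k by case: (k) ik.
rewrite stp_root; case: eqP => [pyy|/eqP pyy].
  by rewrite (run_along gap) // gap.
rewrite iterSr stp_other //.
  by rewrite ppy eqxx (run_along gap) ?gap // ltnW.
by apply: contraTneq pyQ => ->.
Qed.

(** The new path follows [p] from [p y]. If it reaches the predecessor of [y], then [x] is on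
    another cycle and the path jumps to [p x]. As the cycle of [y] has at least three points, this
    jump lands at the second step at the earliest, so that [K <= k.+1] suffices. *)
Lemma gap_long k K : gapge p W1 x k -> p (p y) != y -> p y \in Q -> K <= k.+1 ->
  gapge p W1 (p y) K -> gapge p' W1 (p' w) K.
Proof.
move=> gap ppy pyQ Kk gapy.
have pyy : p y != y by apply: contraNneq ppy => e; rewrite !e.
rewrite stp_root (negbTE pyy).
have key j : j <= K ->
   (iter j p' (p y) = iter j p (p y) /\
     forall i, i <= j -> (iter i p (p y) != y)) \/
   exists t, [/\ t.+2 <= j, iter j p' (p y) = iter t.+1 p x & y \notin porbit p x].
  elim: j => [|j IH] jK.
    by left; split=> // i; rewrite leqn0 => /eqP->.
  case: (IH (ltnW jK)) => [[ej nj]|[t [tj ej yx']]]; last first.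
    right; exists t.+1; split=> //; rewrite iterS ej.
    have tk : t.+1 < k := leq_trans (leq_ltn_trans tj jK) Kk.
    by rewrite -(run_along gap yx' (ltnW tk)) -iterS (run_along gap yx' tk).
  rewrite iterS ej; set z := iter j p (p y).
  have zW : z \notin unzip1 W1.
    rewrite /z; case: (j) jK => [|j'] jK; last by apply: gapy; apply: ltnW.
    by apply/negP => h; case: vW => _ /(_ _ h); rewrite pyQ.
  have zw : z != w by apply: contraNneq zW => ->.
  have zy : z != y by apply: nj.
  have zx : z != x.
    rewrite /z; case: (j) jK => [|j'] jK; first exact: pyx.
    rewrite iterS /x (inj_eq perm_inj).
    case: (j') jK => [|j''] jK; first by apply: contraTneq pyQ => /= ->.
    by have := gapy j'' (ltnW (ltnW jK)); apply: contraNneq => ->; rewrite inE eqxx.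
  rewrite stp_other //; case: (eqVneq (p z) y) => [pzy|pzy]; last first.
    left; split; first by [].
    by move=> i; rewrite leq_eqVlt => /orP[/eqP->|]; [exact: pzy|exact: nj].
  right; exists 0; split=> //.
    by rewrite !ltnS lt0n; apply: contraNneq ppy => j0; rewrite -[X in _ == X]pzy /z j0.
  apply/negP => yox; have : w \in porbit p y.
    by rewrite porbit_sym -(porbit_step p w).
  rewrite (@porbit_period _ _ _ j.+2) //; last by rewrite permX iterS iterSr.
  rewrite inE => /trajectP[[|[|i]] ij ew].
  - by have := wy; rewrite ew eqxx.
  - by have := wQ; rewrite ew pyQ.
  have iK : i < K by apply: ltn_trans jK.
  by have := gapy i iK; rewrite -iterSr -ew wW.
move=> i iK; case: (key i.+1 iK) => [[-> _]|[t [tj -> _]]]; first exact: gapy.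
by apply: gap; move: (leq_trans tj (leq_trans iK Kk)).
Qed.

End OneStep.
End Step.

Local Open Scope ring_scope.

Definition rem_at (T : Type) i (s : seq T) := take i s ++ drop i.+1 s.

Lemma size_rem_at (T : Type) i (s : seq T) : (i < size s)%N ->
  size (rem_at i s) = (size s).-1.
Proof.
by move=> i_s; rewrite size_cat size_take size_drop i_s; lia.
Qed.

Lemma map_rem_at (T U : Type) (f : T -> U) i (s : seq T) :
  map f (rem_at i s) = rem_at i (map f s).
Proof. by rewrite map_cat map_take map_drop. Qed.

Lemma rem_atK (T : Type) (x0 : T) i (s : seq T) : (i < size s)%N ->
  s = take i s ++ nth x0 s i :: drop i.+1 s.
Proof. by move=> i_s; rewrite -drop_nth // cat_take_drop. Qed.

Lemma rem_at_subseq (T : eqType) i (s : seq T) : subseq (rem_at i s) s.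
Proof.
rewrite -{2}(cat_take_drop i s) /rem_at cat_subseq //.
by rewrite -addn1 addnC -drop_drop drop_subseq.
Qed.

(** * The exact law of the cycle weights of a uniform permutation *)

Section Feller.
Variable R : realFieldType.

(** The Feller coupling for weighted points, as an expectation of [g] over the list of cycle
    weights: the path from the first point next meets its own start or one of the other points, all
    equally likely, and a point that is met adds its weight to the current cycle. *)
Fixpoint Fel n (g : seq nat -> R) (ws : seq nat) : R :=
  match n, ws with
  | n'.+1, a :: rest =>
    (Fel n' (fun l => g (a :: l)) rest +
     \sum_(i < size rest) Fel n' g ((a + nth 0 rest i)%N :: rem_at i rest))
    / (size rest).+1%:R
  | _, _ => g [::]
  end.

Lemma Fel_bound n g ws : (forall l, `|g l| <= 1) -> `|Fel n g ws| <= 1.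
Proof.
elim: n g ws => [|n IH] g [|a rest] g1 //=.
rewrite normrM normfV normr_nat ler_pdivrMr ?ltr0n // mul1r.
apply: le_trans (ler_normD _ _) _; rewrite -natr1 addrC lerD //; last exact: IH.
apply: le_trans (ler_norm_sum _ _ _) _.
rewrite -[X in _ <= X%:R]card_ord -sumr_const ler_sum // => i _; exact: IH.
Qed.

End Feller.

Section TypSteps.
Variable V : finType.
Implicit Types (e : rel V) (W : seq (V * nat)).

Lemma typ_close n e w c W : (forall b, b \in W -> e w b.1 = false) ->
  typ n.+1 e ((w, c) :: W) = c :: typ n e W.
Proof.
move=> ew /=; congr cons.
  by rewrite big_seq_cond big_pred0 ?addn0 // => b; case: (boolP (b \in W)) => // /ew->.
by rewrite (@eq_in_filter _ _ predT) ?filter_predT // => b /ew->.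
Qed.

Lemma typ_merge n e w c W i b0 : (i < size W)%N -> (size W <= n)%N ->
  e w (nth b0 W i).1 ->
  typ n.+1 e ((w, c) :: W) = typ n e ((w, c + (nth b0 W i).2)%N :: rem_at i W).
Proof.
move=> iW Wn ewb; case: n Wn => [|n] Wn; first by case: W iW Wn {ewb}.
rewrite -(@typ_fuel _ n.+2 n.+1); last 2 first.
- by rewrite /= size_rem_at //; lia.
- by rewrite /= size_rem_at //; lia.
have := rem_atK b0 iW; rewrite /rem_at.
move: (take i W) (drop i.+1 W) (nth b0 W i) ewb => t1 t2 b ewb ->.
rewrite [LHS]/= [RHS]/= !big_cat big_cons /= ewb.
by rewrite filter_cat /= ewb /= -filter_cat; congr cons; lia.
Qed.

End TypSteps.

(** The inequality left by one step of the walk, multiplied by the number [d] of choices of [y]. In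
    its last hypothesis the first alternative is a walk with no root directly ahead, the second a
    walk with gap 0. *)
Lemma step_arith (R : realFieldType) (d r1 F ka A m m0 f hk S1 S2 e : R) :
  0 < F -> 0 <= ka -> 0 <= A -> 0 <= m -> m <= m0 -> 0 <= r1 -> f < F ->
  8 * F <= r1 -> r1 <= d -> 4 * (3 * m0 + F) <= ka * r1 ->
  3 * m0 * ka + 4 / F <= A * r1 -> 0 <= hk ->
  S1 <= d * (hk / 2) + 2 * m + 2 * hk * f -> S2 <= d * f + 4 ->
  e <= m * ka \/ (hk = 1 /\ e <= 3 * m + f) ->
  e + ka * S1 + S2 / F <= d * (A + ka * hk + f / F).
Proof.
move=> F0 ka0 A0 m00 mm r0 fF HF dr Hka HA hk0 S1le S2le ele.
have S2F : S2 / F <= d * (f / F) + 4 / F.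
  by rewrite mulrA -mulrDl ler_pM2r ?invr_gt0.
have kS1 : ka * S1 <= ka * (d * (hk / 2) + 2 * m + 2 * hk * f).
  by rewrite ler_wpM2l.
have fd : 8 * f <= d by lra.
have kf : (ka * hk) * (8 * f) <= (ka * hk) * d.
  by rewrite ler_wpM2l // mulr_ge0.
have Ad : A * r1 <= A * d by rewrite ler_wpM2l.
have kam : m * ka <= m0 * ka by rewrite ler_wpM2r.
case: ele => [e2|[hk1 e2]].
  have q0 : 0 <= ka * hk * d by rewrite !mulr_ge0 // (le_trans r0).
  lra.
rewrite hk1 in kS1 kf *.
have kad : ka * r1 <= ka * d by rewrite ler_wpM2l.
have mk0 : 0 <= m * ka by rewrite mulr_ge0.
have e3 : e <= ka * d / 4 by lra.
lra.
Qed.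

(** * An error potential for the walk *)

Section MatchingBound.
Variables (R : realFieldType) (V : finType).
Variables (m0 r0 : nat) (F ka A : R).
Hypotheses (F0 : 0 < F) (ka0 : 0 <= ka) (A0 : 0 <= A).
Hypothesis HF : 8 * F <= r0.*2.+1%:R.
Hypothesis Hka : 4 * (3 * m0%:R + F) <= ka * r0.*2.+1%:R.
Hypothesis HA : 3 * m0%:R * ka + 4 / F <= A * r0.*2.+1%:R.

(** Ideal probability that a given root is still unmet when [r0] pairs remain: with [i + 1] pairs
    left the partner of [x] has [2i + 1] possible values, exactly one of which leads to that
    root. *)
Definition uu r : R := \prod_(r0 <= i < r) (1 - (i.*2.+1%:R)^-1).

Lemma uu_ge0 r : 0 <= uu r.
Proof.
by apply: prodr_ge0 => i _; rewrite subr_ge0 invf_le1 ?ler1n ?ltr0n.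
Qed.

Lemma uu_le1 r : uu r <= 1.
Proof.
apply: prodr_ile1 => i _; rewrite subr_ge0 invf_le1 ?ler1n ?ltr0n //=.
by rewrite gerBl invr_ge0 ler0n.
Qed.

Lemma uuS r : (r0 <= r)%N -> uu r.+1 = uu r * (1 - (r.*2.+1%:R)^-1).
Proof. by move=> rr; rewrite /uu big_nat_recr. Qed.

(** The potential: roots not met before level [r0], a loss [A] per step, a price [ka / 2^k] for a
    root possibly [k] steps ahead, and the short loops relative to a threshold [F]. It is at least 1
    at [r = r0] if there is a root, and whenever [f >= F]; there the trivial bound 2 on [diff] is
    enough. *)
Definition bnd (r m k f : nat) : R :=
  m%:R * uu r + A * (r - r0)%:R + ka * (2^-1) ^+ k + f%:R / F.

Lemma bnd_ge0 r m k f : 0 <= bnd r m k f.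
Proof. by rewrite !addr_ge0 ?mulr_ge0 ?uu_ge0 ?exprn_ge0 ?invr_ge0 ?(ltW F0) //; lra. Qed.

Lemma bnd_mono r m k f f' : (f <= f')%N -> bnd r m k f <= bnd r m k f'.
Proof. by move=> ff; rewrite lerD2l ler_pM2r ?invr_gt0 // ler_nat. Qed.

Let diff (g : seq nat -> R) r (p : {perm V}) Q W : R :=
  `|IL r Q (fun m => g (typ (size W) (orb (p * m)%g) W)) - Fel (size W) g (unzip2 W)|.

Lemma diff_le2 g r p Q W : (forall l, `|g l| <= 1) -> diff g r p Q W <= 2.
Proof.
move=> g1; apply: le_trans (ler_normB _ _) _; rewrite (_ : 2 = 1 + 1 :> R) ?lerD //.
  by apply: IL_bound => // m; apply: g1.
exact: Fel_bound.
Qed.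

Section Step.
Variable r : nat.
Hypothesis rr : (r0 <= r)%N.
Hypothesis IH : forall (g : seq nat -> R) (p : {perm V}) (Q : {set V}) (w : V)
  (c : nat) (W : seq (V * nat)) (k : nat), (forall l, `|g l| <= 1) ->
  let W1 := (w, c) :: W in
  (size W1 <= m0)%N -> #|Q| = r.*2 -> valid p Q W1 -> gapge p W1 (p w) k ->
  diff g r p Q W1 <= 2 * bnd r (size W1) k #|short p Q|.

Variables (g : seq nat -> R) (p : {perm V}) (Q : {set V}) (w : V) (c : nat).
Variables (W : seq (V * nat)) (k : nat).
Hypothesis g1 : forall l, `|g l| <= 1.
Let W1 := (w, c) :: W.
Let Wv := unzip1 W1.
Let m := size W1.
Let x := p w.
Let f := #|short p Q|.
Let d : R := r.*2.+1%:R.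
Let Fl := Fel m g (unzip2 W1).
Hypotheses (mm0 : (m <= m0)%N) (cQ : #|Q| = r.+1.*2) (vW : valid p Q W1).
Hypothesis gap : gapge p W1 x k.

Let val y := IL r (Q :\ x :\ y)
  (fun s => g (typ m (orb (p * (tperm x y * s))%g) W1)).
Let xQ : x \in Q. Proof. by case: vW => _ _ h _; apply: h; rewrite inE eqxx. Qed.
Let wQ : w \notin Q. Proof. by case: vW => _ h _ _; apply: h; rewrite inE eqxx. Qed.

Let bump y : nat := (y \in [:: p (p x); p (p (p x))]).*2.

(** Gap guaranteed after choosing [y]: [k.-1] by [gap_short], otherwise by [gap_long] the distance
    from [p y] to the next root, truncated at [k.+1] because the path may fall back on that of
    [x]. *)
Let Ky y : nat := if p (p y) == y then k.-1
  else find (fun i => iter i.+1 p (p y) \in Wv) (iota 0 k.+1).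

Let valE y : y \in Q :\ x ->
  val y = IL r (Q :\ x :\ y) (fun s => g (typ m (orb (stp p x y * s)%g) W1)).
Proof.
case/setD1P=> yx yQ; apply: eq_IL => s sQ; congr g; apply: eq_typ => a b aW bW.
have fixs z : z \notin Q :\ x :\ y -> s z = z by exact: out_perm sQ.
have xy : x != y by rewrite eq_sym.
have wx : w != x by apply: contraNneq wQ => ->.
have wy : w != y by apply: contraNneq wQ => ->.
have [ax ay] := rootNQ vW yQ aW; have [bx by'] := rootNQ vW yQ bW.
by rewrite -orb_stp // fixs // !inE eqxx ?andbF.
Qed.

Let IH0 (g' : seq nat -> R) s (Q' : {set V}) W' : (forall l, `|g' l| <= 1) -> (size W' <= m0)%N ->
  #|Q'| = r.*2 -> valid s Q' W' ->
  diff g' r s Q' W' <= 2 * bnd r (size W') 0 #|short s Q'|.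
Proof.
case: W' => [|[w' c'] W'] g'1 sW cQ' vW'; last by apply: IH.
by rewrite /diff /= IL_cst // subrr normr0 mulr_ge0 // bnd_ge0.
Qed.

Let cQ' y : y \in Q :\ x -> #|Q :\ x :\ y| = r.*2.
Proof. exact: card_rem2. Qed.

(** The walk lands on a point still to be matched, so all roots survive and the induction hypothesis
    applies to the same [W1]. The last condition keeps the state [valid]: when [p x] is a root, a
    fixed point [y] or the image [y] of another root would send a root to a root. *)
Let nonglue y : y \in Q :\ x -> p y \in Q ->
  (p x \notin Wv) || (y \notin short p Q) && (y \notin map p Wv) ->
  `|val y - Fl| <= 2 * bnd r m (Ky y) (f + bump y).
Proof.
move=> yS pyQ good; have /setD1P[yx yQ] := yS.
have [uW WQ pW pQ] := vW.
have vW' : valid (stp p x y) (Q :\ x :\ y) W1.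
  split => //; last exact: stp_closed.
    by move=> v vW1; have := WQ v vW1; rewrite !inE => /negbTE->; rewrite !andbF.
  move=> v vW1; have [->|vw] := eqVneq v w; last first.
    apply: (stp_roots (W := W) (c := c)) => //; move: good.
    case: (boolP (p x \in Wv)) => [_ /orP[//|/andP[_ ny]]|nx _]; last by left.
    by right; apply: contraNneq ny => ->; apply/mapP; exists v.
  rewrite (stp_root vW yQ yx); case: eqP => [pyy|/eqP pyy]; last first.
    rewrite !inE pyy pyQ andbT (inj_eq perm_inj).
    by apply: contraNneq wQ => <-.
  have px : p x \notin Wv.
    move: good; case: (p x \notin Wv) => //= /andP[+ _].
    by rewrite inE yQ pyQ !pyy eqxx.
  have /orP[h|h] := pQ _ xQ; last by rewrite h in px.
  have xw : x != w by apply: contraNneq wQ => <-.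
  by rewrite !inE h (inj_eq perm_inj) xw -pyy (inj_eq perm_inj) eq_sym yx.
rewrite valE //; apply: le_trans (IH g1 mm0 (cQ' yS) vW' _) _; last first.
  apply: ler_wpM2l => //; apply: bnd_mono; exact: (short_stp vW yQ yx).
rewrite /Ky; case: eqP => [ppy|/eqP ppy]; first exact: (gap_short vW yQ yx gap).
apply: (gap_long vW yQ yx gap) => //.
  by rewrite (leq_trans (find_size _ _)) ?size_iota.
move=> i ik; have ik1 : (i < k.+1)%N.
  by apply: leq_trans ik _; rewrite (leq_trans (find_size _ _)) ?size_iota.
by have /negbT := before_find 0%N ik; rewrite nth_iota.
Qed.

Let sWm0 : (size W <= m0)%N. Proof. exact: leq_trans (leqnSn _) mm0. Qed.

(** The alternatives of the recursion for [Fel]: index 0 closes the class of [w], index [i.+1]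
    merges it with the [i]-th other root. Their mean is exactly the target, so a uniform choice of
    the root met costs nothing. *)
Let outc j : R := if j is i.+1
  then Fel (size W) g ((c + nth 0%N (unzip2 W) i)%N :: rem_at i (unzip2 W))
  else Fel (size W) (fun l => g (c :: l)) (unzip2 W).

Let sum_outc : \sum_(j < m) outc j = m%:R * Fl.
Proof.
rewrite big_ord_recl /Fl [Fel m g _]/= [RHS]mulrC.
have -> : m%:R = (size (unzip2 W)).+1%:R :> R by rewrite size_map.
rewrite divfK ?pnatr_eq0 // size_map; congr (_ + _).
Qed.

(** The walk has met the root [p y]: either [w] closes its class and leaves the list, or [p y] is
    bypassed and its weight passes to [w]. One root disappears, and nothing is known about the new
    gap, hence [m.-1] and gap 0. *)
Let glue y : y \in Q :\ x -> p y \in Wv -> p x \notin Wv ->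
  `|val y - outc (index (p y) Wv)| <= 2 * bnd r m.-1 0 (f + bump y).
Proof.
move=> yS pyW good; have /setD1P[yx yQ] := yS.
have [uW WQ pW pQ] := vW.
have pyy : p y != y by apply: contraTneq yQ => <-; apply: WQ.
have wx : w != x by apply: contraNneq wQ => ->.
have wy : w != y by apply: contraNneq wQ => ->.
set p' := stp p x y; set Q' := Q :\ x :\ y.
have p'w : p' w = p y by rewrite (stp_root vW yQ yx) (negbTE pyy).
have clos := stp_closed vW yQ yx.
have roots v : v \in Wv -> v != w -> p' v \in Q'.
  by move=> vW1; apply: (stp_roots (W := W) (c := c)) => //; left.
have NQ' v : v \in Wv -> v \notin Q'.
  by move=> vW1; have := WQ v vW1; rewrite !inE => /negbTE->; rewrite !andbF.
have sh : (#|short p' Q'| <= f + bump y)%N by exact: (short_stp vW yQ yx).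
have fixs s z : perm_on Q' s -> z \notin Q' -> s z = z by exact: out_perm.
move: uW; rewrite [unzip1 W1]/= cons_uniq => /andP[wW uW].
rewrite valE // [index _ _]/=; case: eqP => [wpy|/eqP wpy]; rewrite /outc.
  have vW' : valid p' Q' W.
    split=> //.
    - by move=> v vW1; apply: NQ'; rewrite inE vW1 orbT.
    - move=> v vW1; apply: roots; first by rewrite inE vW1 orbT.
      by apply: contraNneq wW => <-.
    move=> q qQ'; have := clos q qQ'; rewrite -/p' -/Q' => /orP[->//|].
    rewrite inE => /orP[/eqP e|->]; last by rewrite orbT.
    have qw : q = w by apply: (@perm_inj _ p'); rewrite e p'w.
    by have := NQ' w; rewrite inE eqxx -qw qQ' => /(_ isT).
  rewrite (@eq_IL _ _ _ _ _ (fun s => g (c :: typ (size W) (orb (p' * s)%g) W))).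
    apply: le_trans (IH0 _ _ _ vW') _ => //.
    - exact: (cQ' yS).
    by apply: ler_wpM2l => //; apply: bnd_mono.
  move=> s sQ; rewrite /m /W1 [size (_ :: _)]/= typ_close // => b bW; rewrite /orb.
  have sw : (p' * s)%g w = w.
    by rewrite permM p'w -wpy; apply: fixs sQ _; apply: NQ'; rewrite inE eqxx.
  rewrite (@porbit_period _ _ _ 1) ?expg1 // !inE /=.
  by apply: contraNF wW => /eqP <-; apply: map_f.
have pyW' : p y \in unzip1 W by move: pyW; rewrite inE eq_sym (negbTE wpy).
set i := index (p y) (unzip1 W).
have iW : (i < size W)%N by rewrite -(size_map fst) index_mem.
have b1 : (nth (w, c) W i).1 = p y.
  by rewrite -(nth_map (w,c) w fst) // nth_index.
have b2 : (nth (w, c) W i).2 = nth 0%N (unzip2 W) i.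
  by rewrite (nth_map (w, c)).
set W' := (w, (c + nth 0%N (unzip2 W) i)%N) :: rem_at i W.
have memW' v : (v \in unzip1 W') = (v == w) || (v \in rem_at i (unzip1 W)).
  by rewrite /unzip1 -map_rem_at /= inE.
have subW' v : v \in unzip1 W' -> v \in Wv.
  rewrite memW' => /orP[/eqP->|h]; first by rewrite inE eqxx.
  by rewrite inE (mem_subseq (rem_at_subseq _ _) h) orbT.
have iW' : (i < size (unzip1 W))%N by rewrite size_map.
have memWv v : (v \in unzip1 W) = (v == p y) || (v \in rem_at i (unzip1 W)).
  rewrite {1}(rem_atK w iW') nth_index // /rem_at; move: (take _ _) => t1.
  by rewrite !mem_cat inE orbCA.
have NpyW' : p y \notin unzip1 W'.
  rewrite memW' eq_sym (negbTE wpy) /=.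
  have := uW; rewrite {1}(rem_atK w iW') nth_index // /rem_at.
  rewrite -cat_rcons cat_uniq rcons_uniq mem_cat.
  case/and3P=> /andP[/negbTE-> _] /hasPn h _.
  by apply/negP => /h; rewrite mem_rcons inE eqxx.
have vW' : valid (byp p' (p y)) Q' W'.
  have step v : v != p y -> byp p' (p y) v = if v == w then p' (p y) else p' v.
    by move=> vpy; rewrite bypE // -{1}p'w (inj_eq perm_inj).
  have p'py : p' (p y) \in Q' by apply: roots => //; rewrite eq_sym.
  split.
  - rewrite /unzip1 /= map_rem_at (subseq_uniq (rem_at_subseq _ _) uW) andbT.
    by apply: contra wW => h; apply: mem_subseq (rem_at_subseq _ _) _ h.
  - by move=> v /subW'; apply: NQ'.
  - move=> v vW1; rewrite step; last by apply: contraNneq NpyW' => <-.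
    by case: eqP => // /eqP vw; apply: roots => //; apply: subW'.
  move=> q qQ'; have qw : q != w.
    by apply: contraTneq qQ' => ->; apply: NQ'; rewrite inE eqxx.
  rewrite step ?(negbTE qw); last by apply: contraTneq qQ' => ->; apply: NQ'.
  have := clos q qQ'; rewrite -/p' -/Q' => /orP[->//|]; rewrite inE memW'.
  case/orP=> [->|]; first by rewrite orbT.
  have npq : p' q != p y by rewrite -p'w (inj_eq perm_inj).
  by rewrite memWv (negbTE npq) /= => ->; rewrite !orbT.
have sW' : size W' = size W by rewrite /= size_rem_at // prednK // (leq_ltn_trans _ iW).
rewrite (@eq_IL _ _ _ _ _ (fun s => g (typ (size W') (orb (byp p' (p y) * s)%g) W'))).
  have -> : Fel (size W) g ((c + nth 0%N (unzip2 W) i)%N :: rem_at i (unzip2 W)) =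
     Fel (size W') g (unzip2 W').
    by rewrite sW' /= /unzip2 map_rem_at.
  apply: le_trans (IH0 g1 _ _ vW') _.
  - by rewrite sW'.
  - exact: (cQ' yS).
  rewrite sW'; apply: ler_wpM2l => //; apply: bnd_mono; apply: leq_trans sh.
  apply/subset_leq_card/subsetP => q; rewrite !inE => /and3P[qQ].
  have nq v : v \in Q' -> byp p' (p y) v = p' v.
    move=> vQ; rewrite bypE; last by apply: contraTneq vQ => ->; apply: NQ'.
    rewrite -{1}p'w (inj_eq perm_inj); case: eqP => // e.
    by move: vQ; rewrite e => h; have := NQ' w; rewrite inE eqxx h => /(_ isT).
  have qQ' : q \in Q' by rewrite !inE.
  by rewrite !(nq q) // => h1 h2; move: h2; rewrite nq ?inE // => ->; rewrite qQ h1.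
move=> s sQ; congr g; rewrite sW' /m [size W1]/= (@typ_merge _ _ _ _ _ _ i (w, c)) //; last first.
  rewrite /orb b1; apply/porbitP; exists 1%N; rewrite expg1 permM p'w.
  by rewrite (fixs _ _ sQ) // NQ'.
rewrite b2 -/W'; apply: eq_typ => a b aW bW; rewrite /orb.
rewrite -byp_mulr ?(fixs _ _ sQ) ?NQ' // porbit_byp; last first.
  by apply: contraNneq NpyW' => <-.
by rewrite !inE; have -> : b != p y by apply: contraNneq NpyW' => <-.
Qed.

Let card_S : #|Q :\ x| = r.*2.+1. Proof. exact: card_rem1. Qed.

Let sum_bump : \sum_(y in Q :\ x) (f + bump y)%:R <= d * f%:R + 4 :> R.
Proof.
under eq_bigr do rewrite natrD; rewrite big_split /= sumr_const card_S.
rewrite -[f%:R *+ _]mulr_natl lerD2l.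
apply: le_trans (_ : \sum_(y in [set p (p x); p (p (p x))]) 2%:R <= _).
  rewrite big_mkcond [leRHS]big_mkcond ler_sum // => y _.
  rewrite /bump !inE; case: (_ && _); case: (_ || _) => //=; rewrite ?ler0n //.
rewrite sumr_const cards2 -mulrnA ler_nat.
by case: (_ != _).
Qed.

Let half : R := 2^-1.

(** For each [i], injectivity of the iterates leaves at most [m] choices of [y] with a root at
    distance [i], each weighing [2^-i]; the geometric series gives [2 m]. The other two terms come
    from the truncation and from the short loops. *)
Let sum_Ky : \sum_(y in Q :\ x | p y \in Q) half ^+ Ky y <=
  d * half ^+ k.+1 + 2 * m%:R + 2 * half ^+ k * f%:R.
Proof.
have h0 : 0 <= half by rewrite /half; lra.
pose cnt i (y : V) : R := (iter i.+2 p y \in Wv)%:R.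
have one y : y \in Q :\ x -> p y \in Q -> half ^+ Ky y <= half ^+ k.+1 +
    (\sum_(i < k.+1) half ^+ i * cnt i y) + 2 * half ^+ k * (y \in short p Q)%:R.
  case/setD1P=> _ yQ pyQ; rewrite inE yQ pyQ /= /Ky.
  have s0 : 0 <= \sum_(i < k.+1) half ^+ i * cnt i y.
    by apply: sumr_ge0 => i _; rewrite mulr_ge0 ?exprn_ge0.
  have hk0 j : 0 <= half ^+ j by rewrite exprn_ge0.
  case: eqP => [_|/eqP ppy].
    rewrite (_ : true%:R = 1) // mulr1; apply: le_trans (_ : 2 * half ^+ k <= _).
      case: (k) => [|k'] /=; first by rewrite expr0; lra.
      by rewrite exprS mulrA /half mulfV ?mul1r // pnatr_eq0.
    by rewrite lerDr addr_ge0.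
  rewrite (_ : false%:R = 0) // mulr0 addr0; set K := find _ _.
  have [Kk|Kk] := ltnP K k.+1; last first.
    have -> : K = k.+1.
      by apply/eqP; rewrite eqn_leq Kk andbT (leq_trans (find_size _ _)) ?size_iota.
    by rewrite lerDl.
  apply: le_trans (_ : \sum_(i < k.+1) half ^+ i * cnt i y <= _); last by rewrite lerDr.
  rewrite (bigD1 (Ordinal Kk)) // [nat_of_ord (Ordinal Kk)]/=.
  have -> : cnt K y = 1.
    rewrite /cnt; suff -> : iter K.+2 p y \in Wv by [].
    have : has (fun i => iter i.+1 p (p y) \in Wv) (iota 0 k.+1).
      by rewrite has_find size_iota.
    by move/(nth_find 0%N); rewrite -/K nth_iota // add0n -iterSr.
  by rewrite mulr1 lerDl sumr_ge0 // => i _; rewrite mulr_ge0.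
rewrite -big_filter_cond.
apply: le_trans (_ : \sum_(y in Q :\ x) (half ^+ k.+1 +
    (\sum_(i < k.+1) half ^+ i * cnt i y) + 2 * half ^+ k * (y \in short p Q)%:R) <= _).
  rewrite big_filter_cond big_mkcondr /=; apply: ler_sum => y yS.
  case: ifP => pyQ; first exact: one.
  by rewrite !addr_ge0 ?mulr_ge0 ?exprn_ge0 // sumr_ge0 // => i _; rewrite mulr_ge0 ?exprn_ge0.
rewrite !big_split /= sumr_const card_S -[_ *+ _]mulr_natl -/d.
rewrite -mulr_sumr lerD // ?lerD2l.
  rewrite exchange_big /=.
  apply: le_trans (_ : \sum_(i < k.+1) half ^+ i * m%:R <= _).
    apply: ler_sum => i _; rewrite -mulr_sumr ler_wpM2l ?exprn_ge0 //.
    rewrite -natr_sum ler_nat.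
    apply: leq_trans (_ : \sum_y (iter i.+2 p y \in Wv) <= _)%N.
      by rewrite big_mkcond leq_sum // => y _; case: ifP.
    rewrite -big_mkcond sum1_card.
    have -> : m = size Wv by rewrite size_map.
    apply: leq_trans (card_size Wv).
    have inj : injective (iter i.+2 p) by move=> a b; rewrite -!permX; apply: perm_inj.
    by rewrite -(card_image inj); apply/subset_leq_card/subsetP => z /imageP[y yW ->].
  rewrite -mulr_suml ler_wpM2r //.
  have geo : \sum_(i < k.+1) half ^+ i = 2 * (1 - half ^+ k.+1).
    have := subrX1 half k.+1; rewrite /= => e.
    have -> : 1 - half ^+ k.+1 = half * \sum_(i < k.+1) half ^+ i.
      by rewrite -opprB e /half; lra.
    by rewrite mulrA /half mulfV ?mul1r // pnatr_eq0.
  by rewrite geo mulrBr mulr1 gerBl mulr_ge0 ?exprn_ge0.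
rewrite ler_wpM2l ?mulr_ge0 ?exprn_ge0 // -natr_sum ler_nat.
apply: leq_trans (_ : \sum_y (y \in short p Q) <= _)%N.
  by rewrite big_mkcond leq_sum // => y _; case: ifP.
by rewrite -big_mkcond sum1_card.
Qed.

(** [p] maps the finite set of roots and points of [Q] into itself, hence onto itself. The preimage
    of a root lies there, and it is not a root because roots are mapped into [Q]. *)
Let inWv_pre y : p y \in Wv -> y \in Q.
Proof.
have [uW WQ pW pQ] := vW => pyW.
pose X := Q :|: [set v in Wv].
have pX : p @: X = X.
  apply/eqP; rewrite eqEcard card_imset ?leqnn ?andbT; last exact: perm_inj.
  apply/subsetP => _ /imsetP[z + ->]; rewrite !in_setU !in_set => /orP[/pQ//|/pW->//].
have : p y \in p @: X by rewrite pX in_setU in_set pyW orbT.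
case/imsetP=> z + /perm_inj yz; rewrite -yz in_setU in_set => /orP[//|/pW].
by move=> h; have := WQ _ pyW; rewrite h.
Qed.

Let sum_roots (G : V -> R) : p x \notin Wv ->
  \sum_(y in Q :\ x | p y \in Wv) G (p y) = \sum_(v <- Wv) G v.
Proof.
move=> good; have [uW _ _ _] := vW.
rewrite [RHS]big_uniq //= [RHS](reindex_inj (@perm_inj _ p)) /=.
rewrite [LHS](eq_bigl (fun y => p y \in Wv)) // => y.
case: (boolP (p y \in Wv)) => [pyW|]; last by rewrite andbF.
rewrite andbT !inE (inWv_pre pyW) andbT.
by apply: contraNneq good => <-.
Qed.

Let final_ineq (S1 S2 e : R) :
  f%:R < F -> S1 <= d * half ^+ k.+1 + 2 * m%:R + 2 * half ^+ k * f%:R ->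
  S2 <= d * f%:R + 4 ->
  e <= m%:R * ka \/ (k = 0%N /\ e <= 3 * m%:R + f%:R) ->
  e + ka * S1 + S2 / F <= d * (A + ka * half ^+ k + f%:R / F).
Proof.
move=> fF S1le S2le ele.
have hk0 : 0 <= half ^+ k by rewrite exprn_ge0 // /half; lra.
apply: (step_arith (m := m%:R) (m0 := m0%:R) (r1 := r0.*2.+1%:R) F0 ka0 A0) => //.
- by rewrite ler_nat.
- by rewrite ler_nat ltnS leq_double.
- by move: S1le; rewrite exprS /half; congr (_ <= _ + _ + _); ring.
case: ele => [|[-> e2]]; [by left|right; by rewrite expr0].
Qed.

Lemma step_bound : diff g r.+1 p Q W1 <= 2 * bnd r.+1 m k f.
Proof.
have [Ff|fF] := lerP F f%:R.
  apply: le_trans (diff_le2 _ _ _ _ g1) _.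
  rewrite -[leLHS]mulr1 ler_wpM2l // /bnd -[leLHS]add0r lerD //.
    by rewrite !addr_ge0 ?mulr_ge0 ?uu_ge0 ?exprn_ge0 //; lra.
  by rewrite ler_pdivlMr // mul1r.
have d0 : 0 < d by rewrite ltr0n.
have [uW WQ pW pQ] := vW.
have Gl y : y \in Q :\ x -> (p y \in Q) = ~~ (p y \in Wv).
  case/setD1P=> _ yQ; case: (boolP (p y \in Wv)) => [/WQ/negbTE->//|nW].
  by have /orP[->|h] := pQ _ yQ; last by rewrite h in nW.
suff [tgt stgt ltgt] : exists2 tgt, \sum_(y in Q :\ x) tgt y = d * Fl &
    \sum_(y in Q :\ x) `|val y - tgt y| <= 2 * (d * bnd r.+1 m k f).
  rewrite /diff (IL_start _ cQ xQ) {1}/avg card_S -/d -/Fl.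
  have -> : Fl = (\sum_(y in Q :\ x) tgt y) / d.
    by rewrite stgt mulrAC divff ?mul1r ?gt_eqF.
  rewrite -mulrBl -sumrB normrM normfV (gtr0_norm d0) ler_pdivrMr //.
  apply: le_trans (ler_norm_sum _ _ _) _; apply: le_trans ltgt _.
  by rewrite mulrCA mulrC.
have bndE : d * bnd r.+1 m k f = d * (m%:R * uu r) - m%:R * uu r +
    d * (A * (r - r0)%:R) + d * (A + ka * half ^+ k + f%:R / F).
  rewrite /bnd uuS // -/d subSn // -natr1 -/half.
  have -> : d * (m%:R * (uu r * (1 - d^-1)) + A * ((r - r0)%:R + 1) + ka * half ^+ k
     + f%:R / F) = d * (m%:R * uu r) - (d / d) * (m%:R * uu r) +
     d * (A * (r - r0)%:R) + d * (A + ka * half ^+ k + f%:R / F) by ring.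
  by rewrite divff ?mul1r // gt_eqF.
pose S1 : R := \sum_(y in Q :\ x | p y \in Q) half ^+ Ky y.
pose S2 : R := \sum_(y in Q :\ x) (f + bump y)%:R.
have sc (z : R) : \sum_(y in Q :\ x) z = d * z.
  by rewrite sumr_const card_S mulr_natl.
have base (c1 : V -> R) (e : R) :
   \sum_(y in Q :\ x) c1 y = e ->
   \sum_(y in Q :\ x) 2 * (m%:R * uu r + c1 y + A * (r - r0)%:R +
      ka * (if p y \in Q then half ^+ Ky y else 0) + (f + bump y)%:R / F) =
   2 * (d * (m%:R * uu r) + e + d * (A * (r - r0)%:R) + ka * S1 + S2 / F).
  move=> ce; rewrite -mulr_sumr; congr (_ * _); rewrite !big_split /= ce.
  rewrite !sc -mulr_sumr -mulr_suml.
  by rewrite /S1 big_mkcondr.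
have half0 j : 0 <= half ^+ j by rewrite exprn_ge0 // /half; lra.
(* If [p x] is no root, every root is met through exactly one [y] and the targets average to [Fl].
   Otherwise the gap is 0, and the at most [2 m + f] harmful choices are paid by halving the term
   [ka]. *)
have [bad|good] := boolP (p x \in Wv); last first.
  exists (fun y => if p y \in Wv then outc (index (p y) Wv) else Fl).
    rewrite (bigID (fun y => p y \in Wv)) /=.
    rewrite (eq_bigr (fun y => outc (index (p y) Wv))); last by move=> y /andP[_ ->].
    rewrite (sum_roots (fun v => outc (index v Wv)) good).
    rewrite [X in _ + X](eq_bigr (fun=> Fl)); last first.
      by move=> y /andP[_ /negbTE->].
    have -> : \sum_(v <- Wv) outc (index v Wv) = m%:R * Fl.
      rewrite -sum_outc (big_nth w) big_mkord size_map; apply: eq_bigr => j _.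
      by rewrite index_uniq // size_map.
    have -> : d * Fl = \sum_(y in Q :\ x) Fl by rewrite sumr_const card_S mulr_natl.
    rewrite [RHS](bigID (fun y => p y \in Wv)) /=; congr (_ + _).
    rewrite (sum_roots (fun=> Fl) good) big_tnth sumr_const card_ord size_map.
    by rewrite mulr_natl.
  (* Meeting a root lowers [m] by one but resets the gap: compared with [m * uu r] it costs
     [ka - uu r]. The saved [uu r], summed over the [m] roots, is the factor by which [uu]
     decreases. *)
  apply: le_trans (_ : \sum_(y in Q :\ x) 2 * (m%:R * uu r +
      (if p y \in Wv then ka - uu r else 0) + A * (r - r0)%:R +
      ka * (if p y \in Q then half ^+ Ky y else 0) + (f + bump y)%:R / F) <= _).
    apply: ler_sum => y yS; rewrite Gl //; case: (boolP (p y \in Wv)) => pyW /=.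
      apply: le_trans (glue yS pyW good) _; rewrite ler_wpM2l // /bnd /m /=.
      by rewrite -natr1 expr0; lra.
    by apply: le_trans (nonglue yS _ _) _; rewrite ?Gl ?good ?pyW // addr0 /bnd; lra.
  rewrite (base _ (m%:R * (ka - uu r))); last first.
    rewrite -big_mkcondr /= (sum_roots (fun=> ka - uu r) good).
    by rewrite big_tnth sumr_const card_ord size_map mulr_natl.
  rewrite ler_wpM2l // bndE.
  have := @final_ineq S1 S2 (m%:R * ka) fF sum_Ky sum_bump (or_introl _ (lexx _)).
  by lra.
have k0 : k = 0%N.
  by case: (k) gap => // k' h; have := h 0%N isT; rewrite /= -/Wv bad.
exists (fun=> Fl); first by rewrite sumr_const card_S mulr_natl.
pose err y := [|| p y \in Wv, y \in short p Q | y \in map p Wv].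
have err_sum : \sum_(y in Q :\ x) (err y)%:R <= 2 * m%:R + f%:R :> R.
  rewrite -natr_sum -[2 * _]natrM -natrD ler_nat.
  apply: leq_trans (_ : \sum_y ((p y \in Wv) + (y \in short p Q) + (y \in map p Wv)) <= _)%N.
    rewrite big_mkcond leq_sum // => y _; case: ifP => // _; rewrite /err.
    by do 3!case: (_ \in _).
  rewrite !big_split /= -!big_mkcond !sum1_card.
  have -> : m = size Wv by rewrite size_map.
  have c1 : (#|[pred y | p y \in Wv]| <= size Wv)%N.
    apply: leq_trans (card_size Wv); rewrite -(card_image (@perm_inj _ p)).
    by apply/subset_leq_card/subsetP => z /imageP[y yW ->].
  have c2 : (#|[pred y | y \in map p Wv]| <= size Wv)%N.
    by rewrite -(size_map p Wv); apply: leq_trans (card_size _); apply: eq_leq; apply: eq_card.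
  have c3 : (#|[pred y | y \in short p Q]| <= f)%N by apply: eq_leq; apply: eq_card.
  by rewrite mul2n -addnn addnAC !leq_add.
have u1 := uu_le1 r; have u0 := uu_ge0 r.
apply: le_trans (_ : \sum_(y in Q :\ x) 2 * (m%:R * uu r +
      (err y)%:R + A * (r - r0)%:R +
      ka * (if p y \in Q then half ^+ Ky y else 0) + (f + bump y)%:R / F) <= _).
  apply: ler_sum => y yS; have [ey|] := boolP (err y).
    apply: le_trans (_ : 2 * 1 <= _).
      rewrite mulr1; apply: le_trans (ler_normB _ _) _.
      rewrite (_ : 2 = 1 + 1 :> R) // lerD //; last exact: Fel_bound.
      by apply: IL_bound => // s; apply: g1.
    have h1 : 0 <= m%:R * uu r by rewrite mulr_ge0.
    have h2 : 0 <= A * (r - r0)%:R by rewrite mulr_ge0.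
    have h3 : 0 <= ka * (if p y \in Q then half ^+ Ky y else 0).
      by rewrite mulr_ge0 //; case: ifP.
    have h4 : 0 <= (f + bump y)%:R / F by rewrite divr_ge0 // ltW.
    rewrite ler_wpM2l // (_ : true%:R = 1) // -!addrA.
    by rewrite addrCA lerDl !addr_ge0.
  rewrite /err => /norP[e1 /norP[e2 e3]].
  have pyQ : p y \in Q by rewrite (Gl _ yS); exact: e1.
  have cnd : (p x \notin Wv) || (y \notin short p Q) && (y \notin map p Wv).
    by rewrite e2 e3 orbT.
  apply: le_trans (nonglue yS pyQ cnd) _; rewrite pyQ /bnd (_ : false%:R = 0) //.
  by rewrite addr0; lra.
rewrite (base _ _ erefl) ler_wpM2l // bndE.
set E := \sum_(y in _) _ in err_sum *.
have e' : E + m%:R * uu r <= 3 * m%:R + f%:R.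
  have : m%:R * uu r <= m%:R * 1 by rewrite ler_wpM2l.
  by rewrite mulr1; lra.
have := @final_ineq S1 S2 (E + m%:R * uu r) fF sum_Ky sum_bump (or_intror _ (conj k0 e')).
by lra.
Qed.

End Step.

Theorem matching_bound r g (p : {perm V}) (Q : {set V}) w c (W : seq (V * nat)) k :
  (r0 <= r)%N -> (forall l, `|g l| <= 1) ->
  let W1 := (w, c) :: W in
  (size W1 <= m0)%N -> #|Q| = r.*2 -> valid p Q W1 -> gapge p W1 (p w) k ->
  `|IL r Q (fun m => g (typ (size W1) (orb (p * m)%g) W1)) -
    Fel (size W1) g (unzip2 W1)|
  <= 2 * bnd r (size W1) k #|short p Q|.
Proof.
move=> rr; rewrite -(subnKC rr); elim: (r - r0)%N g p Q w c W k => [|q IH] g p Q w c W k g1 /=.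
  rewrite addn0 => sW cQ vW gap; apply: le_trans (diff_le2 r0 p Q ((w, c) :: W) g1) _.
  rewrite -[leLHS]mulr1 ler_wpM2l // /bnd /uu big_geq // mulr1 -addrA -addrA.
  apply: ler_wpDr; last by rewrite ler1n.
  by rewrite !addr_ge0 ?mulr_ge0 ?exprn_ge0 ?invr_ge0 ?(ltW F0) //; lra.
rewrite addnS => sW cQ vW gap.
exact: (step_bound (leq_addr q r0) IH).
Qed.

End MatchingBound.

Lemma nat_above (R : realType) (x : R) : exists N : nat, x <= N%:R.
Proof.
exists (Num.truncn `|x|).+1; apply: le_trans (ler_norm x) (ltW _).
by case/andP: (Num.Theory.truncn_itv (normr_ge0 x)).
Qed.

(** * Choice of the stopping level and of the constants *)

Section UnmatchedRoots.
Variable R : realFieldType.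

(** A rational substitute for the exponential bound on such a product; divergence of the sum still
    forces the product to 0. *)
Lemma prod_1sub_le (s : seq nat) (x : nat -> R) : (forall i, 0 <= x i <= 1) ->
  \prod_(i <- s) (1 - x i) * (1 + \sum_(i <- s) x i) <= 1.
Proof.
move=> x01; elim: s => [|i s IH]; first by rewrite !big_nil addr0 mulr1.
rewrite !big_cons; have /andP[xi0 xi1] := x01 i.
set P := \prod_(j <- s) _ in IH *; set S := \sum_(j <- s) _ in IH *.
have P0 : 0 <= P by apply: prodr_ge0 => j _; rewrite subr_ge0; case/andP: (x01 j).
have S0 : 0 <= S by apply: sumr_ge0 => j _; case/andP: (x01 j).
apply: le_trans IH; rewrite -subr_ge0.
have -> : P * (1 + S) - (1 - x i) * P * (1 + (x i + S)) = P * (x i * S + x i * x i).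
  by ring.
by rewrite mulr_ge0 // addr_ge0 // mulr_ge0.
Qed.

(** A dyadic block starting at [b] has [b] terms, each at least [1 / (4 b + 1)], hence contributes
    at least [1 / 5]. *)
Lemma harmonic_block (a q : nat) : (0 < a)%N ->
  q%:R / 5 <= \sum_(a <= i < a * 2 ^ q) (i.*2.+1%:R)^-1 :> R.
Proof.
move=> a0; elim: q => [|q IH]; first by rewrite muln1 big_geq // mul0r.
have aq : (a <= a * 2 ^ q)%N by rewrite leq_pmulr // expn_gt0.
have aq2 : (a * 2 ^ q <= a * 2 ^ q.+1)%N by rewrite leq_pmul2l // leq_exp2l.
rewrite (big_cat_nat aq aq2) /= -natr1 mulrDl lerD //.
set b := (a * 2 ^ q)%N in aq aq2 *.
have -> : (a * 2 ^ q.+1 = b.*2)%N by rewrite expnS mulnCA mul2n.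
have b0 : (0 < b)%N by apply: leq_trans aq.
apply: le_trans (_ : \sum_(b <= i < b.*2) (b.*2.*2.+1%:R)^-1 <= _); last first.
  apply: ler_sum_nat => i /andP[_ ib].
  by rewrite lef_pV2 ?posrE ?ltr0n // ler_nat ltnS leq_double ltnW.
rewrite sumr_const_nat (_ : (b.*2 - b = b)%N); last by rewrite -addnn addnK.
rewrite -[leRHS]mulr_natl ler_pdivlMr ?ltr0n // mul1r mulrC.
rewrite ler_pdivrMr ?ltr0n // -natrM ler_nat -!addnn; move: b0; clear; lia.
Qed.

Lemma uu_small (r0 r q : nat) : (0 < r0)%N -> (r0 * 2 ^ q <= r)%N ->
  uu R r0 r * (1 + q%:R / 5) <= 1.
Proof.
move=> r00 rr.
have x01 i : 0 <= (i.*2.+1%:R : R)^-1 <= 1.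
  by rewrite invr_ge0 ler0n /= invf_le1 ?ler1n ?ltr0n.
apply: le_trans (prod_1sub_le (index_iota r0 r) x01).
rewrite -/(uu R r0 r) ler_wpM2l ?uu_ge0 // lerD2l.
apply: le_trans (harmonic_block q r00) _.
have h : (r0 <= r0 * 2 ^ q)%N by rewrite leq_pmulr // expn_gt0.
rewrite [leRHS](big_cat_nat h rr) /= lerDl sumr_ge0 // => i _.
by case/andP: (x01 i).
Qed.

End UnmatchedRoots.

(** The walk is stopped at [r0 = r / 2^q] pairs, with [q] so large that roots are unlikely to
    survive until then. As this level is proportional to [r], the remaining errors are of order
    [1 / r] or proportional to [ph], apart from the term counting short loops, which is left in the
    conclusion. *)
Theorem matching_asymptotic (R : realType) (m0 : nat) (eps : R) : 0 < eps ->
  exists2 ph : R, 0 < ph & exists r1 : nat, (0 < r1)%N /\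
  forall (V : finType) (r : nat) (g : seq nat -> R) (p : {perm V}) (Q : {set V})
    (W : seq (V * nat)),
  (r1 <= r)%N -> (forall l, `|g l| <= 1) -> (size W <= m0)%N -> #|Q| = r.*2 ->
  valid p Q W ->
  `|IL r Q (fun m => g (typ (size W) (orb (p * m)%g) W)) - Fel (size W) g (unzip2 W)|
  <= eps + 2 * #|short p Q|%:R / (ph * r%:R).
Proof.
wlog e1 : eps / eps <= 1 => [hw e0|e0].
  have [||ph ph0 [r1 [r10 h]]] := hw (Num.min eps 1).
  - by rewrite ge_min lexx orbT.
  - by rewrite lt_min e0 ltr01.
  exists ph => //; exists r1; split=> // V r g p Q W rr g1 sW cQ vW.
  by apply: le_trans (h _ _ _ _ _ _ rr g1 sW cQ vW) _; rewrite lerD2r ge_min lexx.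
have [q qle] := nat_above (40 * (m0.+1%:R / eps)).
have [P PE] : exists P : R, P = (2 ^ q)%:R by exists (2 ^ q)%:R.
have P1 : 1 <= P by rewrite PE ler1n expn_gt0.
have [M ME] : exists M : R, M = m0.+1%:R by exists m0.+1%:R.
have M1 : 1 <= M by rewrite ME ler1n.
have MP0 : 0 < 100 * M * P ^+ 2 by rewrite !mulr_gt0 ?exprn_gt0 //; lra_local.
(* The factor 100 leaves room for the terms [12 M ph P^2] and [4 M ph P^2] of the final sum, and it
   also gives [8 F <= d0]. *)
have [ph phdef] : exists ph, ph = eps / (100 * M * P ^+ 2) by exists (eps / (100 * M * P ^+ 2)).
have ph0 : 0 < ph by rewrite phdef divr_gt0.
have phE : ph * (100 * M * P ^+ 2) = eps by rewrite phdef divfK // gt_eqF.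
pose X : R := 36 * M ^+ 2 * P ^+ 2 + 4 * P / ph + 12 * M * P.
have [r1 r1le] := nat_above (8 * X / eps).
exists ph => //; exists (maxn r1 (2 ^ q)); split.
  by rewrite leq_max expn_gt0 orbT.
move=> V r g p Q W; rewrite geq_max => /andP[rr1 rP] g1 sW cQ vW.
have m0M : m0%:R <= M by rewrite ME ler_nat.
have m00 : 0 <= m0%:R :> R by [].
pose r0 := (r %/ 2 ^ q)%N.
have r00 : (0 < r0)%N by rewrite divn_gt0 ?expn_gt0.
have r0r : (r0 <= r)%N by apply: leq_div.
have r0P : (r0 * 2 ^ q <= r)%N by rewrite leq_trunc_div.
pose rho : R := r%:R; pose d0 : R := r0.*2.+1%:R.
have rho0 : 0 < rho by rewrite ltr0n (leq_trans r00).
have d0P : rho <= d0 * P.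
  rewrite /rho /d0 PE -natrM ler_nat ltnW //.
  by apply: leq_trans (ltn_ceil r (expn_gt0 2 q : 0 < 2 ^ q)%N) _;
    rewrite leq_mul2r -/r0 -addnn ltnS leq_addr orbT.
pose F := ph * rho; have F0 : 0 < F by rewrite mulr_gt0.
(* [ka] and [A] solve [Hka] and [HA] with [d0] replaced by its lower bound [rho / P]. *)
pose ka := 4 * (3 * m0%:R + F) * P / rho.
pose A := (3 * m0%:R * ka + 4 / F) * P / rho.
have P0 : 0 < P by lra_local.
have M0 : 0 < M by lra_local.
have rho0' := ltW rho0; have P0' := ltW P0; have F0' := ltW F0.
have ka0 : 0 <= ka.
  by rewrite divr_ge0 // mulr_ge0 // mulr_ge0 // addr_ge0 // mulr_ge0.
have A0 : 0 <= A.
  by rewrite divr_ge0 // mulr_ge0 // addr_ge0 ?divr_ge0 // mulr_ge0 // mulr_ge0.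
have phP : 8 * ph * P <= 1.
  have h : ph * P * (100 * M * P) <= 1.
    by apply: le_trans e1; rewrite -phE; lra_local.
  have MP : 1 <= M * P by rewrite -[leLHS]mulr1 ler_pM.
  have : ph * P * 8 <= ph * P * (100 * M * P).
    by rewrite ler_wpM2l ?mulr_ge0 ?(ltW ph0) ?(ltW P0) //; lra_local.
  by lra_local.
have HF : 8 * F <= d0.
  rewrite -(ler_pM2r P0); apply: le_trans d0P.
  rewrite (_ : 8 * F * P = (8 * ph * P) * rho); last by rewrite /F; ring.
  by rewrite -[leRHS]mul1r ler_wpM2r // ltW.
have Hka : 4 * (3 * m0%:R + F) <= ka * d0.
  have -> : ka * d0 = 4 * (3 * m0%:R + F) * (d0 * P / rho) by rewrite /ka; ring.
  rewrite -[leLHS]mulr1 ler_wpM2l //; last by rewrite ler_pdivlMr // mul1r.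
  by rewrite mulr_ge0 // addr_ge0 ?(ltW F0) // mulr_ge0.
have HA : 3 * m0%:R * ka + 4 / F <= A * d0.
  have -> : A * d0 = (3 * m0%:R * ka + 4 / F) * (d0 * P / rho) by rewrite /A; ring.
  rewrite -[leLHS]mulr1 ler_wpM2l //; last by rewrite ler_pdivlMr // mul1r.
  by rewrite addr_ge0 ?divr_ge0 // mulr_ge0 // mulr_ge0.
case: W sW vW => [|[w c] W] sW vW.
  by rewrite /= IL_cst // subrr normr0 addr_ge0 ?(ltW e0) // divr_ge0 ?mulr_ge0 // ltW.
have vg : gapge p ((w, c) :: W) (p w) 0 by [].
apply: le_trans (matching_bound F0 ka0 A0 HF Hka HA r0r g1 sW cQ vW vg) _.
rewrite /bnd expr0 mulr1 mulrDr; apply: lerD; last by rewrite mulrA.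
have u1 : m0%:R * uu R r0 r <= eps / 8.
  have := uu_small R r00 r0P; set u := uu R r0 r => hu.
  have u0 : 0 <= u by apply: uu_ge0.
  have q1 : 40 * M <= q%:R * eps by move: qle; rewrite mulrA ler_pdivrMr // ME.
  have h1 : u * (q%:R / 5) <= 1 by lra_local.
  have h2 : u * (q%:R * eps) <= 5 * eps by rewrite mulrA; have := ler_wpM2r (ltW e0) h1; lra_local.
  have h3 : u * (40 * M) <= u * (q%:R * eps) by rewrite ler_wpM2l.
  have h4 : m0%:R * u <= M * u by rewrite ler_wpM2r.
  by lra_local.
have u2 : (size ((w, c) :: W))%:R * uu R r0 r <= eps / 8.
  by apply: le_trans u1; rewrite ler_wpM2r ?uu_ge0 // ler_nat.
have kaE : ka = 12 * m0%:R * P / rho + 4 * ph * P.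
  by rewrite /ka /F; field; rewrite gt_eqF.
have Ar : A * (r - r0)%:R <= A * rho by rewrite ler_wpM2l // ler_nat leq_subr.
have ArE : A * rho = 36 * m0%:R ^+ 2 * P ^+ 2 / rho + 12 * m0%:R * ph * P ^+ 2
    + 4 * P / ph / rho.
  by rewrite /A kaE /F; field; rewrite !gt_eqF.
have Xr : X / rho <= eps / 8.
  rewrite ler_pdivrMr // mulrAC ler_pdivlMr //; move: r1le; rewrite ler_pdivrMr //.
  move=> h; rewrite mulrC; apply: le_trans h _; rewrite mulrC ler_wpM2l ?(ltW e0) // ler_nat //.
have XrE : X / rho = 36 * M ^+ 2 * P ^+ 2 / rho + 4 * P / ph / rho + 12 * M * P / rho.
  by rewrite /X !mulrDl.
have ir : 0 <= rho^-1 by rewrite invr_ge0 ltW.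
have t1 : 36 * m0%:R ^+ 2 * P ^+ 2 / rho <= 36 * M ^+ 2 * P ^+ 2 / rho.
  rewrite ler_wpM2r // ler_wpM2r ?exprn_ge0 ?(ltW P0) // ler_wpM2l //.
  by rewrite lerXn2r // ?nnegrE // ltW.
have t2 : 12 * m0%:R * P / rho <= 12 * M * P / rho.
  by rewrite ler_wpM2r // ler_wpM2r ?(ltW P0) // ler_wpM2l.
have t3 : 12 * m0%:R * ph * P ^+ 2 <= 12 * M * ph * P ^+ 2.
  by rewrite ler_wpM2r ?exprn_ge0 ?(ltW P0) // ler_wpM2r ?(ltW ph0) // ler_wpM2l.
have t4 : 4 * ph * P <= 4 * M * ph * P ^+ 2.
  rewrite (_ : 4 * M * ph * P ^+ 2 = 4 * ph * P * (M * P)); last by ring.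
  have MP : 1 <= M * P by rewrite -[leLHS]mulr1 ler_pM.
  by rewrite -[leLHS]mulr1 ler_wpM2l // !mulr_ge0 ?(ltW ph0) ?(ltW P0).
have phE' : 12 * M * ph * P ^+ 2 = 12 / 100 * eps by rewrite -phE; field.
have phE2 : 4 * M * ph * P ^+ 2 = 4 / 100 * eps by rewrite -phE; field.
lra_local.
Qed.

(** * Cycles versus components *)

Local Open Scope nat_scope.

Section Components.
Variable V : finType.
Implicit Types (E : rel V) (s t : {perm V}) (l : seq (V * V)).

(** Ordered pairs: each transposition comes from exactly two of them, so a uniform pair still gives
    a uniform transposition ([avg_pairs_tp]). *)
Definition pairs : {set V * V} := [set p | p.1 != p.2].

Definition eqv E := [/\ reflexive E, symmetric E & transitive E].

(** Effect of one edge on the connectivity relation. For an equivalence, a single passage through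
    the edge, in either direction, already yields a transitive relation. *)
Definition addE E (p : V * V) : rel V :=
  fun a b => [|| E a b, E a p.1 && E p.2 b | E a p.2 && E p.1 b].

Definition Efold E l : rel V := foldl addE E l.

Definition cls E a : {set V} := [set b | E a b].

Definition prodl l : {perm V} := (\prod_(p <- l) tperm p.1 p.2)%g.

Lemma prodl_cat l1 l2 : prodl (l1 ++ l2) = (prodl l1 * prodl l2)%g.
Proof. by rewrite /prodl big_cat. Qed.

Lemma prodl_cons p l : prodl (p :: l) = (tperm p.1 p.2 * prodl l)%g.
Proof. by rewrite /prodl big_cons. Qed.

Lemma eqv_addE E p : eqv E -> eqv (addE E p).
Proof.
move=> [rE sE tE]; split=> [a|a b|b a c].
- by rewrite /addE rE.
- rewrite /addE (sE a b) (sE a p.1) (sE p.2 b) (sE a p.2) (sE p.1 b).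
  by rewrite [X in _ || X]orbC [X in _ || (X || _)]andbC [X in _ || (_ || X)]andbC.
rewrite /addE => /or3P[ab|/andP[a1 b2]|/andP[a2 b1]] /or3P[bc|/andP[b1' c2]|/andP[b2' c1]].
- by rewrite (tE _ _ _ ab bc).
- by rewrite (tE _ _ _ ab b1') c2 orbT.
- by rewrite (tE _ _ _ ab b2') c1 !orbT.
- by rewrite a1 (tE _ _ _ b2 bc) orbT.
- by rewrite a1 c2 orbT.
- by rewrite (tE _ _ _ a1 c1).
- by rewrite a2 (tE _ _ _ b1 bc) !orbT.
- by rewrite (tE _ _ _ a2 c2).
- by rewrite a2 c1 !orbT.
Qed.

Lemma eqv_Efold E l : eqv E -> eqv (Efold E l).
Proof. by elim: l E => //= p l IH E vE; apply/IH/eqv_addE. Qed.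

Lemma addE_sub E p : subrel E (addE E p).
Proof. by move=> a b ab; rewrite /addE ab. Qed.

Lemma addE_mono E E' p : subrel E E' -> subrel (addE E p) (addE E' p).
Proof.
move=> s a b /or3P[/s ab|/andP[/s a1 /s b2]|/andP[/s a2 /s b1]]; rewrite /addE.
- by rewrite ab.
- by rewrite a1 b2 orbT.
- by rewrite a2 b1 !orbT.
Qed.

Lemma Efold_mono E E' l : subrel E E' -> subrel (Efold E l) (Efold E' l).
Proof. by elim: l E E' => //= p l IH E E' s; apply/IH/addE_mono. Qed.

Lemma Efold_sub E l : subrel E (Efold E l).
Proof.
by elim: l E => [|p l IH] E a b ab //=; apply: IH; apply: addE_sub.
Qed.

Lemma Efold_cat E l1 l2 : Efold E (l1 ++ l2) = Efold (Efold E l1) l2.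
Proof. by rewrite /Efold foldl_cat. Qed.

Lemma Efold_mem E l p : eqv E -> p \in l -> Efold E l p.1 p.2.
Proof.
move=> vE /splitPr[l1 l2]; rewrite Efold_cat /=; apply: Efold_sub.
have [r _ _] := eqv_Efold l1 vE.
by rewrite /addE !r /= orbT.
Qed.

Lemma addE_id E p : eqv E -> E p.1 p.2 -> addE E p =2 E.
Proof.
move=> [rE sE tE] e a b; rewrite /addE; case: (boolP (E a b)) => //= nab.
apply/negP => /orP[/andP[a1 b2]|/andP[a2 b1]]; case/negP: nab.
  by apply: tE (tE _ _ _ a1 e) b2.
by apply: tE (tE _ _ _ a2 _) b1; rewrite sE.
Qed.

Lemma cls_sub E E' a : subrel E E' -> cls E a \subset cls E' a.
Proof. by move=> s; apply/subsetP => b; rewrite !inE; apply: s. Qed.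

Lemma cls_eq E a b : eqv E -> E a b -> cls E a = cls E b.
Proof.
case=> rE sE tE ab; apply/setP => c; rewrite !inE; apply/idP/idP => h.
  by apply: tE h; rewrite sE.
by apply: tE h.
Qed.

Lemma porbit_memE s x y : y \in porbit s x -> porbit s y = porbit s x.
Proof. by rewrite -eq_porbit_mem => /eqP. Qed.

Lemma orb_eqv s : eqv (orb s).
Proof.
split=> [a|a b|b a c]; rewrite /orb ?porbit_id //; first exact: porbit_sym.
exact: porbit_refl_trans.
Qed.

Lemma orb_tperm s u v : subrel (orb (s * tperm u v)%g) (addE (orb s) (u, v)).
Proof.
have [<-|uv] := eqVneq u v.
  by rewrite tperm1 mulg1; apply: addE_sub.
have [_ os ot] := orb_eqv s.
move=> a b; rewrite /addE /= /orb.
have [au|au] := boolP (a \in porbit s u).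
  have [vu|vu] := boolP (v \in porbit s u).
    have [eU _] := porbit_splitE uv vu; move: (au); rewrite -eU inE.
    move=> /orP[]; rewrite -eq_porbit_mem => /eqP-> h.
      have bu : b \in porbit s u by rewrite -eU inE h.
      by move: au; rewrite -eq_porbit_mem => /eqP->; rewrite bu.
    have bu : b \in porbit s u by rewrite -eU inE h orbT.
    by move: au; rewrite -eq_porbit_mem => /eqP->; rewrite bu.
  have aU : a \in porbit (s * tperm u v)%g u by rewrite porbit_mergeE // inE au.
  move: aU; rewrite -eq_porbit_mem => /eqP->; rewrite porbit_mergeE // inE.
  move=> /orP[h|h].
    by move: au; rewrite -eq_porbit_mem => /eqP->; rewrite h.
  by rewrite (porbit_sym s u a) au h orbT.
have [av|av] := boolP (a \in porbit s v); last first.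
  by rewrite porbit_mul_tperm_out // => ->.
have vu : v \notin porbit s u.
  by apply: contra au => h; apply: porbit_refl_trans h av.
have aU : a \in porbit (s * tperm u v)%g u by rewrite porbit_mergeE // inE av orbT.
move: aU; rewrite -eq_porbit_mem => /eqP->; rewrite porbit_mergeE // inE.
move=> /orP[h|h].
  by rewrite (porbit_sym s v a) av h !orbT.
by move: av; rewrite -eq_porbit_mem => /eqP->; rewrite h.
Qed.

Lemma orb_prodl s E l : subrel (orb s) E ->
  subrel (orb (s * prodl l)%g) (Efold E l).
Proof.
elim: l s E => [|[u v] l IH] s E sE; first by rewrite /prodl big_nil mulg1.
rewrite prodl_cons mulgA; apply: IH => a b /orb_tperm.
exact: addE_mono.
Qed.

Section BadCycles.
Variable k : nat.
Implicit Types C : {set V}.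

(** A short cycle that does not fill its class. A short cycle equal to its class is harmless: it
    only says that the component is small. *)
Definition badc E (C : {set V}) : bool :=
  (#|C| < k) && [exists a in C, exists b, E a b && (b \notin C)].

Definition badset s E : {set {set V}} := [set C in porbits s | badc E C].

Lemma eq_badc E E' C : E =2 E' -> badc E C = badc E' C.
Proof.
move=> ee; rewrite /badc; congr (_ && _); apply: eq_existsb => a; congr (_ && _).
by apply: eq_existsb => b; rewrite ee.
Qed.

Lemma badcI E C a b : #|C| < k -> a \in C -> E a b -> b \notin C -> badc E C.
Proof.
move=> Ck aC ab bC; rewrite /badc Ck; apply/existsP; exists a; rewrite aC.
by apply/existsP; exists b; rewrite ab.
Qed.

Lemma badcP E C : badc E C -> #|C| < k /\ exists a b, [/\ a \in C, E a b & b \notin C].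
Proof.
case/andP=> Ck /existsP[a /andP[aC /existsP[b /andP[ab bC]]]]; split=> //.
by exists a, b.
Qed.

(** A split creates at most two bad cycles, and only if one of the pieces is short. A merge never
    raises the number: if the merged cycle is bad, one of its two parts was bad before and has
    disappeared. *)
Lemma bad_step s E u v : u != v -> eqv E -> subrel (orb s) E ->
  #|badset (s * tperm u v)%g (addE E (u, v))| <=
  #|badset s E| + (small_split s k (u, v)).*2.
Proof.
move=> uv vE sE; set t := (s * _)%g; set E' := addE E _.
have [rE yE tE] := vE.
have [vu|vu] := boolP (v \in porbit s u).
  have EE : E' =2 E by apply: addE_id => //; apply: sE.
  have [eU _] := porbit_splitE uv vu; rewrite -/t in eU.
  set X := if small_split s k (u, v) then [set porbit t u; porbit t v] else set0.
  have sub : badset t E' \subset badset s E :|: X.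
    apply/subsetP => C; rewrite !inE => /andP[/imsetP[z _ ->]].
    rewrite (eq_badc _ EE) => bC.
    have [zu|zu] := boolP (z \in porbit s u); last first.
      have e : porbit t z = porbit s z.
        by rewrite porbit_mul_tperm_out // (porbit_memE vu).
      by rewrite e imset_f ?inE // -e bC.
    apply/orP; right; have [zk _] := badcP bC.
    have -> : X = [set porbit t u; porbit t v].
      rewrite /X /small_split /= vu /= -/t.
      move: zu zk; rewrite -eU inE.
      by case/orP => /porbit_memE-> ->; rewrite ?orbT.
    move: zu; rewrite -eU !inE.
    by case/orP => /porbit_memE->; rewrite eqxx ?orbT.
  apply: leq_trans (subset_leq_card sub) _.
  apply: leq_trans (leq_card_setU _ _) _; rewrite leq_add2l /X.
  by case: small_split; rewrite ?cards0 // cards2; case: (_ != _).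
have -> : small_split s k (u, v) = false by rewrite /small_split /= (negbTE vu).
rewrite addn0; set Cu := porbit s u; set Cv := porbit s v.
have tU : porbit t u = Cu :|: Cv by apply: porbit_mergeE.
have out z : z \notin Cu -> z \notin Cv -> badc E' (porbit t z) ->
    porbit t z \in badset s E.
  move=> zu zv bC; have e : porbit t z = porbit s z by rewrite porbit_mul_tperm_out.
  rewrite inE e imset_f ?inE //= -e.
  have [Ck [a [b [aC ab bC']]]] := badcP bC.
  have uC : u \notin porbit t z by rewrite e porbit_sym.
  have vC : v \notin porbit t z by rewrite e porbit_sym.
  case/or3P: ab => [ab|/andP[au _]|/andP[av _]].
  - exact: badcI Ck aC ab bC'.
  - exact: badcI Ck aC au uC.
  - exact: badcI Ck aC av vC.
have dich C : C \in badset t E' -> C = porbit t u \/ (C \in badset s E) /\ (u \notin C) /\ (v \notin C).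
  rewrite inE => /andP[/imsetP[z _ ->] bC].
  have [zu|zu] := boolP (z \in Cu).
    by left; apply/eqP; rewrite eq_porbit_mem tU inE zu.
  have [zv|zv] := boolP (z \in Cv).
    by left; apply/eqP; rewrite eq_porbit_mem tU inE zv orbT.
  right; split; first exact: out.
  by rewrite porbit_mul_tperm_out // !(porbit_sym s _ z).
have [bU|nbU] := boolP (badc E' (porbit t u)); last first.
  apply/subset_leq_card/subsetP => C CB; case: (dich C CB) => [e|[]//].
  by move: CB; rewrite inE e (negbTE nbU) andbF.
have [X [XB Xuv]] : exists X, X \in badset s E /\ (u \in X \/ v \in X).
  have [Ck [a [b [aC ab bC]]]] := badcP bU; rewrite tU in Ck aC bC.
  have Cuk : #|Cu| < k.
    by apply: leq_ltn_trans Ck; apply: subset_leq_card; apply: subsetUl.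
  have Cvk : #|Cv| < k.
    by apply: leq_ltn_trans Ck; apply: subset_leq_card; apply: subsetUr.
  move: bC; rewrite inE negb_or => /andP[bu bv].
  have Bu c : c \in Cu -> E c b -> exists X, X \in badset s E /\ (u \in X \/ v \in X).
    move=> cC cb; exists Cu; split; last by left; apply: porbit_id.
    by rewrite inE imset_f ?inE //=; apply: badcI Cuk cC cb bu.
  have Bv c : c \in Cv -> E c b -> exists X, X \in badset s E /\ (u \in X \/ v \in X).
    move=> cC cb; exists Cv; split; last by right; apply: porbit_id.
    by rewrite inE imset_f ?inE //=; apply: badcI Cvk cC cb bv.
  case/or3P: ab => [ab|/andP[_ /= vb]|/andP[_ /= ub]].
  - by move: aC; rewrite inE => /orP[/Bu|/Bv]; apply.
  - exact: Bv (porbit_id _ _) vb.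
  - exact: Bu (porbit_id _ _) ub.
have sub : badset t E' \subset porbit t u |: (badset s E :\ X).
  apply/subsetP => C CB; rewrite in_setU1 in_setD1.
  case: (dich C CB) => [->|[-> [nu nv]]]; first by rewrite eqxx.
  rewrite andbT; apply/orP; right; apply/eqP => e.
  by case: Xuv; rewrite -e ?(negbTE nu) ?(negbTE nv).
apply: leq_trans (subset_leq_card sub) _.
rewrite cardsU1 [X in _ <= X](cardsD1 X) XB leq_add2r.
by case: (_ \notin _).
Qed.

(** The short splits are counted along the pairs selected by [keep], because in the window only the
    pairs outside [inner A] act before the matching. *)
Fixpoint nss s (keep : pred (V * V)) l : nat :=
  if l is p :: l' then
    if keep p then small_split s k p + nss (s * tperm p.1 p.2)%g keep l'
    else nss s keep l'
  else 0.

Lemma bad_fold s E keep l : all (mem pairs) l -> eqv E -> subrel (orb s) E ->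
  #|badset (s * prodl (filter keep l))%g (Efold E (filter keep l))| <=
  #|badset s E| + (nss s keep l).*2.
Proof.
elim: l s E => [|[u v] l IH] s E /=.
  by move=> _ _ _; rewrite /prodl big_nil mulg1 addn0.
case/andP=> uv lP vE sE; case: ifP => kp; last exact: IH.
rewrite prodl_cons mulgA /=; move: uv; rewrite inE /= => uv.
apply: leq_trans (IH _ _ lP (eqv_addE _ vE) _) _.
  by move=> a b /orb_tperm; apply: addE_mono.
rewrite doubleD addnA leq_add2r; exact: bad_step.
Qed.

Lemma badset0 s : badset s (orb s) = set0.
Proof.
apply/setP => C; rewrite !inE; apply/negP => /andP[/imsetP[z _ ->] /badcP[_ [a [b [az ab]]]]].
by rewrite (porbit_refl_trans az ab).
Qed.

(** Each such vertex lies in a bad cycle, and a bad cycle has fewer than [k] points. *)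
Lemma bad_vertices s E : eqv E -> subrel (orb s) E ->
  #|[set a | (#|porbit s a| < k) && (k <= #|cls E a|)]| <= k * #|badset s E|.
Proof.
move=> vE sE.
have sub : [set a | (#|porbit s a| < k) && (k <= #|cls E a|)] \subset
    \bigcup_(C in badset s E) C.
  apply/subsetP => a; rewrite inE => /andP[ak ka].
  apply/bigcupP; exists (porbit s a); last exact: porbit_id.
  have /subsetPn[b bE bC] : ~~ (cls E a \subset porbit s a).
    by apply/negP => /subset_leq_card; rewrite leqNgt (leq_trans ak).
  rewrite !inE in bE; rewrite inE imset_f ?inE //=.
  by apply: badcI ak (porbit_id _ _) bE bC.
apply: leq_trans (subset_leq_card sub) _.
apply: leq_trans (leq_card_cover _) _.
rewrite mulnC -sum_nat_const; apply: leq_sum => C; rewrite inE => /andP[_ /badcP[Ck _]].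
exact: ltnW.
Qed.

End BadCycles.

Section Expect.
Variable R : realFieldType.
Local Open Scope ring_scope.
Hypothesis n2 : (1 < #|V|)%N.
Let n1 : R := #|V|.-1%:R.

Lemma sum_pairs (F : V * V -> R) :
  \sum_(p in pairs) F p = \sum_u \sum_(v | v != u) F (u, v).
Proof.
rewrite pair_big_dep /=; apply: eq_big => [[u v]|[u v] _] //=.
by rewrite inE /= eq_sym.
Qed.

Lemma card_pairs : #|pairs|%:R = #|V|%:R * n1 :> R.
Proof.
rewrite -sum1_card natr_sum sum_pairs.
rewrite (eq_bigr (fun=> n1)); last first.
  by move=> u _; rewrite -natr_sum sum1_card cardC1.
by rewrite sumr_const mulr_natl.
Qed.

Lemma n1_gt0 : 0 < n1.
Proof. by rewrite ltr0n -ltnS prednK // ltnW. Qed.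

Lemma pairs_neq0 : pairs != set0.
Proof.
have /card_gt1P[u [v [_ _ uv]]] := n2.
by apply/set0Pn; exists (u, v); rewrite inE.
Qed.

Lemma avg_pairs_row (F : V * V -> R) (c : R) :
  (forall u, \sum_(v | v != u) F (u, v) <= c) -> avg pairs F <= c / n1.
Proof.
move=> Fc; have V0 : 0 < #|V|%:R :> R by rewrite ltr0n ltnW.
rewrite /avg card_pairs sum_pairs ler_pdivrMr ?mulr_gt0 ?n1_gt0 //.
have -> : c / n1 * (#|V|%:R * n1) = #|V|%:R * c.
  by rewrite mulrCA divfK // gt_eqF // n1_gt0.
by rewrite mulr_natl -sumr_const ler_sum.
Qed.

Lemma avg_small_split s k :
  avg pairs (fun p => (small_split s k p)%:R : R) <= 2 * k%:R / n1.
Proof.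
apply: avg_pairs_row => u; rewrite -natr_sum -natrM ler_nat mul2n -addnn.
apply: leq_trans (card_small_split s k u).
rewrite -sum1_card [leqLHS]big_mkcond [leqRHS]big_mkcond /=.
by apply: leq_sum => v _; rewrite inE; case: (v != u) => //=; case: small_split.
Qed.

Lemma EL_nss s k keep r :
  EL pairs r (fun l => (nss k s keep l)%:R : R) <= r%:R * (2 * k%:R / n1).
Proof.
have c0 : 0 <= 2 * k%:R / n1 by rewrite divr_ge0 ?mulr_ge0 ?(ltW n1_gt0).
elim: r s => [|r IH] s /=; first by rewrite mul0r.
rewrite -natr1 mulrDl mul1r addrC.
apply: le_trans (_ : avg pairs (fun p => (small_split s k p)%:R +
   r%:R * (2 * k%:R / n1)) <= _); last first.
  by rewrite avgD avg_cst ?pairs_neq0 // lerD2r avg_small_split.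
apply: ler_avg => p _; case: (boolP (keep p)) => kp.
  rewrite (@eq_EL _ _ _ _ _ (fun l => (small_split s k p)%:R +
    (nss k (s * tperm p.1 p.2)%g keep l)%:R)); last by move=> l _; rewrite natrD.
  by rewrite ELD EL_cst ?pairs_neq0 // lerD2l IH.
by apply: le_trans (IH s) _; rewrite lerDr.
Qed.

Lemma EL_bad_vertices s k keep r :
  EL pairs r (fun l => #|[set a |
     (#|porbit (s * prodl (filter keep l))%g a| < k)%N &&
     (k <= #|cls (Efold (orb s) (filter keep l)) a|)%N]|%:R : R)
  <= 4 * k%:R ^+ 2 * r%:R / n1.
Proof.
apply: le_trans (_ : EL pairs r (fun l => (2 * k%:R) * (nss k s keep l)%:R) <= _).
  apply: ler_EL => l /andP[_ lP]; rewrite -!natrM ler_nat.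
  apply: leq_trans (bad_vertices _ _ _) _.
  - exact/eqv_Efold/orb_eqv.
  - exact: orb_prodl.
  rewrite -mulnA mulnCA leq_mul2l mul2n.
  have := bad_fold k keep lP (orb_eqv s) (fun _ _ => id).
  by rewrite badset0 cards0 add0n => ->; rewrite orbT.
rewrite ELZ.
apply: le_trans (_ : 2 * k%:R * (r%:R * (2 * k%:R / n1)) <= _).
  by rewrite ler_wpM2l ?mulr_ge0 // EL_nss.
by rewrite le_eqVlt; apply/orP; left; apply/eqP; ring.
Qed.

End Expect.
End Components.

Local Open Scope ring_scope.

(** * Sprinkling *)

Lemma EL_all (R : realFieldType) (T : finType) (A : {set T}) s (f : pred T) :
  EL A s (fun l => (all f l)%:R : R) = avg A (fun x => (f x)%:R) ^+ s.
Proof.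
elim: s => [|s IH] //=; rewrite exprS -IH mulrC -avgZ; apply: eq_avg => x _.
by case: (f x); rewrite ?mulr1 ?mulr0 // EL0.
Qed.

Section Sprinkle.
Variable V : finType.
Implicit Types (E : rel V) (l : seq (V * V)).

Definition saturated E (Y : {set V}) : bool :=
  [forall a in Y, forall b, E a b ==> (b \in Y)].

Lemma saturatedP E (Y : {set V}) : reflect (forall a b, a \in Y -> E a b -> b \in Y) (saturated E Y).
Proof.
apply: (iffP forall_inP) => [h a b aY ab|h a aY].
  by move/forallP: (h a aY) => /(_ b)/implyP; apply.
by apply/forallP => b; apply/implyP; apply: h.
Qed.

(** Take a smallest saturated set meeting [Z] in at least [h] points. If it misses fewer than [h]
    points of [Z], remove from it one class that meets [Z]: by minimality fewer than [h] points of
    [Z] remain, so this class contains all but [2 h] points of [Z]. *)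
Lemma giant_or_separated E (Z : {set V}) h (a0 : V) : eqv E ->
  (exists a, #|Z| <= #|cls E a :&: Z| + h.*2)%N \/
  (exists Y : {set V}, [/\ saturated E Y, h <= #|Y :&: Z| & h <= #|Z :\: Y|])%N.
Proof.
move=> [rE sE tE].
have [Zh|hZ] := ltnP #|Z| h.
  by left; exists a0; rewrite -addnn addnA (leq_trans (ltnW Zh)) // leq_addl.
pose P Y := saturated E Y && (h <= #|Y :&: Z|)%N.
have PT : P setT.
  by rewrite /P setTI hZ andbT; apply/saturatedP => a b _ _; rewrite inE.
case: (arg_minnP (fun Y : {set V} => #|Y|) PT) => Y /andP[satY hY] minY.
have [hZY|ZYh] := leqP h #|Z :\: Y|; first by right; exists Y.
left; have h0 : (0 < h)%N by apply: leq_ltn_trans ZYh.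
have /card_gt0P[a] : (0 < #|Y :&: Z|)%N by apply: leq_trans hY.
rewrite inE => /andP[aY aZ]; exists a.
pose Y' := Y :\: cls E a.
have satY' : saturated E Y'.
  apply/saturatedP => b c; rewrite !inE => /andP[nab bY] bc.
  rewrite (saturatedP _ _ satY _ _ bY bc) andbT; apply: contra nab => ac.
  by apply: tE ac _; rewrite sE.
have Y'Y : (#|Y'| < #|Y|)%N.
  apply: proper_card; apply/properP; split; first exact: subsetDl.
  by exists a => //; rewrite !inE rE.
have Y'h : (#|Y' :&: Z| < h)%N.
  rewrite ltnNge; apply/negP => hY'; have := minY Y'; rewrite /P satY' hY'.
  by move=> /(_ isT); rewrite leqNgt Y'Y.
have : (#|Z| <= #|Z :\: Y| + #|Y' :&: Z| + #|cls E a :&: Z|)%N.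
  apply: leq_trans (_ : #|(Z :\: Y) :|: (Y' :&: Z) :|: (cls E a :&: Z)| <= _)%N.
    apply/subset_leq_card/subsetP => z zZ; rewrite !inE zZ !andbT.
    by case: (z \in Y); case: (E a z).
  by apply: leq_trans (leq_card_setU _ _) _; rewrite leq_add2r leq_card_setU.
move=> /leq_trans; apply; rewrite addnC -addnn leq_add2l leq_add // ltnW //.
Qed.

Section Blocks.
Variables (E0 : rel V) (k : nat).
Hypotheses (vE0 : eqv E0) (k0 : (0 < k)%N).
Let Z := [set a | k <= #|cls E0 a|]%N.

Lemma card_blocks : (#|[set cls E0 a | a in Z]| <= #|V| %/ k)%N.
Proof.
set B := [set _ | _ in _]; rewrite leq_divRL //.
have tB : trivIset B.
  apply/trivIsetP => _ _ /imsetP[a _ ->] /imsetP[b _ ->] ab.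
  rewrite -setI_eq0; apply: contraNT ab => /set0Pn[c].
  rewrite !inE => /andP[ac bc]; have [_ sE tE] := vE0; apply/eqP.
  by apply: cls_eq => //; apply: tE ac _; rewrite sE.
apply: leq_trans (_ : #|cover B| <= _)%N; last exact: max_card.
rewrite -(eqP tB) -sum_nat_const; apply: leq_sum => _ /imsetP[a aZ ->].
by rewrite inE in aZ.
Qed.

(** A saturated subset of [Z] is determined by the classes it contains, of which there are at most
    [#|V| %/ k]. *)
Lemma card_saturated :
  (#|[set X : {set V} | (X \subset Z) && saturated E0 X]| <= 2 ^ (#|V| %/ k))%N.
Proof.
set B := [set cls E0 a | a in Z].
apply: leq_trans (_ : #|powerset B| <= _)%N; last first.
  by rewrite card_powerset leq_exp2l // card_blocks.
pose f (X : {set V}) := [set cls E0 a | a in X].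
have [rE _ _] := vE0.
have finj : {in [set X : {set V} | (X \subset Z) && saturated E0 X] &, injective f}.
  suff h X : saturated E0 X -> X = cover (f X).
    move=> X Y; rewrite !inE => /andP[_ sX] /andP[_ sY] e.
    by rewrite (h X sX) (h Y sY) e.
  move=> sX; apply/setP => a; apply/idP/bigcupP.
    by move=> aX; exists (cls E0 a); rewrite ?imset_f // inE rE.
  case=> _ /imsetP[b bX ->]; rewrite inE => ba.
  exact: (saturatedP _ _ sX _ _ bX ba).
rewrite -(card_in_imset finj); apply/subset_leq_card/subsetP => _ /imsetP[X + ->].
by rewrite !inE => /andP[XZ _]; apply: imsetS.
Qed.

Section Prob.
Variables (R : realFieldType) (h : nat).
Hypothesis n2 : (1 < #|V|)%N.
Let n : R := #|V|%:R.

(** Counting only pairs oriented from [X] to [Y] already gives at least [h^2] crossing pairs among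
    fewer than [n^2]. *)
Lemma avg_nocross (X Y : {set V}) : [disjoint X & Y] -> (h <= #|X|)%N -> (h <= #|Y|)%N ->
  avg (pairs V) (fun p => (~~ ((p.1 \in X) && (p.2 \in Y)))%:R : R) <=
  1 - (h%:R / n) ^+ 2.
Proof.
move=> dXY hX hY; have n0 : 0 < n by rewrite ltr0n ltnW.
have P0 : 0 < #|pairs V|%:R :> R.
  by rewrite ltr0n card_gt0 pairs_neq0.
have -> : avg (pairs V) (fun p => (~~ ((p.1 \in X) && (p.2 \in Y)))%:R : R) =
    1 - avg (pairs V) (fun p => ((p.1 \in X) && (p.2 \in Y))%:R).
  rewrite -[X in _ = X - _](avg_cst 1 (pairs_neq0 n2)) -avgB; apply: eq_avg => p _.
  by case: (_ && _); rewrite ?subr0 ?subrr.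
rewrite lerD2l lerN2 /avg ler_pdivlMr //.
have -> : \sum_(p in pairs V) ((p.1 \in X) && (p.2 \in Y))%:R = (#|X| * #|Y|)%:R :> R.
  rewrite -natr_sum -cardsX -sum1_card big_mkcond [in RHS]big_mkcond; congr _%:R.
  apply: eq_bigr => -[a b] _; rewrite !inE /=.
  case: (boolP (a \in X)) => aX /=; last by case: ifP.
  case: (boolP (b \in Y)) => bY /=; last by case: ifP.
  suff -> : a != b by [].
  by apply: contraTneq aX => ->; rewrite (disjointFl dXY).
apply: le_trans (_ : (h * h)%:R <= _); last by rewrite ler_nat leq_mul.
rewrite natrM expr_div_n mulrAC ler_pdivrMr ?exprn_gt0 // -expr2 ler_wpM2l ?exprn_ge0 //.
rewrite card_pairs -/n expr2 ler_wpM2l ?(ltW n0) // ler_nat leq_pred //.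
Qed.

(* Union bound over the unions of blocks that could be separated from the rest. *)
Lemma sprinkling s : (h <= #|V|)%N ->
  EL (pairs V) s (fun l => (~~ [exists a,
     #|Z| <= #|cls (Efold E0 l) a :&: Z| + h.*2])%N%:R : R)
  <= 2 ^+ (#|V| %/ k) * (1 - (h%:R / n) ^+ 2) ^+ s.
Proof.
move=> hn; have /card_gt0P[a0 _] : (0 < #|V|)%N by apply: ltnW.
pose good (X : {set V}) := [&& X \subset Z, saturated E0 X, (h <= #|X|)%N & (h <= #|Z :\: X|)%N].
pose cross (X : {set V}) (p : V * V) := (p.1 \in X) && (p.2 \in Z :\: X).
apply: le_trans (_ : EL (pairs V) s (fun l => \sum_(X in [set X | good X])
   (all (fun p => ~~ cross X p) l)%:R) <= _).
  apply: ler_EL => l _; case: (boolP [exists a, _]) => [_|nex] /=.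
    by apply: sumr_ge0.
  have [] := @giant_or_separated _ Z h a0 (eqv_Efold l vE0).
    by move=> ex; case/existsP: nex.
  case=> Y [satY hY hZ].
  have gX : good (Y :&: Z).
    apply/and4P; split=> //; first exact: subsetIr.
      apply/saturatedP => a b; rewrite !inE => /andP[aY aZ] ab.
      rewrite -(cls_eq vE0 ab) aZ andbT.
      exact: (saturatedP _ _ satY _ _ aY (Efold_sub l ab)).
    apply: leq_trans hZ _; apply/subset_leq_card/subsetP => z.
    by rewrite !inE => /andP[/negbTE-> ->].
  rewrite (bigD1 (Y :&: Z)) ?inE //=.
  have -> : all (fun p => ~~ cross (Y :&: Z) p) l.
    apply/allP => p pl; apply/negP => /andP[]; rewrite !inE => /andP[pY _].
    have := Efold_mem vE0 pl => pE; have := saturatedP _ _ satY _ _ pY pE => ->.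
    by case: (k <= _)%N.
  by rewrite lerDl sumr_ge0.
rewrite EL_sum.
have q0 : 0 <= 1 - (h%:R / n) ^+ 2.
  rewrite subr_ge0 expr_le1 // ?divr_ge0 // ler_pdivrMr ?mul1r ?ler_nat //.
  by rewrite ltr0n ltnW.
apply: le_trans (_ : \sum_(X in [set X | good X]) (1 - (h%:R / n) ^+ 2) ^+ s <= _).
  apply: ler_sum => X; rewrite inE => /and4P[XZ _ hX hZ].
  rewrite EL_all lerXn2r ?nnegrE //; first by apply: avg_ge0.
  apply: avg_nocross => //.
  by rewrite -setI_eq0; apply/eqP/setP => z; rewrite !inE; case: (z \in X).
rewrite sumr_const -[leLHS]mulr_natl ler_wpM2r ?exprn_ge0 // -natrX ler_nat.
apply: leq_trans card_saturated; apply/subset_leq_card/subsetP => X.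
by rewrite !inE => /and4P[-> -> _ _].
Qed.

End Prob.
End Blocks.
End Sprinkle.

(** * The giant component *)

Section PowerBounds.
Variable R : realFieldType.
Implicit Types z e : R.

Lemma geo_le z a : 0 <= z < 1 -> \sum_(i < a) z ^+ i <= (1 - z)^-1.
Proof.
move=> /andP[z0 z1]; rewrite -[leRHS]mul1r ler_pdivlMr ?subr_gt0 //.
have -> : (\sum_(i < a) z ^+ i) * (1 - z) = 1 - z ^+ a.
  by have := subrX1 z a; rewrite mulrC => h; rewrite -[RHS]opprB h; ring.
by rewrite gerBl exprn_ge0.
Qed.

Lemma natpow_le z a : 0 <= z < 1 -> a%:R * z ^+ a <= (1 - z)^-1.
Proof.
move=> z01; have /andP[z0 z1] := z01; apply: le_trans (geo_le a z01).
rewrite mulr_natl -[X in _ *+ X]card_ord -sumr_const ler_sum // => i _.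
by rewrite ler_wiXn2l ?(ltW z1) // ltnW.
Qed.

Lemma natsqpow_le z a : 0 <= z < 1 -> a%:R ^+ 2 * z ^+ a <= 2 * ((1 - z)^-1) ^+ 2.
Proof.
move=> z01; have /andP[z0 z1] := z01.
have d0 : 0 < 1 - z by rewrite subr_gt0.
have h b : \sum_(i < b) i.+1%:R * z ^+ i <= ((1 - z)^-1) ^+ 2.
  rewrite expr2 -[leRHS]mul1r mulrA ler_pdivlMr //.
  rewrite mul1r; apply: le_trans (geo_le b z01).
  suff -> : (\sum_(i < b) i.+1%:R * z ^+ i) * (1 - z) = \sum_(i < b) z ^+ i - b%:R * z ^+ b.
    by rewrite gerBl mulr_ge0 ?exprn_ge0.
  elim: b => [|b IH]; first by rewrite !big_ord0 !mul0r subrr.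
  by rewrite !big_ord_recr /= mulrDl IH -natr1 exprS; ring.
have e : a%:R ^+ 2 <= 2 * \sum_(i < a) i.+1%:R :> R.
  elim: a => [|b IH]; first by rewrite big_ord0 expr0n mulr0.
  rewrite big_ord_recr /= -natr1 mulrDr sqrrD expr1n mulr1.
  have : 0 <= b%:R :> R by []; move: IH; set S := \sum_(i < b) _; lra.
apply: le_trans (_ : 2 * (\sum_(i < a) i.+1%:R) * z ^+ a <= _).
  by rewrite ler_wpM2r ?exprn_ge0.
rewrite -mulrA ler_wpM2l //; apply: le_trans (h a).
rewrite mulr_suml ler_sum // => i _; rewrite ler_wpM2l //.
by rewrite ler_wiXn2l ?(ltW z1) // ltnW.
Qed.

Lemma pow_1sub e a : 0 <= e <= 1 ->
  1 - a%:R * e <= (1 - e) ^+ a <= 1 - a%:R * e + a%:R ^+ 2 * e ^+ 2.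
Proof.
move=> /andP[e0 e1]; elim: a => [|a /andP[IH1 IH2]].
  by rewrite expr0 expr0n !mul0r subr0 addr0 lexx.
have a0 : 0 <= a%:R :> R by [].
have ae : 0 <= a%:R * e ^+ 2 by rewrite mulr_ge0 ?exprn_ge0.
have ae3 : 0 <= a%:R ^+ 2 * e ^+ 2 * e by rewrite !mulr_ge0 ?exprn_ge0.
have e2 : 0 <= e ^+ 2 by rewrite exprn_ge0.
have d0 : 0 <= 1 - e by lra.
rewrite exprS -natr1; apply/andP; split.
  apply: le_trans (ler_wpM2l d0 IH1); lra.
apply: le_trans (ler_wpM2l d0 IH2) _; lra.
Qed.

End PowerBounds.

(** The drift computation of [step_sq]. The main effects of moving [z] and of the new edge combine
    to [2 (Y / n) X], proportional to the deviation [X]; the remainders [r1], [e2], [e3], [e4] are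
    each of order [C^2 / n]. *)
Lemma sq_arith (R : realFieldType) (n g0 C S S1 Y a q ep X : R) :
  2 <= n -> 0 <= g0 -> g0 <= 1 -> 1 <= C -> 0 <= S -> S <= n -> 0 <= S1 -> S1 <= n ->
  0 <= Y -> Y <= n * C -> 0 <= ep -> ep * n = 2 * g0 ->
  - (ep * Y) <= S1 - S -> S1 - S <= - (ep * Y) + 3 * C ^+ 2 * ep ^+ 2 * n ->
  S1 - S <= 0 -> `|a - 2 * Y * S1 / (n * (n - 1))| <= 4 * C ^+ 2 / (n - 1) ->
  q <= 4 * C ^+ 2 -> X = S / n - g0 ->
  X ^+ 2 + 2 * X / n * (S1 - S + a) + n^-1 ^+ 2 * q <=
  (1 + 4 * C / n) * X ^+ 2 + 80 * C ^+ 2 / n ^+ 2.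
Proof.
move=> n2' g00 g01 C1 Sl Su S1l S1u Yl Yu ep0 epn cl cu cm avd qle XE.
have n0 : 0 < n by lra.
have nn0 : n != 0 by rewrite gt_eqF.
have n1 : 0 < n - 1 by lra.
have in0 : 0 <= n^-1 by rewrite invr_ge0 ltW.
have C0 : 0 <= C by lra.
have i1 : (n - 1)^-1 <= 2 / n.
  by rewrite ler_pdivlMr // mulrC ler_pdivrMr //; lra.
have epY : ep * Y <= 2 * C.
  have h1 : ep * Y <= ep * (n * C) by rewrite ler_wpM2l.
  have h2 : g0 * C <= 1 * C by rewrite ler_wpM2r.
  have h3 : ep * (n * C) = 2 * g0 * C by rewrite mulrA epn.
  lra.
have YnC : Y / n <= C by rewrite ler_pdivrMr // mulrC.
have Yn0 : 0 <= Y / n by rewrite divr_ge0 // ltW.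
have Sn0 : 0 <= S / n by rewrite divr_ge0 // ltW.
have Sn1 : S / n <= 1 by rewrite ler_pdivrMr // mul1r.
have X1 : `|X| <= 1 by rewrite ler_norml XE; apply/andP; split; lra.
have C2 : C <= C ^+ 2 by rewrite expr2 ler_peMl.
have C20 : 0 <= C ^+ 2 by rewrite exprn_ge0.
have [e eE] : exists e, e = (S1 - S) + a - 2 * (Y / n) * X.
  by exists ((S1 - S) + a - 2 * (Y / n) * X).
have ele : `|e| <= 28 * C ^+ 2 / n.
  have [r1 r1E] : exists r1, r1 = (S1 - S) + ep * Y by exists ((S1 - S) + ep * Y).
  have r1l : 0 <= r1 by lra.
  have r1u : r1 <= 12 * C ^+ 2 / n.
    have h1 : r1 <= 3 * C ^+ 2 * ep ^+ 2 * n by lra.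
    have epE : ep = 2 * g0 / n by rewrite -epn mulfK.
    have h2 : 3 * C ^+ 2 * ep ^+ 2 * n = 12 * C ^+ 2 / n * g0 ^+ 2.
      by rewrite epE; field.
    rewrite h2 in h1; apply: le_trans h1 _; rewrite ler_piMr //; last by rewrite expr_le1.
    by rewrite divr_ge0 ?mulr_ge0 // ltW.
  have [e2 e2E] : exists e2, e2 = a - 2 * Y * S1 / (n * (n - 1)).
    by exists (a - 2 * Y * S1 / (n * (n - 1))).
  have e2le : `|e2| <= 8 * C ^+ 2 / n.
    rewrite e2E; apply: le_trans avd _.
    have h : 4 * C ^+ 2 * (n - 1)^-1 <= 4 * C ^+ 2 * (2 / n).
      by rewrite ler_wpM2l // mulr_ge0.
    by apply: le_trans h _; rewrite le_eqVlt; apply/orP; left; apply/eqP; ring.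
  have [e3 e3E] : exists e3, e3 = 2 * (Y / n) * ((S1 - S) / n).
    by exists (2 * (Y / n) * ((S1 - S) / n)).
  have e3le : `|e3| <= 4 * C ^+ 2 / n.
    rewrite e3E mulrA normrM (ger0_norm in0) ler_wpM2r // normrM.
    rewrite ger0_norm; last by lra.
    have -> : 4 * C ^+ 2 = (2 * C) * (2 * C) by ring.
    apply: ler_pM => //; [lra|lra|].
    by rewrite ler_norml; apply/andP; split; lra.
  have [e4 e4E] : exists e4, e4 = 2 * (Y / n) * (S1 / (n * (n - 1))).
    by exists (2 * (Y / n) * (S1 / (n * (n - 1)))).
  have h0 : 0 <= S1 / (n * (n - 1)) by rewrite divr_ge0 // mulr_ge0 // ltW.
  have e4l : 0 <= e4 by rewrite e4E mulr_ge0 // mulr_ge0.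
  have e4u : e4 <= 4 * C ^+ 2 / n.
    have h : S1 / (n * (n - 1)) <= 2 / n.
      rewrite invfM mulrA; apply: le_trans i1; rewrite -[leRHS]mul1r ler_wpM2r //.
        by rewrite invr_ge0 ltW.
      by rewrite ler_pdivrMr // mul1r.
    have h2 : 2 * (Y / n) * (S1 / (n * (n - 1))) <= 2 * C * (2 / n).
      by apply: ler_pM => //; lra.
    have h3 : C / n <= C ^+ 2 / n by rewrite ler_wpM2r.
    rewrite e4E; lra.
  have eS : e = r1 + e2 + e3 + e4.
    rewrite eE r1E e2E e3E e4E XE; have -> : ep = 2 * g0 / n by rewrite -epn mulfK.
    by field; rewrite nn0 gt_eqF.
  have t1 := ler_normD (r1 + e2 + e3) e4.
  have t2 := ler_normD (r1 + e2) e3; have t3 := ler_normD r1 e2.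
  rewrite (ger0_norm e4l) in t1; rewrite (ger0_norm r1l) in t3.
  rewrite eS; lra.
have -> : S1 - S + a = e + 2 * (Y / n) * X by rewrite eE; lra.
have X20 : 0 <= X ^+ 2 by rewrite -real_normK ?num_real // exprn_ge0.
have t1 : 2 * X / n * (e + 2 * (Y / n) * X) <=
    56 * C ^+ 2 / n ^+ 2 + 4 * C / n * X ^+ 2.
  have -> : 2 * X / n * (e + 2 * (Y / n) * X) =
    (2 / n) * (X * e) + (4 / n * X ^+ 2) * (Y / n) by field.
  apply: lerD.
    have h : X * e <= 28 * C ^+ 2 / n.
      apply: le_trans (ler_norm _) _; rewrite normrM -[leRHS]mul1r.
      by apply: ler_pM.
    have h2 : 0 <= 2 / n by rewrite mulr_ge0.
    apply: le_trans (ler_wpM2l h2 h) _.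
    by rewrite le_eqVlt; apply/orP; left; apply/eqP; field.
  have -> : 4 * C / n * X ^+ 2 = 4 / n * X ^+ 2 * C by ring.
  by rewrite ler_wpM2l // mulr_ge0 // mulr_ge0.
have in2 : 0 <= n^-1 ^+ 2 by rewrite exprn_ge0.
have t2 : n^-1 ^+ 2 * q <= 4 * C ^+ 2 / n ^+ 2.
  by rewrite -exprVn [leRHS]mulrC ler_wpM2l.
have t3 : 0 <= C ^+ 2 / n ^+ 2 by rewrite divr_ge0 // exprn_ge0 // ltW.
lra.
Qed.

Lemma step_norm (R : realFieldType) (C Y D S S1 ep : R) :
  0 <= D - S1 -> D - S1 <= 2 * C -> S1 - S <= 0 -> ep * Y <= 2 * C ->
  - (ep * Y) <= S1 - S -> `|S1 - S + (D - S1)| <= 2 * C.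
Proof. by move=> *; rewrite ler_norml; apply/andP; split; lra. Qed.

Section Susceptibility.
Variables (R : realFieldType) (V : finType).
Hypothesis n2 : (1 < #|V|)%N.
Implicit Types (E : rel V) (z : R).
Let n : R := #|V|%:R.
Let n0 : 0 < n. Proof. by rewrite ltr0n ltnW. Qed.

(** If vertices are marked independently with probability [1 - z], this is the mean number of
    vertices whose component contains a mark. [SP] is [-z] times its derivative in [z]. *)
Definition SS E z : R := \sum_u (1 - z ^+ #|cls E u|).
Definition SP E z : R := \sum_u (#|cls E u|%:R * z ^+ #|cls E u|).

Lemma cls_addE E u v w : eqv E -> cls (addE E (u, v)) w =
  if (w \in cls E u) || (w \in cls E v) then cls E u :|: cls E v else cls E w.
Proof.
move=> vE; have [rE sE tE] := vE.
rewrite !inE (sE u w) (sE v w); apply/setP => b; rewrite inE /addE /=.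
have [wu|wu] := boolP (E w u).
  have -> : E w b = E u b.
    by apply/idP/idP => h; [apply: tE h; rewrite sE | apply: tE wu h].
  by rewrite !inE; case: (E u b); case: (E v b); rewrite ?orbT ?andbF.
have [wv|wv] /= := boolP (E w v).
  have -> : E w b = E v b.
    by apply/idP/idP => h; [apply: tE h; rewrite sE | apply: tE wv h].
  by rewrite !inE orbC.
by rewrite !inE !orbF.
Qed.

Lemma SS_step E z u v : eqv E ->
  SS (addE E (u, v)) z = SS E z + (~~ E u v)%:R *
    (#|cls E u|%:R * z ^+ #|cls E u| * (1 - z ^+ #|cls E v|) +
     #|cls E v|%:R * z ^+ #|cls E v| * (1 - z ^+ #|cls E u|)).
Proof.
move=> vE; have [rE sE tE] := vE; have [uv|nuv] /= := boolP (E u v).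
  rewrite mul0r addr0; apply: eq_bigr => w _; congr (1 - _ ^+ _).
  by apply: eq_card => b; rewrite !inE addE_id.
rewrite mul1r; set a := #|cls E u|; set b := #|cls E v|.
have dis : [disjoint cls E u & cls E v].
  rewrite -setI_eq0; apply/eqP/setP => w; rewrite !inE; apply/negP => /andP[uw vw].
  by case/negP: nuv; apply: tE uw _; rewrite sE.
have cU : #|cls E u :|: cls E v| = (a + b)%N.
  by rewrite cardsU disjoint_setI0 // cards0 subn0.
apply/eqP; rewrite -subr_eq0 opprD addrA -sumrB.
rewrite (bigID (mem (cls E u))) /= [X in _ + X - _](bigID (mem (cls E v))) /=.
rewrite [X in _ + (_ + X) - _]big1 => [|w /andP[wu wv]]; last first.
  by rewrite cls_addE // (negbTE wu) (negbTE wv) subrr.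
rewrite (eq_bigr (fun=> z ^+ a - z ^+ (a + b))) => [|w wu]; last first.
  rewrite cls_addE // wu /= cU; rewrite inE in wu; rewrite -(cls_eq vE wu) -/a; ring.
rewrite [X in _ + (X + _) - _](eq_bigr (fun=> z ^+ b - z ^+ (a + b))); last first.
  move=> w /andP[_ wv]; rewrite cls_addE // wv orbT cU; rewrite inE in wv.
  by rewrite -(cls_eq vE wv) -/b; ring.
rewrite sumr_const -/a.
rewrite [X in _ + (X + _) - _](eq_bigl (mem (cls E v))); last first.
  move=> w /=; case: (boolP (w \in cls E v)) => wv; last by rewrite andbF.
  by rewrite (disjointFl dis wv).
rewrite sumr_const -/b addr0 -(mulr_natl (z ^+ a - _) a) -(mulr_natl (z ^+ b - _) b).
by rewrite exprD; apply/eqP; ring.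
Qed.

Lemma SS_le E z : 0 <= z <= 1 -> 0 <= SS E z <= n.
Proof.
move=> /andP[z0 z1]; have h u : 0 <= 1 - z ^+ #|cls E u| <= 1.
  by rewrite subr_ge0 exprn_ile1 //= gerBl exprn_ge0.
rewrite sumr_ge0 => [|u _]; last by case/andP: (h u).
have -> : n = \sum_(u : V) 1 by rewrite sumr_const.
rewrite ler_sum // => u _.
by case/andP: (h u).
Qed.

Section OneStep.
Variables (C z z' g0 : R).
Let ep : R := 2 * g0 / n.
Hypotheses (g00 : 0 <= g0) (g01 : g0 <= 1) (z0 : 0 <= z) (C1 : 1 <= C).
Hypotheses (z'1 : z' < 1) (zC : (1 - z')^-1 <= C) (zz : z' = z * (1 + ep)).

Let ep0 : 0 <= ep. Proof. by rewrite divr_ge0 ?mulr_ge0 // ltW. Qed.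
Let z'0 : 0 <= z'. Proof. by rewrite zz mulr_ge0 // addr_ge0. Qed.
Let z'01 : 0 <= z' < 1. Proof. by rewrite z'0. Qed.
Let zz' : z <= z'. Proof. by rewrite zz ler_peMr // lerDl. Qed.
Let C0 : 0 <= C. Proof. by apply: le_trans C1. Qed.

Let psi_le a : a%:R * z' ^+ a <= C.
Proof. exact: le_trans (natpow_le a z'01) zC. Qed.

Let psi_ge0 a : 0 <= a%:R * z' ^+ a.
Proof. by rewrite mulr_ge0 ?exprn_ge0. Qed.

Let psi2_le a : a%:R ^+ 2 * z' ^+ a <= 2 * C ^+ 2.
Proof.
apply: le_trans (natsqpow_le a z'01) _; rewrite ler_wpM2l // lerXn2r ?nnegrE //.
by rewrite invr_ge0 subr_ge0 ltW.
Qed.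

Let phi01 a : 0 <= 1 - z' ^+ a <= 1.
Proof. by rewrite subr_ge0 exprn_ile1 ?(ltW z'1) //= gerBl exprn_ge0. Qed.

Let powdiff a : ep * (a%:R * z' ^+ a) - 3 * C ^+ 2 * ep ^+ 2 <= z' ^+ a - z ^+ a <=
  ep * (a%:R * z' ^+ a).
Proof.
(* [z = z' (1 - de)]: the power is expanded around the larger point [z'], where [1 / (1 - z')] is
   bounded by [C]. *)
pose de := ep / (1 + ep).
have e1 : 0 < 1 + ep by rewrite ltr_wpDr.
have de0 : 0 <= de by rewrite divr_ge0 // ltW.
have de1 : de <= 1 by rewrite ler_pdivrMr // mul1r lerDr.
have dele : de <= ep by rewrite ler_pdivrMr // ler_peMr // lerDl.
have dege : ep - ep ^+ 2 <= de.
  rewrite ler_pdivlMr // -subr_ge0.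
  have -> : ep - (ep - ep ^+ 2) * (1 + ep) = ep ^+ 3 by ring.
  by rewrite exprn_ge0.
have zE : z ^+ a = z' ^+ a * (1 - de) ^+ a.
  rewrite -exprMn; congr (_ ^+ _); rewrite zz /de; field.
  by rewrite gt_eqF.
rewrite zE; have := pow_1sub a (_ : 0 <= de <= 1); rewrite de0 de1 => /(_ isT)/andP[p1 p2].
have Z0 : 0 <= z' ^+ a by rewrite exprn_ge0.
have q1 := ler_wpM2l Z0 p1; have q2 := ler_wpM2l Z0 p2.
have pa := psi_le a; have pa0 := psi_ge0 a; have pa2 := psi2_le a.
have r1 : de * (a%:R * z' ^+ a) <= ep * (a%:R * z' ^+ a) by rewrite ler_wpM2r.
have r2 : (ep - ep ^+ 2) * (a%:R * z' ^+ a) <= de * (a%:R * z' ^+ a) by rewrite ler_wpM2r.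
have de2 : de ^+ 2 <= ep ^+ 2 by rewrite lerXn2r ?nnegrE.
have r3 : (a%:R ^+ 2 * z' ^+ a) * de ^+ 2 <= (2 * C ^+ 2) * ep ^+ 2.
  apply: ler_pM => //; last by rewrite exprn_ge0.
  by rewrite mulr_ge0 // exprn_ge0.
have r4 : ep ^+ 2 * (a%:R * z' ^+ a) <= ep ^+ 2 * C ^+ 2.
  rewrite ler_wpM2l ?exprn_ge0 //; apply: le_trans pa _.
  by rewrite expr2 ler_peMl.
apply/andP; split; lra.
Qed.

(** Summed over all pairs the increments factor into [2 SP SS]. Pairs inside one class must be
    subtracted; they contribute at most [4 C^2] per vertex. *)
Lemma avg_SS_step E : eqv E ->
  `|avg (pairs V) (fun p => SS (addE E p) z' - SS E z') -
    2 * SP E z' * SS E z' / (n * (n - 1))| <= 4 * C ^+ 2 / (n - 1).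
Proof.
move=> vE; have [rE sE tE] := vE.
have n1 : 0 < n - 1 by rewrite subr_gt0 ltr1n.
have cP : #|pairs V|%:R = n * (n - 1) :> R.
  rewrite card_pairs -/n; congr (_ * _).
  by rewrite -subn1 natrB // ltnW.
pose D u v := #|cls E u|%:R * z' ^+ #|cls E u| * (1 - z' ^+ #|cls E v|) +
     #|cls E v|%:R * z' ^+ #|cls E v| * (1 - z' ^+ #|cls E u|).
have sumD : \sum_u \sum_v D u v = 2 * SP E z' * SS E z'.
  have -> : \sum_u \sum_v D u v = \sum_u \sum_v (#|cls E u|%:R * z' ^+ #|cls E u|) *
      (1 - z' ^+ #|cls E v|) + \sum_u \sum_v (#|cls E v|%:R * z' ^+ #|cls E v|) *
      (1 - z' ^+ #|cls E u|).
    by rewrite -big_split; apply: eq_bigr => u _; rewrite -big_split.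
  have e : \sum_u \sum_v (#|cls E u|%:R * z' ^+ #|cls E u|) * (1 - z' ^+ #|cls E v|) =
      SP E z' * SS E z'.
    by rewrite /SP mulr_suml; apply: eq_bigr => u _; rewrite mulr_sumr.
  by rewrite [X in _ + X]exchange_big /= e; ring.
pose err := \sum_u \sum_(v | E u v) D u v.
have err0 : 0 <= err.
  apply: sumr_ge0 => u _; apply: sumr_ge0 => v _.
  by rewrite addr_ge0 // mulr_ge0 // (andP (phi01 _)).1.
have errle : err <= n * (4 * C ^+ 2).
  have -> : n * (4 * C ^+ 2) = \sum_(u : V) 4 * C ^+ 2.
    by rewrite sumr_const; apply: mulr_natl.
  rewrite ler_sum // => u _.
  rewrite (eq_bigr (fun=> 2 * ((#|cls E u|%:R * z' ^+ #|cls E u|) * (1 - z' ^+ #|cls E u|)))).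
    rewrite sumr_const; set a := #|cls E u|.
    have -> : #|[pred v | E u v]| = a by apply: eq_card => v; rewrite !inE.
    have -> : 2 * (a%:R * z' ^+ a * (1 - z' ^+ a)) *+ a =
      2 * (a%:R ^+ 2 * z' ^+ a * (1 - z' ^+ a)) by rewrite -(mulr_natl (2 * _)); ring.
    have pa2 := psi2_le a; have /andP[f0 f1] := phi01 a.
    have : a%:R ^+ 2 * z' ^+ a * (1 - z' ^+ a) <= 2 * C ^+ 2 * 1.
      by rewrite ler_pM // mulr_ge0 ?exprn_ge0.
    by lra.
  by move=> v uv; rewrite /D -(cls_eq vE uv); ring.
have -> : avg (pairs V) (fun p => SS (addE E p) z' - SS E z') =
    (2 * SP E z' * SS E z' - err) / (n * (n - 1)).
  rewrite /avg cP; congr (_ / _); rewrite sum_pairs -sumD -sumrB.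
  apply: eq_bigr => u _; rewrite [X in _ = X - _](bigID (E u)) /= addrAC subrr add0r.
  rewrite big_mkcond [RHS]big_mkcond; apply: eq_bigr => v _.
  rewrite SS_step // addrAC subrr add0r.
  have [e|] := eqVneq v u; first by rewrite e rE.
  by case: (E u v); rewrite ?mul0r ?mul1r.
rewrite mulrBl addrAC subrr add0r normrN ger0_norm ?divr_ge0 ?mulr_ge0 ?(ltW n0) ?(ltW n1) //.
rewrite ler_pdivrMr ?mulr_gt0 //.
have -> : 4 * C ^+ 2 / (n - 1) * (n * (n - 1)) = n * (4 * C ^+ 2).
  by field; rewrite gt_eqF.
exact: errle.
Qed.

Lemma dSS_bound E p : eqv E -> 0 <= SS (addE E p) z' - SS E z' <= 2 * C.
Proof.
case: p => u v vE; rewrite SS_step // addrAC subrr add0r.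
have t a b : 0 <= a%:R * z' ^+ a * (1 - z' ^+ b) <= C.
  have /andP[f0 f1] := phi01 b; rewrite mulr_ge0 //=.
  by rewrite -[leRHS]mulr1 ler_pM.
have /andP[t1 t2] := t #|cls E u| #|cls E v|.
have /andP[t3 t4] := t #|cls E v| #|cls E u|.
by case: (~~ _); rewrite ?mul1r ?mul0r; lra.
Qed.

Lemma SP_bound E : 0 <= SP E z' <= n * C.
Proof.
rewrite sumr_ge0 //=.
have -> : n * C = \sum_(u : V) C by rewrite sumr_const; apply: mulr_natl.
by rewrite ler_sum.
Qed.

Lemma SS_change E : - (ep * SP E z') <= SS E z' - SS E z <=
  - (ep * SP E z') + 3 * C ^+ 2 * ep ^+ 2 * n.
Proof.
have -> : SS E z' - SS E z = - \sum_u (z' ^+ #|cls E u| - z ^+ #|cls E u|).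
  by rewrite -sumrB -sumrN; apply: eq_bigr => u _; ring.
have h1 : \sum_u (z' ^+ #|cls E u| - z ^+ #|cls E u|) <= ep * SP E z'.
  by rewrite mulr_sumr ler_sum // => u _; case/andP: (powdiff #|cls E u|).
have h2 : ep * SP E z' - 3 * C ^+ 2 * ep ^+ 2 * n <=
    \sum_u (z' ^+ #|cls E u| - z ^+ #|cls E u|).
  have -> : 3 * C ^+ 2 * ep ^+ 2 * n = \sum_(u : V) 3 * C ^+ 2 * ep ^+ 2.
    by rewrite sumr_const [LHS]mulrC; apply: mulr_natl.
  by rewrite mulr_sumr -sumrB ler_sum // => u _; case/andP: (powdiff #|cls E u|).
by apply/andP; split; lra.
Qed.

Lemma SS_mono E : SS E z' - SS E z <= 0.
Proof.
rewrite -sumrB sumr_le0 // => u _.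
have h : z ^+ #|cls E u| <= z' ^+ #|cls E u|.
  by apply: lerXn2r => //; rewrite nnegrE.
lra.
Qed.

(** A new edge raises [SS / n] by about [(2 SP / n^2) (SS / n)] on average, while passing from [z]
    to [z (1 + 2 g0 / n)] lowers it by about [(2 SP / n^2) g0]. Along this characteristic the drift
    cancels where [SS / n = g0], and the squared deviation is multiplied by [1 + O(1 / n)] up to
    [O(1 / n^2)]. *)
Lemma step_sq E : eqv E ->
  avg (pairs V) (fun p => (SS (addE E p) z' / n - g0) ^+ 2) <=
  (1 + 4 * C / n) * (SS E z / n - g0) ^+ 2 + 80 * C ^+ 2 / n ^+ 2.
Proof.
move=> vE; set S := SS E z; set S1 := SS E z'.
pose dS p := SS (addE E p) z' - S1.
have z1 : z <= 1 by apply: le_trans zz' (ltW z'1).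
have /andP[Sl Su] : 0 <= S <= n by apply: SS_le; rewrite z0.
have /andP[S1l S1u] : 0 <= S1 <= n by apply: SS_le; rewrite z'0 ltW.
have /andP[Yl Yu] := SP_bound E.
have /andP[cl cu] := SS_change E.
have sq : avg (pairs V) (fun p => (S1 - S + dS p) ^+ 2) <= 4 * C ^+ 2.
  apply: avg_le_cst => [|p _]; first by rewrite mulr_ge0 // exprn_ge0.
  have /andP[d1 d2] := dSS_bound p vE.
  have cm := SS_mono E; have epY : ep * SP E z' <= 2 * C.
    have h1 : ep * SP E z' <= ep * (n * C) by rewrite ler_wpM2l.
    have h2 : g0 * C <= 1 * C by rewrite ler_wpM2r.
    have h3 : ep * (n * C) = 2 * g0 * C by rewrite mulrA /ep divfK // gt_eqF.
    by apply: le_trans h1 _; rewrite h3 -mulrA ler_wpM2l // -[leRHS]mul1r.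
  have -> : 4 * C ^+ 2 = (2 * C) ^+ 2 by ring.
  rewrite -real_normK ?num_real // lerXn2r ?nnegrE //; first by rewrite mulr_ge0.
  exact: (step_norm d1 d2 cm epY cl).
have XE p : (SS (addE E p) z' / n - g0) ^+ 2 =
    (S / n - g0) ^+ 2 + 2 * (S / n - g0) / n * ((S1 - S) + dS p)
    + n^-1 ^+ 2 * ((S1 - S) + dS p) ^+ 2.
  by rewrite /dS; field; rewrite gt_eqF.
rewrite (eq_avg (fun p _ => XE p)) !avgD !avgZ avgD !avg_cst ?pairs_neq0 //.
apply: (sq_arith _ g00 g01 C1 Sl Su S1l S1u Yl Yu ep0 _ cl cu (SS_mono E) (avg_SS_step vE) sq erefl).
  by rewrite ler_nat.
by rewrite /ep divfK // gt_eqF.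
Qed.

End OneStep.
End Susceptibility.

Section Powers.
Variable R : realFieldType.

Lemma bernoulli (x : R) a : 0 <= x -> 1 + a%:R * x <= (1 + x) ^+ a.
Proof.
move=> x0; elim: a => [|a IH]; first by rewrite mul0r addr0 expr0.
have x1 : 0 <= 1 + x by rewrite addr_ge0.
rewrite exprS -natr1; apply: le_trans (ler_wpM2l x1 IH).
have : 0 <= x * (a%:R * x) by rewrite !mulr_ge0.
lra.
Qed.

Lemma pow_half_small (x : R) L s : 0 <= x <= 1 -> (0 < L)%N -> 1 <= L%:R * x ->
  (1 - x) ^+ s <= 2^-1 ^+ (s %/ L).
Proof.
move=> /andP[x0 x1] L0 Lx; have y0 : 0 <= 1 - x by lra.
have yL : (1 - x) ^+ L <= 2^-1.
  have h : (1 - x) ^+ L * (1 + x) ^+ L <= 1.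
    rewrite -exprMn; apply: exprn_ile1.
      by rewrite mulr_ge0 //; lra.
    have : 0 <= x * x by rewrite mulr_ge0.
    lra.
  have b := bernoulli L x0; have p0 : 0 <= (1 - x) ^+ L by rewrite exprn_ge0.
  have : (1 - x) ^+ L * 2 <= (1 - x) ^+ L * (1 + x) ^+ L.
    by rewrite ler_wpM2l //; lra.
  lra.
rewrite {1}(divn_eq s L) exprD mulnC exprM -[leRHS]mulr1.
rewrite ler_pM ?exprn_ge0 //; last by apply: exprn_ile1 => //; lra.
by apply: lerXn2r => //; rewrite nnegrE ?exprn_ge0 //; lra.
Qed.

Lemma pow_compare (a b B : nat) : (a + B <= b)%N ->
  2 ^+ a * 2^-1 ^+ b <= (B.+1%:R)^-1 :> R.
Proof.
move=> abB; rewrite -(subnKC (leq_trans (leq_addr B a) abB)) exprD mulrA.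
rewrite -exprMn mulfV ?pnatr_eq0 // expr1n mul1r.
have h : (B <= b - a)%N by rewrite leq_subRL // (leq_trans (leq_addr B a)).
apply: le_trans (_ : 2^-1 ^+ B <= _).
  by rewrite ler_wiXn2l // ?invr_ge0 //; lra.
rewrite exprVn lef_pV2 ?posrE ?exprn_gt0 ?ltr0n // -natrX ler_nat.
exact: ltn_expl.
Qed.

Lemma euler_bound n : (0 < n)%N -> (1 + n%:R^-1) ^+ n <= 4 :> R.
Proof.
move=> n0; have nR : 0 < n%:R :> R by rewrite ltr0n.
pose y : R := (n.+1%:R)^-1.
have y0 : 0 <= y by rewrite invr_ge0.
have y1 : y <= 1 by rewrite invf_le1 ?ler1n ?ltr0n.
have e : (1 + n%:R^-1) * (1 - y) = 1.
  by rewrite /y -natr1; field; apply/andP; split; rewrite gt_eqF //; lra.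
pose m := n.+1./2.
have m2 : (n <= m + m)%N by rewrite addnn /m; lia.
have m3 : (m + m <= n.+1)%N by rewrite addnn /m; lia.
have hm : 2^-1 <= (1 - y) ^+ m.
  have y01 : 0 <= y <= 1 by rewrite y0.
  have /andP[h _] := pow_1sub m y01; apply: le_trans h.
  have : m%:R * y <= 2^-1.
    rewrite /y ler_pdivrMr ?ltr0n // mulrC ler_pdivlMr // -natrM ler_nat.
    by rewrite muln2 -addnn.
  lra.
have d0 : 0 <= 1 - y by lra.
have h2 : 4^-1 <= (1 - y) ^+ n.
  apply: le_trans (_ : (1 - y) ^+ (m + m) <= _); last first.
    by rewrite ler_wiXn2l //; lra.
  rewrite exprD; apply: le_trans (_ : 2^-1 * 2^-1 <= _); first by lra.
  by apply: ler_pM => //; rewrite invr_ge0.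
have e2 : (1 + n%:R^-1) ^+ n * (1 - y) ^+ n = 1 by rewrite -exprMn e expr1n.
have p0 : 0 <= (1 + n%:R^-1) ^+ n :> R by rewrite exprn_ge0 // addr_ge0 // invr_ge0.
have := ler_wpM2l p0 h2; rewrite e2; lra.
Qed.

Lemma euler_bound_mul n M (x : R) : (0 < n)%N -> 0 <= x -> x <= M%:R ->
  (1 + x / n%:R) ^+ n <= 4 ^+ M.
Proof.
move=> n0 x0 xM; have nR : 0 < n%:R :> R by rewrite ltr0n.
have i0 : 0 <= n%:R^-1 :> R by rewrite invr_ge0 ltW.
apply: le_trans (_ : ((1 + n%:R^-1) ^+ M) ^+ n <= _).
  apply: lerXn2r; rewrite ?nnegrE ?exprn_ge0 ?addr_ge0 ?mulr_ge0 //.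
  apply: le_trans (bernoulli M i0); rewrite lerD2l ler_wpM2r //.
rewrite -exprM mulnC exprM; apply: lerXn2r; rewrite ?nnegrE ?exprn_ge0 ?addr_ge0 //.
exact: euler_bound.
Qed.

End Powers.

Lemma eq_op_eqv (V : finType) : eqv (@eq_op V).
Proof.
split; [exact: eqxx | exact: eq_sym | by move=> b a c /eqP-> /eqP->].
Qed.

Section Iterate.
Variables (R : realFieldType) (V : finType).
Hypothesis n2 : (1 < #|V|)%N.
Let n : R := #|V|%:R.
Let n0 : 0 < n. Proof. by rewrite ltr0n ltnW. Qed.
Variables (z0 C : R) (N : nat).
Let g0 := 1 - z0.
Let z j := z0 * (1 + 2 * g0 / n) ^+ j.
Hypotheses (z00 : 0 <= z0) (z01 : z0 < 1) (C1 : 1 <= C).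
Hypotheses (zN1 : z N < 1) (zNC : (1 - z N)^-1 <= C).
Local Notation EG l := (Efold (@eq_op V) l).

Let ep0 : 0 <= 2 * g0 / n.
Proof. by rewrite divr_ge0 ?mulr_ge0 // ?(ltW n0) // /g0 subr_ge0 ltW. Qed.

Let z_ge0 j : 0 <= z j. Proof. by rewrite mulr_ge0 ?exprn_ge0 ?addr_ge0. Qed.

Let z_mono i j : (i <= j)%N -> z i <= z j.
Proof. by move=> ij; rewrite ler_wpM2l // ler_weXn2l // lerDl. Qed.

Lemma SS_eq_op (y : R) : SS (@eq_op V) y = n * (1 - y).
Proof.
rewrite /SS (eq_bigr (fun=> 1 - y)) => [|u _].
  by rewrite sumr_const; symmetry; apply: mulr_natl.
have -> : cls (@eq_op V) u = [set u] by apply/setP => w; rewrite !inE eq_sym.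
by rewrite cards1 expr1.
Qed.

(** The right-hand side solves [x -> (1 + 4 C / n) x + 80 C^2 / n^2] from 0. The start is exact: for
    isolated vertices [SS / n = 1 - z0 = g0]. *)
Lemma iter_sq j : (j <= N)%N ->
  EL (pairs V) j (fun l => (SS (EG l) (z j) / n - g0) ^+ 2) <=
  20 * C / n * ((1 + 4 * C / n) ^+ j - 1).
Proof.
elim: j => [|j IH] jN.
  rewrite /= SS_eq_op /z expr0 mulr1 mulrAC divff ?gt_eqF // mul1r subrr.
  by rewrite expr0 expr0n subrr mulr0.
rewrite EL_rcons.
apply: le_trans (_ : EL (pairs V) j (fun l => (1 + 4 * C / n) *
   (SS (EG l) (z j) / n - g0) ^+ 2 + 80 * C ^+ 2 / n ^+ 2) <= _).
  apply: ler_EL => l _.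
  under eq_avg => p _ do rewrite -cats1 Efold_cat /=.
  apply: step_sq => //.
  - by rewrite /g0 subr_ge0 ltW.
  - by rewrite /g0 gerBl.
  - by apply: le_lt_trans (z_mono jN) zN1.
  - apply: le_trans zNC; rewrite lef_pV2 ?posrE ?subr_gt0 ?lerB ?z_mono //.
    by apply: le_lt_trans (z_mono jN) zN1.
  - by rewrite /z exprSr mulrA.
  exact/eqv_Efold/eq_op_eqv.
rewrite ELD ELZ EL_cst ?pairs_neq0 //.
have a0 : 0 <= 1 + 4 * C / n.
  by rewrite addr_ge0 // divr_ge0 ?mulr_ge0 ?(ltW n0) // (le_trans _ C1).
apply: le_trans (_ : (1 + 4 * C / n) * (20 * C / n * ((1 + 4 * C / n) ^+ j - 1)) +
   80 * C ^+ 2 / n ^+ 2 <= _).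
  by rewrite lerD2r ler_wpM2l // IH // ltnW.
rewrite le_eqVlt; apply/orP; left; apply/eqP; rewrite [in RHS]exprS.
have nn : n != 0 by rewrite gt_eqF.
by move: (n) nn => m nn; move: ((1 + 4 * C / m) ^+ j) => P; field.
Qed.

End Iterate.

Section Fraction.
Variables (R : realFieldType) (V : finType).
Let n : R := #|V|%:R.

(** A vertex in a class smaller than [K] contributes at most [K (1 - z)] to [SS]. *)
Lemma large_fraction (E : rel V) (z g0 : R) K : 0 <= z <= 1 ->
  K%:R * (1 - z) <= g0 / 4 -> n * (g0 / 2) <= SS E z ->
  n * (g0 / 4) <= #|[set a | K <= #|cls E a|]%N|%:R.
Proof.
move=> /andP[z0 z1] Kz Sle; set Z := [set a | _].
have h : SS E z <= #|Z|%:R + n * (g0 / 4).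
  rewrite /SS (bigID (mem Z)) /= lerD //.
    rewrite -sum1_card natr_sum ler_sum // => u _.
    by rewrite gerBl exprn_ge0.
  have -> : n * (g0 / 4) = \sum_(u : V) g0 / 4 by rewrite sumr_const; apply: mulr_natl.
  have g0' : 0 <= g0 / 4 by apply: le_trans Kz; rewrite mulr_ge0 // subr_ge0.
  rewrite big_mkcond ler_sum // => u _; case: ifP => // uZ.
  apply: le_trans Kz; rewrite inE -ltnNge in uZ.
  have z01 : 0 <= 1 - z <= 1 by rewrite subr_ge0 z1 gerBl.
  have /andP[] := pow_1sub #|cls E u| z01; rewrite subKr => p _.
  apply: le_trans (_ : #|cls E u|%:R * (1 - z) <= _); first by lra.
  by rewrite ler_wpM2r ?subr_ge0 // ler_nat ltnW.
lra.
Qed.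

End Fraction.

Lemma sprinkling_small (R : realFieldType) (V : finType) (E0 : rel V) (k h L B s : nat)
    (Z := [set a | k <= #|cls E0 a|]%N) :
  eqv E0 -> (0 < k)%N -> (1 < #|V|)%N -> (h <= #|V|)%N -> (0 < L)%N ->
  #|V|%:R ^+ 2 <= L%:R * h%:R ^+ 2 :> R -> (#|V| %/ k + B <= s %/ L)%N ->
  EL (pairs V) s (fun l => (~~ [exists a,
     #|Z| <= #|cls (Efold E0 l) a :&: Z| + h.*2])%N%:R : R) <= (B.+1%:R)^-1.
Proof.
move=> vE0 k0 n2 hn L0 Lh aB.
apply: le_trans (sprinkling vE0 k0 R n2 s hn) _.
apply: le_trans (pow_compare R aB); rewrite ler_wpM2l ?exprn_ge0 //.
have n0 : 0 < #|V|%:R :> R by rewrite ltr0n ltnW.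
apply: pow_half_small => //.
  rewrite exprn_ge0 ?divr_ge0 //= expr_le1 // ?divr_ge0 //.
  by rewrite ler_pdivrMr // mul1r ler_nat.
by rewrite expr_div_n mulrA ler_pdivlMr ?exprn_gt0 // mul1r.
Qed.

Lemma first_crossing (P : pred nat) T : P 0%N -> ~~ P T ->
  exists N, [/\ (N < T)%N, P N & ~~ P N.+1].
Proof.
move=> P0; elim: T => [|T IH] PT; first by rewrite P0 in PT.
have [PT'|PT'] := boolP (P T); first by exists T; rewrite leqnn PT'.
by have [N [NT h1 h2]] := IH PT'; exists N; split=> //; apply: ltnW.
Qed.

(** The characteristic issued from [1 - nu] comes within order [nu / K] of 1 before time [c1 n].
    There [SS] is still about [nu n], so a positive fraction of the vertices lies in components of
    size at least [K], which the remaining [(c - c1) n] edges join. *)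
Lemma giant_exists (R : realType) (c : R) : 2^-1 < c ->
  exists2 de : R, 0 < de & forall eps : R, 0 < eps -> exists n0 : nat,
  forall V : finType, (n0 <= #|V|)%N -> forall t : nat, c * #|V|%:R <= t%:R ->
  EL (pairs V) t (fun l => (~~ [exists a,
     de * #|V|%:R <= #|cls (Efold (@eq_op V) l) a|%:R])%:R : R) <= eps.
Proof.
move=> c12.
have [c1 [c1l c1u c1c]] : exists c1 : R, [/\ 2^-1 < c1, c1 < 1 & c1 < c].
  exists ((2^-1 + Num.min c 1) / 2).
  have : 2^-1 < Num.min c 1 by rewrite lt_min c12; lra_local.
  have : Num.min c 1 <= c by rewrite ge_min lexx.
  have : Num.min c 1 <= 1 by rewrite ge_min lexx orbT.
  by move=> *; split; lra_local.
have c10 : 0 < c1 by lra_local.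
(* The nonzero root of [(1 - nu) (1 + 2 c1 nu) = 1]; Bernoulli's inequality then shows that the
   characteristic has reached 1 by time [c1 n]. *)
have [nu nuE] : exists nu, nu = (2 * c1 - 1) / (2 * c1) by exists ((2 * c1 - 1) / (2 * c1)).
have nu0 : 0 < nu by rewrite nuE divr_gt0 //; lra_local.
have nuc : nu * (2 * c1) = 2 * c1 - 1 by rewrite nuE divfK // gt_eqF //; lra_local.
have nu1 : nu < 2^-1.
  have : nu * (2 * c1) < 2^-1 * (2 * c1) by rewrite nuc; lra_local.
  by rewrite ltr_pM2r //; lra_local.
have cc0 : 0 < c - c1 by lra_local.
have [L Lle] := nat_above ((32 / nu) ^+ 2).
have L0 : (0 < L)%N.
  rewrite -(ltr0n R); apply: lt_le_trans Lle; rewrite exprn_gt0 // divr_gt0 //.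
have [K Kle] := nat_above (4 * L%:R / (c - c1)).
have LR : 0 < L%:R :> R by rewrite ltr0n.
have K0 : (0 < K)%N.
  by rewrite -(ltr0n R); apply: lt_le_trans Kle; rewrite divr_gt0 // mulr_gt0.
have KR : 1 <= K%:R :> R by rewrite ler1n.
pose zs : R := 1 - nu / (8 * K%:R).
pose C : R := 8 * K%:R / nu.
have C1 : 1 <= C by rewrite ler_pdivlMr // mul1r; lra_local.
have C0 : 0 <= C by apply: le_trans C1.
have [M Mle] := nat_above (4 * C).
exists (nu / 16); first by rewrite divr_gt0.
move=> eps eps0.
have [B Ble] := nat_above (2 / eps).
have [q1 q1le] := nat_above (20 * C * 4 ^+ M * (4 / nu ^+ 2) * (2 / eps)).
have [q2 q2le] := nat_above (32 / nu).
have [q3 q3le] := nat_above ((B%:R + 1) * L%:R / (c - c1) * 2).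
exists (q1 + q2 + q3 + 16 * K + 2)%N => V nV t ct.
have [n2 [k1 [k2 [k3 k4]]]] : (1 < #|V| /\ q1 <= #|V| /\ q2 <= #|V| /\
    q3 <= #|V| /\ 16 * K <= #|V|)%N by clear -nV; lia.
pose n : R := #|V|%:R.
have n0 : 0 < n by rewrite ltr0n ltnW.
have nq1 : q1%:R <= n by rewrite ler_nat.
have nq2 : q2%:R <= n by rewrite ler_nat.
have nq3 : q3%:R <= n by rewrite ler_nat.
have nK : 16 * K%:R <= n by rewrite -natrM ler_nat.
pose z0 := 1 - nu; pose z j := z0 * (1 + 2 * (1 - z0) / n) ^+ j.
have g0E : 1 - z0 = nu by rewrite /z0; lra_local.
have z00 : 2^-1 <= z0 by rewrite /z0; lra_local.
have ep0 : 0 <= 2 * nu / n by rewrite divr_ge0 ?mulr_ge0 // ltW.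
have nuK : nu / (8 * K%:R) <= nu / 8.
  by rewrite ler_wpM2l ?(ltW nu0) // lef_pV2 ?posrE ?mulr_gt0 //; lra_local.
have nuK0 : 0 < nu / (8 * K%:R) by rewrite divr_gt0 // mulr_gt0 //; lra_local.
have [T1 T1le T1ge] : exists2 T1 : nat, c1 * n <= T1%:R & T1%:R <= c1 * n + 1.
  exists (Num.truncn (c1 * n)).+1.
    by apply: ltW; case/andP: (Num.Theory.truncn_itv (ltW (mulr_gt0 c10 n0))).
  by rewrite -natr1 lerD2r; case/andP: (Num.Theory.truncn_itv (ltW (mulr_gt0 c10 n0))).
(* Last time at or below [zs]. Staying below gives [1 / (1 - z N) <= C], and being within one step
   of [zs] makes [K (1 - z N)] small. *)
have [N [NT zN zN1]] : exists N, [/\ (N < T1)%N, z N <= zs & ~~ (z N.+1 <= zs)].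
  apply: (@first_crossing (fun j => z j <= zs)).
    by rewrite /z expr0 mulr1 /z0 /zs; lra_local.
  rewrite -ltNge; apply: lt_le_trans (_ : 1 <= _); first by rewrite /zs; lra_local.
  rewrite /z g0E; have b := bernoulli T1 ep0.
  apply: le_trans (_ : z0 * (1 + T1%:R * (2 * nu / n)) <= _); last first.
    by rewrite ler_wpM2l //; lra_local.
  apply: le_trans (_ : z0 * (1 + 2 * c1 * nu) <= _).
    have -> : z0 * (1 + 2 * c1 * nu) =
      1 + nu * (2 * c1 - 1) - nu * (nu * (2 * c1)) by rewrite /z0; ring.
    by rewrite nuc addrK.
  rewrite ler_wpM2l //; first lra_local.
  rewrite lerD2l; apply: le_trans (_ : (c1 * n) * (2 * nu / n) <= _).
    rewrite le_eqVlt; apply/orP; left; apply/eqP; field; by rewrite gt_eqF.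
  by rewrite ler_wpM2r.
rewrite -ltNge in zN1.
have zs1 : zs < 1 by rewrite /zs; lra_local.
have zNlt : z N < 1 by apply: le_lt_trans zN zs1.
have zsC : (1 - zs)^-1 = C.
  rewrite /zs /C subKr invf_div //.
have zNC : (1 - z N)^-1 <= C.
  by rewrite -zsC lef_pV2 ?posrE ?subr_gt0 // lerB.
have z00' : 0 <= z0 by lra_local.
have zN0 : 0 <= z N by rewrite /z g0E mulr_ge0 // exprn_ge0 // addr_ge0.
have KzN : K%:R * (1 - z N) <= nu / 4.
  have e : z N.+1 = z N + z N * (2 * nu / n) by rewrite /z exprSr g0E; ring.
  have h1 : z N * (2 * nu / n) <= 1 * (2 * nu / n) by rewrite ler_wpM2r // ltW.
  have h2 : 2 * nu / n <= nu / (8 * K%:R).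
    rewrite ler_pdivrMr // mulrAC ler_pdivlMr; last by lra_local.
    have : nu * (16 * K%:R) <= nu * n by rewrite ler_wpM2l // ltW.
    lra_local.
  have h3 : 1 - z N <= 2 * (nu / (8 * K%:R)) by move: zN1; rewrite /zs e; lra_local.
  have : K%:R * (1 - z N) <= K%:R * (2 * (nu / (8 * K%:R))) by rewrite ler_wpM2l.
  have -> : K%:R * (2 * (nu / (8 * K%:R))) = nu / 4 by field; rewrite gt_eqF //; lra_local.
  by [].
have z01 : z0 < 1 by rewrite /z0; lra_local.
have NnR : N%:R <= c1 * n by move: NT; rewrite -(ler_nat R) -natr1; lra_local.
have Nn : (N <= #|V|)%N.
  rewrite -(ler_nat R); apply: le_trans NnR _.
  by rewrite -[leRHS]mul1r ler_wpM2r // ?(ltW n0) // ltW.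
have cheb : EL (pairs V) N (fun l => (~~ (n * (nu / 2) <= SS (Efold (@eq_op V) l) (z N)))%:R : R) <= eps / 2.
  have hsq := @iter_sq R V n2 z0 C N z00' z01 C1 zNlt zNC N (leqnn N).
  apply: le_trans (_ : (4 / nu ^+ 2) * EL (pairs V) N
     (fun l => (SS (Efold (@eq_op V) l) (z N) / n - (1 - z0)) ^+ 2) <= _).
    rewrite -ELZ; apply: ler_EL => l _.
    set S := SS _ _; rewrite g0E; have [h|h] := boolP (n * (nu / 2) <= S) => /=.
      by rewrite mulr_ge0 ?sqr_ge0 // divr_ge0 ?sqr_ge0.
    rewrite -ltNge in h.
    have h2 : S / n < nu / 2 by rewrite ltr_pdivrMr // mulrC.
    have h3 : (nu / 2) ^+ 2 <= (S / n - nu) ^+ 2.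
      rewrite -[leRHS]real_normK ?num_real // lerXn2r ?nnegrE //; first lra_local.
      by rewrite ler0_norm; lra_local.
    apply: le_trans (_ : 4 / nu ^+ 2 * (nu / 2) ^+ 2 <= _).
      rewrite le_eqVlt; apply/orP; left; apply/eqP; field; by rewrite gt_eqF.
    by rewrite ler_wpM2l // divr_ge0 // exprn_ge0 // ltW.
  apply: le_trans (_ : (4 / nu ^+ 2) * (20 * C / n * 4 ^+ M) <= _).
    rewrite ler_wpM2l ?divr_ge0 ?exprn_ge0 ?(ltW nu0) //.
    apply: le_trans hsq _; rewrite ler_wpM2l //.
      by apply: divr_ge0; [apply: mulr_ge0 | apply: ltW].
    apply: le_trans (_ : (1 + 4 * C / n) ^+ N <= _); first by lra_local.
    have x1 : 1 <= 1 + 4 * C / n by rewrite lerDl; apply: divr_ge0; [apply: mulr_ge0 | apply: ltW].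
    apply: le_trans (ler_weXn2l x1 Nn) _.
    by apply: euler_bound_mul => //; [apply: ltnW | rewrite mulr_ge0].
  have -> : 4 / nu ^+ 2 * (20 * C / n * 4 ^+ M) = (20 * C * 4 ^+ M * (4 / nu ^+ 2)) / n.
    by move: (4 ^+ M) => PM; field; rewrite !gt_eqF.
  rewrite ler_pdivrMr // [leRHS]mulrAC ler_pdivlMr //.
  move: q1le; rewrite mulrA ler_pdivrMr // => h.
  by apply: le_trans h _; rewrite [leRHS]mulrC ler_wpM2r // ltW.
have Nt : (N <= t)%N.
  rewrite -(ler_nat R); apply: le_trans NnR _; apply: le_trans ct.
  by rewrite ler_wpM2r // ltW // ltW.
pose s := (t - N)%N.
have sE : t = (N + s)%N by rewrite subnKC.
have sR : (c - c1) * n <= s%:R by rewrite /s natrB //; lra_local.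
have [h hle hge] : exists2 h : nat, h%:R <= nu * n / 16 & nu * n / 16 - 1 <= h%:R.
  have p0 : 0 <= nu * n / 16 by rewrite divr_ge0 // mulr_ge0 // ltW.
  exists (Num.truncn (nu * n / 16)).
    by case/andP: (Num.Theory.truncn_itv p0).
  by rewrite lerBlDr natr1 ltW //; case/andP: (Num.Theory.truncn_itv p0).
have nun : 32 <= nu * n.
  by move: q2le; rewrite ler_pdivrMr // => /le_trans; apply; rewrite mulrC ler_wpM2l // ltW.
have nunn : nu * n <= n by rewrite ler_piMl ?(ltW n0) //; lra_local.
rewrite sE EL_cat.
apply: le_trans (_ : EL (pairs V) N (fun l =>
  (~~ (n * (nu / 2) <= SS (Efold (@eq_op V) l) (z N)))%:R + eps / 2) <= _); last first.
  by rewrite ELD EL_cst ?pairs_neq0 //; lra_local.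
apply: ler_EL => l _; set E := Efold (@eq_op V) l.
have vE : eqv E by apply/eqv_Efold/eq_op_eqv.
have [SE|SE] := boolP (n * (nu / 2) <= SS E (z N)); last first.
  apply: le_trans (_ : 1 <= _); last by rewrite lerDl divr_ge0 // ltW.
  by apply: EL_le_cst => // l2 _; case: (~~ _).
rewrite add0r.
have z01N : 0 <= z N <= 1 by rewrite zN0 ltW.
have frac := large_fraction z01N KzN SE.
have hn : (h <= #|V|)%N by rewrite -(ler_nat R); apply: le_trans hle _; rewrite -/n; lra_local.
have Lh : #|V|%:R ^+ 2 <= L%:R * h%:R ^+ 2 :> R.
  have h1 : nu * n / 32 <= h%:R by lra_local.
  have h2 : (nu * n / 32) ^+ 2 <= h%:R ^+ 2.
    by apply: lerXn2r => //; rewrite nnegrE; lra_local.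
  apply: le_trans (_ : (32 / nu) ^+ 2 * (nu * n / 32) ^+ 2 <= _).
    rewrite le_eqVlt; apply/orP; left; apply/eqP; rewrite -/n; field; by rewrite gt_eqF.
  by apply: ler_pM => //; rewrite exprn_ge0 // ?divr_ge0 ?mulr_ge0 // ltW.
have aB : (#|V| %/ K + B <= s %/ L)%N.
  have h1 : (#|V| %/ K)%:R <= n / K%:R.
    rewrite ler_pdivlMr; last by lra_local.
    by rewrite -natrM ler_nat leq_trunc_div.
  have h2 : s%:R / L%:R <= (s %/ L)%:R + 1 :> R.
    by rewrite ler_pdivrMr // natr1 -natrM ler_nat ltnW // ltn_ceil.
  have h3 : n / K%:R <= (c - c1) * n / (4 * L%:R).
    rewrite ler_pdivrMr; last by lra_local.
    rewrite mulrAC ler_pdivlMr ?mulr_gt0 //.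
    move: Kle; rewrite ler_pdivrMr // => hK.
    have := ler_wpM2l (ltW n0) hK; lra_local.
  have h4 : (c - c1) * n / L%:R <= s%:R / L%:R by rewrite ler_wpM2r // invr_ge0.
  have h5 : (c - c1) * n / (4 * L%:R) = ((c - c1) * n / L%:R) / 4 by field; rewrite gt_eqF.
  have h6 : (B%:R + 1) * 2 <= (c - c1) * n / L%:R.
    rewrite ler_pdivlMr //; have := le_trans q3le nq3.
    have -> : (B%:R + 1) * L%:R / (c - c1) * 2 = (B%:R + 1) * 2 * L%:R / (c - c1) by ring.
    by rewrite ler_pdivrMr // [n * _]mulrC.
  have B0 : 0 <= B%:R :> R by [].
  by rewrite -(ler_nat R) natrD; lra_local.
apply: le_trans (_ : (B.+1%:R)^-1 <= _); last first.
  rewrite -[leRHS]invrK lef_pV2 ?posrE ?invr_gt0 ?divr_gt0 // ?ltr0n //.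
  by rewrite invf_div; apply: le_trans Ble _; rewrite ler_nat.
apply: le_trans (sprinkling_small vE K0 n2 hn L0 Lh aB).
apply: ler_EL => l2 _; rewrite -Efold_cat.
set Z := [set a | _] in frac *.
case: (boolP [exists a, (#|Z| <= _)%N]) => [/existsP[a aZ]|_] /=; last by case: (~~ _).
suff -> : [exists a, nu / 16 * #|V|%:R <= #|cls (Efold eq_op (l ++ l2)) a|%:R] by [].
apply/existsP; exists a; rewrite -/n.
have h1 : #|cls (Efold eq_op (l ++ l2)) a :&: Z|%:R <= #|cls (Efold eq_op (l ++ l2)) a|%:R :> R.
  by rewrite ler_nat subset_leq_card // subsetIl.
have h2 : #|Z|%:R <= #|cls (Efold eq_op (l ++ l2)) a :&: Z|%:R + 2 * h%:R :> R.
  by rewrite -natrM -natrD ler_nat mul2n.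
lra_local.
Qed.

(** * The last window *)

Lemma sum_avg (R : realFieldType) (T : finType) (A : {set T}) (F : T -> R) :
  \sum_(x in A) F x = #|A|%:R * avg A F.
Proof.
have [->|A0] := eqVneq A set0; first by rewrite big_set0 cards0 mul0r.
by rewrite /avg mulrC divfK // pnatr_eq0 cards_eq0.
Qed.

Lemma avg_sub_close (R : realFieldType) (T : finType) (A A' : {set T}) (F : T -> R) :
  A' \subset A -> A' != set0 -> (forall x, x \in A -> `|F x| <= 1) ->
  `|avg A F - avg A' F| <= 2 * #|A :\: A'|%:R / #|A|%:R.
Proof.
move=> sA A'0 F1.
have a0 : 0 < #|A|%:R :> R.
  rewrite ltr0n card_gt0; apply: contra_neq A'0 => A0.
  by apply/eqP; rewrite -subset0 -A0.
have e : #|A|%:R * avg A F = #|A'|%:R * avg A' F + \sum_(x in A :\: A') F x.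
  by rewrite -!sum_avg (big_setID A') /= (setIidPr sA).
have c : #|A|%:R = #|A'|%:R + #|A :\: A'|%:R :> R.
  by rewrite -natrD (cardsD A A') (setIidPr sA) subnKC // subset_leq_card.
rewrite -(ler_pM2r a0) divfK ?gt_eqF //.
rewrite -[X in _ * X](ger0_norm (ltW a0)) -normrM.
have -> : (avg A F - avg A' F) * #|A|%:R =
    \sum_(x in A :\: A') F x - #|A :\: A'|%:R * avg A' F.
  by rewrite mulrBl mulrC e c; ring.
apply: le_trans (ler_normB _ _) _; rewrite (_ : 2 * _ = #|A :\: A'|%:R + #|A :\: A'|%:R); last (by ring); apply: lerD.
  apply: le_trans (ler_norm_sum _ _ _) _; rewrite -sum1_card natr_sum.
  by apply: ler_sum => x /setDP[xA _]; apply: F1.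
rewrite normrM normr_nat ler_piMr //.
apply: le_trans (avg_norm _ _) _; apply: avg_le_cst => // x xA.
by apply: F1; apply: (subsetP sA).
Qed.

Section Resample.
Variables (R : realFieldType) (V : finType).
Implicit Types (A D : {set V}) (l : seq (V * V)) (h : {perm V} -> R).

Definition inner A : {set V * V} := [set p in pairs V | (p.1 \in A) && (p.2 \in A)].

Lemma sum_inner A (G : V * V -> R) : \sum_(p in inner A) G p =
  \sum_(x in A) \sum_(y in A :\ x) G (x, y).
Proof.
rewrite pair_big_dep /=; apply: eq_big => [[x y]|[x y] _] //=.
by rewrite !inE /= eq_sym; case: (x \in A); rewrite ?andbF ?andbT.
Qed.

Lemma card_inner A : #|inner A|%:R = #|A|%:R * #|A|.-1%:R :> R.
Proof.
rewrite -sum1_card natr_sum sum_inner (eq_bigr (fun=> #|A|.-1%:R)) => [|x xA].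
  by rewrite sumr_const mulr_natl.
rewrite (_ : #|A|.-1 = #|A :\ x|); first by rewrite -sum1_card natr_sum.
by rewrite (cardsD1 x A) xA.
Qed.

Lemma avg_inner A (F : V * V -> R) :
  avg (inner A) F = avg A (fun x => avg (A :\ x) (fun y => F (x, y))).
Proof.
rewrite /avg sum_inner card_inner invfM mulrA mulrAC; congr (_ * _).
rewrite mulr_suml; apply: eq_bigr => x xA; congr (_ / _%:R).
by rewrite (cardsD1 x A) xA.
Qed.

(** Redraws every pair of [l] lying inside [A] and keeps the others. The inner pairs thus become
    fresh randomness, while the outer ones, which may damage long cycles, stay fixed with [l]. *)
Fixpoint MX A l h : R :=
  if l is p :: l' then
    if p \in inner A then avg (inner A) (fun q => MX A l' (fun m => h (tperm q.1 q.2 * m)%g))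
    else MX A l' (fun m => h (tperm p.1 p.2 * m)%g)
  else h 1%g.

(** Given which positions hold inner pairs and the values of the outer pairs, the inner pairs are
    independent and uniform on [inner A]. *)
Lemma EL_MX A s h :
  EL (pairs V) s (fun l => h (prodl l)) = EL (pairs V) s (fun l => MX A l h).
Proof.
elim: s h => [|s IH] h /=; first by rewrite /prodl big_nil.
pose G p := EL (pairs V) s (fun l => MX A l (fun m => h (tperm p.1 p.2 * m)%g)).
transitivity (avg (pairs V) G).
  by apply: eq_avg => p _; rewrite /G -IH; apply: eq_EL => l _; rewrite prodl_cons.
transitivity (avg (pairs V) (fun p => if p \in inner A then avg (inner A) G else G p)).
  congr (_ / _); rewrite (big_setID (inner A)) [RHS](big_setID (inner A)) /=.
  have -> : pairs V :&: inner A = inner A.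
    by apply/setIidPr/subsetP => p; rewrite inE => /andP[].
  congr (_ + _); last first.
    by apply: eq_bigr => p /setDP[_ /negPf->].
  rewrite [RHS](eq_bigr (fun=> avg (inner A) G)) => [|p ->] //.
  by rewrite sum_avg sumr_const mulr_natl.
apply: eq_avg => p _; case: (p \in inner A) => //.
exact: esym (EL_avg (pairs V) (inner A) s
  (fun q l => MX A l (fun m => h (tperm q.1 q.2 * m)%g))).
Qed.

Lemma MX_bound A l h : (forall m, `|h m| <= 1) -> `|MX A l h| <= 1.
Proof.
elim: l h => [|p l IH] h h1 //=; case: ifP => _; last by apply: IH.
apply: le_trans (avg_norm _ _) _; apply: avg_le_cst => // q _.
by apply: IH.
Qed.

Definition outer A l := [seq p <- l | p \notin inner A].

Definition touched l : {set V} := [set a | has (fun p => (p.1 == a) || (p.2 == a)) l].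

Lemma touched_cons p l : touched (p :: l) = p.1 |: (p.2 |: touched l).
Proof. by apply/setP => a; rewrite !inE /= ![a == _]eq_sym orbA. Qed.

Lemma card_touched l : (#|touched l| <= (size l).*2)%N.
Proof.
elim: l => [|p l IH].
  by rewrite leqn0 cards_eq0; apply/eqP/setP => a; rewrite !inE.
rewrite touched_cons doubleS; apply: leq_trans (leq_card_setU _ _).1 _.
rewrite cards1 add1n ltnS; apply: leq_trans (leq_card_setU _ _).1 _.
by rewrite cards1 add1n ltnS.
Qed.

Lemma prodl_comm x y l : x \notin touched l -> y \notin touched l ->
  (tperm x y * prodl l)%g = (prodl l * tperm x y)%g.
Proof.
elim: l => [|p l IH]; first by rewrite /prodl big_nil mulg1 mul1g.
rewrite touched_cons !in_setU1 !negb_or => /and3P[x1 x2 xl] /and3P[y1 y2 yl].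
by rewrite prodl_cons mulgA tperm_disj_comm // -!mulgA IH.
Qed.

Lemma avg2_close A D (F : V -> V -> R) (d : nat) :
  (#|D| <= d)%N -> (d.+2 <= #|A|)%N -> (forall x y, `|F x y| <= 1) ->
  `|avg A (fun x => avg (A :\ x) (F x)) -
    avg (A :\: D) (fun x => avg (A :\: D :\ x) (F x))| <= 4 * d%:R / #|A|.-1%:R.
Proof.
move=> Dd dA F1.
have a1 : 0 < #|A|.-1%:R :> R by rewrite ltr0n -ltnS prednK; apply: leq_trans dA.
have aa : #|A|.-1%:R <= #|A|%:R :> R by rewrite ler_nat leq_pred.
have cD : (#|A :\: (A :\: D)| <= d)%N.
  by apply: leq_trans Dd; rewrite subset_leq_card // setDDr setDv set0U subsetIr.
have cA' : (2 <= #|A :\: D|)%N.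
  rewrite cardsD; have : (#|A :&: D| <= d)%N by apply: leq_trans Dd; rewrite subset_leq_card // subsetIr.
  by clear -dA; lia.
have avg1 (B : {set V}) x : `|avg B (F x)| <= 1.
  by apply: le_trans (avg_norm _ _) _; apply: avg_le_cst => // y _.
apply: le_trans (ler_distD (avg (A :\: D) (fun x => avg (A :\ x) (F x))) _ _) _.
apply: le_trans (_ : 2 * d%:R / #|A|.-1%:R + 2 * d%:R / #|A|.-1%:R <= _); last by lra.
apply: lerD.
  apply: le_trans (avg_sub_close _ _ _) _ => //; first exact: subsetDl.
    by rewrite -card_gt0; apply: leq_trans cA'.
  rewrite ler_pM // ?invr_ge0 ?mulr_ge0 //; first by rewrite ler_pM2l // ler_nat.
  by rewrite lef_pV2 ?posrE //; apply: lt_le_trans aa.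
rewrite -avgB; apply: le_trans (avg_norm _ _) _; apply: avg_le_cst => [|x xA].
  by rewrite divr_ge0 // mulr_ge0.
have cx : #|A :\ x| = #|A|.-1 by rewrite (cardsD1 x A); case/setDP: xA => ->.
apply: le_trans (avg_sub_close _ _ _) _ => //.
- by apply: setSD; apply: subsetDl.
- by rewrite -card_gt0 -ltnS (cardsD1 x (A :\: D)) xA in cA' *.
rewrite cx ler_wpM2r ?invr_ge0 // ler_pM2l // ler_nat.
apply: leq_trans cD; apply: subset_leq_card; apply/subsetP => y.
by rewrite !inE; case: (y == x).
Qed.

(** A redrawn pair avoids the vertices already used except with probability of order [d / #|A|]. It
    then commutes with the outer transpositions, which can be moved in front. [D] collects the used
    vertices, two more for each pair, within the budget [d]. *)
Lemma MX_close A D l h (d : nat) :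
  touched (outer A l) \subset D -> (#|D| + (size l).*2 <= d)%N -> (d.+2 <= #|A|)%N ->
  (forall m, `|h m| <= 1) ->
  `|MX A l h - IL (count (mem (inner A)) l) (A :\: D) (fun m => h (prodl (outer A l) * m)%g)|
  <= (size l)%:R * (4 * d%:R / #|A|.-1%:R).
Proof.
have e0 : 0 <= 4 * d%:R / #|A|.-1%:R :> R by rewrite divr_ge0 // mulr_ge0.
move=> + + dA; elim: l D h => [|p l IH] D h tD Dd h1 /=.
  by rewrite /prodl big_nil mul1g subrr normr0 mul0r.
rewrite doubleS !addnS in Dd.
rewrite /outer /= in tD *; move: tD; case: (boolP (p \in inner A)) => pA tD /=; last first.
  rewrite -natr1 mulrDl mul1r; apply: ler_wpDr => //.
  rewrite ?add0n (@eq_IL _ _ _ _ _ (fun m => h (tperm p.1 p.2 * (prodl (outer A l) * m))%g)); last first.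
    by move=> m _; rewrite prodl_cons mulgA.
  apply: (IH D (fun m => h (tperm p.1 p.2 * m)%g)) => //.
    by apply: subset_trans tD; rewrite touched_cons setUA subsetUr.
  by apply: leq_trans Dd; rewrite leqW.
rewrite -natr1 mulrDl mul1r ?add1n /= avg_inner.
pose A' := A :\: D.
pose G x y := MX A l (fun m => h (tperm x y * m)%g).
apply: le_trans (ler_distD (avg A' (fun x => avg (A' :\ x) (G x))) _ _) _.
rewrite addrC; apply: lerD.
  rewrite -avgB; apply: le_trans (avg_norm _ _) _; apply: avg_le_cst => [|x xA].
    by rewrite mulr_ge0.
  rewrite -avgB; apply: le_trans (avg_norm _ _) _; apply: avg_le_cst => [|y yA].
    by rewrite mulr_ge0.
  have -> : A' :\ x :\ y = A :\: (x |: (y |: D)).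
    by apply/setP => z; rewrite !inE !negb_or; case: (z == x); case: (z == y); rewrite ?andbF.
  have xD : x \notin touched (outer A l).
    by move: xA; rewrite in_setD => /andP[xD _]; apply: contra xD; apply: (subsetP tD).
  have yD : y \notin touched (outer A l).
    by move: yA; rewrite in_setD1 in_setD => /and3P[_ yD _]; apply: contra yD; apply: (subsetP tD).
  rewrite (@eq_IL _ _ _ _ _ (fun m => h (tperm x y * (prodl (outer A l) * m))%g)); last first.
    by move=> m _; rewrite !mulgA prodl_comm.
  apply: (IH (x |: (y |: D)) (fun m => h (tperm x y * m)%g)) => //.
    by apply: subset_trans tD _; rewrite setUA subsetUr.
  apply: leq_trans (Dd); rewrite -2!addSn leq_add2r.
  apply: leq_trans (leq_card_setU _ _).1 _; rewrite cards1 add1n ltnS.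
  by apply: leq_trans (leq_card_setU _ _).1 _; rewrite cards1 add1n.
apply: avg2_close => // [|x y].
  by apply: leq_trans Dd; rewrite -addnS -addnS leq_addr.
by apply: MX_bound.
Qed.

Definition ksub A k : {set {set V}} := [set Q : {set V} | (Q \subset A) && (#|Q| == k)].

(** Double counting of the sets of size [k + 1] with a distinguished element; the normalizations
    agree by [mul_bin_diag]. *)
Lemma subset_step A k (F : V -> {set V} -> R) : (k < #|A|)%N ->
  avg (ksub A k.+1) (fun Q => avg Q (fun x => F x (Q :\ x))) =
  avg A (fun x => avg (ksub (A :\ x) k) (F x)).
Proof.
move=> kA.
pose S := \sum_(x in A) \sum_(Q in ksub (A :\ x) k) F x Q.
transitivity (S / (k.+1%:R * 'C(#|A|, k.+1)%:R)).
  rewrite /avg cards_draws invfM mulrA; congr (_ / _).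
  rewrite (eq_bigr (fun Q : {set V} => (\sum_(x in Q) F x (Q :\ x)) / k.+1%:R)); last first.
    by move=> Q; rewrite inE => /andP[_ /eqP->].
  rewrite -mulr_suml; congr (_ / _).
  rewrite (exchange_big_dep (mem A)) /=; last first.
    by move=> Q x; rewrite inE => /andP[/subsetP QA _]; apply: QA.
  apply: eq_bigr => x xA.
  rewrite (reindex_onto (fun Q : {set V} => x |: Q) (fun Q : {set V} => Q :\ x)) /=; last first.
    by move=> Q /andP[_ xQ]; rewrite setD1K.
  apply: eq_big => [Q|Q /andP[_ /eqP->]] //.
  rewrite !inE eqxx andbT subUset sub1set xA /=.
  have [xQ|xQ] := boolP (x \in Q).
    rewrite [RHS](_ : _ = false); last first.
      apply/negbTE; rewrite negb_and; apply/orP; left; apply/subsetPn; exists x => //.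
      by rewrite !inE eqxx.
    apply/negbTE; rewrite negb_and orbC; apply/orP; left; apply/eqP => /setP/(_ x).
    by rewrite !inE eqxx xQ.
  rewrite setU1K // eqxx andbT cardsU1 xQ add1n eqSS subsetD1 xQ andbT //.
transitivity (S / (#|A|%:R * 'C(#|A|.-1, k)%:R)).
  by rewrite -!natrM -mul_bin_diag.
rewrite /S /avg invfM mulrA mulrAC mulr_suml; congr (_ / _).
apply: eq_bigr => x xA; rewrite cards_draws; congr (_ / _).
by rewrite (cardsD1 x A) xA.
Qed.

Lemma IL_subsets j A h : (j.*2 <= #|A|)%N ->
  IL j A h = avg (ksub A j.*2) (fun Q => IL j Q h).
Proof.
elim: j A h => [|j IH] A h jA /=.
  rewrite avg_cst // -card_gt0 cards_draws bin0 //.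
rewrite doubleS in jA *.
rewrite (subset_step (fun x Q => avg Q (fun y => IL j (Q :\ y) (fun m => h (tperm x y * m)%g)))) //.
apply: eq_avg => x xA.
have cx : #|A :\ x| = #|A|.-1 by rewrite (cardsD1 x A) xA.
rewrite (subset_step (fun y Q => IL j Q (fun m => h (tperm x y * m)%g))); last first.
  by rewrite cx -ltnS prednK //; apply: leq_trans jA.
apply: eq_avg => y yA; apply: IH.
have := cardsD1 y (A :\ x); rewrite yA cx => e; clear -e jA; lia.
Qed.

(** Sampling without replacement, since the roots of a [valid] state are distinct. *)
Fixpoint EI A m (F : seq V -> R) : R :=
  if m is m'.+1 then avg A (fun x => EI (A :\ x) m' (fun w => F (x :: w))) else F [::].

Lemma eq_EI A m F G : F =1 G -> EI A m F = EI A m G.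
Proof.
elim: m A F G => [|m IH] A F G FG //=; apply: eq_avg => x _.
by apply: IH => w; apply: FG.
Qed.

(** Drawing the sample first and the matched set next, or their union first and the sample inside
    it, gives the same law. In the second order the short loops depend on the union only. *)
Lemma EI_ksub A m k (F : seq V -> {set V} -> R) : (m + k <= #|A|)%N ->
  EI A m (fun w => avg (ksub (A :\: [set x in w]) k) (F w)) =
  avg (ksub A (m + k)) (fun Q => EI Q m (fun w => F w (Q :\: [set x in w]))).
Proof.
have nilE B : B :\: [set x in [::]] = B by apply/setP => x; rewrite !inE in_nil.
have consE B x w : B :\: [set y in x :: w] = B :\ x :\: [set y in w].
  by apply/setP => y; rewrite !inE negb_or; case: (y == x); rewrite ?andbF ?andbT.
elim: m A F => [|m IH] A F mA /=.
  by rewrite nilE; apply: eq_avg => Q _; rewrite nilE.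
rewrite addSn in mA *.
transitivity (avg A (fun x => avg (ksub (A :\ x) (m + k)) (fun Q => EI Q m (fun w => F (x :: w) (Q :\: [set y in w]))))).
  apply: eq_avg => x xA; rewrite -(IH (A :\ x) (fun w => F (x :: w))); last first.
    by have := cardsD1 x A; rewrite xA add1n => e; rewrite e ltnS in mA.
  by apply: eq_EI => w; rewrite consE.
rewrite -(subset_step (fun x Q => EI Q m (fun w => F (x :: w) (Q :\: [set y in w])))) //.
apply: eq_avg => Q _; apply: eq_avg => x _.
by apply: eq_EI => w; rewrite consE.
Qed.

End Resample.

Section EIfacts.
Variables (R : realFieldType) (V : finType).
Implicit Types (A D : {set V}) (F G : seq V -> R).

Definition ulist A m : pred (seq V) := fun w => [&& size w == m, uniq w & all (mem A) w].

Lemma ler_EI A m F G : (forall w, ulist A m w -> F w <= G w) -> EI A m F <= EI A m G.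
Proof.
elim: m A F G => [|m IH] A F G FG /=; first exact: FG.
apply: ler_avg => x xA; apply: IH => w /and3P[sw uw aw]; apply: FG.
have aw' y : y \in w -> (y != x) && (y \in A) by move/(allP aw); rewrite /= !inE.
rewrite /ulist /= eqSS sw uw andbT xA /=; apply/andP; split.
  by apply/negP => /aw'; rewrite eqxx.
by apply/allP => y /aw'/andP[].
Qed.

Lemma EID A m F G : EI A m (fun w => F w + G w) = EI A m F + EI A m G.
Proof.
elim: m A F G => [|m IH] A F G //=; rewrite -avgD.
by apply: eq_avg => x _; rewrite IH.
Qed.

Lemma EIZ A m c F : EI A m (fun w => c * F w) = c * EI A m F.
Proof.
elim: m A F => [|m IH] A F //=; rewrite -avgZ.
by apply: eq_avg => x _; rewrite IH.
Qed.

Lemma EIB A m F G : EI A m (fun w => F w - G w) = EI A m F - EI A m G.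
Proof.
elim: m A F G => [|m IH] A F G //=; rewrite -avgB.
by apply: eq_avg => x _; rewrite IH.
Qed.

Lemma EI_cst A m (c : R) : (m <= #|A|)%N -> EI A m (fun=> c) = c.
Proof.
elim: m A => [|m IH] A mA //=.
rewrite (@eq_avg _ _ _ _ (fun=> c)) => [|x xA].
  by rewrite avg_cst // -card_gt0; apply: leq_trans mA.
by apply: IH; have := cardsD1 x A; rewrite xA => e; rewrite e ltnS in mA.
Qed.

Lemma EI_norm A m F : `|EI A m F| <= EI A m (fun w => `|F w|).
Proof.
elim: m A F => [|m IH] A F //=; apply: le_trans (avg_norm _ _) _.
by apply: ler_avg => x _; apply: IH.
Qed.

Lemma EL_EI_close A D m F (d : nat) :
  (#|D| + m <= d)%N -> (d < #|A|)%N -> (forall w, `|F w| <= 1) ->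
  `|EL A m F - EI (A :\: D) m F| <= m%:R * (2 * d%:R / #|A|%:R).
Proof.
move=> + dA; have e0 : 0 <= 2 * d%:R / #|A|%:R :> R by rewrite divr_ge0 // mulr_ge0.
elim: m D F => [|m IH] D F Dd F1 /=; first by rewrite subrr normr0 mul0r.
have dD : (#|D| <= d)%N by apply: leq_trans Dd; rewrite leq_addr.
rewrite -natr1 mulrDl mul1r.
apply: le_trans (ler_distD (avg (A :\: D) (fun x => EL A m (fun w => F (x :: w)))) _ _) _.
rewrite addrC; apply: lerD; last first.
  apply: le_trans (avg_sub_close _ _ _) _; first exact: subsetDl.
  - rewrite -card_gt0 cardsD subn_gt0; apply: leq_ltn_trans dA.
    by apply: leq_trans dD; rewrite subset_leq_card // subsetIr.
  - by move=> x _; apply: le_trans (EL_norm _ _ _) _; apply: EL_le_cst.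
  rewrite ler_wpM2r ?invr_ge0 // ler_pM2l // ler_nat.
  by apply: leq_trans dD; rewrite subset_leq_card // setDDr setDv set0U subsetIr.
rewrite -avgB; apply: le_trans (avg_norm _ _) _; apply: avg_le_cst => [|x xA].
  by rewrite mulr_ge0.
have -> : A :\: D :\ x = A :\: (x |: D).
  by apply/setP => z; rewrite !inE negb_or andbA.
apply: IH => //; rewrite addnS -addSn in Dd; apply: leq_trans Dd.
rewrite leq_add2r; apply: leq_trans (leq_card_setU _ _).1 _.
by rewrite cards1 add1n.
Qed.

End EIfacts.

(** * First-return permutations and random roots *)

Section Reduce.
Variable V : finType.
Implicit Types (s m : {perm V}) (X : {set V}) (l : seq V).

(** The first-return map of [s] on [X], obtained by bypassing all other points. By [orb_red],
    composing it with a matching supported in [X] gives the same cycles on [X] as composing [s]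
    itself. *)
Definition red s X : {perm V} := foldl (@byp V) s (enum (~: X)).

Lemma foldl_byp_porbit s l z : z \notin l ->
  porbit (foldl (@byp V) s l) z = porbit s z :\: [set a in l].
Proof.
elim: l s => [|a l IH] s /=.
  by move=> _; apply/setP => y; rewrite !inE.
rewrite inE negb_or => /andP[za zl]; rewrite IH // porbit_byp //.
by apply/setP => y; rewrite !inE negb_or andbA [_ && (y \notin l)]andbC.
Qed.

Lemma foldl_byp_mulr s m l : {in l, forall a, m a = a} ->
  foldl (@byp V) (s * m)%g l = (foldl (@byp V) s l * m)%g.
Proof.
elim: l s => [|a l IH] s //= ma; rewrite byp_mulr; last by apply: ma; rewrite inE eqxx.
by rewrite IH // => b bl; apply: ma; rewrite inE bl orbT.
Qed.

Lemma porbit_red s X z : z \in X -> porbit (red s X) z = porbit s z :&: X.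
Proof.
move=> zX; rewrite foldl_byp_porbit ?mem_enum ?inE ?zX //.
by apply/setP => y; rewrite !inE mem_enum inE negbK andbC.
Qed.

Lemma red_closed s X z : z \in X -> red s X z \in X.
Proof.
move=> zX; have : red s X z \in porbit (red s X) z by rewrite mem_porbit_step porbit_id.
by rewrite porbit_red // inE => /andP[].
Qed.

Lemma orb_red s m X a b : perm_on X m -> a \in X -> b \in X ->
  orb (red s X * m)%g a b = orb (s * m)%g a b.
Proof.
move=> mX aX bX; rewrite /orb /red -foldl_byp_mulr.
  by rewrite -/(red _ _) porbit_red // inE bX andbT.
move=> c; rewrite mem_enum inE => cX; exact: (out_perm mX).
Qed.

Definition loop2 s X : {set V} := [set q in X | red s X (red s X q) == q].

Lemma loop2_card s X q : q \in loop2 s X -> (#|porbit s q :&: X| <= 2)%N.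
Proof.
rewrite inE => /andP[qX /eqP e]; rewrite -porbit_red //.
rewrite (@porbit_period _ _ _ 2) //; last by rewrite permX /= e.
by rewrite cardsE; apply: leq_trans (card_size _) _; rewrite size_traject.
Qed.

Definition ones l : seq (V * nat) := [seq (x, 1%N) | x <- l].

Lemma unzip1_ones l : unzip1 (ones l) = l.
Proof. by rewrite /unzip1 -map_comp map_id. Qed.

Lemma unzip2_ones l : unzip2 (ones l) = nseq (size l) 1%N.
Proof. by elim: l => //= a l ->. Qed.

(** A new root conflicts with the set [D] of earlier ones when [r] maps it to itself or joins it
    directly, in either direction, to one of them; the initial state would then fail to be
    [valid]. *)
Definition conf (r : {perm V}) (D : {set V}) (x : V) : bool :=
  [|| r x == x, r x \in D | x \in r @: D].

Fixpoint confl (r : {perm V}) (D : {set V}) l : bool :=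
  if l is x :: l' then conf r D x || confl r (x |: D) l' else false.

Lemma conflP r D l : uniq l -> ~~ confl r D l ->
  forall x y, x \in l -> (y \in D) || (y \in l) -> (r x != y) && (r y != x).
Proof.
elim: l D => [|a l IH] D //= /andP[al ul]; rewrite negb_or => /andP[ca cl] x y.
have {}IH := IH _ ul cl.
move: ca; rewrite /conf !negb_or => /and3P[aa aD Da].
have ca z : (z \in D) || (z == a) -> (r a != z) && (r z != a).
  case/orP => [zD|/eqP->]; last by rewrite aa.
  by apply/andP; split; [apply: contra aD => /eqP-> | apply: contra Da => /eqP<-; apply: imset_f].
rewrite !inE; have [->|xa] := eqVneq x a => /=.
  move=> _; case/or3P => [yD|ya|yl]; [by rewrite ca ?yD|by rewrite ca ?ya ?orbT|].
  by rewrite andbC; apply: IH => //; rewrite !inE eqxx.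
by move=> xl yy; apply: IH => //; rewrite !inE; case/or3P: yy => ->; rewrite ?orbT.
Qed.

Lemma EI_confl (R : realFieldType) (r : {perm V}) (X D : {set V}) (k m f N : nat) :
  (#|[set x in X | r x == x]| <= f)%N -> (#|D| + m <= k)%N -> (N + m <= #|X|)%N -> (0 < N)%N ->
  EI X m (fun w => (confl r D w)%:R : R) <= m%:R * ((f + k.*2)%:R / N%:R).
Proof.
have e0 : 0 <= (f + k.*2)%:R / N%:R :> R by rewrite divr_ge0.
move=> + + + N0; elim: m X D => [|m IH] X D fX Dk NX /=; first by rewrite mul0r.
have X0 : (0 < #|X|)%N by apply: leq_trans NX; rewrite addnS.
rewrite -natr1 mulrDl mul1r.
apply: le_trans (_ : avg X (fun x => (conf r D x)%:R + m%:R * ((f + k.*2)%:R / N%:R)) <= _).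
  apply: ler_avg => x xX.
  have NX' : (N + m <= #|X :\ x|)%N.
    by have := cardsD1 x X; rewrite xX => e; rewrite e addnS ltnS in NX.
  apply: le_trans (_ : EI (X :\ x) m (fun w => (conf r D x)%:R + (confl r (x |: D) w)%:R) <= _).
    by apply: ler_EI => w _; rewrite -natrD ler_nat; case: (conf _ _ _); case: (confl _ _ _).
  rewrite EID EI_cst; last by apply: leq_trans NX'; rewrite leq_addl.
  rewrite lerD2l; apply: IH => //.
    apply: leq_trans fX; apply: subset_leq_card; apply/subsetP => y; rewrite !inE.
    by case/andP => /andP[_ ->] ->.
  rewrite addnS -addSn in Dk; apply: leq_trans Dk.
  by rewrite leq_add2r; apply: leq_trans (leq_card_setU _ _).1 _; rewrite cards1 add1n.
rewrite avgD avg_cst -?card_gt0 // addrC lerD2l.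
rewrite /avg ler_pM ?invr_ge0 ?sumr_ge0 //; last first.
  by rewrite lef_pV2 ?posrE ?ltr0n // ler_nat; apply: leq_trans NX; rewrite leq_addr.
rewrite -natr_sum ler_nat.
have -> : (\sum_(x in X) conf r D x = #|[set x in X | conf r D x]|)%N.
  rewrite -sum1_card [LHS]big_mkcond [RHS]big_mkcond /=; apply: eq_bigr => x _.
  by rewrite inE; case: (x \in X) => //=; case: (conf _ _ _).
apply: leq_trans (_ : #|[set x in X | r x == x] :|: ((r @^-1: D) :|: (r @: D))| <= _)%N.
  by apply: subset_leq_card; apply/subsetP => x; rewrite /conf !inE => /andP[->].
apply: leq_trans (leq_card_setU _ _).1 _; apply: leq_add => //.
apply: leq_trans (leq_card_setU _ _).1 _.
have dk : (#|D| <= k)%N by apply: leq_trans Dk; rewrite leq_addr.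
rewrite -addnn leq_add // ?card_imset ?(leq_trans _ dk) //; try exact: perm_inj.
by rewrite card_preimset //; exact: perm_inj.
Qed.

End Reduce.

Theorem reduced_matching (R : realType) (m : nat) (eps : R) : 0 < eps ->
  exists2 ph : R, 0 < ph & exists2 r1 : nat, (0 < r1)%N &
  forall (V : finType) (j : nat) (g : seq nat -> R) (s : {perm V}) (X : {set V}),
  (r1 <= j)%N -> (forall l, `|g l| <= 1) -> #|X| = (m + j.*2)%N ->
  `|EI X m (fun w => IL j (X :\: [set x in w])
        (fun mu => g (typ m (orb (s * mu)%g) (ones w)))) - Fel m g (nseq m 1%N)|
  <= eps + #|loop2 s X|%:R / (ph * j%:R).
Proof.
move=> eps0; have eps20 : 0 < eps / 2 by rewrite divr_gt0.
have [ph ph0 [r1 [r10 H]]] := matching_asymptotic m eps20.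
have [r2 r2le] := nat_above (4 * m%:R ^+ 2 / eps : R).
(* Absorbs the loss [2 f / (ph j)] of the walk together with the loss [m f / j] from roots fixed by
   the first-return map. *)
exists (2 / ph + m%:R)^-1; first by rewrite invr_gt0 ltr_pwDl // divr_gt0.
exists (r1 + r2)%N; first by rewrite addn_gt0 r10.
move=> V j g s X jr g1 cX.
have j1 : (r1 <= j)%N by apply: leq_trans jr; rewrite leq_addr.
have j2 : (r2 <= j)%N by apply: leq_trans jr; rewrite leq_addl.
have j0 : (0 < j)%N by apply: leq_trans j1.
have jR : 0 < j%:R :> R by rewrite ltr0n.
set f := #|loop2 s X|; set r := red s X.
have f0 : (#|[set x in X | r x == x]| <= f)%N.
  apply: subset_leq_card; apply/subsetP => x; rewrite !inE => /andP[-> /eqP e].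
  by rewrite -/r !e eqxx.
rewrite -(@EI_cst R V X m (Fel m g (nseq m 1%N))); last by rewrite cX leq_addr.
rewrite -EIB; apply: le_trans (EI_norm _ _ _) _.
apply: le_trans (_ : EI X m (fun w => (eps / 2 + 2 * f%:R / (ph * j%:R)) +
   2 * (confl r set0 w)%:R) <= _).
  apply: ler_EI => w /and3P[/eqP sw uw aw].
  have [cw|cw] := boolP (confl r set0 w).
    rewrite mulr1; apply: le_trans (_ : 1 + 1 <= _).
      apply: le_trans (ler_normB _ _) _; apply: lerD; last exact: Fel_bound.
      by apply: IL_bound.
    by rewrite (_ : 1 + 1 = 2) // lerDr addr_ge0 ?(ltW eps20) // divr_ge0 ?mulr_ge0 ?(ltW ph0) ?(ltW jR).
  rewrite mulr0 addr0.
  have wX x : x \in w -> x \in X by move/(allP aw).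
  have sw' : size (ones w) = m by rewrite size_map.
  have cQ : #|X :\: [set x in w]| = j.*2.
    rewrite cardsD; have -> : X :&: [set x in w] = [set x in w].
      by apply/setIidPr/subsetP => x; rewrite inE => /wX.
    have -> : #|[set x in w]| = m by rewrite cardsE -sw; apply/card_uniqP.
    by rewrite cX addnC addnK.
  have vW : valid r (X :\: [set x in w]) (ones w).
    rewrite /valid unzip1_ones; split=> // [x xw|x xw|q]; rewrite ?inE.
    - by rewrite xw.
    - rewrite red_closed ?wX // andbT; apply/negP => rw.
      have := conflP uw cw xw; move/(_ (r x)); rewrite rw orbT eqxx /=.
      by move=> /(_ isT).
    - case/andP => qw qX; rewrite red_closed // andbT.
      by case: (_ \in w); rewrite ?orbT.
  rewrite (@eq_IL _ _ _ _ _ (fun mu => g (typ (size (ones w)) (orb (r * mu)%g) (ones w)))); last first.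
    move=> mu muQ; rewrite sw'; congr g; apply: eq_typ => a b; rewrite unzip1_ones => aw' bw'.
    rewrite orb_red ?wX //; apply: subset_trans muQ _; exact: subsetDl.
  have -> : Fel m g (nseq m 1%N) = Fel (size (ones w)) g (unzip2 (ones w)).
    by rewrite unzip2_ones sw' sw.
  apply: le_trans (H _ _ _ _ _ _ j1 g1 _ cQ vW) _; first by rewrite sw'.
  rewrite lerD2l ler_wpM2r ?invr_ge0 ?mulr_ge0 ?(ltW ph0) ?(ltW jR) //.
  rewrite ler_pM2l // ler_nat; apply: subset_leq_card; apply/subsetP => q.
  by rewrite !inE => /and3P[/andP[_ ->] _ ->].
rewrite EID EI_cst; last by rewrite cX leq_addr.
rewrite EIZ.
have := @EI_confl V R r X set0 m m f j.*2 f0; rewrite cards0 add0n leqnn => /(_ isT).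
rewrite cX addnC leqnn double_gt0 => /(_ isT j0) h.
apply: le_trans (_ : eps / 2 + 2 * f%:R / (ph * j%:R) +
   2 * (m%:R * ((f + m.*2)%:R / j.*2%:R)) <= _); first by rewrite lerD2l ler_pM2l.
have -> : (j.*2)%:R = 2 * j%:R :> R by rewrite -mul2n natrM.
rewrite natrD -[m.*2]mul2n natrM.
have -> : eps / 2 + 2 * f%:R / (ph * j%:R) + 2 * (m%:R * ((f%:R + 2 * m%:R) / (2 * j%:R))) =
  eps / 2 + 2 * m%:R ^+ 2 / j%:R + f%:R / ((2 / ph + m%:R)^-1 * j%:R).
  field; rewrite !gt_eqF //=.
  by rewrite ltr_pwDl // mulr_ge0 // ltW.
rewrite lerD2r -lerBrDl (_ : eps - eps / 2 = eps / 2); last by field.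
rewrite ler_pdivrMr //; move: r2le; rewrite ler_pdivrMr // => h2.
have : r2%:R * eps <= j%:R * eps by rewrite ler_pM2r // ler_nat.
by clear -h2; lra.
Qed.

(** * Damage done to the long cycles by the outer transpositions *)

Section Bad.
Variable V : finType.
Implicit Types (s : {perm V}) (S Y A B X : {set V}) (l : seq (V * V)).

Lemma card_porbits s S : #|S| = (\sum_(C in porbits s) #|C :&: S|)%N.
Proof.
rewrite -sum1_card (partition_big (porbit s) (mem (porbits s))) /=; last first.
  by move=> x _; apply: imset_f.
apply: eq_bigr => C /imsetP[y _ ->]; rewrite -sum1_card; apply: eq_bigl => x.
by rewrite inE andbC eq_porbit_mem.
Qed.

Lemma card_by_porbit s S Y a b :
  (forall v, v \in S -> a * #|porbit s v :&: S| <= b * #|porbit s v :&: Y|)%N ->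
  (a * #|S| <= b * #|Y|)%N.
Proof.
move=> h; rewrite (card_porbits s S) (card_porbits s Y) !big_distrr /=.
apply: leq_sum => C /imsetP[y _ ->].
have [e|[v]] := set_0Vmem (porbit s y :&: S); first by rewrite e cards0 muln0.
by rewrite inE => /andP[vy vS]; have := h v vS; rewrite (porbit_memE vy).
Qed.

Section Det.
Variables (s : {perm V}) (K k0 : nat) (l : seq (V * V)).
Let A := [set v | K <= #|porbit s v|]%N.
Let l0 := outer A l.
Let s1 := (s * prodl l0)%g.
Let B := touched l0.
Let A' := A :\: B.

(** Vertices whose cycle, after the outer transpositions, keeps fewer than [K / 2] untouched long
    vertices. On any other cycle at most two points belong to [loop2], against [K / 2] points of
    [A'], whatever the subset [X] of [A'] is. *)
Definition badv : {set V} := [set v in A' | #|porbit s1 v :&: A'|.*2 < K]%N.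

(** What the outer transpositions can bring into the new cycle of a long vertex from outside [A']:
    touched vertices, and vertices of shorter [s]-cycles that contain a touched one. *)
Let Th := B :|: [set u in ~: A | [exists b in B, u \in porbit s b]].

Lemma prodl_untouched l' x : x \notin touched l' -> prodl l' x = x.
Proof.
elim: l' => [|p l' IH]; first by rewrite /prodl big_nil perm1.
rewrite touched_cons !in_setU1 !negb_or => /and3P[x1 x2 xl].
by rewrite prodl_cons permM tpermD ?IH // eq_sym.
Qed.

Lemma porbit_untouched u : (forall b, b \in B -> u \notin porbit s b) ->
  porbit s1 u = porbit s u.
Proof.
move=> nb.
have e i : (s1 ^+ i)%g u = (s ^+ i)%g u.
  elim: i => [|i IH]; first by rewrite !expg0.
  rewrite !expgSr !permM IH.
  apply: prodl_untouched; apply: contraT; rewrite negbK => tB.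
  have := nb _ tB; rewrite porbit_sym -permM -expgSr.
  by rewrite mem_porbit.
apply/setP => y; apply/porbitP/porbitP => -[i ->]; exists i; by rewrite e.
Qed.

Lemma outA_Th v u : v \in A -> u \in porbit s1 v -> u \notin A' -> u \in Th.
Proof.
move=> vA uv; rewrite !in_setD negb_and negbK => /orP[uB|uA]; first by rewrite in_setU uB.
rewrite in_setU; apply/orP; right; rewrite in_set in_setC uA /=.
apply: contraT => nB; have e : porbit s1 u = porbit s u.
  apply: porbit_untouched => b bB; apply: contra nB => ub.
  by apply/existsP; exists b; rewrite bB.
have vu : v \in porbit s u by rewrite -e porbit_sym.
by move: vA uA; rewrite !in_set (porbit_memE vu) => ->.
Qed.

(** A bad vertex either lies in a short new cycle inside a large class, which [EL_bad_vertices]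
    counts, or its new cycle has at least [K] points, fewer than half of them in [A']. The vertices
    of the second kind are charged to the other points of their cycle, all in [Th]. *)
Lemma card_badv : (#|badv| <= #|[set a | (#|porbit s1 a| < K) &&
   (K <= #|cls (Efold (orb s) l0) a|)]| + #|Th|)%N.
Proof.
set S1 := [set a | _].
have -> : badv = (badv :&: S1) :|: (badv :\: S1) by rewrite setID.
apply: leq_trans (leq_card_setU _ _).1 _; apply: leq_add.
  by rewrite subset_leq_card // subsetIr.
rewrite -[#|_ :\: _|]mul1n -[#|Th|]mul1n; apply: (@card_by_porbit s1) => v.
rewrite !mul1n in_setD => /andP[vS]; rewrite in_set => /andP[vA' small].
have vA : v \in A by move: vA'; rewrite in_setD => /andP[].
have big : (K <= #|porbit s1 v|)%N.
  move: vS; rewrite in_set negb_and -leqNgt => /orP[//|]; apply: contraNT => _.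
  apply: leq_trans (_ : #|porbit s v| <= _)%N; first by move: vA; rewrite in_set.
  apply: subset_leq_card; apply/subsetP => b vb; rewrite in_set.
  by apply: (@Efold_sub _ (orb s)).
apply: leq_trans (_ : #|porbit s1 v :&: A'| <= _)%N.
  apply: subset_leq_card; apply: setIS; apply/subsetP => x.
  by rewrite in_setD => /andP[_]; rewrite in_set => /andP[].
apply: leq_trans (_ : #|porbit s1 v :\: A'| <= _)%N.
  have := cardsID A' (porbit s1 v); move: small big; rewrite -addnn.
  move: #|_ :&: _| #|_ :\: _| #|porbit _ _| => x y z; clear; lia.
apply: subset_leq_card; apply/subsetP => u; rewrite in_setD => /andP[uA uv].
by rewrite in_setI uv; apply: (outA_Th vA uv uA).
Qed.

(** Absorbed cycles of intermediate length are counted globally, because the estimates on components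
    make them rare; those shorter than [k0] number at most one per touched vertex. *)
Lemma card_Th : (#|Th| <= #|B| + (#|[set v | k0 <= #|porbit s v| < K]| + #|B| * k0))%N.
Proof.
apply: leq_trans (leq_card_setU _ _).1 _; rewrite leq_add2l.
pose S3 := \bigcup_(b in B | (#|porbit s b| < k0)%N) porbit s b.
apply: leq_trans (_ : #|[set v | k0 <= #|porbit s v| < K]%N :|: S3| <= _)%N.
  apply: subset_leq_card; apply/subsetP => u; rewrite in_set in_setC in_set -ltnNge.
  case/andP => uK /existsP[b /andP[bB ub]]; rewrite in_setU in_set uK andbT.
  have [//|uk] := leqP k0 #|porbit s u|; rewrite /=; apply/bigcupP; exists b => //.
  by rewrite bB -(porbit_memE ub) uk.
apply: leq_trans (leq_card_setU _ _).1 _; rewrite leq_add2l.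
rewrite /S3; apply: leq_trans (_ : \sum_(b in B | (#|porbit s b| < k0)%N) #|porbit s b| <= _)%N.
  elim/big_rec2: _ => [|b n C _ IH]; first by rewrite cards0.
  by apply: leq_trans (leq_card_setU _ _).1 _; rewrite leq_add2l.
rewrite -sum_nat_const big_mkcondr /=; apply: leq_sum => b _.
by case: ltnP => // /ltnW.
Qed.

Lemma card_loop2 X : X \subset A' -> (K * #|loop2 s1 X :\: badv| <= 4 * #|V|)%N.
Proof.
move=> XA; apply: leq_trans (_ : 4 * #|A'| <= _)%N; last first.
  by rewrite leq_mul2l /= max_card.
apply: (@card_by_porbit s1) => v; rewrite in_setD => /andP[vb vl].
have vX : v \in X by move: vl; rewrite in_set => /andP[].
have : (#|porbit s1 v :&: (loop2 s1 X :\: badv)| <= 2)%N.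
  apply: leq_trans (loop2_card vl); apply: subset_leq_card; apply: setIS.
  by apply/subsetP => x; rewrite in_setD => /andP[_]; rewrite in_set => /andP[].
move: vb; rewrite in_set (subsetP XA _ vX) /= -leqNgt -addnn.
move: #|_ :&: _| #|_ :&: A'| => x y; clear; nia.
Qed.

End Det.

Lemma avg_ksub_inter (R : realFieldType) A S k : (k <= #|A|)%N ->
  avg (ksub A k) (fun X : {set V} => #|X :&: S|%:R : R) <= k%:R * #|S|%:R / #|A|%:R.
Proof.
case: k => [|k] kA.
  rewrite !mul0r; apply: avg_le_cst => // X; rewrite inE => /andP[_ /eqP c].
  by rewrite lern0 -leqn0 -c subset_leq_card // subsetIl.
have -> : avg (ksub A k.+1) (fun X : {set V} => #|X :&: S|%:R : R) =
    k.+1%:R * avg (ksub A k.+1) (fun Q : {set V} => avg Q (fun x => (x \in S)%:R)).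
  rewrite -avgZ; apply: eq_avg => X; rewrite inE => /andP[_ /eqP c].
  rewrite -c -sum_avg -sum1_card natr_sum [RHS]big_mkcond [LHS]big_mkcond /=.
  by apply: eq_bigr => x _; rewrite inE; case: (x \in X) => //; case: (x \in S).
rewrite (subset_step (fun x (_ : {set V}) => (x \in S)%:R)) // -mulrA ler_wpM2l //.
rewrite (@eq_avg _ _ _ _ (fun x => (x \in S)%:R)) => [|x xA].
  rewrite /avg ler_wpM2r ?invr_ge0 // -natr_sum ler_nat -sum1_card big_mkcond /=.
  rewrite [leqRHS]big_mkcond /=; apply: leq_sum => x _.
  by case: (x \in A); case: (x \in S).
rewrite avg_cst // -card_gt0 cards_draws bin_gt0.
by have := cardsD1 x A; rewrite xA => e; rewrite e ltnS in kA.
Qed.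

End Bad.

(** Chebyshev's inequality; the variance of an indicator is at most its mean. *)
Lemma EL_count_low (R : realFieldType) (T : finType) (P I : {set T}) s (p : R) :
  P != set0 -> (0 < s)%N -> 0 < p -> p <= avg P (fun x => (x \in I)%:R) ->
  EL P s (fun l => ((count (mem I) l)%:R < p * s%:R / 2 :> R)%R%:R) <= 4 / (p * s%:R).
Proof.
move=> P0 s0 p0; have [q qE] : exists q, q = avg P (fun x => (x \in I)%:R : R) by eexists.
rewrite -qE => pq.
have q0 : 0 < q by apply: lt_le_trans pq.
have sR : 0 < s%:R :> R by rewrite ltr0n.
pose y x : R := (x \in I)%:R - q.
have y0 : avg P y = 0 by rewrite /y avgB avg_cst // -qE subrr.
have v : avg P (fun x => y x ^+ 2) <= q.
  have -> : avg P (fun x => y x ^+ 2) = avg P (fun x => (1 - 2 * q) * (x \in I)%:R + q ^+ 2).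
    apply: eq_avg => x _; rewrite /y; case: (x \in I); rewrite ?mulr1 ?mulr0 /=; ring.
  rewrite avgD avgZ avg_cst // -qE; have : 0 <= q ^+ 2 by rewrite exprn_ge0 // ltW.
  by move=> h; clear -h; lra.
have := EL_sqr_sum s y0 => e2.
apply: le_trans (_ : EL P s (fun l => 4 / (q * s%:R) ^+ 2 * (\sum_(x <- l) y x) ^+ 2) <= _).
  apply: ler_EL => l /andP[/eqP sl _].
  have sE : \sum_(x <- l) y x = (count (mem I) l)%:R - q * s%:R.
    rewrite -sl /y; elim: l {sl} => [|x l IH]; first by rewrite big_nil mulr0 subrr.
    rewrite big_cons IH /= natrD -natr1; ring.
  have [h|h] := boolP (_ < _); last by rewrite mulr_ge0 ?sqr_ge0 // divr_ge0 ?sqr_ge0.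
  have h2 : (count (mem I) l)%:R < q * s%:R / 2.
    by apply: lt_le_trans h _; rewrite ler_wpM2r ?invr_ge0 // ler_wpM2r // ltW.
  have h3 : (q * s%:R / 2) ^+ 2 <= (\sum_(x <- l) y x) ^+ 2.
    have qs : 0 < q * s%:R by rewrite mulr_gt0.
    rewrite sE -[leRHS]real_normK ?num_real // lerXn2r ?nnegrE //; first by lra.
    by rewrite ler0_norm; lra.
  apply: le_trans (_ : 4 / (q * s%:R) ^+ 2 * (q * s%:R / 2) ^+ 2 <= _).
    rewrite (_ : true%:R = 1) // le_eqVlt; apply/orP; left; apply/eqP; field; by rewrite !gt_eqF.
  by rewrite ler_wpM2l // divr_ge0 // sqr_ge0.
rewrite ELZ e2; apply: le_trans (_ : 4 / (q * s%:R) ^+ 2 * (s%:R * q) <= _).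
  by rewrite ler_wpM2l ?divr_ge0 ?sqr_ge0 // ler_wpM2l.
have -> : 4 / (q * s%:R) ^+ 2 * (s%:R * q) = 4 / (q * s%:R).
  by field; rewrite !gt_eqF.
by rewrite ler_pM2l // lef_pV2 ?posrE ?mulr_gt0 // ler_pM2r.
Qed.

Lemma avg_inner_ge (R : realFieldType) (V : finType) (A : {set V}) (de : R) :
  0 < de -> de * #|V|%:R <= #|A|%:R -> 2 <= de * #|V|%:R ->
  de ^+ 2 / 2 <= avg (pairs V) (fun p => (p \in inner A)%:R).
Proof.
move=> de0 dA d2.
have n0 : 0 < #|V|%:R :> R by rewrite -(pmulr_rgt0 _ de0); apply: lt_le_trans d2.
have An : #|A|%:R <= #|V|%:R :> R by rewrite ler_nat max_card.
have n2 : (1 < #|V|)%N.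
  by rewrite -(ltr_nat R); apply: lt_le_trans (le_trans (le_trans d2 dA) An); rewrite ltr1n.
have A2 : (1 < #|A|)%N by rewrite -(ltr_nat R); apply: lt_le_trans (le_trans d2 dA); rewrite ltr1n.
have c : #|inner A|%:R = #|A|%:R * #|A|.-1%:R :> R by exact: card_inner.
have -> : avg (pairs V) (fun p => (p \in inner A)%:R) = #|A|%:R * #|A|.-1%:R / (#|V|%:R * #|V|.-1%:R) :> R.
  rewrite /avg card_pairs -?c //; congr (_ / _).
  rewrite -natr_sum -sum1_card; congr (_%:R); rewrite big_mkcond [RHS]big_mkcond /=.
  by apply: eq_bigr => p _; rewrite !inE; case: (p.1 != p.2) => //=; case: (_ && _).
have n10 : 0 < #|V|.-1%:R :> R by rewrite ltr0n -ltnS prednK // ltnW.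
have e1 : #|A|.-1%:R = #|A|%:R - 1 :> R by rewrite -subn1 natrB // ltnW.
have e2 : #|V|.-1%:R <= #|V|%:R :> R by rewrite ler_nat leq_pred.
rewrite ler_pdivlMr ?mulr_gt0 //.
apply: le_trans (_ : de ^+ 2 / 2 * (#|V|%:R * #|V|%:R) <= _).
  by rewrite ler_wpM2l ?divr_ge0 ?sqr_ge0 // ler_wpM2l // ltW.
have -> : de ^+ 2 / 2 * (#|V|%:R * #|V|%:R) = (de * #|V|%:R) * ((de * #|V|%:R) / 2) by ring.
apply: ler_pM => //; rewrite ?mulr_ge0 ?invr_ge0 ?(ltW de0) ?(ltW n0) //.
by rewrite e1; move: dA d2; move: (de * _) => x; lra.
Qed.

(** All smallness conditions on the scales pass through [eta]. They bound the expected number [E] of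
    bad vertices by [14 eta n], and the constant 2000 brings each of the two fractions below
    [eps / 8]. *)
Lemma window_arith (R : realFieldType) (eta de ph eps n s K a n1 a' mid k0 E : R) :
  0 < eps -> 0 < ph -> 0 < de -> de <= 1 -> ph <= 1 -> 1 <= s -> 0 < n1 -> n <= 2 * n1 ->
  0 < n -> 0 < K ->
  eta = eps * ph * de ^+ 2 / 2000 ->
  de * n <= a -> a <= 2 * a' -> n <= eta * s * K ->
  mid <= eta * n -> s * k0 <= eta * n -> s ^+ 2 <= eta * n -> K ^+ 2 * s <= eta * n ^+ 2 ->
  E <= 4 * K ^+ 2 * s / n1 + (2 * s + (mid + 2 * s * k0)) ->
  3 * E / (a' * ph) + 4 * n / K / (ph * (de ^+ 2 / 4 * s)) <= eps / 4.
Proof.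
move=> eps0 ph0 de0 de1 ph1 s1 n10 nn n0 K0 etaE dA aa nK hmid hk0 hs hK hE.
have eta0 : 0 < eta by rewrite etaE divr_gt0 // !mulr_gt0.
have s0 : 0 < s by lra.
have ss : s <= eta * n by apply: le_trans hs; rewrite expr2 ler_peMl // ltW.
have h1 : 4 * K ^+ 2 * s / n1 <= 8 * eta * n.
  rewrite ler_pdivrMr //.
  have : n * n <= n * (2 * n1) by rewrite ler_pM2l.
  have : 0 <= eta * n by rewrite mulr_ge0 ?ltW.
  move=> en nn2; have := ler_wpM2l (ltW eta0) nn2; rewrite -expr2 => h.
  have := ler_wpM2l (ltW eta0) nn2; move: hK; rewrite expr2; lra.
have hE2 : E <= 14 * eta * n by have en := mulr_gt0 eta0 n0; clear -hE h1 ss hmid hk0 en; lra.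
have a'0 : 0 < a' by have := mulr_gt0 de0 n0; lra.
have h3 : 3 * E / (a' * ph) <= eps / 8.
  rewrite ler_pdivrMr ?mulr_gt0 //.
  apply: le_trans (_ : 3 * (14 * eta * n) <= _); first by rewrite ler_pM2l.
  apply: le_trans (_ : eps / 8 * ((de * n / 2) * ph) <= _); last first.
    rewrite ler_wpM2l ?divr_ge0 ?(ltW eps0) // ler_wpM2r ?(ltW ph0) //; lra.
  have -> : 3 * (14 * eta * n) = (eps * ph * de * n) * (42 / 2000 * de) by rewrite etaE; field.
  have -> : eps / 8 * (de * n / 2 * ph) = (eps * ph * de * n) * (1 / 16) by field.
  by rewrite ler_pM2l ?mulr_gt0 //; lra.
have h4 : 4 * n / K / (ph * (de ^+ 2 / 4 * s)) <= eps / 8.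
  have p0 : 0 < ph * (de ^+ 2 / 4 * s).
    by rewrite mulr_gt0 // mulr_gt0 // divr_gt0 // exprn_gt0.
  rewrite (ler_pdivrMr _ _ p0) (ler_pdivrMr _ _ K0).
  apply: le_trans (_ : 4 * (eta * s * K) <= _); first by rewrite ler_pM2l.
  have -> : 4 * (eta * s * K) = (eps * ph * de ^+ 2 * s * K) * (4 / 2000) by rewrite etaE; field.
  have -> : eps / 8 * (ph * (de ^+ 2 / 4 * s)) * K = (eps * ph * de ^+ 2 * s * K) * (1 / 32) by field.
  by rewrite ler_pM2l ?mulr_gt0 ?exprn_gt0 //; lra.
by lra.
Qed.

Section FixedList.
Variables (R : realType) (m : nat) (eps ph : R) (r1 : nat).
Hypotheses (eps0 : 0 < eps) (ph0 : 0 < ph).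
Variable V : finType.
Hypothesis RM : forall (j : nat) (g : seq nat -> R) (s : {perm V}) (X : {set V}),
  (r1 <= j)%N -> (forall l, `|g l| <= 1) -> #|X| = (m + j.*2)%N ->
  `|EI X m (fun w => IL j (X :\: [set x in w])
        (fun mu => g (typ m (orb (s * mu)%g) (ones w)))) - Fel m g (nseq m 1%N)|
  <= eps + #|loop2 s X|%:R / (ph * j%:R).

(** Three replacements for a fixed list: independent samples by distinct ones, redrawn inner pairs
    by a matching, and this matching by a perfect one on a uniform set of [m + 2 j] points shared
    with the sample. Averaging over that set turns the number of bad vertices in it into its share
    [#|badv| / #|A|]. *)
Lemma window_fixed (s : {perm V}) (K r : nat) (l : seq (V * V)) g
    (A := [set v | K <= #|porbit s v|]%N) (j := count (mem (inner A)) l) :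
  size l = r -> (forall l, `|g l| <= 1) -> (0 < K)%N -> (m <= r)%N ->
  (14 * r <= #|A|)%N -> (1 < r)%N -> (r1 <= j)%N -> (m <= j)%N -> (0 < j)%N ->
  `|EL A m (fun w => MX A l (fun mu => g (typ m (orb (s * mu)%g) (ones w)))) -
     Fel m g (nseq m 1%N)| <=
  50 * r%:R ^+ 2 / #|A|%:R + eps +
  (3 * #|badv s K l|%:R / ((#|A|%:R / 2) * ph) + 4 * #|V|%:R / K%:R / (ph * j%:R)).
Proof.
move=> sl g1 K0 mr rA r2 rj mj j0.
set B := touched (outer A l); set s1 := (s * prodl (outer A l))%g.
have cB : (#|B| <= r.*2)%N.
  apply: leq_trans (card_touched _) _; rewrite leq_double -sl.
  by rewrite size_filter count_size.
have jr : (j <= r)%N by rewrite -sl count_size.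
pose A' := A :\: B.
have cA' : (#|A| <= #|A'| + r.*2)%N.
  rewrite -(cardsID B A) addnC leq_add2l; apply: leq_trans cB.
  by rewrite subset_leq_card // subsetIr.
have rR : 0 < r%:R :> R by rewrite ltr0n ltnW.
have aR : 0 < #|A|%:R :> R by rewrite ltr0n; clear -rA r2; lia.
have jR : 0 < j%:R :> R by rewrite ltr0n.
pose F w := MX A l (fun mu => g (typ m (orb (s * mu)%g) (ones w))).
pose I w := IL j (A' :\: [set x in w]) (fun mu => g (typ m (orb (s1 * mu)%g) (ones w))).
have F1 w : `|F w| <= 1 by apply: MX_bound.
apply: le_trans (ler_distD (EI A' m F) _ _) _.
rewrite -addrA [50 * _ / _](_ : _ = 10 * r%:R ^+ 2 / #|A|%:R + 40 * r%:R ^+ 2 / #|A|%:R); last first.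
  by rewrite -mulrDl -mulrDl; congr (_ * _ / _); ring.
rewrite -addrA; apply: lerD.
  (* Budget of used vertices: [2 r] touched by outer pairs, at most [r] sampled, and [2 r] endpoints
     still to be drawn. *)
  have d1 : (#|B| + m <= 5 * r)%N by clear -cB mr; lia.
  have d2 : (5 * r < #|A|)%N by clear -rA r2; lia.
  apply: le_trans (EL_EI_close d1 d2 F1) _.
  rewrite natrM; apply: le_trans (_ : r%:R * (2 * (5 * r%:R) / #|A|%:R) <= _).
    by rewrite ler_wpM2r ?ler_nat // divr_ge0 ?mulr_ge0.
  by rewrite le_eqVlt; apply/orP; left; apply/eqP; field; rewrite gt_eqF.
apply: le_trans (ler_distD (EI A' m I) _ _) _; apply: lerD.
  rewrite -EIB; apply: le_trans (EI_norm _ _ _) _.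
  have mA' : (m <= #|A'|)%N by clear -cA' rA mr; lia.
  rewrite -[leRHS](@EI_cst R V A' m _ mA'); apply: ler_EI => w /and3P[/eqP sw uw aw].
  rewrite /I /A' setDDl.
  have -> : IL j (A :\: (B :|: [set x in w])) (fun mu => g (typ m (orb (s1 * mu)%g) (ones w))) =
    IL j (A :\: (B :|: [set x in w])) (fun mu => g (typ m (orb (s * (prodl (outer A l) * mu))%g) (ones w))).
    by apply: eq_IL => mu _; rewrite /s1 mulgA.
  have h2 : (#|B :|: [set x in w]| + (size l).*2 <= 5 * r)%N.
    have : (#|[set x in w]| <= m)%N by rewrite cardsE -sw card_size.
    have := (leq_card_setU B [set x in w]).1; rewrite sl.
    by clear -cB mr; lia.
  have h3 : ((5 * r).+2 <= #|A|)%N by clear -rA r2; lia.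
  have h1 : touched (outer A l) \subset B :|: [set x in w] by apply: subsetUl.
  apply: le_trans (MX_close h1 h2 h3 (h := fun mu => g (typ m (orb (s * mu)%g) (ones w))) _) _ => //.
  rewrite sl.
  have a1 : #|A|%:R / 2 <= #|A|.-1%:R :> R.
    rewrite ler_pdivrMr // -natrM ler_nat; clear -rA r2; lia.
  apply: le_trans (_ : r%:R * (4 * (5 * r)%:R / (#|A|%:R / 2)) <= _).
    rewrite ler_wpM2l // ler_wpM2l ?mulr_ge0 // lef_pV2 ?posrE //.
      by apply: lt_le_trans a1; rewrite divr_gt0.
    by rewrite divr_gt0.
  by rewrite natrM le_eqVlt; apply/orP; left; apply/eqP; field; rewrite gt_eqF.
have kA' : (m + j.*2 <= #|A'|)%N by clear -cA' jr mr rA; lia.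
have IE : EI A' m I = avg (ksub A' (m + j.*2)) (fun X => EI X m (fun w =>
    IL j (X :\: [set x in w]) (fun mu => g (typ m (orb (s1 * mu)%g) (ones w))))).
  rewrite -(EI_ksub (fun w Q => IL j Q (fun mu => g (typ m (orb (s1 * mu)%g) (ones w))))) //.
  apply/eqP; rewrite -subr_eq0 -EIB -normr_le0.
  apply: le_trans (EI_norm _ _ _) _.
  have mA' : (m <= #|A'|)%N by apply: leq_trans kA'; rewrite leq_addr.
  rewrite -[leRHS](@EI_cst R V A' m _ mA'); apply: ler_EI => w /and3P[/eqP sw uw aw].
  rewrite /I IL_subsets ?subrr ?normr0 //.
  rewrite cardsD.
  have : (#|A' :&: [set x in w]| <= m)%N.
    apply: leq_trans (subset_leq_card (subsetIr _ _)) _; by rewrite cardsE -sw card_size.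
  by move: kA'; move: #|A'| #|A' :&: _| j.*2 => x y z; clear; lia.
rewrite IE -[Fel m g _](@avg_cst R _ (ksub A' (m + j.*2))); last first.
  by rewrite -card_gt0 cards_draws bin_gt0.
rewrite -avgB; apply: le_trans (avg_norm _ _) _.
apply: le_trans (_ : avg (ksub A' (m + j.*2)) (fun X =>
    (eps + 4 * #|V|%:R / K%:R / (ph * j%:R)) + (ph * j%:R)^-1 * #|X :&: badv s K l|%:R) <= _).
  apply: ler_avg => X; rewrite inE => /andP[XA /eqP cX].
  apply: le_trans (RM s1 rj g1 cX) _; rewrite -addrA lerD2l [(_)^-1 * _]mulrC -mulrDl.
  rewrite ler_wpM2r ?invr_ge0 ?mulr_ge0 ?(ltW ph0) ?(ltW jR) //.
  have := card_loop2 XA; rewrite -/s1 => c2.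
  have c1 : (#|loop2 s1 X| <= #|loop2 s1 X :\: badv s K l| + #|X :&: badv s K l|)%N.
    rewrite -(cardsID (badv s K l) (loop2 s1 X)) addnC leq_add2l.
    apply: subset_leq_card; apply: setSI; apply/subsetP => x.
    by rewrite in_set => /andP[].
  apply: le_trans (_ : (#|loop2 s1 X :\: badv s K l| + #|X :&: badv s K l|)%:R <= _).
    by rewrite ler_nat.
  rewrite natrD lerD2r ler_pdivlMr ?ltr0n // -!natrM ler_nat mulnC.
  exact: c2.
rewrite avgD avg_cst; last by rewrite -card_gt0 cards_draws bin_gt0.
rewrite avgZ -addrA lerD2l addrC lerD2r.
have := avg_ksub_inter R (badv s K l) kA'; set X := avg _ _ => hX.
apply: le_trans (_ : (ph * j%:R)^-1 * (3 * j%:R * #|badv s K l|%:R / (#|A|%:R / 2)) <= _).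
  rewrite ler_wpM2l ?invr_ge0 ?mulr_ge0 ?(ltW ph0) ?(ltW jR) //.
  apply: le_trans hX _; apply: ler_pM; rewrite ?mulr_ge0 ?invr_ge0 //.
    rewrite ler_wpM2r // -natrM ler_nat; clear -mj; lia.
  have a'0 : 0 < #|A'|%:R :> R.
    by rewrite ltr0n; apply: leq_trans kA'; rewrite addn_gt0 double_gt0 j0 orbT.
  have a20 : 0 < #|A|%:R / 2 :> R by rewrite divr_gt0.
  rewrite lef_pV2 ?posrE //.
  by rewrite ler_pdivrMr // -natrM ler_nat; clear -cA' rA; lia.
rewrite le_eqVlt; apply/orP; left; apply/eqP; field; by rewrite !gt_eqF.
Qed.

End FixedList.

Lemma EL_badv (R : realFieldType) (V : finType) (s : {perm V}) (K k0 r : nat) :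
  (1 < #|V|)%N ->
  EL (pairs V) r (fun l => #|badv s K l|%:R : R) <=
  4 * K%:R ^+ 2 * r%:R / (#|V|.-1)%:R +
  (2 * r%:R + (#|[set v | k0 <= #|porbit s v| < K]%N|%:R + 2 * r%:R * k0%:R)).
Proof.
move=> n2; set A := [set v | K <= #|porbit s v|]%N; set M := [set v | _ <= _ < _]%N.
apply: le_trans (_ : EL (pairs V) r (fun l => #|[set a |
     (#|porbit (s * prodl (filter (fun p => p \notin inner A) l))%g a| < K)%N &&
     (K <= #|cls (Efold (orb s) (filter (fun p => p \notin inner A) l)) a|)%N]|%:R +
     (2 * r%:R + (#|M|%:R + 2 * r%:R * k0%:R))) <= _).
  apply: ler_EL => l /andP[/eqP sl _].
  have cB : (#|touched (outer A l)| <= r.*2)%N.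
    apply: leq_trans (card_touched _) _; rewrite leq_double -sl.
    by rewrite size_filter count_size.
  rewrite -!natrM -!natrD ler_nat.
  apply: leq_trans (card_badv s K l) _; rewrite leq_add2l.
  apply: leq_trans (card_Th s K k0 l) _; rewrite -/A -/M.
  by rewrite leq_add ?mul2n // leq_add2l leq_mul2r cB orbT.
rewrite ELD EL_cst ?pairs_neq0 // lerD2r.
exact: EL_bad_vertices.
Qed.

Theorem window (R : realType) (m : nat) (de eps : R) : 0 < de -> de <= 1 -> 0 < eps ->
  exists2 eta : R, 0 < eta & exists r0 : nat,
  forall (V : finType) (s : {perm V}) (K k0 r : nat) (g : seq nat -> R)
    (A := [set v | K <= #|porbit s v|]%N),
  (r0 <= r)%N -> (0 < K)%N -> de * #|V|%:R <= #|A|%:R ->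
  #|V|%:R <= eta * r%:R * K%:R ->
  #|[set v | k0 <= #|porbit s v| < K]%N|%:R <= eta * #|V|%:R ->
  r%:R * k0%:R <= eta * #|V|%:R -> r%:R ^+ 2 <= eta * #|V|%:R ->
  K%:R ^+ 2 * r%:R <= eta * #|V|%:R ^+ 2 ->
  (forall l, `|g l| <= 1) ->
  `|EL A m (fun w => EL (pairs V) r (fun l => g (typ m (orb (s * prodl l)%g) (ones w)))) -
     Fel m g (nseq m 1%N)| <= eps.
Proof.
move=> de0 de1 eps0.
have e80 : 0 < eps / 8 by rewrite divr_gt0.
have [ph0 ph00 [r1 r10 RM0]] := reduced_matching m e80.
have [ph [php ph1 phle]] : exists ph : R, [/\ 0 < ph, ph <= 1 & ph <= ph0].
  exists (Num.min ph0 1); split; first by rewrite lt_min ph00 ltr01.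
    by rewrite ge_min lexx orbT.
  by rewrite ge_min lexx.
have [eta etaE] : exists eta : R, eta = eps * ph * de ^+ 2 / 2000 by eexists.
have eta0 : 0 < eta by rewrite etaE divr_gt0 // mulr_gt0 ?mulr_gt0 ?exprn_gt0.
exists (Num.min eta (de / 28)); first by rewrite lt_min eta0 divr_gt0.
have q0 : 0 < de ^+ 2 / 4 by rewrite divr_gt0 // exprn_gt0.
have [r2 r2le] := nat_above ((r1 + m + 1)%:R / (de ^+ 2 / 4)).
have [r3 r3le] := nat_above (16 * 8 / (de ^+ 2 * eps)).
exists (r2 + r3 + m + 2)%N => V s K k0 r g A rr K0 dA hn hm hk hr hK g1.
have [rr2 [rr3 [mr r2']]] : (r2 <= r /\ r3 <= r /\ m <= r /\ 1 < r)%N by clear -rr; lia.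
have n0 : 0 < #|V|%:R :> R.
  have h : 0 < r%:R ^+ 2 :> R by rewrite exprn_gt0 // ltr0n ltnW.
  have := lt_le_trans h hr; rewrite pmulr_rgt0 // lt_min eta0 divr_gt0 //.
have eta1 x : 0 <= x -> Num.min eta (de / 28) * x <= eta * x.
  by move=> x0; rewrite ler_wpM2r // ge_min lexx.
have eta2 x : 0 <= x -> Num.min eta (de / 28) * x <= de / 28 * x.
  by move=> x0; rewrite ler_wpM2r // ge_min lexx orbT.
have hn' : #|V|%:R <= eta * r%:R * K%:R.
  by apply: le_trans hn _; rewrite -!mulrA eta1 // mulr_ge0.
have hm' := le_trans hm (eta1 _ (ltW n0)).
have hk' := le_trans hk (eta1 _ (ltW n0)).
have hr' := le_trans hr (eta1 _ (ltW n0)).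
have hK' := le_trans hK (eta1 _ (sqr_ge0 _)).
have hr2 := le_trans hr (eta2 _ (ltW n0)).
have rR : 2 <= r%:R :> R by rewrite ler_nat.
have rr28 : 28 * r%:R ^+ 2 <= de * #|V|%:R by move: hr2; lra_local.
have r28 : 14 * r%:R <= #|A|%:R :> R.
  apply: le_trans dA; apply: le_trans rr28.
  have h : r%:R * 2 <= r%:R * r%:R :> R by rewrite ler_wpM2l.
  by rewrite expr2; lra_local.
have rA : (14 * r <= #|A|)%N by rewrite -(ler_nat R) natrM.
have aR : 0 < #|A|%:R :> R by apply: lt_le_trans r28; lra_local.
have d2 : 2 <= de * #|V|%:R.
  apply: le_trans rr28; have h : r%:R * 2 <= r%:R * r%:R :> R by rewrite ler_wpM2l.
  by rewrite expr2; lra_local.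
have n2 : (1 < #|V|)%N.
  rewrite -(ltr_nat R) ; apply: lt_le_trans (_ : 2 <= _); first by rewrite ltr1n.
  by apply: le_trans d2 _; rewrite ler_piMl // ltW.
have RM (j : nat) (g' : seq nat -> R) (s' : {perm V}) (X : {set V}) :
  (r1 <= j)%N -> (forall l, `|g' l| <= 1) -> #|X| = (m + j.*2)%N ->
  `|EI X m (fun w => IL j (X :\: [set x in w])
        (fun mu => g' (typ m (orb (s' * mu)%g) (ones w)))) - Fel m g' (nseq m 1%N)|
  <= eps / 8 + #|loop2 s' X|%:R / (ph * j%:R).
  move=> rj g1' cX; apply: le_trans (RM0 V j g' s' X rj g1' cX) _.
  have jp : 0 < j%:R :> R by rewrite ltr0n; apply: leq_trans rj.
  by rewrite lerD2l ler_wpM2l // lef_pV2 ?posrE ?mulr_gt0 // ler_pM2r.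
pose Z l := EL A m (fun w => MX A l (fun mu => g (typ m (orb (s * mu)%g) (ones w)))).
have -> : EL A m (fun w => EL (pairs V) r (fun l => g (typ m (orb (s * prodl l)%g) (ones w))))
   = EL (pairs V) r Z.
  rewrite /Z [RHS]EL_swap; apply: eq_EL => w _.
  exact: (EL_MX A r (fun mu => g (typ m (orb (s * mu)%g) (ones w)))).
have Z1 l : `|Z l| <= 1.
  by apply: le_trans (EL_norm _ _ _) _; apply: EL_le_cst => // w _; apply: MX_bound.
rewrite -(@EL_cst R _ (pairs V) r (Fel m g (nseq m 1%N))) ?pairs_neq0 // -ELB.
apply: le_trans (EL_norm _ _ _) _.
pose c1 : R := 50 * r%:R ^+ 2 / #|A|%:R + eps / 8 +
  4 * #|V|%:R / K%:R / (ph * (de ^+ 2 / 4 * r%:R)).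
pose c2 : R := 3 / ((#|A|%:R / 2) * ph).
(* On this event the trivial bound 2 is paid. Elsewhere at least [de^2 r / 4] pairs are inner, so
   the matching is large enough for [window_fixed]. *)
pose lo l : bool := ((count (mem (inner A)) l)%:R < de ^+ 2 / 2 * r%:R / 2)%R.
have c10 : 0 <= c1.
  rewrite /c1; apply: addr_ge0; first apply: addr_ge0.
  - by rewrite divr_ge0 // mulr_ge0 // sqr_ge0.
  - exact: ltW.
  apply: divr_ge0; first by rewrite divr_ge0 // mulr_ge0.
  by rewrite mulr_ge0 ?(ltW php) // mulr_ge0 // ltW.
have c20 : 0 <= c2 by apply: divr_ge0 => //; apply: mulr_ge0; [rewrite divr_ge0 | apply: ltW].
apply: le_trans (_ : EL (pairs V) r (fun l => 2 * (lo l)%:R + (c1 + c2 * #|badv s K l|%:R)) <= _).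
  apply: ler_EL => l /andP[/eqP sl _]; have [hl|hl] := boolP (lo l).
    apply: le_trans (_ : 2 <= _); last by rewrite mulr1 lerDl addr_ge0 // mulr_ge0.
    apply: le_trans (ler_normB _ _) _; rewrite [leRHS](_ : 2 = 1 + 1) //; apply: lerD => //.
    exact: Fel_bound.
  rewrite mulr0 add0r; move: hl; rewrite /lo -leNgt => hl.
  have qj : de ^+ 2 / 4 * r%:R <= (count (mem (inner A)) l)%:R by apply: le_trans hl; lra_local.
  have jj : (r1 + m + 1 <= count (mem (inner A)) l)%N.
    rewrite -(ler_nat R); apply: le_trans qj; move: r2le; rewrite ler_pdivrMr // mulrC.
    by move=> /le_trans; apply; rewrite ler_pM2l // ler_nat.
  have [j1 [j2 j3]] : (r1 <= count (mem (inner A)) l /\ m <= count (mem (inner A)) l /\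
     0 < count (mem (inner A)) l)%N by clear -jj; lia.
  apply: le_trans (window_fixed php RM sl g1 K0 mr rA r2' j1 j2 j3) _.
  rewrite /c1 -!addrA lerD2l lerD2l [leLHS]addrC; apply: lerD.
    apply: ler_wpM2l; first by rewrite divr_ge0 // mulr_ge0.
    have qr0 : 0 < de ^+ 2 / 4 * r%:R by rewrite mulr_gt0 //; lra_local.
    rewrite lef_pV2 ?posrE ?(mulr_gt0 php) //; last by rewrite ltr0n.
    by rewrite ler_pM2l.
  by rewrite /c2 mulrAC.
rewrite ELD ELD ELZ ELZ EL_cst ?pairs_neq0 //.
have p20 : 0 < de ^+ 2 / 2 by rewrite divr_gt0 // exprn_gt0.
have := EL_count_low (pairs_neq0 n2) (ltnW r2') p20 (avg_inner_ge de0 dA d2).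
rewrite -/lo => hlo.
have hb := EL_badv R s K k0 r n2.
set E := EL _ _ (fun l => #|badv s K l|%:R) in hb *.
set L := EL _ _ _ in hlo *.
have hL : 2 * L <= eps / 8.
  apply: le_trans (_ : 2 * (4 / (de ^+ 2 / 2 * r%:R)) <= _); first by rewrite ler_pM2l.
  have -> : 2 * (4 / (de ^+ 2 / 2 * r%:R)) = 16 / (de ^+ 2 * r%:R).
    by field; rewrite !gt_eqF //; lra_local.
  rewrite ler_pdivrMr ?mulr_gt0 ?exprn_gt0 //; last by lra_local.
  move: r3le; rewrite ler_pdivrMr ?mulr_gt0 ?exprn_gt0 // => h.
  have : r3%:R * (de ^+ 2 * eps) <= r%:R * (de ^+ 2 * eps).
    by rewrite ler_wpM2r ?ler_nat // mulr_ge0 ?sqr_ge0 // ltW.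
  by move: h; clear; lra_local.
have h50 : 50 * r%:R ^+ 2 / #|A|%:R <= eps / 8.
  rewrite ler_pdivrMr //; apply: le_trans (_ : 50 * (eta * #|V|%:R) <= _).
    by rewrite ler_pM2l.
  apply: le_trans (_ : eps / 8 * (de * #|V|%:R) <= _); last by rewrite ler_pM2l.
  have -> : 50 * (eta * #|V|%:R) = (eps * de * #|V|%:R) * (50 / 2000 * (ph * de)) by rewrite etaE; field.
  have -> : eps / 8 * (de * #|V|%:R) = (eps * de * #|V|%:R) * (1 / 8) by field.
  rewrite ler_pM2l ?mulr_gt0 //.
  have : ph * de <= 1 * 1 by apply: ler_pM => //; apply: ltW.
  by lra_local.
have n10 : 0 < #|V|.-1%:R :> R by rewrite ltr0n -ltnS prednK // ltnW.
have nn : #|V|%:R <= 2 * #|V|.-1%:R :> R by rewrite -natrM ler_nat; clear -n2; lia.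
have r1R : 1 <= r%:R :> R by lra_local.
have KR : 0 < K%:R :> R by rewrite ltr0n.
have aa : #|A|%:R <= 2 * (#|A|%:R / 2) :> R by rewrite mulrC divfK // pnatr_eq0.
have := window_arith eps0 php de0 de1 ph1 r1R n10 nn n0 KR etaE dA aa hn' hm' hk' hr' hK' hb.
rewrite /c1 /c2; have -> : 3 / (#|A|%:R / 2 * ph) * E = 3 * E / (#|A|%:R / 2 * ph) by rewrite mulrAC.
move: (3 * E / _) (4 * _ / _ / _) (50 * _ / _) h50 hL => x y z; move: (2 * L) => w.
clear -eps0; lra_local.
Qed.

(** * Stability of the giant component *)

Section RealIneq.
Variable R : realFieldType.

Lemma pow_taylor2 (y b : R) J : 0 <= y -> 0 <= b ->
  y ^+ J.+2 + (J%:R + 2) * b * y ^+ J.+1 + (J%:R + 2) * (J%:R + 1) / 2 * b ^+ 2 * y ^+ J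
  <= (y + b) ^+ J.+2.
Proof.
move=> y0 b0; elim: J => [|J IH].
  by rewrite expr1 expr0 mulr1 [leRHS]expr2 !expr2; lra_local.
have yb : 0 <= y + b by rewrite addr_ge0.
rewrite [leRHS]exprS; apply: le_trans (ler_wpM2l yb IH).
rewrite -natr1 ![y ^+ _.+1]exprS; move: (y ^+ J) (exprn_ge0 J y0) => z z0.
have J0 : 0 <= J%:R :> R by [].
move: (J%:R) J0 => j j0.
have : 0 <= (j + 2) * (j + 1) / 2 * b ^+ 3 * z.
  by rewrite !mulr_ge0 ?invr_ge0 ?exprn_ge0 ?addr_ge0.
rewrite (_ : b ^+ 3 = b * b * b); last by rewrite !exprS expr0 mulr1 mulrA.
rewrite expr2; lra_local.
Qed.

(* quantitative AM-GM for [J.+1] copies of [y] and one [1], with [y + g = 1] *)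
Lemma amgm_gap (g : R) J : 0 <= g <= 1 ->
  (1 - g) ^+ J.+1 * (1 + g ^+ 2 / 4) <= (1 - g * (1 - J.+2%:R^-1)) ^+ J.+2.
Proof.
case/andP => g0 g1; pose y := 1 - g; pose b : R := g / J.+2%:R.
have y0 : 0 <= y by rewrite subr_ge0.
have y1 : y <= 1 by rewrite gerBl.
have b0 : 0 <= b by rewrite divr_ge0.
have -> : 1 - g * (1 - J.+2%:R^-1) = y + b by rewrite /y /b; ring.
apply: le_trans (pow_taylor2 J y0 b0).
have j0 : 0 < J.+2%:R :> R by rewrite ltr0n.
have jE : J.+2%:R = J%:R + 2 :> R by rewrite -natr1 -natr1; ring.
have -> : (J%:R + 2) * b = g by rewrite /b jE mulrC divfK // -jE gt_eqF.
have -> : y ^+ J.+2 + g * y ^+ J.+1 = y ^+ J.+1 by rewrite exprS -mulrDl /y subrK mul1r.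
rewrite mulrDr mulr1 lerD2l.
apply: le_trans (_ : y ^+ J * (g ^+ 2 / 4) <= _).
  by rewrite ler_wpM2r ?divr_ge0 ?sqr_ge0 // exprS ler_piMl ?exprn_ge0.
rewrite mulrC ler_wpM2r ?exprn_ge0 //.
have -> : (J%:R + 2) * (J%:R + 1) / 2 * b ^+ 2 = g ^+ 2 * ((J%:R + 1) / (2 * (J%:R + 2))).
  by rewrite /b jE; field; rewrite -jE gt_eqF.
rewrite ler_wpM2l ?sqr_ge0 // ler_pdivlMr; last by rewrite mulr_gt0 // -jE.
have : 0 <= J%:R :> R by []; lra_local.
Qed.

Lemma pow_1plus_shift (x : R) J : 0 <= x ->
  (1 + x) ^+ J.+1 <= (1 + x * (1 - J.+2%:R^-1)) ^+ J.+2.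
Proof.
move=> x0; pose u := 1 + x; have u0 : 0 < u by rewrite ltr_pwDl.
have j0 : 0 < J.+2%:R :> R by rewrite ltr0n.
have -> : 1 + x * (1 - J.+2%:R^-1) = u - x / J.+2%:R by rewrite /u; ring.
have b0 : 0 <= x / J.+2%:R by rewrite divr_ge0 // ltW.
have bu : x / J.+2%:R <= u.
  by rewrite ler_pdivrMr //; apply: le_trans (_ : u * 1 <= _);
    rewrite ?ler_wpM2l ?ler1n ?(ltW u0) // mulr1 /u lerDr.
have key k : u ^+ k.+1 - k.+1%:R * (x / J.+2%:R) * u ^+ k <= (u - x / J.+2%:R) ^+ k.+1.
  elim: k => [|k IH]; first by rewrite !expr1 expr0 mulr1 mul1r.
  have d0 : 0 <= u - x / J.+2%:R by rewrite subr_ge0.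
  rewrite [leRHS]exprS; apply: le_trans (ler_wpM2l d0 IH).
  rewrite -[in leLHS]natr1 ![u ^+ _.+1]exprS.
  have : 0 <= k.+1%:R * (x / J.+2%:R) * (x / J.+2%:R) * u ^+ k.
    by rewrite !mulr_ge0 // ?exprn_ge0 // ?invr_ge0 ltW.
  move: (x / J.+2%:R) (u ^+ k) (k.+1%:R : R) => b w j; clear; move: u => v; lra_local.
apply: le_trans (key J.+1).
have -> : J.+2%:R * (x / J.+2%:R) = x by rewrite mulrC divfK // gt_eqF.
by rewrite [u ^+ J.+2]exprS -mulrBl /u addrK mul1r.
Qed.

Lemma pow_1plus_drop (x : R) a b : 0 <= x -> (b <= a)%N ->
  (1 + x) ^+ a * (1 - (a - b)%:R * x) <= (1 + x) ^+ b.
Proof.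
move=> x0 ba; rewrite -{1}(subnKC ba) exprD -mulrA.
rewrite ler_piMr ?exprn_ge0 ?addr_ge0 //.
move: (a - b)%N => k; elim: k => [|k IH]; first by rewrite expr0 mul0r subr0 mulr1.
have p0 : 0 <= (1 + x) ^+ k by rewrite exprn_ge0 // addr_ge0.
apply: le_trans IH; rewrite exprSr -mulrA ler_wpM2l //.
rewrite -natr1; have : 0 <= k%:R * x * x :> R by rewrite !mulr_ge0.
have : 0 <= x * x by rewrite mulr_ge0.
by move: (k%:R : R) => j; lra_local.
Qed.

(** Shows that a slightly smaller [g] already works at the earlier time [N1]. After raising to the
    power [J + 2], the arithmetic-geometric mean inequality compares with the [(J + 1)]-th power of
    the original factor and gains [1 + g^2 / 4]; this gain pays for [de] and for the [N - N1]
    missing steps. *)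
Lemma shift_ineq (n g de : R) (N N1 J : nat) : 0 < n -> 0 <= g <= 1 -> (N1 <= N)%N ->
  0 <= de -> (1 - g) * (1 + 2 * g / n) ^+ N = 1 - de ->
  J.+1%:R * (de + (N - N1)%:R * (2 * g / n)) <= g ^+ 2 / 8 ->
  1 <= (1 - g * (1 - J.+2%:R^-1)) *
       (1 + 2 * (g * (1 - J.+2%:R^-1)) / n) ^+ N1.
Proof.
move=> n0 g01 NN de0 zE small; case/andP: (g01) => g0 g1.
have [x xE] : exists x : R, x = 2 * g / n by eexists.
have x0 : 0 <= x by rewrite xE divr_ge0 ?mulr_ge0 // ltW.
have -> : 2 * (g * (1 - J.+2%:R^-1)) / n = x * (1 - J.+2%:R^-1) by rewrite xE; ring.
rewrite -xE in zE small.
have j1 : J.+2%:R^-1 <= 1 :> R by rewrite invf_le1 ?ler1n ?ltr0n.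
have la0 : 0 <= 1 - J.+2%:R^-1 :> R by rewrite subr_ge0.
have la1 : 1 - J.+2%:R^-1 <= 1 :> R by rewrite gerBl invr_ge0.
set X := _ * _ ^+ N1.
have X0 : 0 <= X.
  apply: mulr_ge0; last by rewrite exprn_ge0 // addr_ge0 // mulr_ge0.
  rewrite subr_ge0; apply: le_trans (_ : 1 * 1 <= _); last by rewrite mulr1.
  exact: ler_pM.
suff : 1 <= X ^+ J.+2.
  by apply: contraLR; rewrite -!ltNge => X1; rewrite exprn_ilt1.
rewrite /X exprMn exprAC; have [kd kdE] : exists k, k = (N - N1)%:R * x by eexists.
rewrite -kdE in small.
apply: le_trans (_ : (1 - g) ^+ J.+1 * (1 + g ^+ 2 / 4) * ((1 + x) ^+ J.+1) ^+ N1 <= _); last first.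
  have y0 : 0 <= 1 - g by rewrite subr_ge0.
  have G0 : 0 <= 1 + g ^+ 2 / 4 by rewrite addr_ge0 // divr_ge0 // sqr_ge0.
  apply: ler_pM; [by rewrite mulr_ge0 // exprn_ge0 | by rewrite exprn_ge0 // exprn_ge0 // addr_ge0 | exact: amgm_gap |].
  apply: lerXn2r; rewrite ?nnegrE ?exprn_ge0 ?addr_ge0 ?mulr_ge0 //.
  exact: pow_1plus_shift.
rewrite mulrAC exprAC -exprMn.
have kd0 : 0 <= kd by rewrite kdE mulr_ge0.
have dk := mulr_ge0 de0 kd0.
have J1 : 1 <= J.+1%:R :> R by rewrite ler1n.
have g21 : g ^+ 2 <= 1 by rewrite expr_le1.
have dk1 : de + kd <= 1.
  apply: le_trans (_ : J.+1%:R * (de + kd) <= _); first by rewrite ler_peMl // addr_ge0.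
  by apply: le_trans small _; lra_local.
have h1 : 1 - (de + kd) <= (1 - g) * (1 + x) ^+ N1.
  apply: le_trans (_ : (1 - g) * ((1 + x) ^+ N * (1 - kd)) <= _).
    by rewrite mulrA zE; lra_local.
  by rewrite ler_wpM2l ?subr_ge0 // kdE; apply: pow_1plus_drop.
apply: le_trans (_ : (1 - (de + kd)) ^+ J.+1 * (1 + g ^+ 2 / 4) <= _); last first.
  rewrite ler_wpM2r ?addr_ge0 ?divr_ge0 ?sqr_ge0 //; apply: lerXn2r; rewrite ?nnegrE ?subr_ge0 //.
  by apply: mulr_ge0; rewrite ?subr_ge0 // exprn_ge0 // addr_ge0.
have h2 : 1 - J.+1%:R * (de + kd) <= (1 - (de + kd)) ^+ J.+1.
  have dk0 : 0 <= de + kd by rewrite addr_ge0.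
  move: (de + kd) dk0 dk1 => w w0 w1; clear -w0 w1; move: (J.+1) => k; elim: k => [|k IH].
    by rewrite mul0r subr0 expr0.
  have u0 : 0 <= 1 - w by rewrite subr_ge0.
  rewrite exprS -natr1; apply: le_trans (ler_wpM2l u0 IH).
  have : 0 <= k%:R * w * w by rewrite !mulr_ge0.
  by move: (k%:R : R) => j; lra_local.
have [G GE] : exists G, G = g ^+ 2 by eexists.
rewrite -GE in g21 small *; have G0 : 0 <= G by rewrite GE sqr_ge0.
apply: le_trans (_ : (1 - G / 8) * (1 + G / 4) <= _).
  have : G * G <= G * 1 by rewrite ler_wpM2l.
  lra_local.
by rewrite ler_wpM2r ?addr_ge0 ?divr_ge0 //; apply: le_trans h2; rewrite lerD2l lerN2.
Qed.

End RealIneq.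

Section GF.
Variable V : finType.

Lemma big_le_SS (R : realFieldType) (E : rel V) (z : R) k : 0 <= z <= 1 ->
  (1 - z ^+ k) * #|[set a | k <= #|cls E a|]%N|%:R <= SS E z.
Proof.
move=> /andP[z0 z1]; rewrite /SS (bigID (mem [set a | k <= #|cls E a|]%N)) /=.
rewrite mulrC mulr_natl -sumr_const.
apply: ler_wpDr.
  by apply: sumr_ge0 => u _; rewrite subr_ge0 exprn_ile1.
apply: ler_sum => u; rewrite inE => ku; rewrite lerD2l lerN2.
by apply: ler_wiXn2l.
Qed.

Lemma SS_le_big (R : realFieldType) (E : rel V) (z : R) k : 0 <= z <= 1 ->
  SS E z <= #|[set a | k <= #|cls E a|]%N|%:R + #|V|%:R * (k%:R * (1 - z)).
Proof.
move=> /andP[z0 z1]; rewrite /SS (bigID (mem [set a | k <= #|cls E a|]%N)) /=.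
apply: lerD.
  rewrite -sum1_card natr_sum ler_sum // => u _.
  by rewrite gerBl exprn_ge0.
have k0 : 0 <= k%:R * (1 - z) by rewrite mulr_ge0 // subr_ge0.
have -> : #|V|%:R * (k%:R * (1 - z)) = \sum_(u : V) k%:R * (1 - z).
  by rewrite sumr_const; apply: mulr_natl.
rewrite big_mkcond ler_sum // => u _; case: ifP => // uZ.
rewrite inE -ltnNge in uZ.
apply: le_trans (_ : #|cls E u|%:R * (1 - z) <= _); last first.
  by rewrite ler_wpM2r ?subr_ge0 // ler_nat ltnW.
elim: #|cls E u| => [|j IH]; first by rewrite expr0 subrr mul0r.
have e : 1 - z ^+ j.+1 = (1 - z ^+ j) + z ^+ j * (1 - z) by rewrite exprSr; ring.
rewrite e -natr1 mulrDl mul1r lerD // ler_piMl ?subr_ge0 //.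
exact: exprn_ile1.
Qed.

End GF.

(** The second-moment bound at the prescribed end point [1 - de]. The threshold depends only on
    [M0], [de] and [eta], so the same one serves all [N <= M0 n] and all [g], which vary with
    [n]. *)
Lemma gf_mean (R : realType) (M0 : nat) (de eta : R) : 0 < de -> de <= 1 -> 0 < eta ->
  exists n0 : nat, forall V : finType, (n0 <= #|V|)%N -> forall (N : nat) (g : R),
  (N <= M0 * #|V|)%N -> 0 < g -> g <= 1 ->
  (1 - g) * (1 + 2 * g / #|V|%:R) ^+ N = 1 - de ->
  `|EL (pairs V) N (fun l => SS (Efold (@eq_op V) l) (1 - de) / #|V|%:R) - g| <= eta.
Proof.
move=> de0 de1 eta0.
pose C : R := de^-1.
have C1 : 1 <= C by rewrite invf_ge1.
have C0 : 0 <= C by apply: le_trans C1.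
have [M Mle] := nat_above (4 * C).
have [q1 q1le] := nat_above (20 * C * (4 ^+ M) ^+ M0 * (4 / eta ^+ 2)).
exists (q1 + 2)%N => V nV N g NM g0 g1 zE.
have [n2 qn] : (1 < #|V| /\ q1 <= #|V|)%N by clear -nV; lia.
have n0 : 0 < #|V|%:R :> R by rewrite ltr0n ltnW.
have z00 : 0 <= 1 - g by rewrite subr_ge0.
have z01 : 1 - g < 1 by rewrite gtrBl.
have zE' : (1 - g) * (1 + 2 * (1 - (1 - g)) / #|V|%:R) ^+ N = 1 - de by rewrite subKr.
have zN1 : (1 - g) * (1 + 2 * (1 - (1 - g)) / #|V|%:R) ^+ N < 1 by rewrite zE' gtrBl.
have zNC : (1 - (1 - g) * (1 + 2 * (1 - (1 - g)) / #|V|%:R) ^+ N)^-1 <= C by rewrite zE' subKr.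
have hsq := @iter_sq R V n2 (1 - g) C N z00 z01 C1 zN1 zNC N (leqnn N).
rewrite zE' subKr in hsq.
have hb : 20 * C / #|V|%:R * ((1 + 4 * C / #|V|%:R) ^+ N - 1) <= eta ^+ 2 / 4.
  apply: le_trans (_ : 20 * C / #|V|%:R * (4 ^+ M) ^+ M0 <= _).
    rewrite ler_wpM2l; [by []|by rewrite divr_ge0 // mulr_ge0|].
    have x1 : 1 <= 1 + 4 * C / #|V|%:R by rewrite lerDl divr_ge0 // mulr_ge0.
    apply: le_trans (_ : (1 + 4 * C / #|V|%:R) ^+ (#|V| * M0) <= _).
      apply: le_trans (_ : (1 + 4 * C / #|V|%:R) ^+ N <= _); first by rewrite gerBl.
      by rewrite ler_weXn2l // mulnC.
    rewrite exprM; apply: lerXn2r; rewrite ?nnegrE ?exprn_ge0 ?(le_trans _ x1) //.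
    by apply: euler_bound_mul => //; [apply: ltnW | rewrite mulr_ge0].
  rewrite mulrAC ler_pdivrMr // -ler_pdivrMl ?divr_gt0 ?exprn_gt0 // invf_div mulrC.
  by apply: le_trans q1le _; rewrite ler_nat.
rewrite -(@EL_cst R _ (pairs V) N g) ?pairs_neq0 // -ELB.
apply: le_trans (EL_norm _ _ _) _.
apply: le_trans (_ : EL (pairs V) N (fun l => eta^-1 *
   (SS (Efold (@eq_op V) l) (1 - de) / #|V|%:R - g) ^+ 2 + eta / 2) <= _).
  apply: ler_EL => l _; move: (_ / _ - g) => x.
  rewrite -(ler_pM2l eta0) mulrDr mulVKf ?gt_eqF //.
  have -> : x ^+ 2 = `|x| ^+ 2 by rewrite real_normK ?num_real.
  have := sqr_ge0 (`|x| - eta / 2); rewrite !expr2; move: `|x| => y.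
  have := mulr_gt0 eta0 eta0; lra_local.
rewrite ELD ELZ EL_cst ?pairs_neq0 //.
have := le_trans hsq hb; move: (EL _ _ _) => X hX.
apply: le_trans (_ : eta^-1 * (eta ^+ 2 / 4) + eta / 2 <= _).
  by rewrite lerD2r ler_wpM2l // invr_ge0 ltW.
have -> : eta^-1 * (eta ^+ 2 / 4) = eta / 4 by field; rewrite gt_eqF.
lra_local.
Qed.

Lemma gf_root (R : realType) (n de lo : R) (N : nat) : 0 <= de < 1 -> lo <= 1 ->
  1 <= (1 - lo) * (1 + 2 * lo / n) ^+ N ->
  exists2 g, lo <= g <= 1 & (1 - g) * (1 + 2 * g / n) ^+ N = 1 - de.
Proof.
case/andP => de0 de1 lo1 hlo.
pose p : {poly R} := (1 - de)%:P - (1 - 'X) * (1 + (2 / n)%:P * 'X) ^+ N.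
have pE x : p.[x] = (1 - de) - (1 - x) * (1 + 2 * x / n) ^+ N.
  by rewrite /p (_ : 2 * x / n = 2 / n * x) ?hornerE // mulrAC.
have [|g gI] := @Num.Theory.poly_ivt R p lo 1 lo1.
  by rewrite !pE subrr mul0r subr0; apply/andP; split; lra_local.
by rewrite /root pE subr_eq0 => /eqP e; exists g.
Qed.

Section Maxc.
Variable V : finType.

Definition maxc (E : rel V) : nat := \max_(a : V) #|cls E a|.

Definition bigv (E : rel V) k : {set V} := [set a | k <= #|cls E a|]%N.

Lemma maxc_sprinkle (R : realFieldType) (E0 : rel V) (k h L B s : nat) :
  eqv E0 -> (0 < k)%N -> (1 < #|V|)%N -> (h <= #|V|)%N -> (0 < L)%N ->
  #|V|%:R ^+ 2 <= L%:R * h%:R ^+ 2 :> R -> (#|V| %/ k + B <= s %/ L)%N ->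
  #|bigv E0 k|%:R <= EL (pairs V) s (fun l => (maxc (Efold E0 l))%:R : R) +
    2 * h%:R + #|V|%:R * (B.+1%:R)^-1.
Proof.
move=> vE0 k0 n2 hn L0 Lh aB; set Z := bigv E0 k.
have := sprinkling_small vE0 k0 n2 hn L0 Lh aB; rewrite -/(bigv E0 k) -/Z => hs.
rewrite -[leLHS](@EL_cst R _ (pairs V) s) ?pairs_neq0 //.
apply: le_trans (_ : EL (pairs V) s (fun l => (maxc (Efold E0 l))%:R + 2 * h%:R +
   #|V|%:R * (~~ [exists a, #|Z| <= #|cls (Efold E0 l) a :&: Z| + h.*2])%N%:R) <= _).
  apply: ler_EL => l _; case: (boolP [exists a, _]) => [/existsP[a aZ]|_] /=.
    rewrite mulr0 addr0 -natrM -natrD ler_nat mul2n; apply: leq_trans aZ _.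
    rewrite leq_add2r; apply: leq_trans (leq_bigmax a).
    by rewrite subset_leq_card // subsetIl.
  rewrite mulr1; apply: ler_wpDl; last by rewrite ler_nat max_card.
  by rewrite addr_ge0 // mulr_ge0.
by rewrite !ELD EL_cst ?pairs_neq0 // ELZ lerD2l ler_wpM2l.
Qed.

End Maxc.

Lemma pow_small (R : realType) (de ep : R) : 0 < de -> de <= 1 -> 0 < ep ->
  exists k : nat, (1 - de) ^+ k <= ep.
Proof.
move=> de0 de1 ep0; have [k kle] := nat_above (ep^-1 / de); exists k.
have y0 : 0 <= 1 - de by rewrite subr_ge0.
have h : (1 - de) ^+ k * (1 + de) ^+ k <= 1.
  rewrite -exprMn; apply: exprn_ile1; first by rewrite mulr_ge0 // addr_ge0 // ltW.
  by have := mulr_gt0 de0 de0; lra_local.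
have b := bernoulli k (ltW de0).
have b2 : ep^-1 <= 1 + k%:R * de.
  by move: kle; rewrite ler_pdivrMr // => /le_trans; apply; rewrite lerDr.
have p0 : 0 <= (1 - de) ^+ k by rewrite exprn_ge0.
have : (1 - de) ^+ k * ep^-1 <= 1.
  by apply: le_trans h; rewrite ler_wpM2l //; apply: le_trans b.
by rewrite ler_pdivrMr // mul1r.
Qed.

Lemma natfrac (R : realType) (n : nat) (e : R) : 0 <= e -> 2 <= e * n%:R ->
  exists2 q : nat, e * n%:R / 2 <= q%:R & q%:R <= e * n%:R.
Proof.
move=> e0 en; have p0 : 0 <= e * n%:R by lra_local.
have /andP[h1 h2] := Num.Theory.truncn_itv p0.
exists (Num.truncn (e * n%:R)) => //.
by move: h2; rewrite -natr1; lra_local.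
Qed.

(** Both means are compared with one number [g]. At time [t] at most about [g n] vertices lie in
    components of size at least [k]; [2 q] steps earlier the characteristic equation still has a
    solution [g' >= g - ep1], so about [g n] vertices lie in components of size at least [k'], and
    the next [q] edges join nearly all of them. *)
Theorem giant_stable (R : realType) (c ep : R) : 2^-1 < c -> 0 < ep ->
  exists k : nat, exists2 e : R, 0 < e & exists n0 : nat,
  forall V : finType, (n0 <= #|V|)%N -> forall t : nat, c * #|V|%:R <= t%:R ->
  exists2 t1 : nat, t1%:R + e * #|V|%:R <= t%:R &
  EL (pairs V) t (fun l => #|bigv (Efold (@eq_op V) l) k|%:R : R) <=
  EL (pairs V) t1 (fun l => (maxc (Efold (@eq_op V) l))%:R) + ep * #|V|%:R.
Proof.
move=> c12 ep0.
have [ep1 [e10 e11 e1e]] : exists ep1 : R, [/\ 0 < ep1, ep1 <= 8^-1 & 10 * ep1 <= ep].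
  exists (Num.min 8^-1 (ep / 10)).
  split; first by rewrite lt_min invr_gt0 divr_gt0 // ltr0n.
    by rewrite ge_min lexx.
  have : Num.min 8^-1 (ep / 10) <= ep / 10 by rewrite ge_min lexx orbT.
  lra_local.
have [nu [nu0 nu1 nuc]] : exists nu : R, [/\ 0 < nu, nu <= 1 & 1 <= (1 - nu) * (1 + 2 * nu * c)].
  exists ((2 * c - 1) / (2 * c)); have c0 : 0 < 2 * c by lra_local.
  split; first by rewrite divr_gt0 //; lra_local.
    by rewrite ler_pdivrMr //; lra_local.
  rewrite le_eqVlt; apply/orP; left; apply/eqP; field; by rewrite gt_eqF //; lra_local.
have [J Jle] := nat_above (ep1^-1 : R).
have J0 : 0 < J.+2%:R :> R by rewrite ltr0n.
have J1 : 0 < J.+1%:R :> R by rewrite ltr0n.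
have Jinv : J.+2%:R^-1 <= ep1.
  rewrite -[leRHS]invrK lef_pV2 ?posrE ?invr_gt0 //.
  by apply: le_trans Jle _; rewrite ler_nat -addn2 leq_addr.
(* The smallness asked by [shift_ineq] reads [J.+1 * (2 de) <= nu^2 / 8]: one [de] is the offset of
   the end point, the other bounds the effect of the [2 q] missing steps, since [4 e = de]. *)
have [de deE] : exists de : R, de = nu ^+ 2 / (16 * J.+1%:R) by eexists.
have nn0 : 0 < nu ^+ 2 by rewrite exprn_gt0.
have nn1 : nu ^+ 2 <= 1 by rewrite expr_le1 // ltW.
have de0 : 0 < de by rewrite deE divr_gt0 // mulr_gt0.
have de1 : de < 1.
  rewrite deE ltr_pdivrMr ?mulr_gt0 // mul1r; apply: le_lt_trans nn1 _.
  have : 1 <= J.+1%:R :> R by rewrite ler1n.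
  lra_local.
have [k kle] := pow_small de0 (ltW de1) e10.
have [e eE] : exists e : R, e = nu ^+ 2 / (64 * J.+1%:R) by eexists.
have e0 : 0 < e by rewrite eE divr_gt0 // mulr_gt0.
have ed : 4 * e = de by rewrite eE deE; move: J1; move: (J.+1%:R : R) => j j0; field; rewrite gt_eqF.
have [L Lle] := nat_above (4 / ep1 ^+ 2).
have L0 : (0 < L)%N by rewrite -(ltr0n R); apply: lt_le_trans Lle; rewrite divr_gt0 // exprn_gt0.
have LR : 0 < L%:R :> R by rewrite ltr0n.
have [B Ble] := nat_above (ep1^-1 : R).
have [k' k'le] := nat_above (8 * L%:R / e).
have k'0 : (0 < k')%N by rewrite -(ltr0n R); apply: lt_le_trans k'le; rewrite divr_gt0 // mulr_gt0.
have k'R : 0 < k'%:R :> R by rewrite ltr0n.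
have [d1 d1E] : exists d1 : R, d1 = ep1 / k'%:R by eexists.
have d10 : 0 < d1 by rewrite d1E divr_gt0.
have d11 : d1 < 1.
  rewrite d1E ltr_pdivrMr // mul1r; apply: lt_le_trans (_ : 1 <= _); first by lra_local.
  by rewrite ler1n.
have [n1 H1] := gf_mean (3 * L + 3) de0 (ltW de1) e10.
have [n2 H2] := gf_mean (3 * L + 3) d10 (ltW d11) e10.
have [n3 n3le] := nat_above (2 / e).
have [n4 n4le] := nat_above (4 * L%:R * (B%:R + 1) / e).
have [n5 n5le] := nat_above (2 / ep1).
exists k, (e / 2); first by rewrite divr_gt0.
exists (n1 + n2 + n3 + n4 + n5 + B + 2)%N => V nV t ct.
have [a1 [a2 [a3 [a4 [a5 [a6 a7]]]]]] : (n1 <= #|V| /\ n2 <= #|V| /\ n3 <= #|V| /\ n4 <= #|V| /\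
   n5 <= #|V| /\ B <= #|V| /\ 1 < #|V|)%N by clear -nV; lia.
have [n nE] : exists n : R, n = #|V|%:R by eexists.
have n0 : 0 < n by rewrite nE ltr0n ltnW.
have en : 2 <= e * n.
  move: n3le; rewrite ler_pdivrMr // mulrC => /le_trans; apply.
  by rewrite ler_pM2l // nE ler_nat.
have epn : 2 <= ep1 * n.
  move: n5le; rewrite ler_pdivrMr // mulrC => /le_trans; apply.
  by rewrite ler_pM2l // nE ler_nat.
have [q q1 q2] : exists2 q : nat, e * n / 2 <= q%:R & q%:R <= e * n.
  by rewrite nE in en *; apply: natfrac => //; apply: ltW.
have [h h1 h2] : exists2 h : nat, ep1 * n / 2 <= h%:R & h%:R <= ep1 * n.
  by rewrite nE in epn *; apply: natfrac => //; apply: ltW.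
have e1' : e <= 64^-1.
  rewrite eE ler_pdivrMr ?mulr_gt0 //; apply: le_trans nn1 _.
  have : 1 <= J.+1%:R :> R by rewrite ler1n.
  lra_local.
have en64 : e * n <= n / 64 by rewrite mulrC ler_pM2l.
have q2t : (q.*2 <= t)%N.
  rewrite -(ler_nat R) -mul2n natrM; apply: le_trans ct; rewrite -nE.
  have : 2^-1 * n <= c * n by rewrite ler_pM2r // ltW.
  lra_local.
have qt : (q <= t)%N by apply: leq_trans q2t; rewrite -addnn leq_addl.
exists (t - q)%N; first by rewrite natrB // -nE; lra_local.
have hn : (h <= #|V|)%N.
  rewrite -(ler_nat R) -nE; apply: le_trans h2 _; rewrite ler_piMl ?(ltW n0) //; lra_local.
have Lh : #|V|%:R ^+ 2 <= L%:R * h%:R ^+ 2 :> R.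
  rewrite -nE; apply: le_trans (_ : 4 / ep1 ^+ 2 * (ep1 * n / 2) ^+ 2 <= _).
    by rewrite le_eqVlt; apply/orP; left; apply/eqP; field; rewrite gt_eqF.
  have h0 : 0 <= ep1 * n / 2 by lra_local.
  apply: ler_pM => //; rewrite ?divr_ge0 ?exprn_ge0 ?(ltW e10) //.
  by apply: lerXn2r => //; rewrite nnegrE; lra_local.
have Bn : n * (B.+1%:R)^-1 <= ep1 * n.
  rewrite mulrC ler_pM2r // -[leRHS]invrK lef_pV2 ?posrE ?invr_gt0 //.
  by apply: le_trans Ble _; rewrite ler_nat.
(* [gf_mean] covers only times of order [n]. Later, the [t - q] edges sprinkled on isolated vertices
   already join all but a small fraction of the vertices, and the left side is at most [n]. *)
have [tM|tM] := leqP t ((3 * L + 3) * #|V|); last first.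
  have aB : (#|V| %/ 1 + B <= (t - q) %/ L)%N.
    rewrite divn1 leq_divRL //.
    have qV : (q <= #|V|)%N by rewrite -(ler_nat R) -nE; lra_local.
    have : ((#|V| + B) * L <= 2 * #|V| * L)%N by rewrite leq_mul2r; apply/orP; right; clear -a6; lia.
    by move: tM qV a7; move: #|V| => v; clear; nia.
  have := maxc_sprinkle (eq_op_eqv V) (ltn0Sn 0) a7 hn L0 Lh aB.
  have -> : #|bigv (@eq_op V) 1|%:R = n.
    rewrite nE; congr (_%:R); apply: eq_card => a; rewrite !inE.
    by apply/card_gt0P; exists a; rewrite inE eqxx.
  rewrite -nE => hs.
  apply: le_trans (_ : n <= _).
    by apply: EL_le_cst => [|l _]; [exact: ltW | rewrite nE ler_nat max_card].
  have : 10 * ep1 * n <= ep * n by rewrite ler_pM2r.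
  have en1 := mulr_gt0 e10 n0.
  move: hs h2 Bn; move: (EL _ _ _) (n * B.+1%:R^-1) => x y; clear -en1; lra_local.
have ctn : c * n <= t%:R by rewrite nE.
have lo : 1 <= (1 - nu) * (1 + 2 * nu / n) ^+ t.
  apply: le_trans nuc _; rewrite ler_wpM2l ?subr_ge0 //.
  have x0 : 0 <= 2 * nu / n by rewrite divr_ge0 ?mulr_ge0 // ltW.
  apply: le_trans (bernoulli t x0); rewrite lerD2l.
  apply: le_trans (_ : (c * n) * (2 * nu / n) <= _); last by rewrite ler_wpM2r.
  by rewrite le_eqVlt; apply/orP; left; apply/eqP; field; rewrite gt_eqF.
have de01 : 0 <= de < 1 by rewrite ltW.
have [g /andP[gnu g1] gE] := gf_root de01 nu1 lo.
have g0 : 0 < g by apply: lt_le_trans gnu.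
rewrite nE in gE; have G1 := H1 V a1 t g tM g0 g1 gE; rewrite -nE in gE.
set t0 := (t - q.*2)%N.
have t0t : (t0 <= t)%N by rewrite leq_subr.
have lo2 : 1 <= (1 - g * (1 - J.+2%:R^-1)) * (1 + 2 * (g * (1 - J.+2%:R^-1)) / n) ^+ t0.
  apply: (shift_ineq n0 _ t0t (ltW de0) gE); first by rewrite (ltW g0).
  rewrite subKn // -mul2n natrM.
  have h3 : 2 * q%:R * (2 * g / n) <= 4 * e.
    have -> : 2 * q%:R * (2 * g / n) = 4 * (g * (q%:R / n)) by field; rewrite gt_eqF.
    rewrite ler_pM2l //; apply: le_trans (_ : 1 * e <= _); last by rewrite mul1r.
    by apply: ler_pM => //; rewrite ?divr_ge0 ?(ltW g0) ?(ltW n0) // ler_pdivrMr.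
  apply: le_trans (_ : J.+1%:R * (de + de) <= _).
    by rewrite ler_pM2l // lerD2l -ed.
  have -> : J.+1%:R * (de + de) = nu ^+ 2 / 8.
    by rewrite deE; move: J1; move: (J.+1%:R : R) => j j0; field; rewrite gt_eqF.
  by rewrite ler_wpM2r ?invr_ge0 // lerXn2r ?nnegrE ?(ltW g0) ?(ltW nu0).
have la0 : 0 <= J.+2%:R^-1 :> R by rewrite invr_ge0.
have glo : g * (1 - J.+2%:R^-1) <= 1.
  by apply: le_trans g1; rewrite ler_piMr ?(ltW g0) // gerBl.
have d101 : 0 <= d1 < 1 by rewrite ltW.
have [g' /andP[g'lo g'1] g'E] := gf_root d101 glo lo2.
have g'g : g - ep1 <= g'.
  apply: le_trans g'lo; rewrite mulrBr mulr1 lerD2l lerN2.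
  by apply: le_trans (_ : 1 * ep1 <= _); [apply: ler_pM => //; apply: ltW | rewrite mul1r].
have g'0 : 0 < g'.
  apply: lt_le_trans g'lo; rewrite mulr_gt0 // subr_gt0; apply: le_lt_trans Jinv _; lra_local.
rewrite nE in g'E; have G2 := H2 V a2 t0 g' (leq_trans t0t tM) g'0 g'1 g'E.
have z1 : 0 <= 1 - de <= 1 by apply/andP; split; lra_local.
have z2 : 0 <= 1 - d1 <= 1 by apply/andP; split; lra_local.
have up : EL (pairs V) t (fun l => #|bigv (Efold (@eq_op V) l) k|%:R : R) <= n * (g + 4 * ep1).
  set X := EL _ _ _.
  have hX : (1 - ep1) * X <= n * (g + ep1).
    apply: le_trans (_ : EL (pairs V) t (fun l => n * (SS (Efold (@eq_op V) l) (1 - de) / #|V|%:R)) <= _).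
      rewrite -ELZ; apply: ler_EL => l _; rewrite -nE [n * (_ / _)]mulrC divfK ?gt_eqF //.
      apply: le_trans (big_le_SS (Efold (@eq_op V) l) k z1).
      by rewrite ler_wpM2r // lerD2l lerN2.
    rewrite ELZ ler_pM2l // -lerBlDl.
    by apply: le_trans G1; apply: ler_norm.
  have X0 : 0 <= X by apply: EL_ge0.
  have : (1 - ep1) * X <= (1 - ep1) * (n * (g + 4 * ep1)).
    apply: le_trans hX _; rewrite mulrCA ler_pM2l //.
    have := mulr_gt0 e10 e10; have : g * ep1 <= 1 * ep1 by rewrite ler_pM2r.
    have : ep1 * ep1 <= ep1 * 8^-1 by rewrite ler_pM2l.
    lra_local.
  by rewrite ler_pM2l //; lra_local.
have dn : n * (g - 3 * ep1) <= EL (pairs V) t0 (fun l => #|bigv (Efold (@eq_op V) l) k'|%:R : R).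
  set X := EL _ _ _.
  have hX : n * (g' - ep1) <= X + n * ep1.
    apply: le_trans (_ : EL (pairs V) t0 (fun l => n * (SS (Efold (@eq_op V) l) (1 - d1) / #|V|%:R)) <= _).
      rewrite ELZ ler_pM2l // lerBlDr -lerBlDl.
      by apply: le_trans G2; rewrite distrC; apply: ler_norm.
    rewrite -[n * ep1](@EL_cst R _ (pairs V) t0) ?pairs_neq0 // -ELD.
    apply: ler_EL => l _; rewrite -nE [n * (_ / _)]mulrC divfK ?gt_eqF //.
    apply: le_trans (SS_le_big (Efold (@eq_op V) l) k' z2) _.
    rewrite -nE lerD2l ler_pM2l // subKr d1E mulrC divfK ?gt_eqF //.
  have : n * (g - 3 * ep1) <= n * (g' - 2 * ep1) by rewrite ler_pM2l //; lra_local.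
  lra_local.
have aB : (#|V| %/ k' + B <= q %/ L)%N.
  have h3 : (#|V| %/ k')%:R <= n / k'%:R.
    by rewrite ler_pdivlMr // -natrM nE ler_nat leq_trunc_div.
  have h4 : q%:R / L%:R <= (q %/ L)%:R + 1 :> R.
    by rewrite ler_pdivrMr // natr1 -natrM ler_nat ltnW // ltn_ceil.
  have h5 : n / k'%:R <= e * n / (8 * L%:R).
    rewrite ler_pdivrMr // mulrAC ler_pdivlMr ?mulr_gt0 //.
    move: k'le; rewrite ler_pdivrMr // => hK.
    by have := ler_wpM2l (ltW n0) hK; lra_local.
  have h6 : e * n / (8 * L%:R) = (e * n / L%:R) / 8 by field; rewrite gt_eqF.
  have h7 : 4 * (B%:R + 1) <= e * n / L%:R.
    rewrite ler_pdivlMr //; move: n4le; rewrite ler_pdivrMr // => hn4.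
    have : n4%:R * e <= n * e by rewrite ler_pM2r // nE ler_nat.
    lra_local.
  have h8 : e * n / L%:R / 2 <= q%:R / L%:R.
    by rewrite mulrAC ler_pM2r ?invr_gt0.
  have B0 : 0 <= B%:R :> R by [].
  by rewrite -(ler_nat R) natrD; lra_local.
have tE : (t - q = t0 + q)%N by rewrite /t0; clear -q2t; lia.
rewrite tE EL_cat.
have md : EL (pairs V) t0 (fun l => #|bigv (Efold (@eq_op V) l) k'|%:R : R) <=
   EL (pairs V) t0 (fun l1 => EL (pairs V) q (fun l2 => (maxc (Efold (@eq_op V) (l1 ++ l2)))%:R)) +
   (2 * h%:R + n * (B.+1%:R)^-1).
  rewrite -[X in _ <= _ + X](@EL_cst R _ (pairs V) t0) ?pairs_neq0 // -ELD.
  apply: ler_EL => l _; have vE := eqv_Efold l (eq_op_eqv V).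
  have := maxc_sprinkle vE k'0 a7 hn L0 Lh aB; rewrite -addrA nE => /le_trans; apply.
  rewrite lerD2r; apply: ler_EL => l2 _; by rewrite Efold_cat.
have : 10 * ep1 * n <= ep * n by rewrite ler_pM2r.
move: up dn md; rewrite -nE.
have en1 := mulr_gt0 e10 n0.
move: Bn h2; move: (EL _ t _) (EL _ t0 _) (EL _ t0 _) (n * B.+1%:R^-1) => x y z w; clear -en1; lra_local.
Qed.

(** * The earlier stages *)

(** With [n] between [a^20] and [(a + 1)^20], the powers [k1 = a^8], [s = a^9], [K = a^12],
    [s1 = a^14] separate all scales. Each inequality is a comparison of exponents; one spare factor
    [a] beats [1 / ep] and the constant [2^20] lost between [a] and [a + 1]. *)
Lemma scales (R : realType) (ep : R) : 0 < ep -> exists n0 : nat, forall n : nat, (n0 <= n)%N ->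
  exists k1 s1 K s : nat,
  [/\ k1%:R ^+ 2 <= ep * n%:R, K%:R ^+ 2 * s1%:R <= ep * n%:R ^+ 2,
      K%:R <= ep * n%:R, n%:R <= ep * (k1%:R * s1%:R) & (s1 + s)%:R <= ep * n%:R] /\
  [/\ s%:R ^+ 2 <= ep * n%:R, n%:R <= ep * s%:R * K%:R, K%:R ^+ 2 * s%:R <= ep * n%:R ^+ 2,
      1 <= ep * s%:R & [/\ 1 <= ep * s1%:R, k1%:R <= ep * n%:R, 1 <= ep * K%:R & 1 <= ep * n%:R]].
Proof.
move=> ep0.
have [b ble] := nat_above (2 ^+ 20 * (1 + ep^-1)).
have b1R : 1 <= b%:R :> R.
  apply: le_trans ble; rewrite -[leLHS]mulr1; apply: ler_pM => //.
    by rewrite exprn_ege1 // ler1n.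
  by rewrite lerDl invr_ge0 ltW.
have b1 : (0 < b)%N by rewrite -(ler1n R).
exists (b ^ 20)%N => n bn.
have [a] : exists2 a, (b <= a)%N & (a ^ 20 <= n < a.+1 ^ 20)%N.
  have ex : exists a, (a ^ 20 <= n)%N by exists b.
  have ub a : (a ^ 20 <= n)%N -> (a <= n)%N.
    move=> an; apply: leq_trans an; case: a => // a.
    by rewrite -[leqLHS]expn1 leq_pexp2l.
  have := ex_maxnP ex ub; case=> a an amax; exists a; first exact: amax.
  by rewrite an /= ltnNge; apply/negP => /amax; rewrite ltnn.
move=> ba /andP[n1 n2].
exists (a ^ 8)%N, (a ^ 14)%N, (a ^ 12)%N, (a ^ 9)%N.
have [x xE] : exists x : R, x = a%:R by eexists.
have xb : 2 ^+ 20 * (1 + ep^-1) <= x by apply: le_trans ble _; rewrite xE ler_nat.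
have [T TE] : exists T : R, T = 2 ^+ 20 by eexists.
have T1 : 2 <= T by rewrite TE -[leLHS]expr1 ler_weXn2l // ler1n.
have ei0 : 0 < ep^-1 by rewrite invr_gt0.
rewrite -TE in xb.
have Tei : 0 <= T * ep^-1 by rewrite mulr_ge0 ?(ltW ei0) //; lra.
have x2 : 2 <= x by lra.
have x1 : 1 <= x by lra.
have x0 : 0 <= x by lra.
have Tx : T <= ep * x.
  have : ep * (T * (1 + ep^-1)) <= ep * x by rewrite ler_pM2l.
  rewrite mulrDr mulrDr mulr1 [ep * (T * _)]mulrCA divff ?gt_eqF // mulr1.
  by have := mulr_gt0 ep0 (lt_le_trans (@ltr0Sn R 1) T1); lra.
have ex2 : 2 <= ep * x by lra.
have ex1 : 1 <= ep * x by lra.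
have nx : x ^+ 20 <= n%:R by rewrite xE -natrX ler_nat.
have nT : n%:R <= T * x ^+ 20.
  rewrite TE xE -exprMn -natrM -natrX ler_nat; apply: ltnW; apply: leq_trans n2 _.
  rewrite leq_exp2r //; have : (0 < a)%N by apply: leq_trans b1 ba.
  by clear; lia.
have P i j : (i <= j)%N -> x ^+ i <= x ^+ j by move=> ij; apply: ler_weXn2l.
have Q i j : (i < j)%N -> x ^+ i <= ep * x ^+ j.
  move=> ij; apply: le_trans (_ : (ep * x) * x ^+ i <= _).
    by rewrite ler_peMl // exprn_ge0.
  by rewrite -mulrA -exprS ler_pM2l // P.
have en : ep * x ^+ 20 <= ep * n%:R by rewrite ler_pM2l.
have nn : x ^+ 40 <= n%:R ^+ 2.
  by rewrite -[40%N]/(20 * 2)%N exprM lerXn2r // nnegrE ?exprn_ge0.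
have en2 : ep * x ^+ 40 <= ep * n%:R ^+ 2 by rewrite ler_pM2l.
have U j : (20 < j)%N -> n%:R <= ep * x ^+ j.
  move=> ij; apply: le_trans nT _; apply: le_trans (_ : ep * x * x ^+ 20 <= _).
    by rewrite ler_wpM2r // exprn_ge0.
  by rewrite -mulrA -exprS ler_pM2l // P.
rewrite natrD !natrX -xE -!exprM. rewrite -[ep * x ^+ 9 * _]mulrA -!(exprD x).
split; split; try (by apply: le_trans en; apply: Q); try (by apply: le_trans en2; apply: Q);
  try (by apply: U).
- apply: le_trans en; apply: le_trans (_ : x ^+ 14 * 2 <= _).
    by have := P 9 14 isT; lra.
  apply: le_trans (_ : x ^+ 14 * (ep * x) <= _); first by rewrite ler_wpM2l // exprn_ge0.
  by rewrite mulrCA -exprSr ler_pM2l // P.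
- by rewrite -(expr0 x); apply: Q.
split; try (by apply: le_trans en; apply: Q); try (by rewrite -(expr0 x); apply: Q).
by apply: le_trans en; rewrite -(expr0 x); apply: Q.
Qed.

Section Stages.
Variables (R : realFieldType) (V : finType).
Implicit Types (l : seq (V * V)) (s : {perm V}).
Hypothesis n2 : (1 < #|V|)%N.

Definition longv s k : {set V} := [set v | k <= #|porbit s v|]%N.

Lemma cls_orb s a : cls (orb s) a = porbit s a.
Proof. by apply/setP => b; rewrite inE. Qed.

Lemma bigv_orb s k : bigv (orb s) k = longv s k.
Proof. by apply/setP => b; rewrite !inE cls_orb. Qed.

Lemma cls_leq (E E' : rel V) a : subrel E E' -> (#|cls E a| <= #|cls E' a|)%N.
Proof. by move=> s; apply/subset_leq_card/cls_sub. Qed.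

Lemma maxc_le (E E' : rel V) : subrel E E' -> (maxc E <= maxc E')%N.
Proof.
move=> sE; apply/bigmax_leqP => a _; apply: leq_trans (cls_leq a sE) _.
exact: leq_bigmax.
Qed.

Lemma maxc_attained (E : rel V) : exists a, maxc E = #|cls E a|.
Proof.
have /card_gt0P[a0 _] : (0 < #|V|)%N by apply: ltnW.
by have [a e] := @bigop.eq_bigmax V (fun a => #|cls E a|) (ltnW n2); exists a.
Qed.

Lemma EL_mono_time (F : seq (V * V) -> R) t1 t2 : (t1 <= t2)%N ->
  (forall l l', F l <= F (l ++ l')) -> EL (pairs V) t1 F <= EL (pairs V) t2 F.
Proof.
move=> t12 Fm; rewrite -(subnKC t12) EL_cat; apply: ler_EL => l _.
rewrite -[leLHS](@EL_cst R _ (pairs V) (t2 - t1)) ?pairs_neq0 //.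
by apply: ler_EL => l' _.
Qed.

Definition shortv s E k : {set V} := [set a | (#|porbit s a| < k)%N && (k <= #|cls E a|)%N].

Lemma EL_shortv s k r :
  EL (pairs V) r (fun l => #|shortv (s * prodl l)%g (Efold (orb s) l) k|%:R : R)
  <= 4 * k%:R ^+ 2 * r%:R / #|V|.-1%:R.
Proof.
have := EL_bad_vertices R n2 s k predT r.
by under eq_EL => l _ do rewrite filter_predT.
Qed.

Lemma EL_shortv1 k r :
  EL (pairs V) r (fun l => #|shortv (prodl l) (Efold (@eq_op V) l) k|%:R : R)
  <= 4 * k%:R ^+ 2 * r%:R / #|V|.-1%:R.
Proof.
apply: le_trans (EL_shortv 1%g k r); apply: ler_EL => l _; rewrite ler_nat mul1g.
apply: subset_leq_card; apply/subsetP => a; rewrite !inE => /andP[-> ka] /=.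
apply: leq_trans ka _; apply: cls_leq; apply: Efold_mono => x y /eqP->.
by case: (orb_eqv (1%g : {perm V})).
Qed.

(** The starting permutation is arbitrary, so splits are counted over the last [r] steps alone; this
    treats times that are not of order [n]. *)
Lemma EL_short_restart s k h L B r : (h <= #|V|)%N -> (0 < L)%N ->
  #|V|%:R ^+ 2 <= L%:R * h%:R ^+ 2 :> R -> (#|V| + B <= r %/ L)%N ->
  EL (pairs V) r (fun l => #|~: longv (s * prodl l)%g k|%:R : R) <=
  4 * k%:R ^+ 2 * r%:R / #|V|.-1%:R + (2 * h%:R + #|V|%:R * (B.+1%:R)^-1 + k%:R).
Proof.
move=> hn L0 Lh aB.
have aB' : (#|V| %/ 1 + B <= r %/ L)%N by rewrite divn1.
have vE := orb_eqv s.
have := maxc_sprinkle vE (ltn0Sn 0) n2 hn L0 Lh aB'.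
have -> : #|bigv (orb s) 1| = #|V|.
  apply: eq_card => a; rewrite !inE; apply/card_gt0P; exists a.
  by rewrite inE; case: vE.
move=> hs.
apply: le_trans (_ : EL (pairs V) r (fun l =>
   #|shortv (s * prodl l)%g (Efold (orb s) l) k|%:R +
   (#|V|%:R + k%:R - (maxc (Efold (orb s) l))%:R)) <= _).
  apply: ler_EL => l _; set E := Efold _ _.
  have vE' : eqv E by apply: eqv_Efold.
  have mV : (maxc E <= #|V|)%N by apply/bigmax_leqP => a _; apply: max_card.
  rewrite -natrD -natrB; last by apply: leq_trans mV (leq_addr _ _).
  rewrite -natrD ler_nat.
  have h1 : (#|~: longv (s * prodl l) k| <= #|shortv (s * prodl l)%g E k| + #|~: bigv E k|)%N.
    apply: leq_trans (leq_card_setU _ _).1; apply: subset_leq_card; apply/subsetP => a.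
    by rewrite !inE -!ltnNge => ->; case: leqP.
  apply: leq_trans h1 _; rewrite leq_add2l.
  have [a aE] := maxc_attained E.
  have [ka|ka] := leqP k (maxc E); last first.
    by apply: leq_trans (max_card _) _; clear -ka; lia.
  have : cls E a \subset bigv E k.
    apply/subsetP => b; rewrite !inE => ab.
    by rewrite -(cls_eq vE' ab) -aE.
  move/subset_leq_card; rewrite -aE; have := cardsC (bigv E k).
  by move: #|bigv E k| #|~: _| => x y; clear; lia.
rewrite ELD ELB EL_cst ?pairs_neq0 //; apply: lerD; first exact: EL_shortv.
by move: hs; move: (EL _ _ _) (#|V|%:R * _) => x y; lra.
Qed.

(** Cycles of length at least [k1] form at most [n / k1] blocks, so the union bound of sprinkling is
    already beaten by a number of steps of order [n / k1], small compared with [n]. *)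
Lemma EL_merge_long s k1 K h L B r (D := longv s k1) :
  (0 < k1)%N -> (h <= #|V|)%N -> (0 < L)%N ->
  #|V|%:R ^+ 2 <= L%:R * h%:R ^+ 2 :> R -> (#|V| %/ k1 + B <= r %/ L)%N ->
  EL (pairs V) r (fun l => #|D :\: longv (s * prodl l)%g K|%:R : R) <=
  4 * K%:R ^+ 2 * r%:R / #|V|.-1%:R + (2 * h%:R + K%:R + #|V|%:R * (B.+1%:R)^-1).
Proof.
move=> k10 hn L0 Lh aB; have vE := orb_eqv s.
have := sprinkling_small vE k10 n2 hn L0 Lh aB.
rewrite -/(bigv (orb s) k1) bigv_orb -/D => hs.
apply: le_trans (_ : EL (pairs V) r (fun l =>
   #|shortv (s * prodl l)%g (Efold (orb s) l) K|%:R +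
   ((2 * h%:R + K%:R) +
   #|V|%:R * (~~ [exists a, #|D| <= #|cls (Efold (orb s) l) a :&: D| + h.*2])%N%:R)) <= _).
  apply: ler_EL => l _; set E := Efold _ _.
  have vE' : eqv E by apply: eqv_Efold.
  case: (boolP [exists a, _]) => [/existsP[a aD]|_] /=; last first.
    rewrite mulr1; apply: ler_wpDl => //; apply: ler_wpDl; first by rewrite addr_ge0 // mulr_ge0.
    by rewrite ler_nat max_card.
  rewrite mulr0 addr0 -natrM -!natrD ler_nat mul2n.
  have [Ka|Ka] := leqP K #|cls E a|; last first.
    apply: leq_trans (subset_leq_card (subsetDl _ _)) _; apply: leq_trans aD _.
    have := subset_leq_card (subsetIl (cls E a) D); move: Ka.
    by move: #|cls E a| #|_ :&: _| #|shortv _ _ _| => x y z; clear; lia.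
  apply: leq_trans (_ : #|shortv (s * prodl l)%g E K :|: (D :\: cls E a)| <= _)%N.
    apply: subset_leq_card; apply/subsetP => b; rewrite !inE -!ltnNge => /andP[bK ->].
    rewrite bK andbT /=; case: (boolP (E a b)) => ab; rewrite ?orbT ?orbF //.
    by rewrite -(cls_eq vE' ab).
  apply: leq_trans (leq_card_setU _ _).1 _; rewrite leq_add2l.
  have := cardsID (cls E a) D; rewrite setIC; move: aD.
  by move: #|_ :&: _| #|_ :\: _| #|D| => x y z; clear; lia.
by rewrite ELD ELD EL_cst ?pairs_neq0 // ELZ; apply: lerD; rewrite ?EL_shortv // lerD2l ler_wpM2l.
Qed.

End Stages.

Lemma small_all (R : realFieldType) (bs : seq R) : all (fun b => 0 < b) bs ->
  exists2 ep, 0 < ep & all (fun b => ep <= b) bs.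
Proof.
elim: bs => [|b bs IH] /=; first by exists 1.
case/andP => b0 /IH[ep ep0 h]; exists (Num.min b ep); first by rewrite lt_min b0.
rewrite ge_min lexx /=; apply/allP => x xb; apply: le_trans (allP h x xb).
by rewrite ge_min lexx orbT.
Qed.

Section Det.
Variables (R : realFieldType) (V : finType).
Hypothesis n2 : (1 < #|V|)%N.
Implicit Types (l : seq (V * V)).
Notation EG l := (Efold (@eq_op V) l).

Definition top (E : rel V) : {set V} :=
  if [pick a | #|cls E a| == maxc E] is Some a then cls E a else set0.

Lemma topP E : exists2 a, top E = cls E a & #|top E| = maxc E.
Proof.
rewrite /top; case: pickP => [a /eqP e|h]; first by exists a.
by have [a e] := maxc_attained n2 E; have := h a; rewrite e eqxx.
Qed.

Lemma orb_EG l : subrel (orb (prodl l)) (EG l).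
Proof.
have h : subrel (orb 1%g) (@eq_op V).
  by move=> x y; rewrite /orb => /porbitP[i ->]; rewrite expg1n perm1.
by have := orb_prodl h (l := l); rewrite mul1g.
Qed.

Lemma EG_cat l l' : subrel (EG l) (EG (l ++ l')).
Proof. by rewrite Efold_cat; apply: Efold_sub. Qed.

(** The good event for the window: many vertices in long cycles, few in cycles of intermediate
    length, and the long vertices nearly equal to one final component, outside which few vertices
    lie in components of size [k0]. The first two conditions depend on [l] alone. *)
Definition ok (de eta : R) (K k0 : nat) l l3 : bool :=
  [&& de * #|V|%:R <= #|longv (prodl l) K|%:R,
      #|[set v | k0 <= #|porbit (prodl l) v| < K]%N|%:R <= eta * #|V|%:R &
      [exists a, (#|longv (prodl l) K :\: cls (EG (l ++ l3)) a| +
        #|cls (EG (l ++ l3)) a :\: longv (prodl l) K| +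
        #|bigv (EG (l ++ l3)) k0 :\: cls (EG (l ++ l3)) a|)%:R <= eta * #|V|%:R]].

(** Three defects: final components of size [k0] outside the early giant, vertices of the early
    giant not in cycles of length [k1], and such cycles not lifted to length [K]. Their sum
    dominates each set that [ok] requires to be small. *)
Definition excess (K k0 k1 : nat) l1 l2 l3 : nat :=
  (#|bigv (EG (l1 ++ l2 ++ l3)) k0 :\: top (EG l1)| +
   (#|top (EG l1) :\: longv (prodl l1) k1| +
    #|longv (prodl l1) k1 :\: longv (prodl l1 * prodl l2)%g K|))%N.

Lemma ok_excess (de0 de eta eta' : R) K k0 k1 l1 l2 l3 :
  de + eta' <= de0 -> 3 * eta' <= eta -> 0 <= eta' -> (k0 <= K)%N -> k0%:R <= de0 * #|V|%:R ->
  de0 * #|V|%:R <= (maxc (EG l1))%:R ->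
  (excess K k0 k1 l1 l2 l3)%:R <= eta' * #|V|%:R -> ok de eta K k0 (l1 ++ l2) l3.
Proof.
move=> hde heta e0 kK hk0 hG; rewrite /excess.
have [a tE tm] := topP (EG l1); rewrite -tm in hG.
set T := top _ in tE tm hG *; set E := EG (l1 ++ l2 ++ l3).
set D := longv (prodl l1) k1; rewrite -prodl_cat; set s := prodl (l1 ++ l2).
set A := longv s K; set B := bigv E k0 => hX.
have nR : 0 <= #|V|%:R :> R by [].
have vE : eqv E by apply/eqv_Efold/eq_op_eqv.
have vE1 : eqv (EG l1) by apply/eqv_Efold/eq_op_eqv.
have kT : (k0 <= #|T|)%N by rewrite -(ler_nat R); apply: le_trans hk0 hG.
pose G := cls E a.
have TG : T \subset G by rewrite tE; apply: cls_sub; apply: EG_cat.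
have GB : G \subset B.
  apply/subsetP => b; rewrite !inE => ab; rewrite -(cls_eq vE ab).
  by apply: leq_trans kT (subset_leq_card TG).
have sE : subrel (orb s) E.
  move=> x y /orb_EG; rewrite /E catA; exact: EG_cat.
have longB v : (k0 <= #|porbit s v|)%N -> v \in B.
  rewrite inE => /leq_trans; apply; rewrite -cls_orb; exact: cls_leq.
have BA : (#|B :\: A| <= #|B :\: T| + (#|T :\: D| + #|D :\: A|))%N.
  apply: leq_trans (_ : #|(B :\: T) :|: ((T :\: D) :|: (D :\: A))| <= _)%N.
    apply: subset_leq_card; apply/subsetP => v; rewrite !in_setU !in_setD.
    by case: (v \in B); case: (v \in A); case: (v \in T); case: (v \in D).
  apply: leq_trans (leq_card_setU _ _).1 _; rewrite leq_add2l.
  exact: (leq_card_setU _ _).1.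
set X := (#|_| + _)%N in hX BA.
have BT : (#|B :\: T| <= X)%N by rewrite leq_addr.
have en : 3 * (eta' * #|V|%:R) <= eta * #|V|%:R by rewrite mulrA ler_wpM2r.
have e0n : 0 <= eta' * #|V|%:R by rewrite mulr_ge0.
rewrite /ok; apply/and3P; split.
- have h1 : (#|T| <= #|A| + (#|T :\: D| + #|D :\: A|))%N.
    apply: leq_trans (_ : #|A :|: ((T :\: D) :|: (D :\: A))| <= _)%N.
      apply: subset_leq_card; apply/subsetP => v; rewrite !in_setU !in_setD.
      by case: (v \in A); case: (v \in T); case: (v \in D).
    apply: leq_trans (leq_card_setU _ _).1 _; rewrite leq_add2l.
    exact: (leq_card_setU _ _).1.
  have h2 : #|T|%:R <= #|A|%:R + X%:R :> R.
    rewrite -natrD ler_nat; apply: leq_trans h1 _; rewrite leq_add2l /X.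
    exact: leq_addl.
  have h3 : (de + eta') * #|V|%:R <= de0 * #|V|%:R by rewrite ler_wpM2r.
  move: h2 h3 hX hG; rewrite -/s -/A mulrDl.
  by move: (X%:R : R) (#|T|%:R : R) (#|A|%:R : R) => x y z; lra.
- apply: le_trans (_ : X%:R <= _); last by lra.
  rewrite ler_nat; apply: leq_trans BA; apply: subset_leq_card; apply/subsetP => v.
  by rewrite inE => /andP[v1 v2]; rewrite inE longB // inE -ltnNge v2.
apply/existsP; exists a; rewrite -catA -/E -/G -/B -/A.
apply: le_trans (_ : (X + X + X)%:R <= _); last by rewrite natrD natrD; move: hX; move: (X%:R : R) => x; lra.
rewrite ler_nat; apply: leq_add; first apply: leq_add.
- apply: leq_trans BT; apply: subset_leq_card; apply/subsetP => v.
  rewrite in_setD => /andP[vG]; rewrite inE => vA; rewrite in_setD longB ?andbT.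
    by apply: contra vG; apply: (subsetP TG).
  by apply: leq_trans kK vA.
- by apply: leq_trans BA; rewrite subset_leq_card // setSD.
by apply: leq_trans BT; rewrite subset_leq_card // setDS.
Qed.

End Det.

Lemma EL_le_pt (R : realFieldType) (V : finType) (n2 : (1 < #|V|)%N) (r : nat)
    (F : seq (V * V) -> R) (c : R) : (forall l, lists (pairs V) r l -> F l <= c) ->
  EL (pairs V) r F <= c.
Proof.
move=> h; rewrite -[leRHS](@EL_cst R _ (pairs V) r) ?pairs_neq0 //.
exact: ler_EL.
Qed.

Section Expect.
Variables (R : realType) (V : finType).
Hypothesis n2 : (1 < #|V|)%N.
Notation EG l := (Efold (@eq_op V) l).
Variables (k0 k1 K t' s1 s h L B : nat) (ze ep de0 : R).
Let n : R := #|V|%:R.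
Hypotheses (hn : (h <= #|V|)%N) (L0 : (0 < L)%N)
  (Lh : #|V|%:R ^+ 2 <= L%:R * h%:R ^+ 2 :> R) (hz : h%:R <= ze * n)
  (Bz : n * (B.+1%:R)^-1 <= ze * n) (BV : (B <= #|V|)%N) (ze0 : 0 <= ze).
Hypotheses (k10 : (0 < k1)%N) (k1n : k1%:R ^+ 2 <= ep * n) (k1n' : k1%:R <= ep * n)
  (Kn : K%:R ^+ 2 * s1%:R <= ep * n ^+ 2) (Kn' : K%:R <= ep * n)
  (s1n : (#|V| %/ k1 + B <= s1 %/ L)%N) (epz : 16 * L%:R * ep <= ze) (ep0 : 0 <= ep).
Hypotheses (k0n : k0%:R <= de0 * n) (k1d : k1%:R <= de0 * n)
  (gi : EL (pairs V) t' (fun l => ((maxc (EG l))%:R < de0 * n)%R%:R : R) <= ze)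
  (st : EL (pairs V) (t' + s1 + s) (fun l => #|bigv (EG l) k0|%:R : R) <=
     EL (pairs V) t' (fun l => (maxc (EG l))%:R) + ze * n).

Let n0 : 0 < n. Proof. by rewrite ltr0n ltnW. Qed.
Let n1 : n <= 2 * #|V|.-1%:R. Proof. by rewrite -natrM ler_nat; clear -n2; lia. Qed.
Let n1p : 0 < #|V|.-1%:R :> R. Proof. by move: n0 n1; lra. Qed.
Let LR : 1 <= L%:R :> R. Proof. by rewrite ler1n. Qed.

(** When the early giant is large, it is contained in the final set of vertices in components of
    size [k0]. The size of the difference is then the difference of the sizes, and the comparison of
    means [st] is enough. *)
Lemma excess1 :
  EL (pairs V) t' (fun l1 => EL (pairs V) s1 (fun l2 => EL (pairs V) s (fun l3 =>
    #|bigv (EG (l1 ++ l2 ++ l3)) k0 :\: top (EG l1)|%:R))) <= 2 * ze * n.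
Proof.
apply: le_trans (_ : EL (pairs V) t' (fun l1 => EL (pairs V) s1 (fun l2 => EL (pairs V) s (fun l3 =>
    #|bigv (EG (l1 ++ l2 ++ l3)) k0|%:R))) - EL (pairs V) t' (fun l => (maxc (EG l))%:R) +
    n * EL (pairs V) t' (fun l => ((maxc (EG l))%:R < de0 * n)%R%:R) <= _); last first.
  have e : EL (pairs V) t' (fun l1 => EL (pairs V) s1 (fun l2 => EL (pairs V) s (fun l3 =>
    #|bigv (EG (l1 ++ l2 ++ l3)) k0|%:R : R))) =
    EL (pairs V) (t' + s1 + s) (fun l => #|bigv (EG l) k0|%:R).
    rewrite -addnA EL_cat; apply: eq_EL => l1 _; by rewrite EL_cat.
  rewrite e; have := ler_wpM2l (ltW n0) gi; move: st.
  by move: (EL _ _ _) (EL _ _ _) (n * EL _ _ _) => x y z; rewrite [n * ze]mulrC; lra.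
rewrite -ELB -ELZ -ELD; apply: ler_EL => l1 _.
have [a tE tm] := topP n2 (EG l1).
rewrite -[X in _ <= _ - X + _](@EL_cst R _ (pairs V) s1) ?pairs_neq0 //.
rewrite -[X in _ <= _ - _ + X](@EL_cst R _ (pairs V) s1) ?pairs_neq0 //.
rewrite -ELB -ELD; apply: ler_EL => l2 _.
rewrite -[X in _ <= _ - X + _](@EL_cst R _ (pairs V) s) ?pairs_neq0 //.
rewrite -[X in _ <= _ - _ + X](@EL_cst R _ (pairs V) s) ?pairs_neq0 //.
rewrite -ELB -ELD; apply: ler_EL => l3 _.
set E := EG (l1 ++ l2 ++ l3); set T := top _ in tE tm *.
have vE : eqv E by apply/eqv_Efold/eq_op_eqv.
have [hl|hl] := ltP; last first.
  rewrite mulr0 addr0 -tm; rewrite -tm in hl.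
  have kT : (k0 <= #|T|)%N by rewrite -(ler_nat R); apply: le_trans k0n hl.
  have TB : T \subset bigv E k0.
    have TG : T \subset cls E a by rewrite tE; apply: cls_sub; apply: EG_cat.
    apply: subset_trans TG _; apply/subsetP => b; rewrite !inE => ab.
    rewrite -(cls_eq vE ab); apply: leq_trans kT _; rewrite tE.
    by apply: cls_leq; apply: EG_cat.
  by rewrite cardsD (setIidPr TB) natrB // subset_leq_card.
rewrite mulr1; apply: le_trans (_ : #|bigv E k0|%:R <= _).
  by rewrite ler_nat subset_leq_card // subsetDl.
have : (maxc (EG l1))%:R <= n.
  by rewrite ler_nat; apply/bigmax_leqP => b _; apply: max_card.
by move: (maxc _)%:R (#|bigv E k0|%:R : R) => x y; lra.
Qed.

Lemma excess2 :
  EL (pairs V) t' (fun l1 => #|top (EG l1) :\: longv (prodl l1) k1|%:R : R) <= 6 * ze * n.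
Proof.
have kk r : r%:R <= 2 * L%:R * n -> 4 * k1%:R ^+ 2 * r%:R / #|V|.-1%:R <= ze * n.
  move=> rn; rewrite ler_pdivrMr //.
  apply: le_trans (_ : 4 * (ep * n) * (2 * L%:R * n) <= _).
    apply: ler_pM => //; first by rewrite mulr_ge0 // sqr_ge0.
    by rewrite ler_pM2l.
  have h1 : 16 * L%:R * ep * (n * n / 2) <= ze * (n * n / 2).
    by rewrite ler_wpM2r // divr_ge0 // mulr_ge0 // ltW.
  have h2 : ze * n * n <= ze * n * (2 * #|V|.-1%:R).
    by rewrite ler_wpM2l // mulr_ge0 // ltW.
  lra.
(* The number of short splits is controlled for [t'] of order [n]. For larger [t'] only the last
   [2 L n] steps are considered, from an arbitrary permutation. *)
have [tM|tM] := leqP t' (2 * L * #|V|).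
  apply: le_trans (_ : EL (pairs V) t' (fun l =>
     #|shortv (prodl l) (EG l) k1|%:R + n * ((maxc (EG l))%:R < de0 * n)%R%:R) <= _).
    apply: ler_EL => l _; have [a tE tm] := topP n2 (EG l).
    have vE : eqv (EG l) by apply/eqv_Efold/eq_op_eqv.
    have [hl|hl] := ltP.
      rewrite mulr1; apply: ler_wpDl => //; by rewrite ler_nat max_card.
    rewrite mulr0 addr0 ler_nat; apply: subset_leq_card; apply/subsetP => v.
    rewrite tE !inE -ltnNge => /andP[-> av] /=; rewrite -(cls_eq vE av) -tE tm.
    by rewrite -(ler_nat R); apply: le_trans k1d hl.
  rewrite ELD ELZ.
  have h1 := le_trans (EL_shortv1 R n2 k1 t') (kk t' _).
  have := ler_wpM2l (ltW n0) gi.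
  have : EL (pairs V) t' (fun l => #|shortv (prodl l) (EG l) k1|%:R : R) <= ze * n.
    by apply: h1; rewrite -!natrM ler_nat.
  have := mulr_ge0 ze0 (ltW n0).
  by move: (EL _ _ _) (n * EL _ _ _) => x y; rewrite [n * ze]mulrC; lra.
pose r := (2 * L * #|V|)%N.
have aB : (#|V| + B <= r %/ L)%N.
  rewrite /r leq_divRL // mulnAC [leqRHS]mulnC [(2 * _)%N]mulnC mulnA.
  by move: BV; move: #|V| => v; clear; nia.
have e : t' = (t' - r + r)%N by rewrite subnK // ltnW.
rewrite e EL_cat; apply: EL_le_pt => // l0 _.
apply: le_trans (_ : EL (pairs V) r (fun l => #|~: longv (prodl l0 * prodl l)%g k1|%:R) <= _).
  apply: ler_EL => l _; rewrite ler_nat subset_leq_card // prodl_cat.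
  by apply/subsetP => v; rewrite in_setD in_setC => /andP[].
apply: le_trans (EL_short_restart n2 (prodl l0) k1 hn L0 Lh aB) _.
have h1 : 4 * k1%:R ^+ 2 * r%:R / #|V|.-1%:R <= ze * n by apply: kk; rewrite -!natrM ler_nat.
have h2 : ep * n <= ze * n.
  rewrite ler_pM2r //; apply: le_trans epz; rewrite ler_peMl //.
  by move: LR; lra.
have := mulr_ge0 ze0 (ltW n0).
move: Bz hz h1 h2 k1n'; rewrite -/n -[6 * ze * n]mulrA; move: (_ / #|V|.-1%:R) (n * _^-1) (h%:R : R) (ep * n) (ze * n) => x y z w v; lra.
Qed.

Lemma excess3 :
  EL (pairs V) t' (fun l1 => EL (pairs V) s1 (fun l2 =>
    #|longv (prodl l1) k1 :\: longv (prodl l1 * prodl l2)%g K|%:R : R)) <= 5 * ze * n.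
Proof.
apply: EL_le_pt => // l1 _.
apply: le_trans (EL_merge_long n2 (prodl l1) K k10 hn L0 Lh s1n) _.
have h1 : 4 * K%:R ^+ 2 * s1%:R / #|V|.-1%:R <= 8 * ep * n.
  rewrite ler_pdivrMr //; have hq : ep * n * n <= ep * n * (2 * #|V|.-1%:R).
    by rewrite ler_wpM2l // mulr_ge0 // ltW.
  by move: Kn; rewrite (expr2 n); lra.
have h2 : 16 * (ep * n) <= ze * n.
  rewrite mulrA ler_pM2r //; apply: le_trans epz; rewrite ler_wpM2r //.
  by move: LR; lra.
have := mulr_ge0 ze0 (ltW n0); have := mulr_ge0 ep0 (ltW n0).
move: Bz hz h1 h2 Kn'; rewrite -/n -[5 * ze * n]mulrA -[8 * ep * n]mulrA; move: (_ / #|V|.-1%:R) (n * _^-1) (h%:R : R) (ep * n) (ze * n) => x y z w v; lra.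
Qed.

End Expect.

Theorem stages (R : realType) (c : R) : 2^-1 < c ->
  exists2 de : R, 0 < de <= 1 & forall eta : R, 0 < eta -> exists k0 n0 : nat,
  forall V : finType, (n0 <= #|V|)%N -> forall t : nat, c * #|V|%:R <= t%:R ->
  exists K s t0 : nat,
  [/\ (t = t0 + s)%N, (0 < K)%N, 1 <= eta * s%:R, #|V|%:R <= eta * s%:R * K%:R &
      k0%:R <= eta * #|V|%:R] /\
  [/\ s%:R * k0%:R <= eta * #|V|%:R, s%:R ^+ 2 <= eta * #|V|%:R,
      K%:R ^+ 2 * s%:R <= eta * #|V|%:R ^+ 2, (1 < #|V|)%N &
      EL (pairs V) t0 (fun l => EL (pairs V) s (fun l3 =>
        (~~ ok de eta K k0 l l3)%:R)) <= eta].
Proof.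
move=> c12.
(* [c'] leaves [(c - c') n] steps for merging and for the window, while the giant is still present
   at time [c' n]. *)
have [c' [c'1 c'c]] : exists c' : R, 2^-1 < c' /\ c' < c by exists ((c + 2^-1) / 2); lra_local.
have [de0 de00 GI] := giant_exists c'1.
have [de [dep de1 ded]] : exists de : R, [/\ 0 < de, de <= 1 & 2 * de <= de0].
  exists (Num.min 1 (de0 / 2)); split; first by rewrite lt_min ltr01 divr_gt0.
    by rewrite ge_min lexx.
  have : Num.min 1 (de0 / 2) <= de0 / 2 by rewrite ge_min lexx orbT.
  lra_local.
exists de; first by rewrite dep.
move=> eta eta0.
have [eta' [e'0 e'd e'e]] : exists e' : R, [/\ 0 < e', e' <= de & 3 * e' <= eta].
  exists (Num.min de (eta / 3)); split; first by rewrite lt_min dep divr_gt0.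
    by rewrite ge_min lexx.
  have : Num.min de (eta / 3) <= eta / 3 by rewrite ge_min lexx orbT.
  lra_local.
have [ze [ze0 ze1 zee ze8]] : exists ze : R, [/\ 0 < ze, 13 * ze <= eta / 2 * eta', ze <= eta / 2 & ze <= 8^-1].
  have [|ze ze0 /and4P[h1 h2 h3 _]] := @small_all R [:: eta / 2 * eta' / 13; eta / 2; 8^-1].
    have p1 : 0 < eta / 2 by rewrite divr_gt0.
    by rewrite /= p1 invr_gt0 ltr0n andbT /= divr_gt0 // mulr_gt0.
  by exists ze; split => //; move: h1; rewrite ler_pdivlMr //; lra_local.
have [k0 [e ee0 [n1 GS]]] := giant_stable c12 ze0.
have [n3 GI'] := GI ze ze0.
have [L Lle] := nat_above (4 / ze ^+ 2).
have L0 : (0 < L)%N by rewrite -(ltr0n R); apply: lt_le_trans Lle; rewrite divr_gt0 // exprn_gt0.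
have LR : 0 < L%:R :> R by rewrite ltr0n.
have [B Ble] := nat_above (ze^-1 : R).
have cc0 : 0 < c - c' by lra_local.
have [|ep ep0] := @small_all R [:: ze / (16 * L%:R); eta; e; c - c'; eta / k0.+1%:R;
   (4 * L%:R)^-1; (4 * L%:R * B.+1%:R)^-1; de0; (k0.+1%:R)^-1].
  have L4 : 0 < 4 * L%:R :> R by rewrite mulr_gt0.
  have p1 : 0 < ze / (16 * L%:R) by rewrite divr_gt0 // mulr_gt0.
  have p2 : 0 < eta / k0.+1%:R by rewrite divr_gt0 // ltr0n.
  have p3 : 0 < (4 * L%:R * B.+1%:R)^-1 :> R by rewrite invr_gt0 mulr_gt0 // ltr0n.
  by rewrite /= eta0 ee0 cc0 de00 p1 p2 p3 !invr_gt0 L4 ltr0n.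
rewrite /= => /and5P[b1 b2 b3 b4 /and5P[b5 b6 b7 b8 /andP[b9 _]]].
have [n4 SC] := scales ep0.
have [n5 n5le] := nat_above (2 / ze).
have [n6 n6le] := nat_above (k0.+1%:R / de0).
exists k0, (n1 + n3 + n4 + n5 + n6 + B + 2)%N => V nV t ct.
have [a1 [a3 [a4 [a5 [a6 [a7 a8]]]]]] : (n1 <= #|V| /\ n3 <= #|V| /\ n4 <= #|V| /\ n5 <= #|V| /\
   n6 <= #|V| /\ B <= #|V| /\ 1 < #|V|)%N.
  by move: nV; move: #|V| => v; clear; lia.
have n0 : 0 < #|V|%:R :> R by rewrite ltr0n ltnW.
have [k1 [s1 [K [s [[q1 q2 q3 q4 q5] [q6 q7 q8 q9 [q10 q11 q12 q13]]]]]]] := SC _ a4.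
have up (b : R) x : ep <= b -> 0 <= x -> ep * x <= b * x by move=> h x0; rewrite ler_wpM2r.
have s1s : (s1 + s <= t)%N.
  rewrite -(ler_nat R); apply: le_trans q5 _; apply: le_trans (up _ _ b4 (ltW n0)) _.
  by apply: le_trans ct; rewrite ler_pM2r //; lra_local.
pose t' := (t - (s1 + s))%N.
have tE : t = (t' + s1 + s)%N by rewrite -addnA subnK.
have t'R : t'%:R = t%:R - (s1 + s)%:R :> R by rewrite natrB.
have KR : 0 < K%:R :> R.
  have : 0 < ep * K%:R by apply: lt_le_trans q12.
  by rewrite pmulr_rgt0.
have K0 : (0 < K)%N by rewrite -(ltr0n R).
have sR : 0 <= s%:R :> R by [].
have s1R : 1 <= s%:R :> R.
  rewrite ler1n; case: (s) q9 => //; rewrite mulr0 ler10 //.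
have k0R : k0%:R <= k0.+1%:R :> R by rewrite ler_nat.
have kp : 0 < k0.+1%:R :> R by rewrite ltr0n.
exists K, s, (t' + s1)%N; split; split => //.
- by apply: le_trans q9 _; apply: up.
- by apply: le_trans q7 _; rewrite -!mulrA; apply: up => //; rewrite mulr_ge0.
- have := up _ _ b5 (ltW n0); move: q13 => h1 h2.
  have : k0.+1%:R * 1 <= k0.+1%:R * (eta / k0.+1%:R * #|V|%:R).
    by rewrite ler_pM2l //; apply: le_trans h2.
  have -> : k0.+1%:R * (eta / k0.+1%:R * #|V|%:R) = eta * #|V|%:R.
    by move: kp; move: (k0.+1%:R : R) => k kp; field; rewrite gt_eqF.
  by rewrite mulr1; apply: le_trans.
- have ss : s%:R <= s%:R ^+ 2 :> R by rewrite expr2 ler_peMl.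
  apply: le_trans (_ : (eta / k0.+1%:R * #|V|%:R) * k0.+1%:R <= _).
    apply: ler_pM => //; apply: le_trans ss _; apply: le_trans q6 _; exact: up (ltW n0).
  rewrite le_eqVlt; apply/orP; left; apply/eqP.
  by move: kp; move: (k0.+1%:R : R) => k kp; field; rewrite gt_eqF.
- by apply: le_trans q6 _; apply: up => //; apply: ltW.
- by apply: le_trans q8 _; apply: up => //; apply: sqr_ge0.
rewrite EL_cat.
have zn : 2 <= ze * #|V|%:R.
  move: n5le; rewrite ler_pdivrMr // mulrC => /le_trans; apply.
  by rewrite ler_pM2l // ler_nat.
have [h h1 h2] := natfrac (ltW ze0) zn.
have hn : (h <= #|V|)%N.
  rewrite -(ler_nat R); apply: le_trans h2 _; rewrite ler_piMl ?(ltW n0) //; lra_local.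
have Lh : #|V|%:R ^+ 2 <= L%:R * h%:R ^+ 2 :> R.
  apply: le_trans (_ : 4 / ze ^+ 2 * (ze * #|V|%:R / 2) ^+ 2 <= _).
    by rewrite le_eqVlt; apply/orP; left; apply/eqP; field; rewrite gt_eqF.
  have h0 : 0 <= ze * #|V|%:R / 2 by lra_local.
  apply: ler_pM => //; rewrite ?divr_ge0 ?exprn_ge0 ?(ltW ze0) //.
  by apply: lerXn2r => //; rewrite nnegrE; lra_local.
have Bn : #|V|%:R * (B.+1%:R)^-1 <= ze * #|V|%:R.
  rewrite mulrC ler_pM2r // -[leRHS]invrK lef_pV2 ?posrE ?invr_gt0 //.
  by apply: le_trans Ble _; rewrite ler_nat.
have k10 : (0 < k1)%N.
  rewrite lt0n; apply/eqP => e1; move: q4; rewrite e1 mul0r mulr0.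
  by rewrite leNgt n0.
have k1R : 0 < k1%:R :> R by rewrite ltr0n.
have s1n : (#|V| %/ k1 + B <= s1 %/ L)%N.
  have r1 : (#|V| %/ k1)%:R <= #|V|%:R / k1%:R :> R.
    by rewrite ler_pdivlMr // -natrM ler_nat leq_trunc_div.
  have r2 : s1%:R / L%:R <= (s1 %/ L)%:R + 1 :> R.
    by rewrite ler_pdivrMr // natr1 -natrM ler_nat ltnW // ltn_ceil.
  have r3 : #|V|%:R / k1%:R <= s1%:R / L%:R / 4 :> R.
    rewrite ler_pdivrMr //; apply: le_trans q4 _.
    apply: le_trans (up _ _ b6 _) _; first by rewrite mulr_ge0.
    by rewrite le_eqVlt; apply/orP; left; apply/eqP; field; rewrite gt_eqF.
  have r4 : B%:R + 1 <= s1%:R / L%:R / 4 :> R.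
    have : 1 <= (4 * L%:R * B.+1%:R)^-1 * s1%:R :> R by apply: le_trans q10 _; apply: up.
    rewrite mulrC ler_pdivlMr ?mul1r; last by rewrite !mulr_gt0 ?ltr0n.
    have <- : B%:R + 1 = B.+1%:R :> R by rewrite natr1.
    move=> h3; rewrite ler_pdivlMr // ler_pdivlMr //.
    by move: h3; clear; move: (B%:R : R) (L%:R : R) (s1%:R : R) => x y z; lra_local.
  have sL : 0 <= s1%:R / L%:R :> R by rewrite divr_ge0.
  have B0 : 0 <= B%:R :> R by [].
  rewrite -(ler_nat R) natrD; move: r1 r2 r3 r4 sL B0.
  by move: (_ / k1%:R) (_ / L%:R) (_ %/ k1)%:R (_ %/ L)%:R (B%:R : R) => x y z w v; clear; lra_local.
have epz : 16 * L%:R * ep <= ze by move: b1; rewrite ler_pdivlMr ?mulr_gt0 // mulrC.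
have k0n : k0%:R <= de0 * #|V|%:R.
  apply: le_trans k0R _; move: n6le; rewrite ler_pdivrMr // mulrC => /le_trans; apply.
  by rewrite ler_pM2l // ler_nat.
have k1d : k1%:R <= de0 * #|V|%:R by apply: le_trans q11 _; apply: up => //; apply: ltW.
have t'c : c' * #|V|%:R <= t'%:R.
  rewrite t'R; have := le_trans q5 (up _ _ b4 (ltW n0)); move: ct.
  by move: ((s1 + s)%:R : R) (t%:R : R) => x y; rewrite mulrBl; lra_local.
have gi : EL (pairs V) t' (fun l => ((maxc (Efold (@eq_op V) l))%:R < de0 * #|V|%:R)%R%:R : R) <= ze.
  apply: le_trans (GI' V a3 t' t'c); apply: ler_EL => l _.
  have [|hl] := ltP; last by case: (~~ _).
  move=> hl; rewrite (_ : ~~ _) //; apply/existsPn => a; rewrite -ltNge.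
  by apply: le_lt_trans hl; rewrite ler_nat; apply: leq_bigmax.
have st : EL (pairs V) (t' + s1 + s) (fun l => #|bigv (Efold (@eq_op V) l) k0|%:R : R) <=
     EL (pairs V) t' (fun l => (maxc (Efold (@eq_op V) l))%:R) + ze * #|V|%:R.
  rewrite -tE; have [t1 t1t /le_trans] := GS V a1 t ct; apply; rewrite lerD2r.
  apply: EL_mono_time => //; last first.
    by move=> l l'; rewrite ler_nat; apply: maxc_le; apply: EG_cat.
  rewrite -(ler_nat R) t'R; have := le_trans q5 (up _ _ b3 (ltW n0)); move: t1t.
  by move: ((s1 + s)%:R : R) (t%:R : R) (e * _) => x y z; lra_local.
have kK : (k0 <= K)%N.
  rewrite -(ler_nat R); apply: le_trans k0R _.
  have : 1 <= (k0.+1%:R)^-1 * K%:R :> R by apply: le_trans q12 _; apply: up => //; apply: ltW.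
  by rewrite mulrC ler_pdivlMr // mul1r.
have X1 := @excess1 R V a8 k0 t' s1 s ze de0 k0n gi st.
have X2 := @excess2 R V a8 k1 t' h L B ze ep de0 hn L0 Lh h2 Bn a7 (ltW ze0) q1 q11 epz (ltW ep0) k1d gi.
have X3 := @excess3 R V a8 k1 K t' s1 h L B ze ep hn L0 Lh h2 Bn (ltW ze0) k10 q2 q3 s1n epz (ltW ep0).
pose F (l1 l2 l3 : seq (V * V)) : R := (excess K k0 k1 l1 l2 l3)%:R.
have en0 : 0 < eta' * #|V|%:R by rewrite mulr_gt0.
have XS : EL (pairs V) t' (fun l1 => EL (pairs V) s1 (fun l2 => EL (pairs V) s (F l1 l2))) <= 13 * ze * #|V|%:R.
  have -> : 13 * ze * #|V|%:R = 2 * ze * #|V|%:R + (6 * ze * #|V|%:R + 5 * ze * #|V|%:R) by ring.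
  apply: le_trans (lerD X1 (lerD X2 X3)); rewrite -!ELD; apply: ler_EL => l1 _.
  rewrite -[X in _ <= _ + (X + _)](@EL_cst R _ (pairs V) s1) ?pairs_neq0 // -!ELD.
  apply: ler_EL => l2 _; rewrite -[X in _ <= _ + X](@EL_cst R _ (pairs V) s) ?pairs_neq0 // -ELD.
  by apply: ler_EL => l3 _; rewrite /F /excess !natrD.
(* Markov's inequality for [excess] at level [eta' n]; the lists without a giant at time [t'] are
   counted separately. *)
apply: le_trans (_ : EL (pairs V) t' (fun l1 => (eta' * #|V|%:R)^-1 *
    EL (pairs V) s1 (fun l2 => EL (pairs V) s (F l1 l2)) +
    ((maxc (Efold (@eq_op V) l1))%:R < de0 * #|V|%:R)%R%:R) <= _).
  apply: ler_EL => l1 _.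
  have [hl|hl] := ltP.
    apply: le_trans (_ : 1 <= _).
      by apply: EL_le_pt => // l2 _; apply: EL_le_pt => // l3 _; case: (~~ _).
    rewrite lerDr mulr_ge0 ?invr_ge0 ?(ltW en0) //.
    by apply: EL_ge0 => l2 _; apply: EL_ge0.
  rewrite addr0 -ELZ; apply: ler_EL => l2 _; rewrite -ELZ; apply: ler_EL => l3 _.
  case: (boolP (ok _ _ _ _ _ _)) => [_|nok] /=.
    by rewrite mulr_ge0 ?invr_ge0 ?(ltW en0).
  rewrite mulrC ler_pdivlMr // mul1r; apply: contraNT nok; rewrite -ltNge => hX.
  apply: (@ok_excess R V a8 de0 de eta eta' K k0 k1 l1 l2 l3) => //; try exact: ltW.
  by move: ded e'd; lra_local.
rewrite ELD ELZ; apply: le_trans (_ : eta / 2 + eta / 2 <= _); last by lra_local.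
apply: lerD; last by apply: le_trans gi zee.
rewrite mulrC ler_pdivrMr //; apply: le_trans XS _; rewrite mulrA ler_pM2r //.
Qed.

(** * Sampling the cycle structure *)

(** Order statistics are handled through numbers of large entries, so that two sorted sequences can
    be compared without matching their orderings. *)
Lemma nth_sort_geq (P : pred nat) (l : seq nat) i : ~~ P 0%N ->
  (forall x y, (x <= y)%N -> P x -> P y) ->
  P (nth 0%N (sort geq l) i) = (i < count P l)%N.
Proof.
move=> P0 Pup.
have -> : count P l = count P (sort geq l) by apply/seq.permP; rewrite perm_sym perm_sort.
have : sorted geq (sort geq l) by apply: sort_sorted => x y; apply: leq_total.
elim: (sort geq l) i => [|x s IH] i /=; first by rewrite nth_nil (negPf P0).
move=> ps; have ss : sorted geq s by apply: path_sorted ps.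
have xs y : y \in s -> (y <= x)%N.
  have tr : transitive geq by move=> a b c ba cb; apply: leq_trans cb ba.
  by have := order_path_min tr ps => /allP h /h.
have [Px|Px] := boolP (P x).
  by case: i => [|i] //=; rewrite ?Px // IH.
have c0 : count P s = 0%N.
  apply/eqP; rewrite -leqn0 leqNgt -has_count; apply/hasP => -[y ys Py].
  by move: Px; rewrite (Pup _ _ (xs y ys) Py).
rewrite c0 /=; case: i => [|i] /=; first by rewrite (negPf Px).
by rewrite IH // c0.
Qed.

Section Val.
Variable R : realFieldType.

Definition val_at (l : seq nat) (L i : nat) : R := (nth 0%N (sort geq l) i)%:R / L%:R.

Lemma val_ge0 l L i : 0 <= val_at l L i.
Proof. by rewrite divr_ge0. Qed.

Lemma val_le (l1 l2 : seq nat) (L1 L2 : nat) (de : R) i : 0 <= de ->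
  (forall v : R, de < v -> (count (fun x => (v <= x%:R / L1%:R)%R) l1 <=
     count (fun x => (v - de <= x%:R / L2%:R)%R) l2)%N) ->
  val_at l1 L1 i <= val_at l2 L2 i + de.
Proof.
move=> de0 h; have [v1|v1] := leP (val_at l1 L1 i) de.
  by apply: le_trans v1 _; rewrite lerDr val_ge0.
have up (v : R) (L : nat) x y : (x <= y)%N -> v <= x%:R / L%:R -> v <= y%:R / L%:R.
  by move=> xy /le_trans; apply; rewrite ler_wpM2r ?invr_ge0 // ler_nat.
have z (v : R) (L : nat) : 0 < v -> ~~ (v <= 0%:R / L%:R) by move=> v0; rewrite mul0r -ltNge.
have v0 : 0 < val_at l1 L1 i by apply: le_lt_trans v1.
have := nth_sort_geq l1 i (z _ L1 v0) (@up _ L1).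
rewrite lexx => /esym c1; have c2 := leq_trans c1 (h _ v1).
have v2 : 0 < val_at l1 L1 i - de by rewrite subr_gt0.
by have := nth_sort_geq l2 i (z _ L2 v2) (@up _ L2); rewrite c2 lerBlDr.
Qed.

End Val.

Section Cycles.
Variable V : finType.
Implicit Types (s : {perm V}) (w : seq V).

Definition cyc_sizes s : seq nat := [seq #|C| | C : {set V} <- enum (porbits s)].

Lemma count_cyc_sizes s (P : pred nat) :
  count P (cyc_sizes s) = (\sum_(C in porbits s) P #|C|)%N.
Proof.
rewrite count_map -big_enum /=; elim: (enum _) => [|C r IH]; first by rewrite big_nil.
by rewrite big_cons /= IH.
Qed.

Definition hits (C : {set V}) w : nat := count (mem C) w.

(** [typ] lists the cycles hit by the sample. As [P 0] is false, cycles that are not hit contribute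
    nothing, and the sum may run over all of them. *)
Lemma count_typ s (P : pred nat) n w : ~~ P 0%N -> (size w <= n)%N ->
  count P (typ n (orb s) (ones w)) = (\sum_(C in porbits s) P (hits C w))%N.
Proof.
move=> P0; elim: n w => [|n IH] w.
  rewrite leqn0 size_eq0 => /eqP->; rewrite big1 // => C _.
  by rewrite /hits /= (negPf P0).
case: w => [|x w] sw; first by rewrite /= big1 // => C _; rewrite /hits /= (negPf P0).
set wf := [seq y <- w | ~~ orb s x y].
have -> : typ n.+1 (orb s) (ones (x :: w)) =
   hits (porbit s x) (x :: w) :: typ n (orb s) (ones wf).
  rewrite /=; congr (_ :: _).
    by rewrite /hits /= porbit_id big_map /= sum1_count; congr (_ + _)%N.
  by congr (typ n _ _); rewrite /ones filter_map.
rewrite /= IH; last by apply: (@leq_trans (size w)); [rewrite size_filter count_size | exact: sw].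
have C0 : porbit s x \in porbits s by apply: imset_f.
rewrite (bigD1 (porbit s x)) //= [RHS](bigD1 (porbit s x)) //=.
have -> : hits (porbit s x) wf = 0%N.
  apply/eqP; rewrite -leqn0 leqNgt -has_count; apply/hasP => -[y].
  by rewrite mem_filter => /andP[/negP ny _] /=.
rewrite (negPf P0) add0n; congr (_ + _)%N; apply: eq_bigr => C /andP[/imsetP[z _ ->] Cx].
congr (nat_of_bool (P _)); rewrite /hits /=.
have -> : (x \in porbit s z) = false.
  by apply/negbTE; apply: contra Cx => xz; rewrite (porbit_memE xz).
rewrite add0n count_filter; apply: eq_in_count => y _ /=.
case: (boolP (y \in porbit s z)) => // yz /=.
have -> : ~~ orb s x y by apply/negP => yx; move: Cx; rewrite -(porbit_memE yz) (porbit_memE yx) eqxx.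
by [].
Qed.

(** The variances of the frequencies of all cycles add up to at most [1 / m], because the masses
    [p C] sum to 1. Chebyshev's inequality thus holds for all cycles simultaneously, however many
    there are. *)
Lemma sampling (R : realFieldType) s (A : {set V}) m (de : R) : A != set0 -> (0 < m)%N -> 0 < de ->
  EL A m (fun w => (~~ [forall C in porbits s,
     `|(hits C w)%:R / m%:R - #|C :&: A|%:R / #|A|%:R| <= de])%:R : R) <= 1 / (m%:R * de ^+ 2).
Proof.
move=> A0 m0 de0.
have mR : 0 < m%:R :> R by rewrite ltr0n.
have aR : 0 < #|A|%:R :> R by rewrite ltr0n card_gt0.
pose p (C : {set V}) : R := #|C :&: A|%:R / #|A|%:R.
apply: le_trans (_ : EL A m (fun w => \sum_(C in porbits s)
   (de ^+ 2 * m%:R ^+ 2)^-1 * ((hits C w)%:R - m%:R * p C) ^+ 2) <= _).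
  apply: ler_EL => w _.
  have t0 (C : {set V}) : 0 <= (de ^+ 2 * m%:R ^+ 2)^-1 * ((hits C w)%:R - m%:R * p C) ^+ 2.
    by rewrite mulr_ge0 ?sqr_ge0 // invr_ge0 mulr_ge0 // sqr_ge0.
  case: (boolP [forall C in _, _]) => [_|] /=; first by apply: sumr_ge0.
  case/forall_inPn => C Cs; rewrite -ltNge => hC.
  rewrite (bigD1 C) //=; apply: ler_wpDr; first by apply: sumr_ge0.
  rewrite mulrC ler_pdivlMr ?mulr_gt0 ?exprn_gt0 // mul1r.
  have -> : (hits C w)%:R - m%:R * p C = m%:R * ((hits C w)%:R / m%:R - p C).
    by field; rewrite gt_eqF.
  rewrite exprMn mulrC ler_wpM2l ?sqr_ge0 //.
  rewrite -[leRHS]real_normK ?num_real // lerXn2r ?nnegrE ?(ltW de0) //.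
  exact: ltW.
rewrite EL_sum.
have one C : EL A m (fun w => (de ^+ 2 * m%:R ^+ 2)^-1 * ((hits C w)%:R - m%:R * p C) ^+ 2) <=
   (m%:R * de ^+ 2)^-1 * p C.
  pose y x : R := (x \in C)%:R - p C.
  have pE : avg A (fun x => (x \in C)%:R) = p C.
    rewrite /avg /p; congr (_ / _); rewrite -natr_sum; congr (_%:R).
    rewrite -sum1_card big_mkcond [RHS]big_mkcond /=; apply: eq_bigr => x _.
    by rewrite inE; case: (x \in A); case: (x \in C).
  have y0 : avg A y = 0 by rewrite /y avgB avg_cst // pE subrr.
  have v : avg A (fun x => y x ^+ 2) <= p C.
    have -> : avg A (fun x => y x ^+ 2) = avg A (fun x => (1 - 2 * p C) * (x \in C)%:R + p C ^+ 2).
      apply: eq_avg => x _; rewrite /y; move: (p C) => q.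
      by case: (x \in C); rewrite ?mulr1 ?mulr0 /=; ring.
    rewrite avgD avgZ avg_cst // pE; have h := sqr_ge0 (p C); move: (p C) h => q h.
    by clear -h; lra.
  rewrite ELZ.
  have -> : EL A m (fun w => ((hits C w)%:R - m%:R * p C) ^+ 2) =
            EL A m (fun w => (\sum_(x <- w) y x) ^+ 2).
    apply: eq_EL => w /andP[/eqP sw _]; congr (_ ^+ 2); rewrite -sw /y /hits.
    elim: w {sw} => [|x w IH] /=; first by rewrite big_nil mul0r subrr.
    rewrite big_cons -IH natrD.
    by rewrite (_ : (size w).+1%:R = (size w)%:R + 1) ?natr1 //; ring.
  rewrite (EL_sqr_sum _ y0).
  apply: le_trans (_ : (de ^+ 2 * m%:R ^+ 2)^-1 * (m%:R * p C) <= _).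
    rewrite ler_wpM2l; [by []|by rewrite invr_ge0 mulr_ge0 // sqr_ge0|].
    by rewrite ler_wpM2l.
  rewrite le_eqVlt; apply/orP; left; apply/eqP; move: (p C) => q; field.
  by rewrite !gt_eqF.
apply: le_trans (_ : \sum_(C in porbits s) (m%:R * de ^+ 2)^-1 * p C <= _).
  by apply: ler_sum => C _.
rewrite -mulr_sumr /p -mulr_suml -natr_sum -card_porbits divff ?gt_eqF // mulr1 div1r //.
Qed.

End Cycles.

(** The class of [a] is the largest one and differs from [A] in at most [eta n] points. A cycle lies
    either in it or in another class, and the other classes have at most [eta n] points. *)
Lemma giant_ratio (R : realFieldType) (V : finType) (A C : {set V}) (E : rel V) (a b : V)
    (k0 : nat) (de eta : R) (G := cls E a) :
  eqv E -> 0 < de -> 0 < eta -> 4 * eta <= de -> (0 < #|V|)%N ->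
  de * #|V|%:R <= #|A|%:R -> k0%:R <= eta * #|V|%:R ->
  (#|A :\: G| + #|G :\: A| + #|bigv E k0 :\: G|)%:R <= eta * #|V|%:R ->
  C \subset cls E b ->
  `|#|C|%:R / (maxc E)%:R - #|C :&: A|%:R / #|A|%:R| <= 4 * eta / de :> R.
Proof.
move=> vE de0 eta0 ed n0 dA hk; rewrite !natrD => hs Cb.
have nR : 0 < #|V|%:R :> R by rewrite ltr0n.
have en : 4 * (eta * #|V|%:R) <= de * #|V|%:R by rewrite mulrA ler_pM2r.
have en0 : 0 < eta * #|V|%:R by rewrite mulr_gt0.
have x1 : 0 <= #|A :\: G|%:R :> R by []. have x2 : 0 <= #|G :\: A|%:R :> R by [].
have x3 : 0 <= #|bigv E k0 :\: G|%:R :> R by [].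
have cA : #|A|%:R = #|A :&: G|%:R + #|A :\: G|%:R :> R by rewrite -natrD cardsID.
have cG : #|G|%:R = #|A :&: G|%:R + #|G :\: A|%:R :> R by rewrite setIC -natrD cardsID.
have small c : ~~ E a c -> #|cls E c|%:R <= eta * #|V|%:R.
  move=> ac; have [kc|kc] := leqP k0 #|cls E c|; last first.
    by apply: le_trans hk; rewrite ler_nat ltnW.
  apply: le_trans (_ : #|bigv E k0 :\: G|%:R <= _); last by lra.
  rewrite ler_nat; apply: subset_leq_card; apply/subsetP => v; rewrite !inE => cv.
  rewrite -(cls_eq vE cv) kc andbT; apply: contra ac => av.
  by case: vE => _ sy tr; apply: tr av _; rewrite sy.
have LG : maxc E = #|G|.
  apply/eqP; rewrite eqn_leq leq_bigmax andbT; apply/bigmax_leqP => c _.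
  have [ac|ac] := boolP (E a c); first by rewrite /G (cls_eq vE ac).
  by rewrite -(ler_nat R); apply: le_trans (small c ac) _; lra.
have G0 : 0 < #|G|%:R :> R by lra.
have A0 : 0 < #|A|%:R :> R by lra.
have d1 : `|#|C|%:R - #|C :&: A|%:R| <= eta * #|V|%:R.
  have -> : #|C|%:R - #|C :&: A|%:R = #|C :\: A|%:R :> R.
    by rewrite cardsD natrB // subset_leq_card // subsetIl.
  rewrite ger0_norm //; have [ab|ab] := boolP (E a b).
    apply: le_trans (_ : #|G :\: A|%:R <= _); last by lra.
    by rewrite ler_nat subset_leq_card // setSD // /G (cls_eq vE ab).
  apply: le_trans (small b ab); rewrite ler_nat subset_leq_card //.
  by apply: subset_trans Cb; apply: subsetDl.
have d2 : `|#|A|%:R - #|G|%:R| <= eta * #|V|%:R by rewrite ler_norml; apply/andP; split; lra.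
have CA : #|C :&: A|%:R <= #|A|%:R :> R by rewrite ler_nat subset_leq_card // subsetIr.
rewrite LG; set x := (#|C|%:R : R) in d1 *; set y := (#|C :&: A|%:R : R) in d1 CA *.
have y0 : 0 <= y by [].
have -> : x / #|G|%:R - y / #|A|%:R = ((x - y) + y / #|A|%:R * (#|A|%:R - #|G|%:R)) / #|G|%:R.
  by move: x y {CA d1 y0} => x y; field; rewrite !gt_eqF.
rewrite normrM normfV (ger0_norm (ltW G0)) ler_pdivrMr //.
apply: le_trans (ler_normD _ _) _.
have d3 : `|y / #|A|%:R * (#|A|%:R - #|G|%:R)| <= eta * #|V|%:R.
  rewrite normrM; apply: le_trans (_ : 1 * `|#|A|%:R - #|G|%:R| <= _); last by rewrite mul1r.
  by rewrite ler_wpM2r // ger0_norm ?divr_ge0 // ler_pdivrMr // mul1r.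
apply: le_trans (lerD d1 d3) _.
apply: le_trans (_ : 4 * eta / de * (de * #|V|%:R / 2) <= _); last first.
  by rewrite ler_pM2l ?divr_gt0 ?mulr_gt0 //; lra.
rewrite le_eqVlt; apply/orP; left; apply/eqP; field; by rewrite gt_eqF.
Qed.

(** * From normalized cycles to the discrete law of a finite sample *)

Section Limit.
Variables (R : realType) (F : (nat -> R) -> R).
Hypothesis F1 : forall x, `|F x| <= 1.
Hypothesis Fuc : forall eps : R, 0 < eps -> exists2 de : R, 0 < de &
  forall x y : nat -> R, (forall i, 0 <= x i <= 1) -> (forall i, 0 <= y i <= 1) ->
  (forall i, `|x i - y i| <= de) -> `|F x - F y| <= eps.

(** The truncation keeps the argument in the unit cube, where [F] is uniformly continuous; on lists
    of total [m] it changes nothing. *)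
Definition gm (m : nat) (l : seq nat) : R := F (fun i => Num.min 1 (val_at R l m i)).

Definition ncyc (V : finType) (l : seq (V * V)) : nat -> R :=
  fun i => val_at R (cyc_sizes (prodl l)) (maxc (Efold (@eq_op V) l)) i.

Lemma ncyc01 (V : finType) (l : seq (V * V)) i : 0 <= ncyc l i <= 1.
Proof.
rewrite val_ge0 /ncyc /val_at /=; set L := maxc _.
set x := nth _ _ _.
have xL : (x <= L)%N.
  have [si|si] := ltnP i (size (sort geq (cyc_sizes (prodl l)))); last by rewrite /x nth_default.
  have := mem_nth 0%N si; rewrite -/x mem_sort => /mapP[C]; rewrite mem_enum => /imsetP[a _ ->] ->.
  apply: leq_trans (leq_bigmax a); rewrite -cls_orb; apply: cls_leq; exact: orb_EG.
have [->|L0] := eqVneq L 0%N; first by rewrite invr0 mulr0.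
by rewrite ler_pdivrMr ?ltr0n ?lt0n // mul1r ler_nat.
Qed.

Lemma ncyc_close (V : finType) (l : seq (V * V)) m w (de : R) : (0 < m)%N -> size w = m ->
  (forall C, C \in porbits (prodl l) ->
    `|#|C|%:R / (maxc (Efold (@eq_op V) l))%:R - (hits C w)%:R / m%:R| <= de) ->
  0 <= de ->
  forall i, `|ncyc l i - Num.min 1 (val_at R (typ m (orb (prodl l)) (ones w)) m i)| <= de.
Proof.
move=> m0 sw h de0 i; set L := maxc _ in h.
set s := prodl l in h *; set T := typ _ _ _.
have z (v : R) (k : nat) : 0 < v -> ~~ (v <= 0%:R / k%:R) by move=> v0; rewrite mul0r -ltNge.
have up1 : ncyc l i <= val_at R T m i + de.
  apply: val_le => // v v0; rewrite count_cyc_sizes count_typ ?sw // ?z ?subr_gt0 //.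
  apply: leq_sum => C Cs; case: (boolP (v <= _)) => // vC.
  rewrite (_ : v - de <= _) //; have := h C Cs; rewrite ler_norml => /andP[_].
  by move: vC; move: (_ / m%:R) (_ / L%:R) => x y; lra.
have up2 : val_at R T m i <= ncyc l i + de.
  apply: val_le => // v v0; rewrite count_cyc_sizes count_typ ?sw // ?z //; last by apply: le_lt_trans v0.
  apply: leq_sum => C Cs; case: (boolP (v <= _)) => // vC.
  rewrite (_ : v - de <= _) //; have := h C Cs; rewrite ler_norml => /andP[+ _].
  by move: vC; move: (_ / m%:R) (_ / L%:R) => x y; lra.
have /andP[n0 n1] := ncyc01 l i.
rewrite ler_norml minEle; case: ifP => h1.
  by move: up1 up2 n0 n1 h1; move: (ncyc l i) (val_at _ _ _ _) => x y *; apply/andP; split; lra.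
by move: up1 up2; move: (ncyc l i) (val_at _ _ _ _) => x y *; apply/andP; split; lra.
Qed.

Lemma gm_bound m l : `|gm m l| <= 1. Proof. exact: F1. Qed.

(** [m] is chosen before [n0]: it has to be large only for the frequencies in the sample to
    approximate the cycle lengths, and the window theorem is applied with [m] fixed. *)
Theorem comb_limit (c eps : R) : 2^-1 < c -> 0 < eps -> exists m0 : nat, forall m, (m0 <= m)%N ->
  exists n0 : nat, forall V : finType, (n0 <= #|V|)%N -> forall t : nat, c * #|V|%:R <= t%:R ->
  `|EL (pairs V) t (fun l => F (ncyc l)) - Fel m (gm m) (nseq m 1%N)| <= eps.
Proof.
move=> c12 eps0; have [de /andP[de0 de1] ST] := stages c12.
have e80 : 0 < eps / 8 by rewrite divr_gt0.
have [d d0 FU] := Fuc e80.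
have d20 : 0 < d / 2 by rewrite divr_gt0.
have [m0 m0le] := nat_above (16 / (eps * (d / 2) ^+ 2)).
exists m0.+1 => m mm.
have mp : (0 < m)%N by apply: leq_trans mm.
have mR : 0 < m%:R :> R by rewrite ltr0n.
have [eta1 eta10 [r0 WI]] := window m de0 de1 e80.
have [|eta eta0 /and5P[b1 b2 b3 b4 /andP[b5 _]]] :=
  @small_all R [:: eta1; eps / 32; de / 4; d / 2 * de / 4; (r0.+1%:R)^-1].
  have p4 : 0 < d / 2 * de / 4 by rewrite divr_gt0 // mulr_gt0.
  by rewrite /= eta10 p4 invr_gt0 ltr0n !divr_gt0.
have [k0 [n0 SV]] := ST eta eta0.
exists n0 => V nV t ct.
have [K [s [t0 [[tE K0 s1 q1 q2] [q3 q4 q5 n2 q6]]]]] := SV V nV t ct.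
have nR : 0 < #|V|%:R :> R by rewrite ltr0n ltnW.
have up x : 0 <= x -> eta * x <= eta1 * x by move=> x0; rewrite ler_wpM2r.
have sr0 : (r0 <= s)%N.
  rewrite -(ler_nat R); have : 1 <= (r0.+1%:R)^-1 * s%:R :> R.
    by apply: le_trans s1 _; rewrite ler_wpM2r.
  rewrite mulrC ler_pdivlMr ?ltr0n // mul1r => h; apply: le_trans h.
  by rewrite ler_nat.
pose A (l : seq (V * V)) := longv (prodl l) K.
pose g (l l3 : seq (V * V)) w : R := gm m (typ m (orb (prodl (l ++ l3))) (ones w)).
pose bad (l l3 : seq (V * V)) : R := (~~ ok de eta K k0 l l3)%:R.
have g1 l l3 w : `|g l l3 w| <= 1 by apply: gm_bound.
have Fe1 : `|Fel m (gm m) (nseq m 1%N)| <= 1 by apply: Fel_bound => l; apply: gm_bound.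
rewrite tE EL_cat.
set FF := Fel _ _ _ in Fe1 *.
(* for each [l]: first compare F with its sampled version, then apply the window theorem *)
have step1 l l3 : `|F (ncyc (l ++ l3)) - EL (A l) m (g l l3)| <= eps / 4 + 2 * bad l l3.
  have [h|h] := boolP (ok de eta K k0 l l3); last first.
    rewrite /bad h mulr1; apply: le_trans (ler_normB _ _) _.
    apply: le_trans (_ : 1 + 1 <= _); last by rewrite [2](_ : _ = 1 + 1) // ler_wpDl // divr_ge0 // ltW.
    apply: lerD => //; apply: le_trans (EL_norm _ _ _) _; apply: EL_le_cst => // w _; exact: g1.
  rewrite /bad h mulr0 addr0; case/and3P: h => h1 h2 /existsP[a h3].
  have A0 : A l != set0.
    rewrite -card_gt0 -(ltr0n R); apply: lt_le_trans h1; by rewrite mulr_gt0.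
  rewrite -[F _](@EL_cst R _ (A l) m) // -ELB; apply: le_trans (EL_norm _ _ _) _.
  have SA := sampling (prodl (l ++ l3)) A0 mp d20.
  apply: le_trans (_ : EL (A l) m (fun w => eps / 8 + 2 * (~~ [forall C in porbits (prodl (l ++ l3)),
     `|(hits C w)%:R / m%:R - #|C :&: A l|%:R / #|A l|%:R| <= d / 2])%:R) <= _).
    apply: ler_EL => w /andP[/eqP sw _].
    case: (boolP [forall C in _, _]) => [/forall_inP hC|_] /=; last first.
      rewrite mulr1; apply: le_trans (ler_normB _ _) _.
      apply: le_trans (_ : 1 + 1 <= _); last by rewrite [2](_ : _ = 1 + 1) // ler_wpDl // ltW.
      by apply: lerD => //; apply: g1.
    rewrite mulr0 addr0; apply: FU => [i|i|]; first exact: ncyc01.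
      by rewrite le_min ler01 val_ge0 /= ge_min lexx.
    apply: ncyc_close => //; last by apply: ltW.
    move=> C Cs; have := hC C Cs; case/imsetP: (Cs) => b _ CE.
    have vE : eqv (Efold (@eq_op V) (l ++ l3)) by apply/eqv_Efold/eq_op_eqv.
    have Cb : C \subset cls (Efold (@eq_op V) (l ++ l3)) b.
      rewrite CE -cls_orb; apply: cls_sub; exact: orb_EG.
    have ed : 4 * eta <= de by move: b3; rewrite ler_pdivlMr //; lra.
    have := giant_ratio vE de0 eta0 ed (ltnW n2) h1 q2 h3 Cb.
    have : 4 * eta / de <= d / 2.
      rewrite ler_pdivrMr //; move: b4; rewrite ler_pdivlMr //; lra.
    rewrite -/(A l); move: (_ / (maxc _)%:R) (_ / #|A l|%:R) (_ / m%:R) => x y z.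
    move=> h4 h5 h6; apply: le_trans (ler_distD y _ _) _.
    rewrite distrC in h6; move: h4 h5 h6; move: `|x - y| `|y - z| (_ / de) => u v q; lra.
  rewrite ELD EL_cst // ELZ.
  have : 1 / (m%:R * (d / 2) ^+ 2) <= eps / 16.
    have d22 : 0 < (d / 2) ^+ 2 by rewrite exprn_gt0.
    rewrite (ler_pdivrMr _ _ (mulr_gt0 mR d22)).
    move: m0le; rewrite (ler_pdivrMr _ _ (mulr_gt0 eps0 d22)) => h4.
    have : m0%:R * (eps * (d / 2) ^+ 2) <= m%:R * (eps * (d / 2) ^+ 2).
      by rewrite ler_wpM2r ?ler_nat 1?ltnW // mulr_ge0 ?sqr_ge0 // ltW.
    by move: h4; move: ((d / 2) ^+ 2) => u; lra.
  by move: SA; move: (EL _ _ _) (1 / _) => x y; lra.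
(* The window theorem needs the first two conditions of [ok], which depend on [l] alone. If one of
   them fails then [bad l] is identically 1, and the trivial bound 2 is covered. *)
have step2 l : `|EL (pairs V) s (fun l3 => EL (A l) m (g l l3)) - FF| <=
    eps / 8 + 2 * EL (pairs V) s (bad l).
  have [h|h] := boolP ((de * #|V|%:R <= #|A l|%:R) &&
      (#|[set v | k0 <= #|porbit (prodl l) v| < K]%N|%:R <= eta * #|V|%:R)); last first.
    have -> : EL (pairs V) s (bad l) = 1.
      rewrite -[RHS](@EL_cst R _ (pairs V) s) ?pairs_neq0 //; apply: eq_EL => l3 _.
      by rewrite /bad /ok andbA (negPf h).
    rewrite mulr1; apply: le_trans (ler_normB _ _) _.
    apply: le_trans (_ : 1 + 1 <= _); last by rewrite [2](_ : _ = 1 + 1) // ler_wpDl // ltW.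
    apply: lerD => //; apply: le_trans (EL_norm _ _ _) _; apply: EL_le_cst => // l3 _.
    by apply: le_trans (EL_norm _ _ _) _; apply: EL_le_cst => // w _; apply: g1.
  case/andP: h => h1 h2; apply: ler_wpDr.
    by rewrite mulr_ge0 //; apply: EL_ge0 => l3 _; rewrite /bad; case: (~~ _).
  rewrite EL_swap.
  have := WI V (prodl l) K k0 s (gm m) sr0 K0 h1 _ _ _ _ _ (@gm_bound m).
  have <- : EL (A l) m (fun w => EL (pairs V) s (fun l3 => g l l3 w)) =
     EL [set v | K <= #|porbit (prodl l) v|]%N m (fun w => EL (pairs V) s (fun l0 => gm m (typ m (orb (prodl l * prodl l0)%g) (ones w)))).
    by apply: eq_EL => w _; apply: eq_EL => l3 _; rewrite /g prodl_cat.
  apply.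
  - by apply: le_trans q1 _; rewrite -!mulrA; apply: up; rewrite mulr_ge0.
  - by apply: le_trans h2 _; apply: up; apply: ltW.
  - by apply: le_trans q3 _; apply: up; apply: ltW.
  - by apply: le_trans q4 _; apply: up; apply: ltW.
  - by apply: le_trans q5 _; apply: up; apply: sqr_ge0.
have FFE : FF = EL (pairs V) t0 (fun=> FF) by rewrite EL_cst // pairs_neq0.
rewrite [in leLHS]FFE -ELB; apply: le_trans (EL_norm _ _ _) _.
apply: le_trans (_ : EL (pairs V) t0 (fun l => (eps / 4 + eps / 8) +
    4 * EL (pairs V) s (bad l)) <= _); last first.
  by rewrite ELD EL_cst ?pairs_neq0 // ELZ; move: q6 b2; rewrite -/bad; move: (EL _ _ _) => x; lra.
apply: ler_EL => l _.
apply: le_trans (ler_distD (EL (pairs V) s (fun l3 => EL (A l) m (g l l3))) _ _) _.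
have := step2 l.
have : `|EL (pairs V) s (fun l3 => F (ncyc (l ++ l3))) - EL (pairs V) s (fun l3 => EL (A l) m (g l l3))|
   <= eps / 4 + 2 * EL (pairs V) s (bad l).
  rewrite -ELB; apply: le_trans (EL_norm _ _ _) _.
  rewrite -ELZ -[X in _ <= X + _](@EL_cst R _ (pairs V) s) ?pairs_neq0 // -ELD.
  by apply: ler_EL => l3 _; apply: step1.
by move: (EL _ _ (bad l)) `|_ - FF| `|_ - _| => x y z; lra.
Qed.

End Limit.

(** * Discrete and continuous stick breaking *)

Section Hrec.
Variable R : realFieldType.
Implicit Types g : seq nat -> R.

Definition HH b g : R := Fel b g (nseq b 1%N).

Lemma rem_at_nseq (T : Type) (x : T) r i : (i < r)%N -> rem_at i (nseq r x) = nseq r.-1 x.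
Proof.
move=> ir; rewrite /rem_at take_nseq ?drop_nseq 1?ltnW //.
by rewrite -nseqD; congr nseq; clear -ir; lia.
Qed.

Lemma Fel_cons n g a (rest : seq nat) : Fel n.+1 g (a :: rest) =
  (Fel n (fun l => g (a :: l)) rest +
   \sum_(i < size rest) Fel n g ((a + nth 0 rest i)%N :: rem_at i rest)) / (size rest).+1%:R.
Proof. by []. Qed.

(** The [r] merging alternatives coincide, since all other weights are 1 and the weight becomes
    [a + 1] in each case. The normalizations then telescope, so the first cycle closes at each
    possible size with the same probability. *)
Lemma Fel_nseq a r g : Fel r.+1 g (a :: nseq r 1%N) =
  (\sum_(i < r.+1) HH (r - i) (fun l => g ((a + i)%N :: l))) / r.+1%:R.
Proof.
elim: r a g => [|r IH] a g.
  by rewrite /= big_ord0 addr0 big_ord_recl big_ord0 addr0 /HH /= addn0.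
rewrite Fel_cons size_nseq; congr (_ / _).
rewrite [RHS]big_ord_recl subn0 addn0; congr (_ + _).
rewrite (eq_bigr (fun=> Fel r.+1 g (a.+1 :: nseq r 1%N))) => [|i _]; last first.
  by rewrite rem_at_nseq // nth_nseq ltn_ord addn1.
rewrite sumr_const card_ord -[_ *+ _]mulr_natr IH divfK ?pnatr_eq0 //.
by apply: eq_bigr => i _; rewrite subSS addSnnS.
Qed.

Lemma HHS b g : HH b.+1 g =
  (\sum_(i < b.+1) HH (b - i) (fun l => g (i.+1 :: l))) / b.+1%:R.
Proof. exact: Fel_nseq. Qed.

End Hrec.

Section Chain.
Variable R : realType.
Implicit Types (u : nat -> R) (g : seq nat -> R).

(** Discrete stick breaking driven by the variables of the continuous one: for [u k] uniform, the
    truncation of [b u k] plus one is uniform on [1, ..., b]. *)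
Fixpoint chain f b u k : seq nat :=
  if f is f'.+1 then
    if b is b'.+1 then
      let i := Num.truncn (b%:R * u k) in i.+1 :: chain f' (b' - i)%N u k.+1
    else [::]
  else [::].

(** The value of [g] on [chain] as a finite sum of products of indicators, so that measurability and
    integration reduce to cells of the variables. *)
Fixpoint Sc f b u k g : R :=
  if f is f'.+1 then
    if b is b'.+1 then
      \sum_(i < b'.+1) (i%:R <= b%:R * u k < i.+1%:R)%R%:R *
        Sc f' (b' - i)%N u k.+1 (fun l => g (i.+1 :: l))
    else g [::]
  else g [::].

Lemma Sc_chain f b u k g : (forall j, 0 <= u j < 1) -> Sc f b u k g = g (chain f b u k).
Proof.
move=> u01; elim: f b k g => [|f IH] [|b] k g //=.
have /andP[u0 u1] := u01 k.
have x0 : 0 <= b.+1%:R * u k by rewrite mulr_ge0.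
have /andP[t1 t2] := Num.Theory.truncn_itv x0; set i := Num.truncn _ in t1 t2 *.
have ib : (i < b.+1)%N.
  by rewrite -(ltr_nat R); apply: le_lt_trans t1 _; rewrite gtr_pMr // ltr0n.
rewrite (bigD1 (Ordinal ib)) //= t1 t2 mul1r IH big1 ?addr0 // => j ji.
rewrite (_ : _ && _ = false) ?mul0r //; apply/negP => /andP[j1 j2].
case/negP: ji; apply/eqP/val_inj => /=; apply/eqP; rewrite eqn_leq.
by rewrite -ltnS -(ltr_nat R) (le_lt_trans j1 t2) /= -ltnS -(ltr_nat R) (le_lt_trans t1 j2).
Qed.

(* the remaining mass of the chain, rescaled by the initial size [B], follows the stick-breaking
   remainder up to an error [1 / B] per step *)
Lemma chain_close (B : nat) u (rem : nat -> R) f b k (e : R) :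
  (0 < B)%N -> (b <= f)%N -> (forall j, 0 <= u j < 1) ->
  (forall j, 0 <= rem j <= 1) -> (forall j, rem j.+1 = rem j - u j * rem j) ->
  `|b%:R / B%:R - rem k| <= e ->
  forall j, `|(nth 0%N (chain f b u k) j)%:R / B%:R - u (k + j)%N * rem (k + j)%N| <=
     e + j.+1%:R / B%:R.
Proof.
move=> B0 bf u01 r01 remS; have BR : 0 < B%:R :> R by rewrite ltr0n.
elim: f b k e bf => [|f IH] [|b] k e bf h j //.
- rewrite nth_nil mul0r sub0r normrN; move: h; rewrite mul0r sub0r normrN => h.
  have /andP[u0 u1] := u01 (k + j)%N; have /andP[r0 r1] := r01 (k + j)%N.
  have rk : rem (k + j)%N <= rem k.
    elim: j {u0 u1 r0 r1} => [|j IHj]; first by rewrite addn0.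
    rewrite addnS remS; apply: le_trans IHj; rewrite gerBl.
    by have /andP[? _] := u01 (k + j)%N; have /andP[? _] := r01 (k + j)%N; apply: mulr_ge0.
  rewrite ger0_norm ?mulr_ge0 //; apply: le_trans (_ : rem k <= _).
    by apply: le_trans rk; rewrite ler_piMl // ltW.
  apply: ler_wpDr; first by rewrite divr_ge0.
  by move: h; rewrite ger0_norm //; case/andP: (r01 k).
- rewrite nth_nil mul0r sub0r normrN; move: h; rewrite mul0r sub0r normrN => h.
  have /andP[u0 u1] := u01 (k + j)%N; have /andP[r0 r1] := r01 (k + j)%N.
  have rk : rem (k + j)%N <= rem k.
    elim: j {u0 u1 r0 r1} => [|j IHj]; first by rewrite addn0.
    rewrite addnS remS; apply: le_trans IHj; rewrite gerBl.
    by have /andP[? _] := u01 (k + j)%N; have /andP[? _] := r01 (k + j)%N; apply: mulr_ge0.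
  rewrite ger0_norm ?mulr_ge0 //; apply: le_trans (_ : rem k <= _).
    by apply: le_trans rk; rewrite ler_piMl // ltW.
  apply: ler_wpDr; first by rewrite divr_ge0.
  by move: h; rewrite ger0_norm //; case/andP: (r01 k).
have /andP[u0 u1] := u01 k.
have x0 : 0 <= b.+1%:R * u k by rewrite mulr_ge0.
have /andP[t1 t2] := Num.Theory.truncn_itv x0.
rewrite [chain _ _ _ _]/= ; set i := Num.truncn _ in t1 t2 *.
have ib : (i <= b)%N.
  by rewrite -ltnS -(ltr_nat R); apply: le_lt_trans t1 _; rewrite gtr_pMr // ltr0n.
have L1 : `|i.+1%:R / B%:R - b.+1%:R / B%:R * u k| <= 1 / B%:R.
  rewrite mulrAC -mulrBl normrM [X in _ * X]ger0_norm ?invr_ge0 ?(ltW BR) //.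
  rewrite ler_wpM2r ?invr_ge0 ?(ltW BR) // ler_norml; apply/andP; split.
    by move: t2; lra.
  by move: t1; rewrite -natr1; lra.
have uh : `|(b.+1%:R / B%:R - rem k) * u k| <= e.
  by rewrite normrM; apply: le_trans h; rewrite ler_piMr // ger0_norm // ltW.
case: j => [|j] /=.
  rewrite addn0; apply: le_trans (ler_distD (b.+1%:R / B%:R * u k) _ _) _.
  rewrite addrC; apply: lerD => //.
  by rewrite [u k * _]mulrC -mulrBl.
rewrite addnS -addSn.
apply: le_trans (IH (b - i)%N k.+1 (e + 1 / B%:R) _ _ j) _.
- by apply: leq_trans (leq_subr _ _) _.
- rewrite remS natrB //.
  have -> : (b%:R - i%:R) / B%:R - (rem k - u k * rem k) =
     (b.+1%:R / B%:R - rem k) * (1 - u k) - (i.+1%:R / B%:R - b.+1%:R / B%:R * u k).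
    by rewrite -!natr1; ring.
  apply: le_trans (ler_normB _ _) _; apply: lerD => //.
  by rewrite normrM; apply: le_trans h; rewrite ler_piMr // ger0_norm; lra.
by rewrite -addrA lerD2l -mulrDl -[j.+2%:R]natr1 addrC.
Qed.

Lemma chain_sum f b u k j : (forall j, 0 <= u j < 1) -> (b <= f)%N ->
  (nth 0%N (chain f b u k) j <= b)%N.
Proof.
move=> u01; elim: f b k j => [|f IH] [|b] k j bf; rewrite ?nth_nil //.
have /andP[u0 u1] := u01 k.
have x0 : 0 <= b.+1%:R * u k by rewrite mulr_ge0.
have /andP[t1 t2] := Num.Theory.truncn_itv x0.
rewrite [chain _ _ _ _]/= ; set i := Num.truncn _ in t1 t2 *.
have ib : (i <= b)%N.
  by rewrite -ltnS -(ltr_nat R); apply: le_lt_trans t1 _; rewrite gtr_pMr // ltr0n.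
case: j => [|j] //=; apply: leq_trans (IH _ _ _ _) _; last by rewrite leqW // leq_subr.
by apply: leq_trans (leq_subr _ _) _.
Qed.

(* tail version: beyond step [J] everything is bounded by the remaining mass *)
Lemma chain_tail (B : nat) u (rem : nat -> R) f b k (e : R) J :
  (0 < B)%N -> (b <= f)%N -> (forall j, 0 <= u j < 1) ->
  (forall j, 0 <= rem j <= 1) -> (forall j, rem j.+1 = rem j - u j * rem j) ->
  `|b%:R / B%:R - rem k| <= e ->
  forall j, (J <= j)%N -> (nth 0%N (chain f b u k) j)%:R / B%:R <=
     rem (k + J)%N + e + J%:R / B%:R.
Proof.
move=> B0 bf u01 r01 remS; have BR : 0 < B%:R :> R by rewrite ltr0n.
elim: J f b k e bf => [|J IH] f b k e bf h j Jj.
  rewrite addn0 mul0r addr0; apply: le_trans (_ : b%:R / B%:R <= _).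
    by rewrite ler_wpM2r ?invr_ge0 ?(ltW BR) // ler_nat chain_sum.
  by move: h; rewrite ler_norml => /andP[_]; rewrite lerBlDl.
case: j Jj => // j Jj.
have z : 0 <= rem (k + J.+1)%N + e + J.+1%:R / B%:R.
  rewrite !addr_ge0 ?divr_ge0 //; first by case/andP: (r01 (k + J.+1)%N).
  exact: le_trans h.
case: f b bf h => [|f] [|b] bf h; rewrite ?nth_nil ?mul0r //.
have /andP[u0 u1] := u01 k.
have x0 : 0 <= b.+1%:R * u k by rewrite mulr_ge0.
have /andP[t1 t2] := Num.Theory.truncn_itv x0.
rewrite [chain _ _ _ _]/= ; set i := Num.truncn _ in t1 t2 *.
have ib : (i <= b)%N.
  by rewrite -ltnS -(ltr_nat R); apply: le_lt_trans t1 _; rewrite gtr_pMr // ltr0n.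
have L1 : `|i.+1%:R / B%:R - b.+1%:R / B%:R * u k| <= 1 / B%:R.
  rewrite mulrAC -mulrBl normrM [X in _ * X]ger0_norm ?invr_ge0 ?(ltW BR) //.
  rewrite ler_wpM2r ?invr_ge0 ?(ltW BR) // ler_norml; apply/andP; split.
    by move: t2; lra.
  by move: t1; rewrite -natr1; lra.
rewrite /= addnS -addSn.
apply: le_trans (IH f (b - i)%N k.+1 (e + 1 / B%:R) _ _ j Jj) _.
- by apply: leq_trans (leq_subr _ _) _.
- rewrite remS natrB //.
  have -> : (b%:R - i%:R) / B%:R - (rem k - u k * rem k) =
     (b.+1%:R / B%:R - rem k) * (1 - u k) - (i.+1%:R / B%:R - b.+1%:R / B%:R * u k).
    by rewrite -!natr1; ring.
  apply: le_trans (ler_normB _ _) _; apply: lerD => //.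
  by rewrite normrM; apply: le_trans h; rewrite ler_piMr // ger0_norm; lra.
by rewrite -[J.+1%:R]natr1 mulrDl; move: (_ / B%:R) (1 / _) => x y; lra.
Qed.

End Chain.

Require Import Defs.
From mathcomp Require Import all_classical all_reals all_analysis.
From mathcomp Require Import measurable_realfun.
Import Order.TTheory GRing.Theory Num.Theory.
Import numFieldTopology.Exports numFieldNormedType.Exports.
Local Open Scope classical_set_scope.
Local Open Scope ring_scope.

(** * Sorting and convergence for a fixed sequence of uniform values *)

Section SortNoninc.
Variable R : realType.
Implicit Types (x u : nat -> R).

Let lev x i := [set v : R | 0 <= v /\ exists s : seq nat,
         [/\ uniq s, size s = i.+1 & forall j, j \in s -> v <= x j]].

Lemma lev0 x i : (forall j, 0 <= x j) -> lev x i 0.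
Proof.
by move=> x0; split=> //; exists (iota 0 i.+1); split; rewrite ?iota_uniq ?size_iota.
Qed.

Lemma lev_ub x i : (forall j, x j <= 1) -> ubound (lev x i) 1.
Proof.
move=> x1 v [_ [[|j s] [_ // _ h]]]; apply: le_trans (x1 j); apply: h.
by rewrite inE eqxx.
Qed.

Lemma sort_noninc01 x i : (forall j, 0 <= x j <= 1) -> 0 <= sort_noninc x i <= 1.
Proof.
move=> x01; have x0 j : 0 <= x j by case/andP: (x01 j).
have x1 j : x j <= 1 by case/andP: (x01 j).
apply/andP; split.
  by apply: ub_le_sup; [exists 1; apply: lev_ub | apply: lev0].
by apply: ge_sup; [exists 0; apply: lev0 | apply: lev_ub].
Qed.

(** Sorting does not increase the sup distance. Thresholds up to [de] are treated apart: above [de],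
    an entry of [x] forces a positive entry of the list, hence an index within its size. *)
Lemma sort_noninc_close (l : seq nat) (B : nat) x (de : R) i : 0 <= de ->
  (forall j, 0 <= x j <= 1) -> (forall j, `|(nth 0%N l j)%:R / B%:R - x j| <= de) ->
  `|val_at R l B i - sort_noninc x i| <= de.
Proof.
move=> de0 x01 h; have x0 j : 0 <= x j by case/andP: (x01 j).
have x1 j : x j <= 1 by case/andP: (x01 j).
have /andP[s0 s1] := sort_noninc01 i x01.
have up (v : R) a b : (a <= b)%N -> v <= a%:R / B%:R -> v <= b%:R / B%:R.
  by move=> ab /le_trans; apply; rewrite ler_wpM2r ?invr_ge0 // ler_nat.
have z (v : R) : 0 < v -> ~~ (v <= 0%:R / B%:R) by move=> v0; rewrite mul0r -ltNge.
have idx (P : pred nat) : count P l = count (fun j => P (nth 0%N l j)) (iota 0 (size l)).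
  by rewrite -[in LHS](mkseq_nth 0%N l) /mkseq count_map.
rewrite ler_distlC; apply/andP; split.
  rewrite lerBlDr; have [v1|v1] := leP (val_at R l B i) de; first by apply: le_trans v1 _; rewrite lerDr.
  rewrite -lerBlDr; set v := val_at R l B i in v1 *.
  have v0 : 0 < v by apply: le_lt_trans v1.
  have := nth_sort_geq l i (z v v0) (@up v); rewrite lexx => /esym.
  rewrite idx -size_filter; set s := seq.filter _ _ => si.
  apply: ub_le_sup; first by exists 1; apply: lev_ub.
  split; first by rewrite subr_ge0 ltW.
  exists (take i.+1 s); split.
  - by rewrite take_uniq // filter_uniq // iota_uniq.
  - by rewrite size_takel.
  move=> j /mem_take; rewrite mem_filter => /andP[vj _].
  by have := h j; rewrite ler_norml => /andP[_]; move: vj; move: (_ / _) => y; lra.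
apply: ge_sup; first by exists 0; apply: lev0.
move=> v [v0 [s [us ss hs]]].
have [v1|v1] := leP v de; first by apply: le_trans v1 _; rewrite lerDr val_ge0.
rewrite -lerBlDr; have vd : 0 < v - de by rewrite subr_gt0.
have := nth_sort_geq l i (z _ vd) (@up (v - de)); rewrite /val_at => ->.
have big j : j \in s -> v - de <= (nth 0%N l j)%:R / B%:R.
  move=> js; have := h j; rewrite ler_norml => /andP[+ _]; have := hs j js.
  by move: (_ / _) => y; lra.
rewrite idx -size_filter -ss; apply: uniq_leq_size => // j js.
rewrite mem_filter big //= mem_iota add0n; case: (ltnP j (size l)) => // jl.
by have := big j js; rewrite nth_default // => b; case/negP: (z _ vd).
Qed.

Lemma sb_rem01 u : (forall j, 0 <= u j < 1) -> forall j, 0 <= sb_rem u j <= 1.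
Proof.
move=> u01; elim=> [|j /andP[r0 r1]] /=; first by rewrite ler01 lexx.
have /andP[u0 u1] := u01 j; have -> : sb_rem u j - u j * sb_rem u j = (1 - u j) * sb_rem u j by ring.
rewrite mulr_ge0 ?subr_ge0 ?(ltW u1) //=; apply: le_trans r1; rewrite ler_piMl //.
by rewrite gerBl.
Qed.

Lemma sb_rem_mono u : (forall j, 0 <= u j < 1) -> forall j k, (j <= k)%N -> sb_rem u k <= sb_rem u j.
Proof.
move=> u01 j k /subnKC <-; elim: (k - j)%N => [|m IH]; first by rewrite addn0.
rewrite addnS /=; apply: le_trans IH; rewrite gerBl.
by have /andP[? _] := u01 (j + m)%N; have /andP[? _] := sb_rem01 u01 (j + m)%N; apply: mulr_ge0.
Qed.

Lemma stick01 u : (forall j, 0 <= u j < 1) -> forall j, 0 <= stick u j <= sb_rem u j.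
Proof.
move=> u01 j; have /andP[u0 u1] := u01 j; have /andP[r0 r1] := sb_rem01 u01 j.
by rewrite mulr_ge0 //= ler_piMl // ltW.
Qed.

Lemma stick_le1 u : (forall j, 0 <= u j < 1) -> forall j, 0 <= stick u j <= 1.
Proof.
move=> u01 j; have /andP[h1 h2] := stick01 u01 j; rewrite h1.
by apply: le_trans h2 _; case/andP: (sb_rem01 u01 j).
Qed.

(** Each index with [u j > 1 / 2] at least halves the remainder, and there are infinitely many. *)
Lemma sb_rem_cvg u : (forall j, 0 <= u j < 1) -> (forall q, exists2 j, (q <= j)%N & 2^-1 < u j) ->
  forall de : R, 0 < de -> exists J, sb_rem u J <= de.
Proof.
move=> u01 io.
have half m : exists J, sb_rem u J <= 2^-1 ^+ m.
  elim: m => [|m [J hJ]]; first by exists 0%N; rewrite expr0.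
  have [j Jj uj] := io J; exists j.+1 => /=.
  have /andP[r0 _] := sb_rem01 u01 j.
  have rJ := le_trans (sb_rem_mono u01 Jj) hJ.
  have -> : sb_rem u j - u j * sb_rem u j = (1 - u j) * sb_rem u j by ring.
  rewrite exprS; apply: ler_pM => //; first by rewrite subr_ge0; case/andP: (u01 j) => _ /ltW.
  by lra.
move=> de de0; have [k kle] := nat_above (de^-1 : R).
have [J hJ] := half k; exists J; apply: le_trans hJ _.
have h2 : k%:R <= 2 ^+ k :> R by rewrite -natrX ler_nat ltnW // ltn_expl.
rewrite exprVn -[leRHS]invrK lef_pV2 ?posrE ?invr_gt0 ?exprn_gt0 //.
exact: le_trans kle h2.
Qed.

Section Limit.
Variable F : (nat -> R) -> R.
Hypothesis Fuc : forall eps : R, 0 < eps -> exists2 de : R, 0 < de &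
  forall x y : nat -> R, (forall i, 0 <= x i <= 1) -> (forall i, 0 <= y i <= 1) ->
  (forall i, `|x i - y i| <= de) -> `|F x - F y| <= eps.

Lemma chain_limit u : (forall j, 0 <= u j < 1) ->
  (forall q, exists2 j, (q <= j)%N & 2^-1 < u j) ->
  forall eps : R, 0 < eps -> exists b0 : nat, forall b, (b0 <= b)%N ->
  `|gm F b (chain b b u 0) - F (PD1_sample u)| <= eps.
Proof.
move=> u01 io eps eps0; have [de de0 Fde] := Fuc eps0.
have de20 : 0 < de / 2 by rewrite divr_gt0.
have [J hJ] := sb_rem_cvg u01 io de20.
have [b0 b0le] := nat_above (J.+1%:R / (de / 2)).
exists b0.+1 => b bb.
have bp : (0 < b)%N by apply: leq_trans bb.
have bR : 0 < b%:R :> R by rewrite ltr0n.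
have Jb : J.+1%:R / b%:R <= de / 2.
  rewrite ler_pdivrMr // mulrC -ler_pdivrMr //; apply: le_trans b0le _.
  by rewrite ler_nat ltnW.
have PD01 i : 0 <= PD1_sample u i <= 1 by apply: sort_noninc01; apply: stick_le1.
apply: Fde => // [i|i]; first by rewrite le_min ler01 val_ge0 /= ge_min lexx.
have e0 : `|b%:R / b%:R - sb_rem u 0| <= 0 :> R by rewrite divff ?gt_eqF //= subrr normr0.
have close j : `|(nth 0%N (chain b b u 0) j)%:R / b%:R - stick u j| <= de.
  (* The error of [chain_close] grows with the index. From [J] on, both sequences are instead
     bounded by the mass remaining there, up to a small error. *)
  have [jJ|jJ] := ltnP j J.
    have := chain_close bp (leqnn b) u01 (sb_rem01 u01) (fun j => erefl) e0 j.
    rewrite add0n add0r => /le_trans; apply; apply: le_trans (_ : J.+1%:R / b%:R <= _).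
      by rewrite ler_wpM2r ?invr_ge0 // ler_nat ltnS ltnW.
    by apply: le_trans Jb _; rewrite ler_pdivrMr // ler_peMr ?(ltW de0) // ler1n.
  have := chain_tail bp (leqnn b) u01 (sb_rem01 u01) (fun j => erefl) e0 jJ.
  rewrite add0n addr0 => h1; have /andP[h2 h3] := stick01 u01 j.
  have h4 := le_trans h3 (sb_rem_mono u01 jJ).
  have h5 : J%:R / b%:R <= J.+1%:R / b%:R :> R by rewrite ler_wpM2r ?invr_ge0 // ler_nat.
  have h6 : 0 <= (nth 0%N (chain b b u 0) j)%:R / b%:R :> R by rewrite divr_ge0.
  rewrite ler_norml; move: h1 h2 h4 h5 h6 hJ Jb.
  move: (_ / b%:R) (stick u j) (J%:R / b%:R) (J.+1%:R / b%:R) (sb_rem u J) => a s j1 j2 r *.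
  by apply/andP; split; lra.
have := sort_noninc_close i (ltW de0) (stick_le1 u01) close.
rewrite -/(PD1_sample u i); have /andP[p0 p1] := PD01 i.
rewrite minEle; case: ifP => [h1|_ //].
move: h1 p1; move: (val_at _ _ _ _) (PD1_sample u i) => v p h1 p1.
by rewrite ![`|_ - p|]ger0_norm; lra.
Qed.

End Limit.

End SortNoninc.

(** * Uniform continuity of test functions on the unit cube *)

Section Unif.
Variables (R : realType) (f : {ptws nat -> R} -> R).
Hypothesis cf : continuous f.

Definition cube : set {ptws nat -> R} := [set x | forall i, `[0, 1]%classic (x i)].

Lemma cube_compact : compact cube.
Proof. by apply: (@tychonoff nat (fun=> R) (fun=> `[0, 1]%classic)) => i; apply: segment_compact. Qed.

Lemma coord_continuous i : continuous (fun x : {ptws nat -> R} => x i).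
Proof. exact: (@proj_continuous nat (fun=> R) i). Qed.

Lemma cube_bounded : exists2 M : R, 0 < M & forall x, cube x -> `|f x| <= M.
Proof.
have cc : compact (f @` cube).
  by apply: continuous_compact; [exact: continuous_subspaceT | exact: cube_compact].
have [M [Mr hM]] := compact_bounded cc.
exists (`|M| + 1); first by rewrite ltr_wpDl.
move=> x xc; apply: hM; last by exists x.
by rewrite ltr_pwDr // ler_norm.
Qed.

(** The modulus is for the sup distance although the topology is that of pointwise convergence. If
    it failed, offending pairs at ever smaller distance would cluster in the compact square of the
    cube, necessarily on the diagonal, which contradicts continuity at the cluster point. *)
Lemma cube_unif (eps : R) : 0 < eps -> exists2 de : R, 0 < de &
  forall x y : {ptws nat -> R}, cube x -> cube y -> (forall i, `|x i - y i| <= de) ->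
  `|f x - f y| <= eps.
Proof.
move=> eps0; apply: contrapT => no.
pose T := ({ptws nat -> R} * {ptws nat -> R})%type.
pose S (de : R) : set T := [set p : T | [/\ cube p.1, cube p.2,
   (forall i, `|p.1 i - p.2 i| <= de) & eps < `|f p.1 - f p.2|]].
have S0 de : 0 < de -> S de !=set0.
  move=> de0; apply: contrapT => h; apply: no; exists de => // x y xc yc xy.
  rewrite leNgt; apply/negP => l; apply: h; by exists (x, y).
pose F := filter_from [set de : R | 0 < de] S.
have FF : ProperFilter F.
  apply: filter_from_proper => //; apply: filter_from_filter; first by exists 1 => /=.
  move=> d1 d2 /= d10 d20; exists (Num.min d1 d2); first by rewrite /= lt_min d10.
  by move=> p [p1 p2 p3 p4]; split; split => // i; apply: le_trans (p3 i) _; rewrite ge_min lexx ?orbT.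
have cT : compact (cube `*` cube) by apply: compact_setX; exact: cube_compact.
have FK : F (cube `*` cube) by exists 1 => //= p [].
have [[p q] [[pc qc] cl]] := cT F FF FK.
have pq i : p i = q i.
  apply: contrapT => /eqP ne.
  have d0 : 0 < `|p i - q i| by rewrite normr_gt0 subr_eq0.
  have d40 : 0 < `|p i - q i| / 4 by rewrite divr_gt0.
  have B1 : nbhs p [set x : {ptws nat -> R} | ball (p i) (`|p i - q i| / 4) (x i)].
    by apply: (@coord_continuous i p); apply: nbhsx_ballx.
  have B2 : nbhs q [set x : {ptws nat -> R} | ball (q i) (`|p i - q i| / 4) (x i)].
    by apply: (@coord_continuous i q); apply: nbhsx_ballx.
  have B : nbhs (p, q) ([set x : {ptws nat -> R} | ball (p i) (`|p i - q i| / 4) (x i)] `*`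
     [set x : {ptws nat -> R} | ball (q i) (`|p i - q i| / 4) (x i)]).
    by exists ([set x : {ptws nat -> R} | ball (p i) (`|p i - q i| / 4) (x i)],
      [set x : {ptws nat -> R} | ball (q i) (`|p i - q i| / 4) (x i)]).
  have FS : F (S (`|p i - q i| / 4)) by exists (`|p i - q i| / 4).
  have [z [[_ _ hz _] [b1 b2]]] := cl _ _ FS B.
  move: b1 b2 (hz i); rewrite /ball /= => b1 b2 h3.
  have h4 := ler_distD (z.1 i) (p i) (q i); have h5 := ler_distD (z.2 i) (z.1 i) (q i).
  rewrite (distrC (q i)) in b2.
  by move: b1 b2 h3 h4 h5 d0; move: `|p i - q i| `|p i - _| `|z.1 i - q i| `|z.2 i - q i| `|z.1 i - z.2 i| => a b c d e; lra.
have {}pq : p = q by apply/funext.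
subst q.
have e20 : 0 < eps / 2 by rewrite divr_gt0.
have B1 : nbhs p [set x : {ptws nat -> R} | ball (f p) (eps / 2) (f x)].
  by apply: (@cf p); apply: nbhsx_ballx.
have B : nbhs (p, p) ([set x : {ptws nat -> R} | ball (f p) (eps / 2) (f x)] `*`
     [set x : {ptws nat -> R} | ball (f p) (eps / 2) (f x)]).
  by exists ([set x : {ptws nat -> R} | ball (f p) (eps / 2) (f x)],
    [set x : {ptws nat -> R} | ball (f p) (eps / 2) (f x)]).
have FS : F (S 1) by exists 1 => /=.
have [z [[_ _ _ hz] [b1 b2]]] := cl _ _ FS B.
move: b1 b2; rewrite /ball /= => b1 b2.
have h4 := ler_distD (f p) (f z.1) (f z.2); rewrite (distrC (f p) (f z.1)) in b1.
by move: b1 b2 hz h4; move: `|f z.1 - f p| `|f p - f z.2| `|f z.1 - f z.2| => a b c; lra.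
Qed.

End Unif.

(** * Discarding a null set from an integral *)

Section NullSet.
Local Open Scope ereal_scope.
Context d (T : measurableType d) (R : realType) (mu : {measure set T -> \bar R}).
Variables (D : set T) (mD : measurable D) (D0 : mu (~` D) = 0).
Import HBNNSimple.

Let ge0_integral_conull (f : T -> \bar R) : (forall x, 0 <= f x) ->
  \int[mu]_x f x = \int[mu]_(x in D) f x.
Proof.
move=> f0; rewrite !ge0_integralE// patch_setT; apply/eqP; rewrite eq_le; apply/andP; split.
  apply: ge_ereal_sup => _ [h /= hf] <-.
  apply: ereal_sup_ubound; exists (proj_nnsfun h mD).
    move=> x; rewrite -(mrestrict h mD) /patch; case: ifP => xD; last by rewrite lexx.
    exact: hf.
  rewrite -(mrestrict h mD) -integral_nnsfun // -integralT_nnsfun.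
  rewrite [RHS](@ge0_negligible_integral _ _ _ mu setT (~` D)) //.
  - by rewrite setTD setCK.
  - exact: measurableC.
  - exact/measurable_EFinP.
  - by move=> x _; rewrite lee_fin.
apply: le_ereal_sup => _ [h /= hf] <-; exists h => //= x.
by apply: le_trans (hf x) _; rewrite /patch; case: ifP.
Qed.

(** Stated for arbitrary [f] because the functional of the sorted sticks is obtained as a measurable
    function only on [good], as a pointwise limit. *)
Lemma integral_conull (f : T -> \bar R) : \int[mu]_x f x = \int[mu]_(x in D) f x.
Proof. by rewrite integralE [RHS]integralE !ge0_integral_conull. Qed.

End NullSet.

(** * Integration of the discrete chain and passage to the limit *)

Section PD.
Context (R : realType) (d : measure_display) (Om : measurableType d) (P : probability Om R).
Variable U : nat -> {RV P >-> R}.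
Hypothesis hU : forall i A, measurable A -> distribution P (U i) A = uniform_prob (@ltr01 R) A.
Hypothesis hI : mutually_independent P (fun i => U i).

Lemma P_itv i (a b : R) : 0 <= a -> a <= b -> b <= 1 ->
  P (U i @^-1` `[a, b[) = (b - a)%:E.
Proof.
move=> a0 ab b1.
have -> : P (U i @^-1` `[a, b[) = distribution P (U i) `[a, b[ by [].
rewrite hU // /uniform_prob.
transitivity (\int[lebesgue_measure]_(x in `[a, b[) (cst (1 : \bar R) x))%E.
  apply: eq_integral => x; rewrite inE /= in_itv /= => /andP[ax xb].
  rewrite /uniform_pdf (le_trans a0 ax) (le_trans (ltW xb) b1) /=.
  by rewrite subr0 invr1.
rewrite integral_cst //= mul1e lebesgue_measure_itv /= lte_fin.
by move: ab; rewrite le_eqVlt => /orP[/eqP->|->]; rewrite ?ltxx ?subrr ?EFinB.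
Qed.

Lemma U_measurable i (B : set R) : measurable B -> measurable (U i @^-1` B).
Proof. by move=> mB; rewrite -[X in measurable X]setTI; apply: measurable_funP. Qed.

Definition cyl (s : seq nat) (B : nat -> set R) : set Om :=
  \bigcap_(i in [set i | i \in s]) (U i @^-1` B i).

Lemma cylP s B w : cyl s B w <-> (forall i, i \in s -> B i (U i w)).
Proof. by split=> h i; apply: h. Qed.

Lemma cyl_measurable s B : (forall i, measurable (B i)) -> measurable (cyl s B).
Proof.
move=> mB; rewrite /cyl; apply: bigcap_measurableType => i _; exact: U_measurable.
Qed.

Lemma cyl_cat k (B : nat -> set R) (I : set R) :
  cyl (iota 0 k) B `&` (U k @^-1` I) = cyl (iota 0 k.+1) (fun i => if i == k then I else B i).
Proof.
apply/seteqP; split => w.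
  move=> [/cylP h1 h2]; apply/cylP => i; rewrite mem_iota add0n ltnS leq0n leq_eqVlt.
  case/orP=> [/eqP->|ik]; first by rewrite eqxx.
  by rewrite ltn_eqF //; apply: h1; rewrite mem_iota.
move/cylP => h; split.
  apply/cylP => i; rewrite mem_iota add0n leq0n => ik; have := h i.
  by rewrite mem_iota add0n ltnS leq0n ltnW // ltn_eqF //; apply.
by have := h k; rewrite mem_iota add0n ltnS leq0n leqnn eqxx; apply.
Qed.

Lemma P_cyl_cat k (B : nat -> set R) (I : set R) : (forall i, measurable (B i)) -> measurable I ->
  P (cyl (iota 0 k) B `&` (U k @^-1` I)) = (P (cyl (iota 0 k) B) * P (U k @^-1` I))%E.
Proof.
move=> mB mI; rewrite cyl_cat /cyl !hI ?iota_uniq //; last by move=> i; case: ifP.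
rewrite -addn1 iotaD big_cat /= big_seq1 add0n eqxx; congr (_ * _)%E.
by apply: eq_big_seq => i; rewrite mem_iota add0n => /andP[_ ik]; rewrite ltn_eqF.
Qed.

Definition cell (b k i : nat) : set Om := U k @^-1` `[i%:R / b.+1%:R, i.+1%:R / b.+1%:R[.

Lemma cellE b k i w : (w \in cell b k i) = (i%:R <= b.+1%:R * U k w < i.+1%:R).
Proof.
rewrite /cell; apply/idP/idP.
  by rewrite inE /= in_itv /= ler_pdivrMr ?ltr0n // ltr_pdivlMr ?ltr0n // mulrC.
by move=> h; rewrite inE /= in_itv /= ler_pdivrMr ?ltr0n // ltr_pdivlMr ?ltr0n // mulrC.
Qed.

Lemma cell_measurable b k i : measurable (cell b k i).
Proof. by apply: U_measurable. Qed.

Lemma Sc_measurable f b k g : measurable_fun setT (fun w => Sc f b (fun j => U j w) k g).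
Proof.
elim: f b k g => [|f IH] [|b] k g /=; try exact: measurable_cst.
apply: measurable_sum => i; apply: measurable_funM; last exact: IH.
have -> : (fun w => (i%:R <= b.+1%:R * U k w < i.+1%:R)%R%:R : R) = \1_(cell b k i).
  by apply/funext => w; rewrite indicE cellE.
by apply: measurable_indic; apply: cell_measurable.
Qed.

Lemma Sc_bound f b (c : nat) u k (g : seq nat -> R) : (forall l, `|g l| <= 1) -> (b < c)%N ->
  `|Sc f b u k g| <= c%:R ^+ f.
Proof.
move=> g1; elim: f b k g g1 => [|f IH] [|b] k g g1 bc /=; rewrite ?expr0 //.
  by apply: le_trans (g1 _) _; rewrite exprn_ege1 // ler1n.
apply: le_trans (ler_norm_sum _ _ _) _.
apply: le_trans (_ : \sum_(i < b.+1) c%:R ^+ f <= _).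
  apply: ler_sum => i _; rewrite normrM.
  apply: le_trans (_ : 1 * c%:R ^+ f <= _); last by rewrite mul1r.
  apply: ler_pM => //; first by case: (_ <= _ < _); rewrite ?normr1 ?normr0.
  apply: IH => //; apply: leq_ltn_trans (leq_subr _ _) _; exact: ltnW.
rewrite sumr_const card_ord exprS -[leLHS]mulr_natl ler_wpM2r ?exprn_ge0 // ler_nat.
exact: ltnW.
Qed.

(** The integral runs over a cylinder in the first [k] variables, so that the induction can absorb
    the cell of the next one. By independence this cell contributes the factor [1 / b.+1], which
    gives the recursion [HHS]. *)
Lemma Sc_integral f b k g B : (b <= f)%N -> (forall i, measurable (B i)) ->
  (forall l, `|g l| <= 1) ->
  (\int[P]_(w in cyl (iota 0 k) B) (Sc f b (fun j => U j w) k g)%:E =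
   P (cyl (iota 0 k) B) * (HH b g)%:E)%E.
Proof.
elim: f b k g B => [|f IH] [|b] k g B bf mB g1 //=.
- rewrite (_ : (fun w => _) = cst (g [::])%:E) // integral_cst; first by rewrite muleC.
  exact: cyl_measurable.
- rewrite (_ : (fun w => _) = cst (g [::])%:E) // integral_cst; first by rewrite muleC.
  exact: cyl_measurable.
have mC : measurable (cyl (iota 0 k) B) by apply: cyl_measurable.
pose S (i : 'I_b.+1) w := Sc f (b - i)%N (fun j => U j w) k.+1 (fun l => g (i.+1 :: l)).
pose h (i : 'I_b.+1) w : R := (i%:R <= b.+1%:R * U k w < i.+1%:R)%R%:R * S i w.
transitivity (\int[P]_(w in cyl (iota 0 k) B) (\sum_(i < b.+1) (h i w)%:E))%E.
  by apply: eq_integral => w _; rewrite -sumEFin.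
have mh i : measurable_fun setT (h i).
  apply: measurable_funM; last exact: Sc_measurable.
  have -> : (fun w => (i%:R <= b.+1%:R * U k w < i.+1%:R)%R%:R : R) = \1_(cell b k i).
    by apply/funext => w; rewrite indicE cellE.
  by apply: measurable_indic; apply: cell_measurable.
rewrite (@integral_sum _ _ _ P _ mC _ (fun i w => (h i w)%:E)) => [|i]; last first.
  apply: (@measurable_bounded_integrable _ _ _ P _ _ mC).
  - by apply: le_lt_trans (probability_le1 P mC) _; rewrite ltry.
  - by apply: measurable_funTS.
  exists (b.+1%:R ^+ f); split; first by rewrite num_real.
  move=> x bx w _; apply: le_trans (ltW bx); rewrite /h normrM.
  apply: le_trans (_ : 1 * b.+1%:R ^+ f <= _); last by rewrite mul1r.
  apply: ler_pM => //; first by case: (_ <= _ < _); rewrite ?normr1 ?normr0.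
  by apply: Sc_bound => //; rewrite ltnS leq_subr.
rewrite HHS.
have term (i : 'I_b.+1) : (\int[P]_(w in cyl (iota 0 k) B) (h i w)%:E =
   P (cyl (iota 0 k) B) * (HH (b - i) (fun l => g (i.+1 :: l)) / b.+1%:R)%:E)%E.
  transitivity (\int[P]_(w in cyl (iota 0 k) B `&` cell b k i) (S i w)%:E)%E.
    rewrite integral_mkcondr; apply: eq_integral => w _.
    by rewrite patchE cellE /h; case: ifP => _; rewrite ?mul1r ?mul0r.
  have ib : (i%:R / b.+1%:R <= i.+1%:R / b.+1%:R :> R) by rewrite ler_wpM2r ?invr_ge0 // ler_nat.
  have i1 : i.+1%:R / b.+1%:R <= 1 :> R by rewrite ler_pdivrMr ?ltr0n // mul1r ler_nat.
  have i0 : 0 <= i%:R / b.+1%:R :> R by rewrite divr_ge0.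
  have pc : P (cyl (iota 0 k) B `&` cell b k i) = (P (cyl (iota 0 k) B) * (b.+1%:R^-1)%:E)%E.
    rewrite /cell P_cyl_cat // P_itv //; congr (_ * _%:E)%E.
    by rewrite -mulrBl -natr1 addrAC subrr add0r mul1r.
  rewrite EFinM [((HH _ _)%:E * _)%E]muleC muleA -pc /cell cyl_cat.
  by apply: IH => // [|j]; [apply: leq_trans (leq_subr _ _) _ | case: ifP].
rewrite (eq_bigr _ (fun i _ => term i)) /=.
have fn : P (cyl (iota 0 k) B) \is a fin_num by apply: fin_num_measure.
rewrite -(fin_num_sume_distrr _ fn); last by move=> i j _ _; apply: fin_num_adde_defl.
by rewrite sumEFin mulr_suml.
Qed.

(** A level strictly between [1 / 2] and 1: almost surely infinitely many variables reach it, which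
    supplies the halving steps of [sb_rem_cvg]. *)
Let I34 : set R := `[0, 3 / 4[.

Let low q : set Om := \bigcap_(i in [set i | (q <= i)%N]) (U i @^-1` I34).

Definition good : set Om := (\bigcap_i (U i @^-1` `[0, 1[)) `&` ~` (\bigcup_q low q).

Let low_measurable q : measurable (low q).
Proof. by apply: bigcap_measurableType => i _; apply: U_measurable; apply: measurable_itv. Qed.

Lemma good_measurable : measurable good.
Proof.
apply: measurableI; first by apply: bigcap_measurableType => i _; apply: U_measurable.
by apply: measurableC; apply: bigcup_measurable => q _; apply: low_measurable.
Qed.

Let low_null q : P (low q) = 0%E.
Proof.
have fn : P (low q) \is a fin_num by apply: fin_num_measure; apply: low_measurable.
have bnd r : fine (P (low q)) <= (1 - 4^-1) ^+ r.
  rewrite -lee_fin fineK //.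
  apply: le_trans (_ : P (cyl (iota q r) (fun=> I34)) <= _)%E.
    apply: le_measure; rewrite ?inE.
    - exact: low_measurable.
    - by apply: cyl_measurable => i; apply: measurable_itv.
    move=> w h; apply/cylP => i; rewrite mem_iota => /andP[qi _]; exact: h.
  rewrite /cyl hI ?iota_uniq //; last by move=> i; apply: measurable_itv.
  have -> : (\prod_(i <- iota q r) P (U i @^-1` I34) = ((1 - 4^-1) ^+ r)%:E)%E.
    elim: r q {fn} => [|r IH] q; first by rewrite big_nil expr0.
    have h1 : 0 <= 3 / 4 :> R by lra. have h2 : 3 / 4 <= 1 :> R by lra.
    rewrite /= big_cons IH /I34 (P_itv _ (lexx 0) h1 h2).
    rewrite -EFinM exprS; congr (_ * _)%:E; lra.
  exact: lexx.
rewrite -(fineK fn); congr (_%:E); apply/eqP; rewrite eq_le fine_ge0 ?measure_ge0 // andbT.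
rewrite leNgt; apply/negP => x0.
have h1 : 0 < 4^-1 :> R by lra. have h2 : 4^-1 <= 1 :> R by lra.
have [k hk] := pow_small h1 h2 (divr_gt0 x0 (ltr0Sn R 1)).
by have := le_trans (bnd k) hk; move: (fine _) x0 => x x0; lra.
Qed.

Lemma good_null : P (~` good) = 0%E.
Proof.
apply/eqP; rewrite eq_le measure_ge0 andbT.
suff : P.-negligible (~` good).
  by move=> n; rewrite (measure_negligible _ n) //; apply: measurableC; apply: good_measurable.
rewrite /good setCI setCK setC_bigcap; apply: negligibleU.
  apply: negligible_bigcup => i; exists (~` (U i @^-1` `[0, 1[)); split=> //.
    by apply: measurableC; apply: U_measurable.
  have mU : measurable (U i @^-1` `[(0 : R), 1[) by apply: U_measurable; apply: measurable_itv.
  by have := probability_setC P mU; rewrite P_itv // subr0 subee // => ->.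
apply: negligible_bigcup => q; exists (low q).
by split; [exact: low_measurable|exact: low_null|].
Qed.

Lemma good01 w : good w -> forall j, 0 <= U j w < 1.
Proof. by move=> [h _] j; have := h j I; rewrite /= in_itv. Qed.

Lemma good_io w : good w -> forall q, exists2 j, (q <= j)%N & 2^-1 < U j w.
Proof.
move=> gw q; have [_ h] := gw; apply: contrapT => no; apply: h; exists q => // i /= qi.
have /andP[u0 _] := good01 gw i; rewrite /I34 /= in_itv /= u0 /= ltNge; apply/negP => h.
by apply: no; exists i => //; apply: lt_le_trans h; lra.
Qed.

Section Limit.
Variable F : (nat -> R) -> R.
Hypothesis F1 : forall x, `|F x| <= 1.
Hypothesis Fuc : forall eps : R, 0 < eps -> exists2 de : R, 0 < de &
  forall x y : nat -> R, (forall i, 0 <= x i <= 1) -> (forall i, 0 <= y i <= 1) ->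
  (forall i, `|x i - y i| <= de) -> `|F x - F y| <= eps.

(** For every [b] the discrete expectation [HH b] is exactly the integral of the chain of size [b].
    On one probability space the chains converge pointwise on [good], and dominated convergence
    applies. *)
Theorem PD_limit :
  P.-integrable good (fun w => (F (PD1_sample (fun j => U j w)))%:E) /\
  (fun b => HH b (gm F b)) @ \oo -->
  Rintegral P setT (fun w => F (PD1_sample (fun j => U j w))).
Proof.
pose h b w : R := Sc b b (fun j => U j w) 0 (gm F b).
pose f w : R := F (PD1_sample (fun j => U j w)).
have mg := good_measurable.
have hE b w : good w -> h b w = gm F b (chain b b (fun j => U j w) 0).
  by move=> gw; apply: Sc_chain; apply: good01.
have mh b : measurable_fun good (h b) by apply: measurable_funTS; apply: Sc_measurable.
have hf w : good w -> h ^~ w @ \oo --> f w.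
  move=> gw; apply/cvgrPdist_le => e e0.
  have [b0 hb] := chain_limit Fuc (good01 gw) (good_io gw) e0.
  by exists b0 => // b /= bb; rewrite distrC hE //; apply: hb.
have mf : measurable_fun good f by apply: measurable_fun_cvg mh hf.
have i1 : P.-integrable good (EFin \o cst (1 : R)).
  apply: measurable_bounded_integrable => //.
    by apply: le_lt_trans (probability_le1 P mg) _; rewrite ltry.
  by exists 1; split; rewrite ?num_real // => x x1 w _ /=; rewrite normr1 ltW.
have [ |||| ifn _] := @dominated_convergence _ _ _ P good mg
   (fun b w => (h b w)%:E) (fun w => (f w)%:E) (EFin \o cst 1) _ _ _ i1.
- by move=> b; apply/measurable_EFinP.
- exact/measurable_EFinP.
- by apply: aeW => w gw; apply: cvg_EFin; [exact: nearW | exact: hf].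
- by apply: aeW => w b gw; rewrite /= lee_fin hE //; apply: F1.
have fin : (\int[P]_(w in good) (f w)%:E)%E \is a fin_num by apply: integrable_fin_num.
have e1 : Rintegral P setT f = fine (\int[P]_(w in good) (f w)%:E)%E.
  by rewrite /Rintegral (integral_conull mg good_null).
rewrite -/f e1 => /= cv; split=> //.
have e2 b : (\int[P]_(w in good) (h b w)%:E = (HH b (gm F b))%:E)%E.
  rewrite -(integral_conull mg good_null).
  have c0 : cyl (iota 0 0) (fun=> setT) = setT.
    by apply/seteqP; split=> // w _; apply/cylP.
  have := @Sc_integral b b 0 (gm F b) (fun=> setT) (leqnn b) (fun=> measurableT) (gm_bound F1 b).
  by rewrite c0 probability_setT mul1e.
rewrite -(fineK fin) in cv.
have -> : (fun b => HH b (gm F b)) = fine \o (fun b => \int[P]_(w in good) (h b w)%:E)%E.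
  by apply/funext => b /=; rewrite e2.
exact: fine_cvg cv.
Qed.

End Limit.

End PD.

(** * Transposition sequences as lists of pairs *)

Lemma Efold_min (V : finType) (E C : rel V) (l : seq (V * V)) : eqv C -> subrel E C ->
  (forall p, p \in l -> C p.1 p.2) -> subrel (Efold E l) C.
Proof.
case=> Cr Cs Ct; elim: l E => [|p l IH] E EC h //=; apply: IH => [u v|q ql]; last first.
  by apply: h; rewrite inE ql orbT.
have cp : C p.1 p.2 by apply: h; rewrite inE eqxx.
case/or3P => [/EC //|/andP[/EC h1 /EC h2]|/andP[/EC h1 /EC h2]].
  by apply: Ct h1 (Ct _ _ _ cp h2).
by apply: Ct h1 (Ct _ _ _ _ h2); rewrite Cs.
Qed.

Section Transp.
Variables (R : realType) (n : nat).
Implicit Types (p : 'I_n * 'I_n).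

Definition tp p : {perm 'I_n} := tperm p.1 p.2.

Definition transps : {set {perm 'I_n}} := finset.finset (@is_transp n).

Lemma is_transpP (s : {perm 'I_n}) :
  reflect (exists2 p, p \in pairs 'I_n & s = tp p) (is_transp s).
Proof.
apply: (iffP existsP) => [[x /existsP[y /andP[xy /eqP->]]]|[[x y] xy ->]].
  by exists (x, y) => //; rewrite inE.
by exists x; apply/existsP; exists y; rewrite eqxx andbT; move: xy; rewrite inE.
Qed.

(* each transposition comes from exactly two ordered pairs *)
Lemma tperm_pairs (x y u v : 'I_n) : x != y -> tperm u v = tperm x y ->
  ((u, v) == (x, y)) || ((u, v) == (y, x)).
Proof.
move=> xy e.
have ux : u != v.
  apply/eqP => uv; move: e; rewrite uv tperm1 => /permP/(_ x).
  by rewrite perm1 tpermL => e; rewrite e eqxx in xy.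
have vE : v = tperm x y u by rewrite -e tpermL.
have [ex|nx] := eqVneq u x; first by rewrite vE ex tpermL eqxx.
have [ey|ny] := eqVneq u y; first by rewrite vE ey tpermR eqxx orbT.
by move: ux; rewrite vE tpermD ?eqxx // eq_sym.
Qed.

Lemma sum_pairs_tp (G : {perm 'I_n} -> R) :
  \sum_(p in pairs 'I_n) G (tp p) = 2 * \sum_(s in transps) G s.
Proof.
rewrite (partition_big tp (mem transps)) /=; last first.
  by move=> p pp; rewrite inE; apply/is_transpP; exists p.
rewrite mulr_sumr; apply: eq_bigr => s; rewrite inE => /is_transpP[[x y] xy ->].
rewrite inE /= in xy.
rewrite (bigD1 (x, y)) /=; last by rewrite inE /= xy eqxx.
rewrite (bigD1 (y, x)) /=; last first.
  rewrite inE /= eq_sym xy /tp /= tpermC eqxx /=; apply/eqP => -[e _].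
  by rewrite e eqxx in xy.
rewrite big1 ?addr0 => [|[u v] /andP[/andP[/andP[_ /eqP e] h1] h2]]; last first.
  by have := tperm_pairs xy e; rewrite (negPf h1) (negPf h2).
by rewrite {2}/tp /= tpermC; ring.
Qed.

Lemma avg_pairs_tp (G : {perm 'I_n} -> R) :
  avg (pairs 'I_n) (fun p => G (tp p)) = avg transps G.
Proof.
rewrite /avg sum_pairs_tp.
have -> : #|pairs 'I_n|%:R = 2 * #|transps|%:R :> R.
  have := sum_pairs_tp (fun=> 1); rewrite -!sum1_card !natr_sum.
  by [].
have [->|t0] := eqVneq (#|transps|%:R : R) 0; first by rewrite mulr0 !invr0 !mulr0.
by field.
Qed.

Fixpoint ET t (G : seq {perm 'I_n} -> R) : R :=
  if t is t'.+1 then avg transps (fun s => ET t' (fun l => G (s :: l))) else G [::].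

Lemma EL_tp t (G : seq {perm 'I_n} -> R) :
  EL (pairs 'I_n) t (fun l => G (map tp l)) = ET t G.
Proof.
elim: t G => [|t IH] G //=.
transitivity (avg (pairs 'I_n) (fun p => (fun s => ET t (fun l => G (s :: l))) (tp p))).
  by apply: eq_avg => p _; rewrite -IH.
exact: avg_pairs_tp.
Qed.

Definition transpT t : {set {ffun 'I_t -> {perm 'I_n}}} := finset.finset (@transp_seq n t).

Lemma transp_seq_card t : #|transpT t| = (#|transps| ^ t)%N.
Proof.
rewrite -[t in RHS]card_ord -card_ffun_on; apply: eq_card => T.
rewrite inE; apply/forallP/ffun_onP => h j; have := h j; by rewrite inE.
Qed.

Definition fseq t (T : {ffun 'I_t -> {perm 'I_n}}) : seq {perm 'I_n} := [seq T j | j <- enum 'I_t].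

Definition fcons t (q : {perm 'I_n} * {ffun 'I_t -> {perm 'I_n}}) : {ffun 'I_t.+1 -> {perm 'I_n}} :=
  [ffun j => if unlift ord0 j is Some k then q.2 k else q.1].

Lemma fcons0 t q : @fcons t q ord0 = q.1.
Proof. by rewrite ffunE unlift_none. Qed.

Lemma fconsS t q j : @fcons t q (lift ord0 j) = q.2 j.
Proof. by rewrite ffunE liftK. Qed.

Lemma fseq_cons t q : fseq (@fcons t q) = q.1 :: fseq q.2.
Proof.
rewrite /fseq enum_ordSl /= fcons0 -map_comp; congr (_ :: _).
by apply: eq_map => j /=; rewrite fconsS.
Qed.

Lemma transp_fcons t q : transp_seq (@fcons t q) = (q.1 \in transps) && transp_seq q.2.
Proof.
rewrite inE; apply/forallP/andP => [h|[h1 /forallP h2] j].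
  by split; [have := h ord0; rewrite fcons0 | apply/forallP => j; have := h (lift ord0 j); rewrite fconsS].
by case: (unliftP ord0 j) => [k ->|->]; rewrite ?fconsS ?fcons0.
Qed.

Lemma sum_transp t (G : seq {perm 'I_n} -> R) :
  \sum_(T : {ffun 'I_t.+1 -> {perm 'I_n}} | transp_seq T) G (fseq T) =
  \sum_(s in transps) \sum_(T : {ffun 'I_t -> {perm 'I_n}} | transp_seq T) G (s :: fseq T).
Proof.
rewrite pair_big /= (reindex (@fcons t)) /=.
  by apply: eq_big => [q|q _]; rewrite ?transp_fcons // fseq_cons.
exists (fun T => (T ord0, [ffun j => T (lift ord0 j)])) => [[s T] _|T _].
  congr (_, _); first by rewrite fcons0.
  by apply/ffunP => j; rewrite ffunE fconsS.
apply/ffunP => j; case: (unliftP ord0 j) => [k ->|->]; first by rewrite fconsS ffunE.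
by rewrite fcons0.
Qed.

Lemma ET_ffun t (G : seq {perm 'I_n} -> R) :
  ET t G = (\sum_(T : {ffun 'I_t -> {perm 'I_n}} | transp_seq T) G (fseq T)) / #|transps|%:R ^+ t.
Proof.
elim: t G => [|t IH] G.
  rewrite expr0 divr1 (eq_bigr (fun=> G [::])) => [|T _]; last first.
    by rewrite /fseq enum_ord0.
  rewrite sumr_const; set c := #|_|; suff -> : c = 1%N by [].
  rewrite /c (eq_card (_ : _ =i predT)); first by rewrite card_ffun card_ord expn0.
  by move=> T; rewrite !inE; apply/forallP => -[].
transitivity (avg transps (fun s => (\sum_(T : {ffun 'I_t -> {perm 'I_n}} | transp_seq T)
   G (s :: fseq T)) / #|transps|%:R ^+ t)); first by apply: eq_avg => s _; apply: (IH (fun l => G (s :: l))).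
by rewrite /avg sum_transp -mulr_suml exprSr invfM mulrA.
Qed.

Lemma exp_transpE t (G : seq {perm 'I_n} -> R) :
  exp_transp (fun T : {ffun 'I_t -> {perm 'I_n}} => G (fseq T)) =
  EL (pairs 'I_n) t (fun l => G (map tp l)).
Proof.
rewrite EL_tp ET_ffun /exp_transp -natrX -transp_seq_card; congr (_ / _%:R).
by apply: eq_card => T; rewrite [RHS]inE; apply/idP/idP => [/set_mem|h]; [|apply/mem_set].
Qed.

Definition gr (ls : seq {perm 'I_n}) : rel 'I_n := fun u v => (u != v) && (tperm u v \in ls).

Definition nc (ls : seq {perm 'I_n}) : nat -> R := fun i =>
  (cycle_struct (\prod_(s <- ls) s)%g i)%:R /
  (\max_(x : 'I_n) #|finset.finset (connect (gr ls) x)|)%:R.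

Lemma normalized_cyclesE t (T : {ffun 'I_t -> {perm 'I_n}}) : normalized_cycles R T = nc (fseq T).
Proof.
apply/funext => i; rewrite /normalized_cycles /nc; congr (_%:R / _%:R).
  congr (cycle_struct _ i); by rewrite /pi_t /fseq big_map enumT [index_enum _]unlock.
rewrite /largest_comp; apply: eq_bigr => x _.
have eg : graph_rel T =2 gr (fseq T).
  move=> u v; rewrite /graph_rel /gr; congr (_ && _); apply/existsP/mapP => [[j /eqP e]|[j _ e]].
    by exists j => //; rewrite mem_enum.
  by exists j; rewrite -e.
apply: eq_card => y; rewrite [RHS]inE -(eq_connect eg).
by apply/idP/idP => [/set_mem|h]; [|apply/mem_set].
Qed.

Lemma connect_Efold (l : seq ('I_n * 'I_n)) : all (mem (pairs 'I_n)) l ->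
  connect (gr (map tp l)) =2 Efold (@eq_op 'I_n) l.
Proof.
move=> al; have vE : eqv (Efold (@eq_op 'I_n) l) by apply/eqv_Efold/eq_op_eqv.
have gs : symmetric (gr (map tp l)) by move=> u v; rewrite /gr eq_sym tpermC.
move=> u v; apply/idP/idP.
  case/connectP => q; elim: q u => [|w q IH] u /=; first by move=> _ ->; case: vE.
  case/andP => /andP[uw /mapP[p pl e]] pq /(IH _ pq) wv.
  case: (vE) => _ sy tr; apply: tr wv.
  have := Efold_mem (eq_op_eqv 'I_n) pl; case: p e {pl} => a b; rewrite /tp /= => e.
  by have := tperm_pairs uw (esym e); case/orP => /eqP[-> ->] //; rewrite sy.
apply: Efold_min => [|x y /eqP->|p pl]; last 1 first.
- apply: connect1; rewrite /gr; have := allP al p pl; rewrite /= inE => ->.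
  by apply/mapP; exists p.
- split; [exact: connect0 | exact: sym_connect_sym | exact: connect_trans].
exact: connect0.
Qed.

Lemma nc_ncyc (l : seq ('I_n * 'I_n)) : all (mem (pairs 'I_n)) l -> nc (map tp l) = ncyc R l.
Proof.
move=> al; apply/funext => i; rewrite /nc /ncyc /val_at /cycle_struct; congr (_%:R / _%:R).
  by rewrite big_map.
apply: eq_bigr => x _; apply: eq_card => y; rewrite !inE.
exact: connect_Efold.
Qed.

Lemma exp_ncyc t (f : (nat -> R) -> R) :
  exp_transp (fun T : {ffun 'I_t -> {perm 'I_n}} => f (normalized_cycles R T)) =
  EL (pairs 'I_n) t (fun l => f (ncyc R l)).
Proof.
have -> : (fun T : {ffun 'I_t -> {perm 'I_n}} => f (normalized_cycles R T)) =
    (fun T => f (nc (fseq T))) by apply/funext => T; rewrite normalized_cyclesE.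
rewrite (exp_transpE t (fun ls => f (nc ls))); apply: eq_EL => l /andP[_ al].
by rewrite nc_ncyc.
Qed.

End Transp.

Theorem theorem1p1 (R : realType) (d : measure_display) (Omega : measurableType d)
    (P : probability Omega R) (U : nat -> {RV P >-> R}) (c : R) (t : nat -> nat) :
  (forall i A, measurable A -> distribution P (U i) A = uniform_prob (@ltr01 R) A) ->
  mutually_independent P (fun i => U i) ->
  1 / 2 < c ->
  (forall n, c * n%:R <= (t n)%:R) ->
  forall f : {ptws nat -> R} -> R, continuous f ->
    (fun n : nat => exp_transp (fun T : {ffun 'I_(t n) -> {perm 'I_n}} =>
                        f (normalized_cycles R T)))
      @ \oo --> Rintegral P setT (fun w => f (PD1_sample (fun j => U j w))).
Proof.
move=> hU hI c12 ct f cf.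
have [M M0 fM] := cube_bounded cf.
(* [f] is bounded and uniformly continuous on the cube only. [clip] retracts every sequence to the
   cube, and division by [M] brings the values into [[-1, 1]]. *)
pose clip (x : nat -> R) : {ptws nat -> R} := fun i => Num.min 1 (Num.max 0 (x i)).
pose F (x : nat -> R) : R := M^-1 * f (clip x).
have clip_cube x : cube (clip x).
  by move=> i; rewrite /= in_itv /= le_min ler01 le_max lexx /= ge_min lexx.
have clip_id x : (forall i, 0 <= x i <= 1) -> clip x = x.
  move=> x01; apply/funext => i; rewrite /clip; case/andP: (x01 i) => x0 x1.
  by rewrite (max_idPr x0) (min_idPr x1).
have F1 x : `|F x| <= 1.
  by rewrite normrM normfV (gtr0_norm M0) mulrC ler_pdivrMr // mul1r fM.
have Fuc eps : 0 < eps -> exists2 de : R, 0 < de &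
  forall x y : nat -> R, (forall i, 0 <= x i <= 1) -> (forall i, 0 <= y i <= 1) ->
  (forall i, `|x i - y i| <= de) -> `|F x - F y| <= eps.
  move=> e0; have [de de0 h] := cube_unif cf (mulr_gt0 M0 e0); exists de => // x y x01 y01 xy.
  rewrite /F -mulrBr normrM normfV (gtr0_norm M0) mulrC ler_pdivrMr // mulrC.
  by apply: h; rewrite ?clip_id.
have FE n l : M * F (@ncyc R 'I_n l) = f (ncyc R l).
  by rewrite /F clip_id ?mulVKf ?gt_eqF // => i; apply: ncyc01.
have [iF L] := PD_limit hU hI F1 Fuc.
have PDE : Rintegral P setT (fun w => f (PD1_sample (fun j => U j w))) =
   M * Rintegral P setT (fun w => F (PD1_sample (fun j => U j w))).
  have mg := good_measurable U; have g0 := good_null hU hI.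
  rewrite /Rintegral !(integral_conull mg g0).
  have -> : (\int[P]_(w in good U) (f (PD1_sample (fun j => U j w)))%:E =
     \int[P]_(w in good U) (M%:E * (F (PD1_sample (fun j => U j w)))%:E))%E.
    apply: eq_integral => w /set_mem gw; rewrite -EFinM /F clip_id ?mulVKf ?gt_eqF //.
    by move=> i; apply: sort_noninc01; apply: stick_le1; apply: good01.
  rewrite integralZl // fineM //; exact: integrable_fin_num.
apply/cvgrPdist_le => e e0; rewrite PDE.
set I := Rintegral _ _ _ in L *.
have e20 : 0 < e / M / 2 by rewrite !divr_gt0.
have c12' : 2^-1 < c by rewrite -div1r.
have [m0 H] := comb_limit F1 Fuc c12' e20.
have /cvgrPdist_le /(_ _ e20) [m1 _ L1] := L.
(* One [m] large enough both for the sample to represent the cycles and for the discrete law to be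
   close to its limit; [n] is taken large afterwards. *)
pose m := (m0 + m1)%N.
have [n0 Hn] := H m (leq_addr _ _).
exists n0 => // n /= n0n; rewrite exp_ncyc.
have -> : EL (pairs 'I_n) (t n) (fun l => f (ncyc R l)) = M * EL (pairs 'I_n) (t n) (fun l => F (ncyc R l)).
  by rewrite -ELZ; apply: eq_EL => l _; rewrite FE.
rewrite -mulrBr normrM (gtr0_norm M0) -ler_pdivlMl // mulrC.
have h1 := L1 m (leq_addl _ _).
have cn : (n0 <= #|'I_n|)%N by rewrite card_ord.
have ct' : c * #|'I_n|%:R <= (t n)%:R by rewrite card_ord.
have h2 := Hn 'I_n cn (t n) ct'.
apply: le_trans (ler_distD (HH m (gm F m)) _ _) _.
rewrite (splitr (e / M)); apply: lerD => //.
by rewrite distrC.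
Qed.
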